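(* Let $2\leq k\leq 9$, let $\overline{p}_k(n)$ be the number of $k$-regular overpartitions of $n$, and set $\overline{N}_2=75$, $\overline{N}_3=17$, $\overline{N}_4=33$, $\overline{N}_5=30$, $\overline{N}_6=10$, $\overline{N}_7=24$, $\overline{N}_8=27$, $\overline{N}_9=10$. Put $a_m=\overline{p}_k(m+\overline{N}_k)$ for $m\geq 0$. Then for every $m\geq 1$, \[ a_m^2\left(a_m^2-a_{m-1}a_{m+1}\right)>a_{m-1}^2\left(a_{m+1}^2-a_ma_{m+2}\right), \] i.e., $\{\overline{p}_k(n)\}_{n\geq \overline{N}_k}$ satisfies the Briggs inequality.
   Context: An overpartition of $n$ is a partition of $n$ in which the first occurrence of each distinct part may optionally be overlined; a $k$-regular overpartition is one with no part divisible by $k$. A sequence $\{a_m\}_{m\geq 0}$ satisfies the Briggs inequality if $a_m^2(a_m^2-a_{m-1}a_{m+1})>a_{m-1}^2(a_{m+1}^2-a_ma_{m+2})$ for all $m\geq 1$. *)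

(* Defs.v *)
From mathcomp Require Import all_boot all_order all_algebra.

Set Implicit Arguments.
Unset Strict Implicit.
Unset Printing Implicit Defensive.

Import Order.TTheory GRing.Theory Num.Theory.

(* An overpartition is encoded as the weakly decreasing sequence of its parts,
   each paired with a boolean telling whether that occurrence is overlined.
   An entry may be overlined only if no earlier entry has the same part. *)
Definition is_overpartition (n : nat) (s : seq (nat * bool)) : bool :=
  [&& sorted geq (map fst s),
      all (fun x => 0 < x.1) s,
      pairwise (fun x y => y.2 ==> (x.1 != y.1)) s
    & sumn (map fst s) == n].

Definition is_regular (k : nat) (s : seq (nat * bool)) : bool :=
  all (fun x => ~~ (k %| x.1)) s.

(* All sequences of length at most n with parts at most n; every overpartition
   of n is among them, see mem_overpartitions. *)
Definition bounded_seqs (n : nat) : seq (seq (nat * bool)) :=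
  [seq [seq (val x.1, x.2) | x <- val t]
     | l <- iota 0 n.+1, t <- enum {: l.-tuple ('I_n.+1 * bool)}].

Definition overpartitions (k n : nat) : seq (seq (nat * bool)) :=
  [seq s <- bounded_seqs n | is_overpartition n s && is_regular k s].

Definition pbar (k n : nat) : nat := size (overpartitions k n).

Lemma overpartitions_uniq (k n : nat) : uniq (overpartitions k n).
Proof.
apply/filter_uniq/allpairs_uniq_dep.
- exact: iota_uniq.
- by move=> l _; exact: enum_uniq.
have inj : injective (fun x : 'I_n.+1 * bool => (val x.1, x.2)).
  by move=> [a b] [c d] [/val_inj -> ->].
move=> [l t] [l' t'] _ _ /= /(inj_map inj) e.
have el : l = l' by rewrite -(size_tuple t) -(size_tuple t') e.
by case: _ / el t' e => t' /val_inj ->.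
Qed.

Lemma mem_overpartitions (k n : nat) (s : seq (nat * bool)) :
  (s \in overpartitions k n) = is_overpartition n s && is_regular k s.
Proof.
rewrite mem_filter; case: (boolP (is_overpartition n s)) => //= sP.
case: (is_regular k s) => //=.
case/and4P: sP => _ s_gt0 _ /eqP sn.
have szs : size s <= n.
  rewrite -sn; elim: s s_gt0 {sn} => //= x s IHs /andP[x0 /IHs s0].
  by rewrite -add1n leq_add.
have les x : x \in s -> x.1 <= n.
  rewrite -sn; elim: s {s_gt0 sn szs} => //= y s IHs.
  rewrite inE => /orP[/eqP ->|/IHs h]; first exact: leq_addr.
  exact: leq_trans h (leq_addl _ _).
apply/allpairsPdep.
exists (size s), (map_tuple (fun x : nat * bool => (inord x.1 : 'I_n.+1, x.2))
  (in_tuple s)); split=> //.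
- by rewrite mem_iota add0n ltnS.
- by rewrite mem_enum.
rewrite /= -map_comp -[LHS]map_id; apply/eq_in_map => -[a b] /les /= an.
by rewrite inordK.
Qed.

Definition Nbar (k : nat) : nat :=
  match k with
  | 2 => 75 | 3 => 17 | 4 => 33 | 5 => 30
  | 6 => 10 | 7 => 24 | 8 => 27 | 9 => 10
  | _ => 0
  end.

Definition briggs (R : realDomainType) (a : nat -> R) : Prop :=
  forall m : nat, 1 <= m ->
    (a m ^+ 2 * (a m ^+ 2 - a m.-1 * a m.+1)
     > a m.-1 ^+ 2 * (a m.+1 ^+ 2 - a m * a m.+2))%R.

(* Main.v *)
(* Write a_n for the number of k-regular overpartitions of n, and theta q = sum_(j in Z) (-1)^j q^(j^2).
   Gauss's identity gives sum_n a_n q^n = theta (q^k) / theta q.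

   Large n.  Poisson summation for theta shows that, near q = 1,
   sqrt k * sum_n a_n e^(-n z) is e^(c/z) + O(1) with c = pi^2/4 (1 - 1/k); the function
   e^(c/z) - 1 is approximated by polylogarithms whose coefficients sum up to the Bessel function
   c * I_1 (2 sqrt (c n)) / sqrt (c n).  Away from q = 1 both sides are exponentially smaller, since
   |1 / theta q| is controlled by its value at |q| and by |1 - q|.  Cauchy's formula (in a discrete
   form, averaging over roots of unity) bounds the difference of the coefficients.  A Riccati
   equation for the logarithmic derivative of the Bessel function bounds the differences of its
   logarithm; hence log a is strictly concave and has positive third differences, i.e.
   u_n = a_(n-1) a_(n+1) / a_n^2 satisfies u_n < 1 and u_n < u_(n+1), which implies
   1 - u_n > u_n^2 (1 - u_(n+1)), the Briggs inequality.

   Small n.  The identity theta q * sum_n a_n q^n = theta (q^k) is a recurrence with O(sqrt n) terms,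
   and the finitely many remaining cases are computed.  To keep the numbers small, it is only tested that
   x_n = a_(n+1) / a_n - 1, truncated to 34 bits, is decreasing and convex, which suffices. *)

(* The difficulty is quantitative. With [s = sqrt (c n)] the third difference of [ln a] is only of
   order [s^-5], so the coefficients are needed with a smaller relative error, with explicit
   constants, and from an index on that can still be reached by computation. On the circle of radius
   [e^(-x)] with [x = c/s] the main term is about [e^(2 s)], whereas a generating function of size
   [e^(0.523/x)] contributes at most [e^(1.424 s)] up to powers of [s]. The margin [e^(0.576 s)]
   outweighs these powers for [s >= 66], i.e. [c n >= 4356]; below that the inequality is computed.
   The arcs meet at [|1 - q| = 6 x]. Outside, the rate [0.523] bounds [pi^2/4 - 2 + 2/36]; inside,
   [Re (1/z) >= 25/42], so the leading terms of the dual theta series dominate. No integral and no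
   holomorphic function is used: Gaussian integrals are Riemann sums, contour shifts and
   substitutions are telescoping sums, and the expansions behind the polylogarithms are identities
   of formal power series. *)
Require Import Defs.
From Stdlib Require Import Reals Lra Lia Psatz ZArith NArith List Machin.
From Coquelicot Require Import Coquelicot.
Import ListNotations.

Local Open Scope R_scope.

(** * Finite sums and series *)

Fixpoint Rsum (f : nat -> R) (n : nat) : R :=
  match n with O => 0 | S m => Rsum f m + f m end.

Fixpoint Csum (f : nat -> C) (n : nat) : C :=
  match n with O => RtoC 0 | S m => (Csum f m + f m)%C end.

Lemma Rsum_ext (f g : nat -> R) (n : nat) :
  (forall i, (i < n)%nat -> f i = g i) -> Rsum f n = Rsum g n.
Proof.
  induction n as [|n IH]; simpl; intros H; [reflexivity|].
  rewrite IH, H; auto.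
Qed.

Lemma Csum_ext (f g : nat -> C) (n : nat) :
  (forall i, (i < n)%nat -> f i = g i) -> Csum f n = Csum g n.
Proof.
  induction n as [|n IH]; simpl; intros H; [reflexivity|].
  rewrite IH, H; auto.
Qed.

Lemma Rsum_plus (f g : nat -> R) (n : nat) :
  Rsum (fun i => f i + g i) n = Rsum f n + Rsum g n.
Proof. induction n as [|n IH]; simpl; [ring|rewrite IH; ring]. Qed.

Lemma Rsum_scal (c : R) (f : nat -> R) (n : nat) :
  Rsum (fun i => c * f i) n = c * Rsum f n.
Proof. induction n as [|n IH]; simpl; [ring|rewrite IH; ring]. Qed.

Lemma Csum_plus (f g : nat -> C) (n : nat) :
  Csum (fun i => f i + g i)%C n = (Csum f n + Csum g n)%C.
Proof. induction n as [|n IH]; simpl; [ring|rewrite IH; ring]. Qed.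

Lemma Csum_minus (f g : nat -> C) (n : nat) :
  Csum (fun i => f i - g i)%C n = (Csum f n - Csum g n)%C.
Proof. induction n as [|n IH]; simpl; [ring|rewrite IH; ring]. Qed.

Lemma Csum_scal (c : C) (f : nat -> C) (n : nat) :
  Csum (fun i => c * f i)%C n = (c * Csum f n)%C.
Proof. induction n as [|n IH]; simpl; [ring|rewrite IH; ring]. Qed.

Lemma Rsum_le (f g : nat -> R) (n : nat) :
  (forall i, (i < n)%nat -> f i <= g i) -> Rsum f n <= Rsum g n.
Proof.
  induction n as [|n IH]; simpl; intros H; [lra|].
  apply Rplus_le_compat; auto.
Qed.

Lemma Rsum_ge0 (f : nat -> R) (n : nat) :
  (forall i, (i < n)%nat -> 0 <= f i) -> 0 <= Rsum f n.
Proof.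
  induction n as [|n IH]; simpl; intros H; [lra|].
  apply Rplus_le_le_0_compat; auto.
Qed.

Lemma Rsum_const (c : R) (n : nat) : Rsum (fun _ => c) n = INR n * c.
Proof. induction n as [|n IH]; [simpl; ring|]. rewrite S_INR. simpl Rsum. rewrite IH. ring. Qed.

Lemma Rsum_add (f : nat -> R) (n m : nat) :
  Rsum f (n + m) = Rsum f n + Rsum (fun i => f (n + i)%nat) m.
Proof.
  induction m as [|m IH]; [rewrite Nat.add_0_r; simpl; ring|].
  rewrite Nat.add_succ_r; simpl. rewrite IH. ring.
Qed.

Lemma Csum_add (f : nat -> C) (n m : nat) :
  Csum f (n + m) = (Csum f n + Csum (fun i => f (n + i)%nat) m)%C.
Proof.
  induction m as [|m IH]; [rewrite Nat.add_0_r; simpl; ring|].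
  rewrite Nat.add_succ_r; simpl. rewrite IH. ring.
Qed.

Lemma Csum_S0 (f : nat -> C) (n : nat) :
  Csum f (S n) = (f O + Csum (fun i => f (S i)) n)%C.
Proof. change (S n) with (1 + n)%nat. rewrite Csum_add. simpl. ring. Qed.

Lemma Rsum_S0 (f : nat -> R) (n : nat) :
  Rsum f (S n) = f O + Rsum (fun i => f (S i)) n.
Proof. change (S n) with (1 + n)%nat. rewrite Rsum_add. simpl. ring. Qed.

Lemma Rsum_mono (f : nat -> R) (n m : nat) :
  (forall i, 0 <= f i) -> (n <= m)%nat -> Rsum f n <= Rsum f m.
Proof.
  intros H Hnm. replace m with (n + (m - n))%nat by lia. rewrite Rsum_add.
  pose proof (Rsum_ge0 (fun i => f (n + i)%nat) (m - n)) as H1.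
  assert (0 <= Rsum (fun i => f (n + i)%nat) (m - n)) by auto. lra.
Qed.

Lemma Csum_telescope (f : nat -> C) (n : nat) :
  Csum (fun i => f (S i) - f i)%C n = (f n - f O)%C.
Proof. induction n as [|n IH]; simpl; [ring|rewrite IH; ring]. Qed.

Lemma Csum_rev (f : nat -> C) (n : nat) :
  Csum (fun i => f (n - 1 - i)%nat) n = Csum f n.
Proof.
  induction n as [|n IH]; [reflexivity|].
  rewrite Csum_S0. simpl Csum at 2. rewrite <- IH.
  replace (S n - 1 - 0)%nat with n by lia.
  rewrite Cplus_comm. f_equal. apply Csum_ext. intros i Hi. f_equal. lia.
Qed.

Lemma Csum_swap (f : nat -> nat -> C) (n m : nat) :
  Csum (fun i => Csum (fun j => f i j) m) n = Csum (fun j => Csum (fun i => f i j) n) m.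
Proof.
  induction n as [|n IH]; simpl.
  - induction m as [|m IHm]; simpl; [reflexivity|rewrite <- IHm; ring].
  - rewrite IH, Csum_plus. reflexivity.
Qed.

Lemma Csum_Cmod (f : nat -> C) (n : nat) :
  Cmod (Csum f n) <= Rsum (fun i => Cmod (f i)) n.
Proof.
  induction n as [|n IH]; simpl; [rewrite Cmod_0; lra|].
  eapply Rle_trans; [apply Cmod_triangle|]. lra.
Qed.

Lemma Csum_RtoC (f : nat -> R) (n : nat) :
  Csum (fun i => RtoC (f i)) n = RtoC (Rsum f n).
Proof. induction n as [|n IH]; simpl; [reflexivity|]. rewrite IH, RtoC_plus. reflexivity. Qed.

Lemma Csum_zero (n : nat) : Csum (fun _ => RtoC 0) n = RtoC 0.
Proof. induction n as [|n IH]; simpl; [reflexivity|]. rewrite IH. ring. Qed.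

Lemma Csum_geom (q : C) (n : nat) : ((1 - q) * Csum (fun i => q ^ i) n = 1 - q ^ n)%C.
Proof.
  induction n as [|n IH]; [simpl; ring|].
  change (Csum (fun i => q ^ i)%C (S n)) with (Csum (fun i => q ^ i) n + q ^ n)%C.
  rewrite Cmult_plus_distr_l, IH. simpl. ring.
Qed.

Lemma Rsum_geom (r : R) (n : nat) : (1 - r) * Rsum (fun i => r ^ i) n = 1 - r ^ n.
Proof. induction n as [|n IH]; simpl; [ring|]. rewrite Rmult_plus_distr_l, IH. ring. Qed.

Lemma Rsum_geom_le (r : R) (n : nat) : 0 <= r < 1 -> Rsum (fun i => r ^ i) n <= / (1 - r).
Proof.
  intros H. apply Rmult_le_reg_l with (1 - r); [lra|].
  rewrite Rsum_geom, Rinv_r by lra. pose proof (pow_le r n). lra.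
Qed.

Lemma Cmod_sub_sym (a b : C) : Cmod (a - b) = Cmod (b - a).
Proof. rewrite <- Cmod_opp. f_equal. ring. Qed.

Lemma Cmod_triangle_sub (a b : C) : Cmod a <= Cmod b + Cmod (a - b).
Proof. replace a with (b + (a - b))%C at 1 by ring. apply Cmod_triangle. Qed.

Lemma Cmod_minus_le (a b : C) : Cmod (a - b) <= Cmod a + Cmod b.
Proof. unfold Cminus. eapply Rle_trans; [apply Cmod_triangle|]. rewrite Cmod_opp. lra. Qed.

Lemma Cmod_RtoC_pos (x : R) : 0 <= x -> Cmod (RtoC x) = x.
Proof. intros H. rewrite Cmod_R. apply Rabs_pos_eq, H. Qed.

(** * Convergence of complex sequences *)

Definition Ccv (u : nat -> C) (l : C) : Prop :=
  is_lim_seq (fun n => Cmod (u n - l)%C) 0.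

Lemma squeeze0 (u v : nat -> R) :
  (forall n, 0 <= u n <= v n) -> is_lim_seq v 0 -> is_lim_seq u 0.
Proof.
  intros H Hv. apply (is_lim_seq_le_le (fun _ => 0) u v); auto.
  apply is_lim_seq_const.
Qed.

Lemma squeeze0_ev (u v : nat -> R) (N : nat) :
  (forall n, (N <= n)%nat -> 0 <= u n <= v n) -> is_lim_seq v 0 -> is_lim_seq u 0.
Proof.
  intros H Hv. apply (is_lim_seq_le_le_loc (fun _ => 0) u v); auto.
  - exists N. auto.
  - apply is_lim_seq_const.
Qed.

Lemma Ccv_squeeze (u : nat -> C) (l : C) (v : nat -> R) :
  (forall n, Cmod (u n - l) <= v n) -> is_lim_seq v 0 -> Ccv u l.
Proof. intros H. apply squeeze0. intros n. split; [apply Cmod_ge_0|apply H]. Qed.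

Lemma Ccv_const (a : C) : Ccv (fun _ => a) a.
Proof.
  unfold Ccv. apply is_lim_seq_ext with (fun _ => 0); [|apply is_lim_seq_const].
  intros n. replace (a - a)%C with (RtoC 0) by ring. symmetry. apply Cmod_0.
Qed.

Lemma Ccv_ext (u v : nat -> C) (l : C) : (forall n, u n = v n) -> Ccv u l -> Ccv v l.
Proof. intros H. apply is_lim_seq_ext. intros n. rewrite H. reflexivity. Qed.

Lemma Ccv_plus (u v : nat -> C) (a b : C) :
  Ccv u a -> Ccv v b -> Ccv (fun n => u n + v n)%C (a + b)%C.
Proof.
  intros Hu Hv.
  apply Ccv_squeeze with (fun n => Cmod (u n - a) + Cmod (v n - b)).
  - intros n. replace (u n + v n - (a + b))%C with ((u n - a) + (v n - b))%C by ring.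
    apply Cmod_triangle.
  - replace 0 with (0 + 0) by ring. apply is_lim_seq_plus'; assumption.
Qed.

Lemma Ccv_scal (c : C) (u : nat -> C) (a : C) :
  Ccv u a -> Ccv (fun n => c * u n)%C (c * a)%C.
Proof.
  intros Hu.
  apply Ccv_squeeze with (fun n => Cmod c * Cmod (u n - a)).
  - intros n. rewrite <- Cmod_mult. right. f_equal. ring.
  - replace (Finite 0) with (Rbar_mult (Cmod c) 0) by (simpl; f_equal; ring).
    apply is_lim_seq_scal_l. exact Hu.
Qed.

Lemma Ccv_minus (u v : nat -> C) (a b : C) :
  Ccv u a -> Ccv v b -> Ccv (fun n => u n - v n)%C (a - b)%C.
Proof.
  intros Hu Hv. apply (Ccv_scal (-1)) in Hv.
  apply Ccv_ext with (fun n => u n + -1 * v n)%C; [intros; ring|].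
  replace (a - b)%C with (a + -1 * b)%C by ring. apply Ccv_plus; assumption.
Qed.

Lemma Ccv_bounded (u : nat -> C) (a : C) : Ccv u a ->
  exists M, forall n, Cmod (u n) <= M.
Proof.
  intros H.
  destruct (filterlim_bounded (K := R_AbsRing) (V := R_NormedModule)
              (fun n => Cmod (u n - a))) as [M HM].
  { exists 0. exact H. }
  exists (Cmod a + M). intros n. eapply Rle_trans; [apply (Cmod_triangle_sub _ a)|].
  specialize (HM n). apply Rplus_le_compat_l.
  eapply Rle_trans; [apply Rle_abs|]. exact HM.
Qed.

Lemma Ccv_mult (u v : nat -> C) (a b : C) :
  Ccv u a -> Ccv v b -> Ccv (fun n => u n * v n)%C (a * b)%C.
Proof.
  intros Hu Hv. destruct (Ccv_bounded v b Hv) as [M HM].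
  apply Ccv_squeeze with (fun n => M * Cmod (u n - a) + Cmod a * Cmod (v n - b)).
  - intros n. replace (u n * v n - a * b)%C with (v n * (u n - a) + a * (v n - b))%C by ring.
    eapply Rle_trans; [apply Cmod_triangle|]. rewrite !Cmod_mult.
    apply Rplus_le_compat_r, Rmult_le_compat_r; [apply Cmod_ge_0|apply HM].
  - replace 0 with (M * 0 + Cmod a * 0) by ring.
    apply is_lim_seq_plus';
      [apply (is_lim_seq_scal_l _ M 0)|apply (is_lim_seq_scal_l _ (Cmod a) 0)]; assumption.
Qed.

Lemma Ccv_unique (u : nat -> C) (a b : C) : Ccv u a -> Ccv u b -> a = b.
Proof.
  intros Ha Hb. pose proof (Ccv_minus _ _ _ _ Ha Hb) as H. unfold Ccv in H.
  assert (H2 : is_lim_seq (fun _ => Cmod (a - b)) 0).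
  { eapply is_lim_seq_ext; [|exact H]. intros n. simpl.
    replace (u n - u n - (a - b))%C with (- (a - b))%C by ring. apply Cmod_opp. }
  apply is_lim_seq_unique in H2. rewrite Lim_seq_const in H2. injection H2 as H2.
  apply Cmod_eq_0 in H2. replace a with (b + (a - b))%C by ring. rewrite H2. ring.
Qed.

Lemma Ccv_mod (u : nat -> C) (a : C) : Ccv u a -> is_lim_seq (fun n => Cmod (u n)) (Cmod a).
Proof.
  intros H. apply is_lim_seq_le_le with
    (fun n => Cmod a - Cmod (u n - a)) (fun n => Cmod a + Cmod (u n - a)).
  - intros n. split; [|apply Cmod_triangle_sub].
    pose proof (Cmod_triangle_sub a (u n)) as H1. rewrite (Cmod_sub_sym a) in H1. lra.
  - replace (Cmod a) with (Cmod a - 0) at 1 by ring.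
    apply is_lim_seq_minus'; [apply is_lim_seq_const|exact H].
  - replace (Cmod a) with (Cmod a + 0) at 1 by ring.
    apply is_lim_seq_plus'; [apply is_lim_seq_const|exact H].
Qed.

Lemma Ccv_mod_le (u : nat -> C) (a : C) (M : R) (N : nat) :
  Ccv u a -> (forall n, (N <= n)%nat -> Cmod (u n) <= M) -> Cmod a <= M.
Proof.
  intros H HM. apply Ccv_mod in H.
  apply (is_lim_seq_le_loc (fun n => Cmod (u n)) (fun _ => M) (Cmod a) M); auto.
  - exists N. auto.
  - apply is_lim_seq_const.
Qed.

Lemma Ccv_RtoC (u : nat -> R) (l : R) : is_lim_seq u l -> Ccv (fun n => RtoC (u n)) (RtoC l).
Proof.
  intros H. unfold Ccv.
  apply is_lim_seq_ext with (fun n => Rabs (u n - l)).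
  - intros n. rewrite <- RtoC_minus, Cmod_R. reflexivity.
  - apply -> is_lim_seq_abs_0. replace 0 with (l - l) by ring.
    apply is_lim_seq_minus'; [exact H|apply is_lim_seq_const].
Qed.

Lemma Ccv_RtoC_inv (u : nat -> R) (l : R) :
  Ccv (fun n => RtoC (u n)) (RtoC l) -> is_lim_seq u l.
Proof.
  intros H. unfold Ccv in H.
  assert (H1 : is_lim_seq (fun n => u n - l) 0).
  { apply is_lim_seq_abs_0. eapply is_lim_seq_ext; [|exact H].
    intros n. simpl. rewrite <- RtoC_minus, Cmod_R. reflexivity. }
  pose proof (is_lim_seq_plus' _ _ _ _ H1 (is_lim_seq_const l)) as H2.
  rewrite Rplus_0_l in H2. eapply is_lim_seq_ext; [|exact H2]. intros n. simpl. ring.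
Qed.

Lemma Ccv_subseq (u : nat -> C) (l : C) (phi : nat -> nat) :
  (forall n, (n <= phi n)%nat) -> Ccv u l -> Ccv (fun n => u (phi n)) l.
Proof.
  intros H Hu. apply (is_lim_seq_subseq (fun n => Cmod (u n - l)) 0 phi).
  - apply filterlim_ext with (fun n => phi n); auto.
    intros P [N HN]. exists N. intros n Hn. apply HN. specialize (H n). lia.
  - exact Hu.
Qed.

(** * Absolutely convergent series *)

Lemma Rseries_bounded (a : nat -> R) (M : R) :
  (forall i, 0 <= a i) -> (forall n, Rsum a n <= M) ->
  exists l : R, is_lim_seq (Rsum a) l /\ l <= M /\ forall n, Rsum a n <= l.
Proof.
  intros Ha HM.
  assert (Hinc : forall n, Rsum a n <= Rsum a (S n)).
  { intros n. simpl. specialize (Ha n). lra. }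
  destruct (ex_finite_lim_seq_incr (Rsum a) M Hinc HM) as [l Hl].
  exists l. split; [exact Hl|]. split.
  - apply (is_lim_seq_le (Rsum a) (fun _ => M) l M); auto. apply is_lim_seq_const.
  - intros n. apply is_lim_seq_incr_compare; auto.
Qed.

(** Absolute summability, stated by a common bound of the partial sums so that the sum of the moduli
    needs no name. *)
Definition absbd (a : nat -> C) (M : R) : Prop :=
  forall n, Rsum (fun i => Cmod (a i)) n <= M.

Lemma Csum_tail (a : nat -> C) (n m : nat) : (n <= m)%nat ->
  Cmod (Csum a m - Csum a n) <=
  Rsum (fun i => Cmod (a i)) m - Rsum (fun i => Cmod (a i)) n.
Proof.
  intros H. replace m with (n + (m - n))%nat by lia. rewrite Csum_add, Rsum_add.
  replace (Csum a n + Csum (fun i => a (n + i)%nat) (m - n) - Csum a n)%C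
    with (Csum (fun i => a (n + i)%nat) (m - n)) by ring.
  pose proof (Csum_Cmod (fun i => a (n + i)%nat) (m - n)). lra.
Qed.

(** The increments are dominated by those of a convergent real sequence, so the real and imaginary
    parts are Cauchy sequences. *)
Lemma Ccv_complete (u : nat -> C) (v : nat -> R) (l : R) :
  is_lim_seq v l -> (forall n m, (n <= m)%nat -> Cmod (u m - u n) <= v m - v n) ->
  exists a, Ccv u a.
Proof.
  intros Hv H.
  assert (Hcau : forall eps : posreal, exists N : nat, forall n m,
    (N <= n)%nat -> (N <= m)%nat -> Cmod (u m - u n) < eps).
  { intros eps. apply is_lim_seq_spec in Hv.
    destruct (Hv (pos_div_2 eps)) as [N HN]. exists N. simpl in HN.
    assert (Hle : forall n m, (N <= n)%nat -> (n <= m)%nat -> Cmod (u m - u n) < eps).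
    { intros n m H1 H2. eapply Rle_lt_trans; [apply H, H2|].
      pose proof (HN n ltac:(lia)) as Hn. pose proof (HN m ltac:(lia)) as Hm.
      apply Rabs_def2 in Hn. apply Rabs_def2 in Hm. lra. }
    intros n m Hn Hm. destruct (Nat.le_ge_cases n m) as [Hc|Hc].
    - apply Hle; auto.
    - rewrite Cmod_sub_sym. apply Hle; auto. }
  assert (Hre : ex_finite_lim_seq (fun n => Re (u n))).
  { apply ex_lim_seq_cauchy_corr. intros eps. destruct (Hcau eps) as [N HN].
    exists N. intros n m Hn Hm. eapply Rle_lt_trans; [|apply (HN m n Hm Hn)].
    eapply Rle_trans; [|apply (re_le_Cmod (u n - u m)%C)]. right. f_equal. }
  assert (Him : ex_finite_lim_seq (fun n => Im (u n))).
  { apply ex_lim_seq_cauchy_corr. intros eps. destruct (Hcau eps) as [N HN].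
    exists N. intros n m Hn Hm. eapply Rle_lt_trans; [|apply (HN m n Hm Hn)].
    eapply Rle_trans; [|apply (Rmax_Cmod (u n - u m)%C)].
    eapply Rle_trans; [|apply Rmax_r]. right. f_equal. }
  destruct Hre as [x Hx]. destruct Him as [y Hy]. exists (x, y).
  apply Ccv_ext with (fun n => RtoC (Re (u n)) + Ci * RtoC (Im (u n)))%C.
  { intros n. destruct (u n) as [p q]. unfold RtoC, Ci, Cplus, Cmult, Re, Im. simpl.
    f_equal; ring. }
  replace ((x, y) : C) with (RtoC x + Ci * RtoC y)%C.
  2:{ unfold RtoC, Ci, Cplus, Cmult, Re, Im. simpl. f_equal; ring. }
  apply Ccv_plus; [apply Ccv_RtoC, Hx|]. apply Ccv_scal, Ccv_RtoC, Hy.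
Qed.

Lemma Cseries_abs (a : nat -> C) (M : R) : absbd a M ->
  exists l, Ccv (Csum a) l.
Proof.
  intros H.
  destruct (Rseries_bounded (fun i => Cmod (a i)) M) as [l [Hl _]];
    [intros; apply Cmod_ge_0|exact H|].
  apply (Ccv_complete _ _ _ Hl). intros n m. apply Csum_tail.
Qed.

Lemma Cseries_mod_le (a : nat -> C) (M : R) (l : C) :
  absbd a M -> Ccv (Csum a) l -> Cmod l <= M.
Proof.
  intros H Hl. apply (Ccv_mod_le _ _ M 0 Hl). intros n _.
  eapply Rle_trans; [apply Csum_Cmod|apply H].
Qed.

Lemma absbd_le (a : nat -> C) (b : nat -> R) (M : R) :
  (forall i, Cmod (a i) <= b i) -> (forall n, Rsum b n <= M) -> absbd a M.
Proof.
  intros H HM n. eapply Rle_trans; [|apply (HM n)]. apply Rsum_le. auto.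
Qed.

Lemma Rsum_S (f : nat -> R) (n : nat) : Rsum f (S n) = Rsum f n + f n.
Proof. reflexivity. Qed.

Lemma Csum_S (f : nat -> C) (n : nat) : Csum f (S n) = (Csum f n + f n)%C.
Proof. reflexivity. Qed.

(** * The complex exponential *)

Lemma derive_nonneg_le (f df : R -> R) (a b : R) : a <= b ->
  (forall t, a <= t <= b -> is_derive f t (df t) /\ 0 <= df t) -> f a <= f b.
Proof.
  intros Hab H.
  destruct (MVT_gen f a b df) as [c [Hc E]].
  - rewrite Rmin_left, Rmax_right by lra. intros x Hx. apply H. lra.
  - rewrite Rmin_left, Rmax_right by lra. intros x Hx.
    apply derivable_continuous_pt. exists (df x). apply is_derive_Reals, H. lra.
  - rewrite Rmin_left, Rmax_right in Hc by lra. destruct (H c Hc) as [_ H0].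
    assert (0 <= df c * (b - a)) by (apply Rmult_le_pos; lra). lra.
Qed.

Lemma exp_le (x y : R) : x <= y -> exp x <= exp y.
Proof. intros [H|H]; [left; apply exp_increasing, H|rewrite H; apply Rle_refl]. Qed.

Lemma RtoC_neq (x y : R) : x <> y -> RtoC x <> RtoC y.
Proof. intros H E. apply H, RtoC_inj, E. Qed.

(** * Curves in the complex plane and the mean value inequality *)

Definition Cder (f : R -> C) (t : R) (d : C) : Prop :=
  is_derive (fun s => Re (f s)) t (Re d) /\ is_derive (fun s => Im (f s)) t (Im d).

Lemma Cder_const (a : C) (t : R) : Cder (fun _ => a) t 0%C.
Proof.
  split; [apply (is_derive_const (V := R_NormedModule) (Re a) t)
         |apply (is_derive_const (V := R_NormedModule) (Im a) t)].
Qed.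

Lemma Cder_RtoC (f : R -> R) (t d : R) :
  is_derive f t d -> Cder (fun s => RtoC (f s)) t (RtoC d).
Proof.
  intros H. split; [exact H|]. apply (is_derive_const (V := R_NormedModule) 0 t).
Qed.

Lemma Cder_eq (f : R -> C) (t : R) (d e : C) : Cder f t d -> d = e -> Cder f t e.
Proof. intros H <-. exact H. Qed.

Lemma Cder_ext (f g : R -> C) (t : R) (d : C) :
  (forall s, f s = g s) -> Cder f t d -> Cder g t d.
Proof.
  intros H [H1 H2]. split; eapply is_derive_ext; eauto; intros s; simpl; rewrite H; reflexivity.
Qed.

Lemma Cder_plus (f g : R -> C) (t : R) (d e : C) :
  Cder f t d -> Cder g t e -> Cder (fun s => f s + g s)%C t (d + e)%C.
Proof.
  intros [H1 H2] [H3 H4]. split.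
  - apply (is_derive_plus (fun s => Re (f s)) (fun s => Re (g s)) t _ _ H1 H3).
  - apply (is_derive_plus (fun s => Im (f s)) (fun s => Im (g s)) t _ _ H2 H4).
Qed.

Lemma Cder_mult (f g : R -> C) (t : R) (d e : C) :
  Cder f t d -> Cder g t e -> Cder (fun s => f s * g s)%C t (d * g t + f t * e)%C.
Proof.
  intros [H1 H2] [H3 H4]. split.
  - apply (is_derive_ext (fun s => Re (f s) * Re (g s) - Im (f s) * Im (g s))).
    { intros s. reflexivity. }
    replace (Re (d * g t + f t * e)%C) with
      ((Re d * Re (g t) + Re (f t) * Re e) - (Im d * Im (g t) + Im (f t) * Im e)).
    2:{ unfold Re, Im. simpl. ring. }
    apply (is_derive_minus (V := R_NormedModule) (fun s => Re (f s) * Re (g s)) (fun s => Im (f s) * Im (g s))).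
    + apply (is_derive_mult _ _ _ _ _ H1 H3). intros; apply Rmult_comm.
    + apply (is_derive_mult _ _ _ _ _ H2 H4). intros; apply Rmult_comm.
  - apply (is_derive_ext (fun s => Re (f s) * Im (g s) + Im (f s) * Re (g s))).
    { intros s. reflexivity. }
    replace (Im (d * g t + f t * e)%C) with
      ((Re d * Im (g t) + Re (f t) * Im e) + (Im d * Re (g t) + Im (f t) * Re e)).
    2:{ unfold Re, Im. simpl. ring. }
    apply (is_derive_plus (V := R_NormedModule) (fun s => Re (f s) * Im (g s)) (fun s => Im (f s) * Re (g s))).
    + apply (is_derive_mult _ _ _ _ _ H1 H4). intros; apply Rmult_comm.
    + apply (is_derive_mult _ _ _ _ _ H2 H3). intros; apply Rmult_comm.
Qed.

Lemma Cder_scal (c : C) (f : R -> C) (t : R) (d : C) :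
  Cder f t d -> Cder (fun s => c * f s)%C t (c * d)%C.
Proof.
  intros H. eapply Cder_eq; [apply (Cder_mult (fun _ => c) f t _ _ (Cder_const c t) H)|].
  ring.
Qed.

Lemma Cder_Csum (f : nat -> R -> C) (d : nat -> C) (t : R) (n : nat) :
  (forall i, (i < n)%nat -> Cder (f i) t (d i)) ->
  Cder (fun s => Csum (fun i => f i s) n) t (Csum d n).
Proof.
  induction n as [|n IH]; intros H; [exact (Cder_const 0 t)|].
  refine (Cder_plus (fun s => Csum (fun i => f i s) n) (f n) t (Csum d n) (d n) _ _).
  - apply IH. intros i Hi. apply H. lia.
  - apply H. lia.
Qed.

Definition cexp (z : C) : C := (exp (Re z) * cos (Im z), exp (Re z) * sin (Im z)).

Lemma cexp_plus (a b : C) : cexp (a + b)%C = (cexp a * cexp b)%C.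
Proof.
  unfold cexp, Cmult, Cplus, Re, Im. simpl. rewrite exp_plus, cos_plus, sin_plus.
  f_equal; ring.
Qed.

Lemma cexp_RtoC (x : R) : cexp (RtoC x) = RtoC (exp x).
Proof. unfold cexp, RtoC, Re, Im. simpl. rewrite cos_0, sin_0. f_equal; ring. Qed.

Lemma cexp_0 : cexp 0%C = 1%C.
Proof. rewrite cexp_RtoC, exp_0. reflexivity. Qed.

Lemma Cmod_cexp (z : C) : Cmod (cexp z) = exp (Re z).
Proof.
  unfold Cmod, cexp. simpl.
  replace (exp (Re z) * cos (Im z) * (exp (Re z) * cos (Im z) * 1) +
           exp (Re z) * sin (Im z) * (exp (Re z) * sin (Im z) * 1))
    with ((exp (Re z))² * ((sin (Im z))² + (cos (Im z))²)) by (unfold Rsqr; ring).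
  rewrite sin2_cos2, Rmult_1_r. apply sqrt_Rsqr. left. apply exp_pos.
Qed.

Lemma cexp_pow (z : C) (n : nat) : (cexp z ^ n)%C = cexp (INR n * z)%C.
Proof.
  induction n as [|n IH].
  - simpl. replace (0 * z)%C with (RtoC 0) by ring. symmetry. apply cexp_0.
  - rewrite S_INR, RtoC_plus. simpl Cpow. rewrite IH, <- cexp_plus. f_equal. ring.
Qed.

Lemma Cder_cexp (f : R -> C) (t : R) (d : C) :
  Cder f t d -> Cder (fun s => cexp (f s)) t (d * cexp (f t))%C.
Proof.
  intros [H1 H2]. split.
  - apply (is_derive_ext (fun s => exp (Re (f s)) * cos (Im (f s)))); [reflexivity|].
    replace (Re (d * cexp (f t))%C) with
      (Re d * exp (Re (f t)) * cos (Im (f t)) + exp (Re (f t)) * (Im d * - sin (Im (f t)))).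
    2:{ unfold cexp, Cmult, Re, Im. simpl. ring. }
    apply (is_derive_mult (fun s => exp (Re (f s))) (fun s => cos (Im (f s)))); [| |intros; apply Rmult_comm].
    + apply (is_derive_comp exp (fun s => Re (f s))); [apply is_derive_exp|exact H1].
    + apply (is_derive_comp cos (fun s => Im (f s))); [apply is_derive_cos|exact H2].
  - apply (is_derive_ext (fun s => exp (Re (f s)) * sin (Im (f s)))); [reflexivity|].
    replace (Im (d * cexp (f t))%C) with
      (Re d * exp (Re (f t)) * sin (Im (f t)) + exp (Re (f t)) * (Im d * cos (Im (f t)))).
    2:{ unfold cexp, Cmult, Re, Im. simpl. ring. }
    apply (is_derive_mult (fun s => exp (Re (f s))) (fun s => sin (Im (f s)))); [| |intros; apply Rmult_comm].
    + apply (is_derive_comp exp (fun s => Re (f s))); [apply is_derive_exp|exact H1].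
    + apply (is_derive_comp sin (fun s => Im (f s))); [apply is_derive_sin|exact H2].
Qed.

Lemma Re_conj_le (v d : C) : Re v * Re d + Im v * Im d <= Cmod v * Cmod d.
Proof.
  rewrite <- (Cmod_conj v), <- Cmod_mult.
  eapply Rle_trans; [|apply re_le_Cmod]. eapply Rle_trans; [|apply Rle_abs].
  right. unfold Cconj, Cmult, Re, Im. simpl. ring.
Qed.

Lemma Cmod_sqr (v : C) : Cmod v * Cmod v = Re v * Re v + Im v * Im v.
Proof. pose proof (Cmod2_alt v) as H. nra. Qed.

(* Projecting [f] on the direction of its increment reduces the mean value inequality to the real case. *)
Lemma Cmean_value (f d : R -> C) (b db : R -> R) :
  (forall t, 0 <= t <= 1 -> Cder f t (d t) /\ is_derive b t (db t) /\ Cmod (d t) <= db t) ->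
  Cmod (f 1 - f 0)%C <= b 1 - b 0.
Proof.
  intros H. set (v := (f 1 - f 0)%C).
  assert (Hb : b 0 <= b 1).
  { apply (derive_nonneg_le b db); [lra|]. intros t Ht. destruct (H t Ht) as [_ [H1 H2]].
    split; [exact H1|]. pose proof (Cmod_ge_0 (d t)). lra. }
  pose proof (Cmod_ge_0 v) as Hv.
  pose (h := fun s => Cmod v * b s - (Re v * Re (f s) + Im v * Im (f s))).
  assert (Hh : h 0 <= h 1).
  { apply (derive_nonneg_le h
      (fun t => Cmod v * db t - (Re v * Re (d t) + Im v * Im (d t)))); [lra|].
    intros t Ht. destruct (H t Ht) as [[H1 H2] [H3 H4]]. split.
    - apply (is_derive_minus (V := R_NormedModule) (fun s => Cmod v * b s)
        (fun s => Re v * Re (f s) + Im v * Im (f s))).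
      + apply (is_derive_scal b); exact H3.
      + apply (is_derive_plus (V := R_NormedModule) (fun s => Re v * Re (f s)) (fun s => Im v * Im (f s)));
          apply (is_derive_scal (fun s => _ (f s))); assumption.
    - pose proof (Re_conj_le v (d t)).
      assert (Cmod v * Cmod (d t) <= Cmod v * db t) by (apply Rmult_le_compat_l; lra). lra. }
  pose proof (Cmod_sqr v) as E.
  assert (E2 : Re v = Re (f 1) - Re (f 0) /\ Im v = Im (f 1) - Im (f 0)) by (split; reflexivity).
  destruct E2 as [E2 E3]. unfold h in Hh.
  destruct (Rle_lt_or_eq_dec 0 (Cmod v) Hv) as [Hp|Hz]; [|lra].
  apply Rmult_le_reg_l with (Cmod v); [exact Hp|]. nra.
Qed.

Lemma Cmean_value_const (f d : R -> C) (M : R) :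
  (forall t, 0 <= t <= 1 -> Cder f t (d t) /\ Cmod (d t) <= M) ->
  Cmod (f 1 - f 0)%C <= M.
Proof.
  intros H. replace M with (M * 1 - M * 0) by ring.
  apply (Cmean_value f d (fun t => M * t) (fun _ => M)).
  intros t Ht. destruct (H t Ht) as [H1 H2]. split; [exact H1|]. split; [|exact H2].
  auto_derive; auto. ring.
Qed.

(** * Taylor remainders of the exponential *)

Definition cexp_rem (w : C) (n : nat) : C :=
  (cexp w - Csum (fun i => w ^ i / RtoC (INR (fact i))) n)%C.

Lemma RtoC_fact_neq0 (n : nat) : RtoC (INR (fact n)) <> 0%C.
Proof. intros H. apply RtoC_inj in H. apply (INR_fact_neq_0 n H). Qed.

(** Along a ray the derivative lowers the order of the remainder by one, which is the induction step
    of Taylor's estimate. *)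
Lemma cexp_rem_der (w : C) (n : nat) (t : R) :
  Cder (fun s => cexp_rem (RtoC s * w)%C (S n)) t (w * cexp_rem (RtoC t * w)%C n)%C.
Proof.
  unfold cexp_rem.
  assert (D1 : Cder (fun s => RtoC s * w)%C t w).
  { eapply Cder_eq.
    - apply (Cder_mult (fun s => RtoC s) (fun _ => w)); [|apply Cder_const].
      apply (Cder_RtoC (fun s => s) t 1), (is_derive_id (K := R_AbsRing)).
    - ring. }
  assert (D2 : forall k, Cder (fun s => (RtoC s * w) ^ k)%C t
                (match k with O => 0 | S j => RtoC (INR k) * (w * (RtoC t * w) ^ j) end)%C).
  { induction k as [|k IH]; [exact (Cder_const 1 t)|].
    eapply Cder_eq; [apply (Cder_mult _ _ _ _ _ D1 IH)|].
    destruct k as [|k]; [simpl; ring|]. rewrite (S_INR (S k)), RtoC_plus. simpl Cpow. ring. }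
  apply (Cder_ext (fun s => cexp (RtoC s * w)%C + -1 *
     Csum (fun i => / RtoC (INR (fact i)) * (RtoC s * w) ^ i) (S n))%C).
  { intros s. unfold Cminus. f_equal. rewrite <- Csum_scal.
    replace (- Csum (fun i => (RtoC s * w) ^ i / RtoC (INR (fact i))) (S n))%C
      with (-1 * Csum (fun i => (RtoC s * w) ^ i / RtoC (INR (fact i))) (S n))%C by ring.
    rewrite <- Csum_scal. apply Csum_ext. intros i _. unfold Cdiv. ring. }
  eapply Cder_eq.
  { apply Cder_plus; [apply Cder_cexp, D1|]. apply Cder_scal, Cder_Csum.
    intros i _. apply Cder_scal, D2. }
  rewrite Csum_S0.
  rewrite (Csum_ext _ (fun i => w * ((RtoC t * w) ^ i / RtoC (INR (fact i))))%C).
  - rewrite Csum_scal. ring.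
  - intros i _. rewrite fact_simpl, mult_INR, RtoC_mult. field. split.
    + apply RtoC_fact_neq0.
    + intros H. apply RtoC_inj in H. apply (not_0_INR (S i)); auto.
Qed.

(** Induction on [n] through the mean value inequality. The claim is proved at all points [t w] with
    the factor [t^n], because the majorant of the derivative must itself be the derivative of a
    power of the parameter. *)
Lemma cexp_taylor (w : C) (n : nat) :
  Cmod (cexp_rem w n) <= Cmod w ^ n / INR (fact n) * exp (Cmod w).
Proof.
  enough (H : forall t, 0 <= t <= 1 ->
    Cmod (cexp_rem (RtoC t * w)%C n) <= (t * Cmod w) ^ n / INR (fact n) * exp (Cmod w)).
  { specialize (H 1 ltac:(lra)). rewrite Cmult_1_l, Rmult_1_l in H. exact H. }
  induction n as [|n IH]; intros t Ht.
  - unfold cexp_rem. simpl.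
    replace (cexp (RtoC t * w) - 0)%C with (cexp (RtoC t * w)) by ring.
    rewrite Cmod_cexp.
    replace (1 / 1 * exp (Cmod w)) with (exp (Cmod w)) by field. apply exp_le.
    replace (Re (RtoC t * w)%C) with (t * Re w) by (unfold Re, RtoC, Cmult; simpl; ring).
    pose proof (re_le_Cmod w) as H. pose proof (Rle_abs (Re w)). pose proof (Cmod_ge_0 w). nra.
  - set (K := Cmod w ^ n / INR (fact n) * exp (Cmod w)).
    assert (HF : 0 < INR (fact n)) by apply INR_fact_lt_0.
    assert (E0 : cexp_rem (RtoC (t * 0) * w)%C (S n) = 0%C).
    { unfold cexp_rem. rewrite Rmult_0_r, Cmult_0_l, cexp_0, Csum_S0.
      rewrite (Csum_ext _ (fun _ => RtoC 0)).
      - rewrite Csum_zero. simpl. field.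
      - intros i _. simpl. unfold Cdiv. ring. }
    pose proof (Cmean_value (fun s => cexp_rem (RtoC (t * s) * w)%C (S n))
      (fun s => t * w * cexp_rem (RtoC (t * s) * w)%C n)%C
      (fun s => (t * s * Cmod w) ^ (S n) / INR (fact (S n)) * exp (Cmod w))
      (fun s => t * Cmod w * ((t * s * Cmod w) ^ n / INR (fact n) * exp (Cmod w)))) as HM.
    cbv beta in HM. rewrite E0, Rmult_1_r, Rmult_0_r in HM.
    replace (cexp_rem (RtoC t * w) (S n) - 0)%C with (cexp_rem (RtoC t * w)%C (S n)) in HM by ring.
    eapply Rle_trans; [apply HM|].
    + intros s Hs. split; [|split].
      * pose proof (cexp_rem_der (t * w)%C n s) as HD.
        eapply Cder_eq; [eapply Cder_ext; [|exact HD]|].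
        -- intros u. simpl. f_equal. rewrite RtoC_mult. ring.
        -- simpl. f_equal. f_equal. rewrite RtoC_mult. ring.
      * auto_derive; [exact I|].
        change (fact n + n * fact n)%nat with (fact (S n)).
        rewrite (fact_simpl n), mult_INR.
        change (match n with 0%nat => 1 | S _ => INR n + 1 end) with (INR (S n)).
        pose proof (not_0_INR (S n) ltac:(auto)). field. split; lra.
      * rewrite !Cmod_mult, Cmod_R, Rabs_pos_eq by lra.
        apply Rmult_le_compat_l.
        -- apply Rmult_le_pos; [lra|apply Cmod_ge_0].
        -- apply IH. nra.
    + right. rewrite (Rmult_0_l (Cmod w)). simpl pow at 2. unfold Rdiv. ring.
Qed.

Lemma cexp_m1 (w : C) : Cmod (cexp w - 1)%C <= Cmod w * exp (Cmod w).
Proof.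
  pose proof (cexp_taylor w 1) as H. unfold cexp_rem in H. simpl in H.
  replace (cexp w - (0 + 1 / 1))%C with (cexp w - 1)%C in H by (field; apply RtoC_neq; lra).
  unfold Rdiv in H. rewrite Rinv_1, !Rmult_1_r in H. exact H.
Qed.

Lemma cexp_m1m (w : C) : Cmod (cexp w - 1 - w)%C <= Cmod w ^ 2 * exp (Cmod w).
Proof.
  pose proof (cexp_taylor w 2) as H. unfold cexp_rem in H. simpl in H.
  replace (cexp w - (0 + 1 / 1 + w * 1 / 1))%C with (cexp w - 1 - w)%C in H
    by (field; apply RtoC_neq; lra).
  eapply Rle_trans; [exact H|]. simpl.
  pose proof (exp_pos (Cmod w)). pose proof (Rle_0_sqr (Cmod w)). unfold Rsqr in *. nra.
Qed.

Lemma cexp_series (w : C) : Ccv (Csum (fun i => w ^ i / RtoC (INR (fact i)))%C) (cexp w).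
Proof.
  apply Ccv_squeeze with (fun n => Cmod w ^ n / INR (fact n) * exp (Cmod w)).
  - intros n. rewrite Cmod_sub_sym. apply (cexp_taylor w n).
  - replace (Finite 0) with (Rbar_mult 0 (exp (Cmod w))) by (simpl; f_equal; ring).
    apply is_lim_seq_scal_r. apply is_lim_seq_Reals.
    apply cv_speed_pow_fact.
Qed.

Lemma Rsum_exp_le (x : R) (n : nat) : 0 <= x ->
  Rsum (fun i => x ^ i / INR (fact i)) n <= exp x.
Proof.
  intros Hx.
  assert (Hp : forall i, 0 <= x ^ i / INR (fact i)).
  { intros i. apply Rmult_le_pos; [apply pow_le, Hx|]. left. apply Rinv_0_lt_compat, INR_fact_lt_0. }
  assert (Hl : is_lim_seq (Rsum (fun i => x ^ i / INR (fact i))) (exp x)).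
  { apply Ccv_RtoC_inv. rewrite <- cexp_RtoC.
    eapply Ccv_ext; [|apply cexp_series]. intros m. simpl. rewrite <- Csum_RtoC.
    apply Csum_ext. intros i _. rewrite <- RtoC_pow, <- RtoC_div; [reflexivity|].
    apply INR_fact_neq_0. }
  apply is_lim_seq_incr_compare with (u := Rsum (fun i => x ^ i / INR (fact i))); auto.
  intros m. simpl. specialize (Hp m). lra.
Qed.

(** * Generating function and Shanks' identity *)

Lemma Cpow_add (q : C) (n m : nat) : (q ^ (n + m) = q ^ n * q ^ m)%C.
Proof. induction n as [|n IH]; simpl; [ring|rewrite IH; ring]. Qed.

Lemma Cpow_mul (q : C) (n m : nat) : (q ^ (n * m) = (q ^ n) ^ m)%C.
Proof.
  induction m as [|m IH]; [rewrite Nat.mul_0_r; reflexivity|].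
  rewrite Nat.mul_succ_r, Cpow_add, IH. simpl. ring.
Qed.

Lemma pow_lt_1_disk (q : C) (i : nat) : Cmod q < 1 -> Cmod (q ^ S i)%C < 1.
Proof.
  intros H. rewrite Cmod_pow. pose proof (Cmod_ge_0 q) as H0.
  apply Rle_lt_trans with (Cmod q ^ 1); [|lra].
  apply Rle_pow_le1 || (simpl; rewrite Rmult_1_r;
    assert (Cmod q ^ i <= 1 ^ i) by (apply pow_incr; lra); rewrite pow1 in *; nra).
Qed.

Lemma one_minus_neq0 (w : C) : Cmod w < 1 -> (1 - w)%C <> 0%C.
Proof.
  intros H E. assert (w = 1)%C as -> by (replace w with (1 - (1 - w))%C by ring; rewrite E; ring).
  rewrite Cmod_1 in H. lra.
Qed.

Lemma one_plus_neq0 (w : C) : Cmod w < 1 -> (1 + w)%C <> 0%C.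
Proof.
  intros H. replace (1 + w)%C with (1 - - w)%C by ring. apply one_minus_neq0.
  rewrite Cmod_opp. exact H.
Qed.

(** Each factor is [1 + 2 q^m + 2 q^(2 m) + ...]: a multiplicity for the part [m] and, if it is
    positive, the choice of an overline. *)
Fixpoint eprod (reg : nat -> bool) (q : C) (m : nat) : C :=
  match m with
  | O => RtoC 1
  | S n => if reg m then (eprod reg q n * ((1 + q ^ m) / (1 - q ^ m)))%C else eprod reg q n
  end.

Lemma factor_le (w : C) (r : R) : Cmod w <= r -> r < 1 ->
  Cmod ((1 + w) / (1 - w))%C <= (1 + r) / (1 - r).
Proof.
  intros H Hr. pose proof (Cmod_ge_0 w) as H0.
  rewrite Cmod_div by (apply one_minus_neq0; lra).
  assert (H1 : Cmod (1 + w)%C <= 1 + r).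
  { eapply Rle_trans; [apply Cmod_triangle|]. rewrite Cmod_1. lra. }
  assert (H2 : 1 - r <= Cmod (1 - w)%C).
  { pose proof (Cmod_triangle_sub 1 (1 - w)%C) as H3. rewrite Cmod_1 in H3.
    replace (1 - (1 - w))%C with w in H3 by ring. lra. }
  unfold Rdiv. apply Rmult_le_compat; [apply Cmod_ge_0| |exact H1|].
  - left. apply Rinv_0_lt_compat. lra.
  - apply Rinv_le_contravar; lra.
Qed.

Lemma factor_exp (r : R) (m : nat) : 0 <= r < 1 ->
  (1 + r ^ S m) / (1 - r ^ S m) <= exp (2 * r ^ S m / (1 - r)).
Proof.
  intros Hr. assert (H0 : 0 <= r ^ S m) by (apply pow_le; lra).
  assert (H1 : r ^ S m <= r).
  { simpl. assert (r ^ m <= 1 ^ m) by (apply pow_incr; lra). rewrite pow1 in *. nra. }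
  eapply Rle_trans; [|apply exp_ineq1_le].
  set (w := r ^ S m) in *.
  replace ((1 + w) / (1 - w)) with (1 + 2 * w / (1 - w)) by (field; lra).
  apply Rplus_le_compat_l. unfold Rdiv. apply Rmult_le_compat_l; [lra|].
  apply Rinv_le_contravar; lra.
Qed.

(** The factor with index [i] is at most [exp (2 r^i / (1 - r))], and the geometric series of the
    [r^i] is at most [1 / (1 - r)]; hence a bound for all partial products at once. *)
Definition ebound (r : R) : R := exp (2 / (1 - r) * / (1 - r)).

Lemma eprod_bound_aux (r : R) (m : nat) : 0 <= r < 1 ->
  exp (2 / (1 - r) * Rsum (fun i => r ^ S i) m) <= ebound r.
Proof.
  intros Hr. unfold ebound. apply exp_le. apply Rmult_le_compat_l.
  - apply Rmult_le_pos; [lra|]. left. apply Rinv_0_lt_compat. lra.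
  - eapply Rle_trans; [|apply (Rsum_geom_le r m Hr)]. apply Rsum_le. intros i _.
    simpl. pose proof (pow_le r i ltac:(lra)). nra.
Qed.

Lemma eprod_bound (reg : nat -> bool) (q : C) (m : nat) : Cmod q < 1 ->
  Cmod (eprod reg q m) <= ebound (Cmod q).
Proof.
  intros Hq. pose proof (Cmod_ge_0 q) as H0.
  eapply Rle_trans; [|apply (eprod_bound_aux (Cmod q) m ltac:(lra))].
  set (c := 2 / (1 - Cmod q)).
  assert (Hc : 0 <= c) by (apply Rmult_le_pos; [lra|]; left; apply Rinv_0_lt_compat; lra).
  induction m as [|m IH]; [simpl; rewrite Rmult_0_r, exp_0, Cmod_1; lra|].
  simpl Rsum. rewrite Rmult_plus_distr_l, exp_plus.
  assert (Hp : 0 <= c * (Cmod q ^ S m)) by (apply Rmult_le_pos; [exact Hc|apply pow_le, H0]).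
  pose proof (exp_ineq1_le (c * (Cmod q ^ S m))) as H1.
  simpl eprod. destruct (reg (S m)).
  - rewrite Cmod_mult. apply Rmult_le_compat; try apply Cmod_ge_0; [exact IH|].
    eapply Rle_trans; [|eapply Rle_trans; [apply (factor_exp (Cmod q) m); lra|]].
    + apply factor_le; [rewrite <- Cmod_pow; apply Rle_refl|].
      rewrite <- Cmod_pow. apply pow_lt_1_disk, Hq.
    + right. apply f_equal. unfold c, Rdiv. simpl pow. ring.
  - pose proof (Cmod_ge_0 (eprod reg q m)). simpl in *. nra.
Qed.

Section GeneratingFunction.

Variables (reg : nat -> bool) (c : nat -> nat -> nat) (a : nat -> nat).
Hypothesis c0 : forall n, c O n = match n with O => 1%nat | _ => O end.
Hypothesis c_reg : forall m n, reg (S m) = true ->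
  c (S m) n = (c m n + if (S m <=? n)%nat then c m (n - S m) + c (S m) (n - S m) else 0)%nat.
Hypothesis c_nreg : forall m n, reg (S m) = false -> c (S m) n = c m n.
Hypothesis c_full : forall m n, (n <= m)%nat -> c m n = a n.

Lemma c_incr (m n : nat) : (c m n <= c (S m) n)%nat.
Proof. destruct (reg (S m)) eqn:E; [rewrite (c_reg m n E)|rewrite (c_nreg m n E)]; lia. Qed.

Lemma c_le_a (m n : nat) : (c m n <= a n)%nat.
Proof.
  rewrite <- (c_full (m + n) n) by lia.
  replace (m + n)%nat with (n + m)%nat by lia.
  induction n as [|p IH] at 2; simpl; [lia|]. eapply Nat.le_trans; [exact IH|apply c_incr].
Qed.

Let cs (m : nat) (q : C) : nat -> C := fun n => (RtoC (INR (c m n)) * q ^ n)%C.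

(** Truncating at [S m + N] on one side and at [N] after the shift by [q ^ S m] makes the recurrence
    exact for partial sums. *)
Lemma cs_step (m : nat) (q : C) (N : nat) : reg (S m) = true ->
  Csum (cs (S m) q) (S m + N) =
  (Csum (cs m q) (S m + N) + q ^ S m * (Csum (cs m q) N + Csum (cs (S m) q) N))%C.
Proof.
  intros E. rewrite !(Csum_add _ (S m) N).
  rewrite (Csum_ext (cs (S m) q) (cs m q) (S m)).
  2:{ intros i Hi. unfold cs. rewrite (c_reg m i E).
      destruct (Nat.leb_spec (S m) i); [lia|]. rewrite Nat.add_0_r. reflexivity. }
  rewrite (Csum_ext (fun i => cs (S m) q (S m + i)%nat) (fun i => cs m q (S m + i)%nat + q ^ S m * (cs m q i + cs (S m) q i))%C).
  2:{ intros i Hi. unfold cs. rewrite (c_reg m (S m + i) E).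
      destruct (Nat.leb_spec (S m) (S m + i)); [|lia].
      replace (S m + i - S m)%nat with i by lia. rewrite !plus_INR, !RtoC_plus, Cpow_add.
      ring. }
  rewrite Csum_plus, Csum_scal, Csum_plus. ring.
Qed.

Lemma cs_bound (m : nat) (q : C) : Cmod q < 1 ->
  absbd (cs m q) (exp (2 / (1 - Cmod q) * Rsum (fun i => Cmod q ^ S i) m)).
Proof.
  intros Hq. pose proof (Cmod_ge_0 q) as H0. set (r := Cmod q) in *.
  assert (Habs : forall m n, Cmod (cs m q n) = Cmod (cs m (RtoC r) n)).
  { intros p n. unfold cs. rewrite !Cmod_mult, !Cmod_pow. f_equal. f_equal.
    rewrite (Cmod_RtoC_pos r); auto. }
  assert (Hreal : forall m N, Rsum (fun i => Cmod (cs m q i)) N = Cmod (Csum (cs m (RtoC r)) N)).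
  { intros p N. transitivity (Rsum (fun i => INR (c p i) * r ^ i) N).
    - apply Rsum_ext. intros i _. unfold cs. rewrite Cmod_mult, Cmod_pow.
      rewrite Cmod_RtoC_pos by apply pos_INR. reflexivity.
    - rewrite <- (Cmod_RtoC_pos (Rsum _ _)).
      + rewrite <- Csum_RtoC. f_equal. apply Csum_ext. intros i _. unfold cs.
        rewrite RtoC_mult, RtoC_pow. reflexivity.
      + apply Rsum_ge0. intros. apply Rmult_le_pos; [apply pos_INR|apply pow_le, H0]. }
  assert (Hc : 0 <= 2 / (1 - r)) by (apply Rmult_le_pos; [lra|]; left; apply Rinv_0_lt_compat; lra).
  induction m as [|m IH].
  - intros n. simpl Rsum at 2. rewrite Rmult_0_r, exp_0.
    destruct n as [|n]; [simpl; lra|]. rewrite Rsum_S0.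
    rewrite (Rsum_ext _ (fun _ => 0)), Rsum_const.
    + unfold cs. rewrite c0. simpl. rewrite Cmult_1_l, Cmod_1. lra.
    + intros i _. unfold cs. rewrite c0. simpl. rewrite Cmult_0_l. apply Cmod_0.
  - change (Rsum (fun i => r ^ S i) (S m)) with (Rsum (fun i => r ^ S i) m + r ^ S m).
    rewrite Rmult_plus_distr_l, exp_plus.
    assert (Hp : 0 <= 2 / (1 - r) * r ^ S m) by (apply Rmult_le_pos; [exact Hc|apply pow_le, H0]).
    pose proof (exp_ineq1_le (2 / (1 - r) * r ^ S m)) as H1.
    set (B := exp (2 / (1 - r) * Rsum (fun i => r ^ S i) m)) in *.
    assert (HB : 0 < B) by apply exp_pos.
    destruct (reg (S m)) eqn:E.
    + intros N.
      assert (Hw : 0 <= r ^ S m < 1).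
      { split; [apply pow_le, H0|]. unfold r. rewrite <- Cmod_pow. apply pow_lt_1_disk, Hq. }
      pose proof (factor_exp r m ltac:(lra)) as HF.
      pose proof (Rsum_mono (fun i => Cmod (cs (S m) q i)) N (S m + N)
        (fun i => Cmod_ge_0 _) ltac:(lia)) as HM.
      set (X := Rsum (fun i => Cmod (cs (S m) q i)) (S m + N)) in *.
      (* The sum up to [N] is at most the sum [X] up to [S m + N], so the recurrence closes up into
         an inequality for [X] alone, which is solved by [B (1 + w) / (1 - w)] with
         [w = r ^ S m]. *)
      assert (HX : X <= B + r ^ S m * (B + X)).
      { unfold X at 1. rewrite Hreal, (cs_step m (RtoC r) N E).
        eapply Rle_trans; [apply Cmod_triangle|].
        apply Rplus_le_compat; [rewrite <- Hreal; apply IH|].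
        rewrite Cmod_mult, Cmod_pow, Cmod_RtoC_pos by exact H0.
        apply Rmult_le_compat_l; [lra|].
        eapply Rle_trans; [apply Cmod_triangle|]. rewrite <- !Hreal.
        apply Rplus_le_compat; [apply IH|exact HM]. }
      eapply Rle_trans; [exact HM|].
      apply Rle_trans with (B * ((1 + r ^ S m) / (1 - r ^ S m))).
      * apply Rmult_le_reg_r with (1 - r ^ S m); [lra|].
        replace (B * ((1 + r ^ S m) / (1 - r ^ S m)) * (1 - r ^ S m))
          with (B * (1 + r ^ S m)) by (field; lra). nra.
      * apply Rmult_le_compat_l; [left; exact HB|]. eapply Rle_trans; [exact HF|]. right.
        apply f_equal. unfold Rdiv. simpl pow. ring.
    + intros N. rewrite (Rsum_ext _ (fun i => Cmod (cs m q i))).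
      * eapply Rle_trans; [apply (IH N)|]. rewrite <- (Rmult_1_r B) at 1.
        apply Rmult_le_compat_l; lra.
      * intros i _. unfold cs. rewrite (c_nreg m i E). reflexivity.
Qed.

(** Once [cs_bound] provides a limit [l], the recurrence becomes a linear equation
    [l = P + w (P + l)], whose solution multiplies the product [P] by its next factor. *)
Lemma cs_sum (m : nat) (q : C) : Cmod q < 1 -> Ccv (Csum (cs m q)) (eprod reg q m).
Proof.
  intros Hq. induction m as [|m IH].
  - apply (squeeze0_ev _ (fun _ => 0) 1); [|apply is_lim_seq_const].
    intros n Hn. split; [apply Cmod_ge_0|]. destruct n as [|n]; [lia|].
    rewrite Csum_S0, (Csum_ext _ (fun _ => RtoC 0)), Csum_zero.
    + unfold cs. rewrite c0. simpl.
      replace (1 * 1 + 0 - 1)%C with (RtoC 0) by ring. rewrite Cmod_0. lra.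
    + intros i _. unfold cs. rewrite c0. simpl. ring.
  - destruct (reg (S m)) eqn:E.
    + destruct (Cseries_abs _ _ (cs_bound (S m) q Hq)) as [l Hl].
      assert (El : l = (eprod reg q m + q ^ S m * (eprod reg q m + l))%C).
      { apply (Ccv_unique (fun N => Csum (cs (S m) q) (S m + N))).
        - apply (Ccv_subseq (Csum (cs (S m) q)) l (fun N => S m + N)%nat); [intros; lia|exact Hl].
        - eapply Ccv_ext; [intros N; symmetry; apply (cs_step m q N E)|].
          apply Ccv_plus; [|apply Ccv_scal, Ccv_plus; [exact IH|exact Hl]].
          apply (Ccv_subseq (Csum (cs m q)) _ (fun N => S m + N)%nat); [intros; lia|exact IH]. }
      replace (eprod reg q (S m)) with l; [exact Hl|].
      simpl eprod. rewrite E. change (q * q ^ m)%C with (q ^ S m)%C.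
      pose proof (one_minus_neq0 _ (pow_lt_1_disk q m Hq)) as Hn.
      set (w := (q ^ S m)%C) in *.
      assert (El2 : (l * (1 - w) = eprod reg q m * (1 + w))%C).
      { replace (l * (1 - w))%C with (l - w * l)%C by ring. rewrite El at 1. ring. }
      replace l with (l * (1 - w) / (1 - w))%C by (field; exact Hn). rewrite El2. field. exact Hn.
    + simpl eprod. rewrite E. eapply Ccv_ext; [|exact IH].
      intros N. apply Csum_ext. intros i _. unfold cs. rewrite (c_nreg m i E). reflexivity.
Qed.

Lemma gf_bound (q : C) : Cmod q < 1 ->
  absbd (fun n => RtoC (INR (a n)) * q ^ n)%C (ebound (Cmod q)).
Proof.
  intros Hq N. pose proof (Cmod_ge_0 q) as H0.
  eapply Rle_trans; [|apply (eprod_bound_aux (Cmod q) N ltac:(lra))].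
  eapply Rle_trans; [|apply (cs_bound N q Hq N)].
  right. apply Rsum_ext. intros i Hi. unfold cs. rewrite c_full by lia. reflexivity.
Qed.

(** The counts [c m n] agree with [a n] for [n <= m] and never exceed it, so the two series differ
    by at most the tail beyond [m] of an absolutely convergent series. *)
Lemma gf_sum (q : C) : Cmod q < 1 ->
  exists f, Ccv (Csum (fun n => RtoC (INR (a n)) * q ^ n)%C) f /\ Ccv (eprod reg q) f.
Proof.
  intros Hq. destruct (Cseries_abs _ _ (gf_bound q Hq)) as [f Hf].
  exists f. split; [exact Hf|].
  destruct (Rseries_bounded (fun i => Cmod (RtoC (INR (a i)) * q ^ i)%C) _
     (fun i => Cmod_ge_0 _) (gf_bound q Hq)) as [l [Hl [_ Hl2]]].
  apply Ccv_squeeze with (fun m => l - Rsum (fun i => Cmod (RtoC (INR (a i)) * q ^ i)%C) m).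
  - intros m. rewrite Cmod_sub_sym.
    apply (Ccv_mod_le (fun N => Csum (fun n => RtoC (INR (a n)) * q ^ n)%C N - Csum (cs m q) N)%C _ _ m).
    + apply Ccv_minus; [exact Hf|apply cs_sum, Hq].
    + intros N HN. rewrite <- Csum_minus.
      replace N with (m + (N - m))%nat by lia. rewrite Csum_add.
      rewrite (Csum_ext _ (fun _ => RtoC 0) m), Csum_zero, Cplus_0_l.
      2:{ intros i Hi. unfold cs. rewrite c_full by lia. ring. }
      pose proof (Hl2 (m + (N - m))%nat) as H2. rewrite Rsum_add in H2.
      eapply Rle_trans; [apply Csum_Cmod|].
      eapply Rle_trans; [apply Rsum_le|apply (Rplus_le_reg_l
        (Rsum (fun i => Cmod (RtoC (INR (a i)) * q ^ i)%C) m)); eapply Rle_trans; [exact H2|lra]].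
      intros i _. cbv beta. unfold cs.
      replace (RtoC (INR (a (m + i))) * q ^ (m + i) - RtoC (INR (c m (m + i))) * q ^ (m + i))%C
        with (RtoC (INR (a (m + i)) - INR (c m (m + i))) * q ^ (m + i))%C
        by (rewrite RtoC_minus; ring).
      rewrite !Cmod_mult. apply Rmult_le_compat_r; [apply Cmod_ge_0|].
      pose proof (le_INR _ _ (c_le_a m (m + i))). pose proof (pos_INR (c m (m + i))).
      rewrite !Cmod_RtoC_pos; [lra|apply pos_INR|lra].
  - replace 0 with (l - l) by ring. apply is_lim_seq_minus'; [apply is_lim_seq_const|exact Hl].
Qed.

End GeneratingFunction.

(** * Shanks' identity *)

Definition all_parts (_ : nat) : bool := true.

Definition theta_sum (q : C) (n : nat) : C :=
  (1 + 2 * Csum (fun j => (-1) ^ S j * q ^ (S j * S j)) n)%C.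

(* Shanks' finite form of Gauss's identity [sum (-1)^j q^(j^2) = prod (1 - q^i) / (1 + q^i)]. *)
Lemma theta_sum_eprod (q : C) (n : nat) : Cmod q < 1 ->
  (theta_sum q n * eprod all_parts q n =
   Csum (fun s => (-1) ^ s * eprod all_parts q s * (2 / (1 + q ^ s)) * q ^ (s * S n)) (S n))%C.
Proof.
  intros Hq. set (P := eprod all_parts q).
  assert (HP : forall m, (P (S m) * (1 - q ^ S m) = P m * (1 + q ^ S m))%C).
  { intros m. unfold P. simpl eprod. change (q * q ^ m)%C with (q ^ S m)%C. field.
    apply one_minus_neq0, pow_lt_1_disk, Hq. }
  assert (Hplus : forall s, (1 + q ^ s)%C <> 0%C).
  { intros [|s]; [simpl; intros H; apply (RtoC_neq 2 0); [lra|]; rewrite <- H, <- RtoC_plus; f_equal; lra|].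
    apply one_plus_neq0, pow_lt_1_disk, Hq. }
  set (T := fun n => Csum (fun s => (-1) ^ s * P s * (2 / (1 + q ^ s)) * q ^ (s * S n))%C (S n)).
  change (theta_sum q n * P n = T n)%C.
  (* The summand of [(1 - q^(n+1)) T (n+1) - (1 + q^(n+1)) T n], without the last term of [T (n+1)],
     telescopes in [s] by the recursion [HP] of the product. *)
  assert (Htel : forall n s, (Csum (fun s => (-1) ^ s * P s * (2 / (1 + q ^ s)) * q ^ (s * S n) *
      ((1 - q ^ S n) * q ^ s - (1 + q ^ S n))) (S s) = - (-1) ^ s * 2 * P s * q ^ (S s * S n))%C).
  { intros m s. induction s as [|s IH].
    - simpl Csum. replace (1 * S m)%nat with (S m) by lia. unfold P at 1 2.
      change (eprod all_parts q 0) with (RtoC 1). simpl Csum. simpl Nat.mul. rewrite ?Nat.add_0_r.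
        change (q ^ 0)%C with (RtoC 1). change ((-1) ^ 0)%C with (RtoC 1).
        change (q ^ S m)%C with (q * q ^ m)%C. field.
    - rewrite Csum_S, IH. specialize (HP s).
      assert (HP2 : (P s = P (S s) * (1 - q ^ S s) / (1 + q ^ S s))%C).
      { rewrite HP. field. apply Hplus. }
      rewrite HP2. replace (S (S s) * S m)%nat with (S m + S s * S m)%nat by lia.
      rewrite (Cpow_add q (S m)). change ((-1) ^ S s)%C with (-1 * (-1) ^ s)%C.
      pose proof (Hplus (S s)) as Hs. field. exact Hs. }
  induction n as [|n IH].
  - unfold theta_sum, T. rewrite Csum_S. change (Csum _ 0) with (RtoC 0).
    unfold P. change (eprod all_parts q 0) with (RtoC 1). simpl. field.
  - assert (HT : ((1 - q ^ S n) * T (S n) - (1 + q ^ S n) * T n =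
       2 * (-1) ^ S n * q ^ (S n * S n) * (1 + q ^ S n) * P n)%C).
    { unfold T. rewrite (Csum_S _ (S n)), Cmult_plus_distr_l, <- !Csum_scal.
      transitivity (Csum (fun s => (-1) ^ s * P s * (2 / (1 + q ^ s)) * q ^ (s * S n) *
        ((1 - q ^ S n) * q ^ s - (1 + q ^ S n))) (S n) +
        (1 - q ^ S n) * ((-1) ^ S n * P (S n) * (2 / (1 + q ^ S n)) * q ^ (S n * S (S n))))%C.
      - rewrite (Csum_ext (fun s => (-1) ^ s * P s * (2 / (1 + q ^ s)) * q ^ (s * S n) *
          ((1 - q ^ S n) * q ^ s - (1 + q ^ S n)))%C
          (fun s => (1 - q ^ S n) * ((-1) ^ s * P s * (2 / (1 + q ^ s)) * q ^ (s * S (S n))) -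
            (1 + q ^ S n) * ((-1) ^ s * P s * (2 / (1 + q ^ s)) * q ^ (s * S n)))%C).
        + rewrite Csum_minus. ring.
        + intros s _. replace (s * S (S n))%nat with (s + s * S n)%nat by lia.
          rewrite Cpow_add. ring.
      - rewrite Htel. replace (S n * S (S n))%nat with (S n + S n * S n)%nat by lia.
        rewrite (Cpow_add q (S n)). specialize (HP n).
        transitivity (- (-1) ^ n * 2 * P n * q ^ (S n * S n) +
          (P (S n) * (1 - q ^ S n)) * ((-1) ^ S n * (2 / (1 + q ^ S n)) * (q ^ S n * q ^ (S n * S n))))%C;
          [ring|]. rewrite HP. change ((-1) ^ S n)%C with (-1 * (-1) ^ n)%C.
        pose proof (Hplus (S n)) as Hs. field. exact Hs. }
    pose proof (one_minus_neq0 _ (pow_lt_1_disk q n Hq)) as Hn.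
    (* Both sides satisfy the same first-order recurrence in [n], and its leading factor
       [1 - q^(n+1)] is nonzero. *)
    assert (E : ((1 - q ^ S n) * (theta_sum q (S n) * P (S n)) = (1 - q ^ S n) * T (S n))%C).
    { replace ((1 - q ^ S n) * T (S n))%C with
        ((1 - q ^ S n) * T (S n) - (1 + q ^ S n) * T n + (1 + q ^ S n) * T n)%C by ring.
      rewrite HT, <- IH.
      replace (theta_sum q (S n)) with (theta_sum q n + 2 * ((-1) ^ S n * q ^ (S n * S n)))%C.
      2:{ unfold theta_sum. rewrite Csum_S. ring. }
      specialize (HP n).
      transitivity ((theta_sum q n + 2 * ((-1) ^ S n * q ^ (S n * S n))) * (P (S n) * (1 - q ^ S n)))%C;
        [ring|]. rewrite HP. ring. }
    replace (theta_sum q (S n) * P (S n))%C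
      with ((1 - q ^ S n) * (theta_sum q (S n) * P (S n)) / (1 - q ^ S n))%C by (field; exact Hn).
    rewrite E. field. exact Hn.
Qed.

(** * The theta series and its reciprocal product *)

Definition Clim (u : nat -> C) : C :=
  (real (Lim_seq (fun n => Re (u n))), real (Lim_seq (fun n => Im (u n)))).

Lemma Im_le_Cmod (z : C) : Rabs (Im z) <= Cmod z.
Proof. eapply Rle_trans; [|apply Rmax_Cmod]. apply Rmax_r. Qed.

Lemma Clim_eq (u : nat -> C) (l : C) : Ccv u l -> Clim u = l.
Proof.
  intros H.
  assert (HR : is_lim_seq (fun n => Re (u n)) (Re l)).
  { apply Ccv_RtoC_inv. eapply squeeze0; [|exact H]. intros n. split; [apply Cmod_ge_0|].
    rewrite <- RtoC_minus, Cmod_R. apply (re_le_Cmod (u n - l)%C). }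
  assert (HI : is_lim_seq (fun n => Im (u n)) (Im l)).
  { apply Ccv_RtoC_inv. eapply squeeze0; [|exact H]. intros n. split; [apply Cmod_ge_0|].
    rewrite <- RtoC_minus, Cmod_R. apply (Im_le_Cmod (u n - l)%C). }
  unfold Clim. rewrite (is_lim_seq_unique _ _ HR), (is_lim_seq_unique _ _ HI).
  destruct l; reflexivity.
Qed.

Lemma Cmod_sign (n : nat) : Cmod ((-1) ^ n)%C = 1.
Proof. rewrite Cmod_pow, Cmod_R, Rabs_left by lra. replace (- -1) with 1 by ring. apply pow1. Qed.

(** [Clim] takes default values on divergent sequences, so this is the theta series only inside the
    unit disc, through [theta_cv]. *)
Definition theta (q : C) : C := Clim (theta_sum q).

Lemma theta_term_bound (q : C) : Cmod q < 1 ->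
  absbd (fun j => (-1) ^ S j * q ^ (S j * S j))%C (/ (1 - Cmod q)).
Proof.
  intros Hq. pose proof (Cmod_ge_0 q) as H0.
  apply absbd_le with (fun j => Cmod q ^ j); [|intros n; apply Rsum_geom_le; lra].
  intros j. rewrite Cmod_mult, Cmod_sign, Cmod_pow, Rmult_1_l.
  replace (S j * S j)%nat with (j + (j * j + j + 1))%nat by lia. rewrite pow_add.
  rewrite <- (Rmult_1_r (Cmod q ^ j)) at 2.
  apply Rmult_le_compat_l; [apply pow_le, H0|].
  rewrite <- (pow1 (j * j + j + 1)). apply pow_incr. lra.
Qed.

Lemma theta_cv (q : C) : Cmod q < 1 -> Ccv (theta_sum q) (theta q).
Proof.
  intros Hq. destruct (Cseries_abs _ _ (theta_term_bound q Hq)) as [l Hl].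
  assert (H : Ccv (theta_sum q) (1 + 2 * l)%C).
  { apply (Ccv_plus (fun _ => RtoC 1)); [apply Ccv_const|]. apply Ccv_scal, Hl. }
  unfold theta. rewrite (Clim_eq _ _ H). exact H.
Qed.

Lemma theta_bound (q : C) : Cmod q < 1 -> Cmod (theta q) <= 1 + 2 / (1 - Cmod q).
Proof.
  intros Hq. apply (Ccv_mod_le _ _ _ 0 (theta_cv q Hq)). intros n _.
  unfold theta_sum. eapply Rle_trans; [apply Cmod_triangle|].
  rewrite Cmod_1, Cmod_mult, Cmod_RtoC_pos by lra. unfold Rdiv.
  apply Rplus_le_compat_l, Rmult_le_compat_l; [lra|].
  eapply Rle_trans; [apply Csum_Cmod|]. apply (theta_term_bound q Hq).
Qed.

Lemma is_lim_seq_pow0 (r : R) : 0 <= r < 1 -> is_lim_seq (fun n => r ^ n) 0.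
Proof. intros H. apply is_lim_seq_geom. rewrite Rabs_pos_eq; lra. Qed.

Lemma is_lim_seq_scal0 (c : R) (u : nat -> R) :
  is_lim_seq u 0 -> is_lim_seq (fun n => c * u n) 0.
Proof.
  intros H. replace (Finite 0) with (Rbar_mult c 0) by (simpl; f_equal; ring).
  apply is_lim_seq_scal_l, H.
Qed.

(** In Shanks' sum the term [s = 0] equals 1; the others carry [q^(s (n+1))] and together are of
    size [|q|^n]. *)
Lemma theta_eprod_cv1 (q : C) : Cmod q < 1 ->
  Ccv (fun n => theta_sum q n * eprod all_parts q n)%C 1%C.
Proof.
  intros Hq. pose proof (Cmod_ge_0 q) as H0. set (r := Cmod q) in *.
  set (K := ebound r * (2 / (1 - r)) * / (1 - r)).
  apply Ccv_squeeze with (fun n => K * r ^ n).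
  - intros n. rewrite (theta_sum_eprod q n Hq), Csum_S0. cbv beta.
    replace ((-1) ^ 0 * eprod all_parts q 0 * (2 / (1 + q ^ 0)) * q ^ (0 * S n))%C
      with (RtoC 1).
    2:{ change (eprod all_parts q 0) with (RtoC 1). simpl. field. }
    match goal with |- Rle (Cmod (Cminus (Cplus _ ?x) _)) _ => replace (1 + x - 1)%C with x by ring end.
    eapply Rle_trans; [apply Csum_Cmod|].
    apply Rle_trans with (Rsum (fun s => ebound r * (2 / (1 - r)) * r ^ n * r ^ s) n).
    + apply Rsum_le. intros s _.
      rewrite !Cmod_mult, Cmod_sign, Cmod_pow, Rmult_1_l.
      assert (H1 : Cmod (2 / (1 + q ^ S s)) <= 2 / (1 - r)).
      { rewrite Cmod_div by (apply one_plus_neq0, pow_lt_1_disk, Hq).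
        rewrite Cmod_RtoC_pos by lra. unfold Rdiv. apply Rmult_le_compat_l; [lra|].
        apply Rinv_le_contravar; [lra|].
        pose proof (Cmod_triangle_sub 1 (1 + q ^ S s)%C) as H1. rewrite Cmod_1 in H1.
        replace (1 - (1 + q ^ S s))%C with (- (q ^ S s))%C in H1 by ring.
        rewrite Cmod_opp, Cmod_pow in H1. fold r in H1.
        assert (r ^ S s <= r).
        { simpl. assert (r ^ s <= 1 ^ s) by (apply pow_incr; lra). rewrite pow1 in *. nra. }
        lra. }
      fold r. replace (S s * S n)%nat with (n + (s + (s * n + 1)))%nat by lia.
      rewrite !pow_add.
      assert (H2 : r ^ (s * n) * r ^ 1 <= 1).
      { rewrite <- pow_add, <- (pow1 (s * n + 1)). apply pow_incr. lra. }
      pose proof (eprod_bound all_parts q (S s) Hq) as H3. fold r in H3.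
      pose proof (pow_le r n H0). pose proof (pow_le r s H0).
      assert (0 <= r ^ (s * n) * r ^ 1) by (apply Rmult_le_pos; apply pow_le; lra).
      rewrite (Rmult_assoc (ebound r * _)).
      apply Rmult_le_compat.
      * apply Rmult_le_pos; apply Cmod_ge_0.
      * apply Rmult_le_pos; [auto|]. apply Rmult_le_pos; auto.
      * apply Rmult_le_compat; auto; apply Cmod_ge_0.
      * apply Rmult_le_compat_l; auto. rewrite <- (Rmult_1_r (r ^ s)) at 2.
        apply Rmult_le_compat_l; auto.
    + rewrite Rsum_scal. unfold K.
      pose proof (Rsum_geom_le r n ltac:(lra)) as Hg. pose proof (pow_le r n H0).
      assert (0 <= ebound r * (2 / (1 - r))).
      { apply Rmult_le_pos; [left; apply exp_pos|]. apply Rmult_le_pos; [lra|].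
        left. apply Rinv_0_lt_compat. lra. }
      replace (ebound r * (2 / (1 - r)) * / (1 - r) * r ^ n)
        with (ebound r * (2 / (1 - r)) * r ^ n * / (1 - r)) by ring.
      apply Rmult_le_compat_l; [apply Rmult_le_pos; lra|exact Hg].
  - apply is_lim_seq_scal0, is_lim_seq_pow0. lra.
Qed.

(** The partial products stay bounded, so a vanishing theta would force the products of
    [theta_eprod_cv1] to 0 instead of 1. *)
Lemma theta_neq0 (q : C) : Cmod q < 1 -> theta q <> 0%C.
Proof.
  intros Hq E. pose proof (theta_cv q Hq) as H. rewrite E in H.
  assert (H2 : Ccv (fun n => theta_sum q n * eprod all_parts q n)%C 0%C).
  { apply Ccv_squeeze with (fun n => ebound (Cmod q) * Cmod (theta_sum q n - 0)%C).
    - intros n. unfold Cminus. rewrite Copp_0, !Cplus_0_r, Cmod_mult, Rmult_comm.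
      apply Rmult_le_compat_r; [apply Cmod_ge_0|apply eprod_bound, Hq].
    - apply is_lim_seq_scal0, H. }
  pose proof (Ccv_unique _ _ _ H2 (theta_eprod_cv1 q Hq)) as H3.
  apply RtoC_inj in H3. lra.
Qed.

Lemma eprod_cv (q : C) : Cmod q < 1 -> Ccv (eprod all_parts q) (/ theta q)%C.
Proof.
  intros Hq. pose proof (theta_neq0 q Hq) as Hn.
  pose proof (theta_cv q Hq) as Ht. pose proof (theta_eprod_cv1 q Hq) as H1.
  apply Ccv_ext with (fun n => / theta q * (theta_sum q n * eprod all_parts q n -
     (theta_sum q n - theta q) * eprod all_parts q n))%C.
  { intros n. field. exact Hn. }
  replace (/ theta q)%C with (/ theta q * (1 - 0))%C at 1 by ring.
  apply Ccv_scal, Ccv_minus; [exact H1|].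
  apply Ccv_squeeze with (fun n => ebound (Cmod q) * Cmod (theta_sum q n - theta q)%C).
  - intros n. unfold Cminus at 1. rewrite Copp_0, Cplus_0_r, Cmod_mult, Rmult_comm.
    apply Rmult_le_compat_r; [apply Cmod_ge_0|apply eprod_bound, Hq].
  - apply is_lim_seq_scal0, Ht.
Qed.

(** * The generating function of the regular parts as a quotient of theta functions *)

Definition not_dvd (k n : nat) : bool := negb (n mod k =? 0)%nat.

(** The factors at multiples of [k] form the product for [q^k]. The induction goes block by block:
    [k - 1] regular indices, then one multiple of [k]. *)
Lemma eprod_split (k : nat) (q : C) (m : nat) : (0 < k)%nat ->
  (eprod all_parts q (k * m) = eprod (not_dvd k) q (k * m) * eprod all_parts (q ^ k) m)%C.
Proof.
  intros Hk. induction m as [|m IH]; [rewrite Nat.mul_0_r; simpl; ring|].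
  assert (H : forall j, (j < k)%nat -> (eprod all_parts q (k * m + j) =
      eprod (not_dvd k) q (k * m + j) * eprod all_parts (q ^ k) m)%C).
  { induction j as [|j IHj]; intros Hj; [rewrite Nat.add_0_r; exact IH|].
    rewrite Nat.add_succ_r. simpl eprod.
    replace (not_dvd k (S (k * m + j))) with true.
    - rewrite IHj by lia. simpl. ring.
    - symmetry. unfold not_dvd. apply Bool.negb_true_iff, Nat.eqb_neq.
      replace (S (k * m + j)) with (S j + m * k)%nat by lia.
      rewrite Nat.Div0.mod_add, Nat.mod_small by lia. lia. }
  replace (k * S m)%nat with (S (k * m + (k - 1))) by lia. simpl eprod.
  replace (not_dvd k (S (k * m + (k - 1)))) with false.
  - rewrite H by lia. simpl.
    replace (q * q ^ (k * m + (k - 1)))%C with (q ^ k * (q ^ k) ^ m)%C; [ring|].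
    rewrite <- Cpow_mul, <- Cpow_add. change (q * q ^ (k * m + (k - 1)))%C
      with (q ^ (S (k * m + (k - 1))))%C. f_equal. lia.
  - symmetry. unfold not_dvd. apply Bool.negb_false_iff, Nat.eqb_eq.
    replace (S (k * m + (k - 1))) with (0 + S m * k)%nat by lia.
    rewrite Nat.Div0.mod_add. apply Nat.mod_0_l. lia.
Qed.

Lemma gf_theta (k : nat) (q f : C) : (0 < k)%nat -> Cmod q < 1 ->
  Ccv (eprod (not_dvd k) q) f -> (f * theta q = theta (q ^ k))%C.
Proof.
  intros Hk Hq Hf.
  assert (Hqk : Cmod (q ^ k)%C < 1).
  { destruct k as [|k]; [lia|]. apply pow_lt_1_disk, Hq. }
  assert (E : (/ theta q = f * / theta (q ^ k))%C).
  { apply (Ccv_unique (fun m => eprod all_parts q (k * m))).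
    - apply (Ccv_subseq (eprod all_parts q) _ (fun m => k * m)%nat); [intros; nia|apply eprod_cv, Hq].
    - eapply Ccv_ext; [intros m; symmetry; apply (eprod_split k q m Hk)|].
      apply Ccv_mult; [|apply eprod_cv, Hqk].
      apply (Ccv_subseq (eprod (not_dvd k) q) _ (fun m => k * m)%nat); [intros; nia|exact Hf]. }
  pose proof (theta_neq0 q Hq). pose proof (theta_neq0 _ Hqk).
  transitivity (f * / theta (q ^ k) * theta q * theta (q ^ k))%C; [field; auto|].
  rewrite <- E. field. auto.
Qed.

(** * Lower bound for the theta function *)

(** Completing the square in [p] leaves [4 u (1 + u) (1 + u - u^2)], which is nonnegative for
    [u >= 0] and for [u < -0.7]. In between [2 u^2 <= 1], and every coefficient is nonnegative. *)
Lemma ray_poly_nonneg (u p : R) : -1 <= u <= 1 -> 0 <= p <= 1 ->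
  0 <= (1 + 2 * u) ^ 2 + p * (2 - 4 * u ^ 2) + p ^ 2.
Proof.
  intros Hu Hp.
  destruct (Rle_dec 0 u) as [H|H].
  - assert (0 <= 4 * (u * (1 + u) * (1 + u - u ^ 2))).
    { apply Rmult_le_pos; [lra|]. apply Rmult_le_pos; nra. }
    pose proof (pow2_ge_0 (p + 1 - 2 * u ^ 2)). nra.
  - destruct (Rle_dec (2 * u ^ 2) 1) as [H1|H1].
    + pose proof (pow2_ge_0 (1 + 2 * u)). pose proof (pow2_ge_0 p). nra.
    + assert (u < - (7 / 10)) by nra.
      assert (0 <= 4 * (- u * (1 + u) * (u ^ 2 - 1 - u))).
      { apply Rmult_le_pos; [lra|]. apply Rmult_le_pos; nra. }
      pose proof (pow2_ge_0 (p + 1 - 2 * u ^ 2)). nra.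
Qed.

(* Along a ray [rho e^(i alpha)], [u = cos alpha], the logarithmic derivative of the left side is largest for [u = 1]. *)
Lemma ray_log_le (u rho : R) : -1 <= u <= 1 -> 0 <= rho < 1 ->
  / 2 * ln (1 + 2 * rho * u + rho ^ 2) - / 2 * ln (1 - 2 * rho * u + rho ^ 2) - 2 * rho * u
  <= ln (1 + rho) - ln (1 - rho) - 2 * rho.
Proof.
  intros Hu Hr.
  set (g := fun t => ln (1 + t) - ln (1 - t) - 2 * t -
    (/ 2 * ln (1 + 2 * t * u + t ^ 2) - / 2 * ln (1 - 2 * t * u + t ^ 2) - 2 * t * u)).
  set (dg := fun t => 2 * (t ^ 2) * (1 - u) *
    ((1 + 2 * u) ^ 2 + t ^ 2 * (2 - 4 * u ^ 2) + (t ^ 2) ^ 2) /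
    ((1 + 2 * t * u + t ^ 2) * (1 - 2 * t * u + t ^ 2) * (1 - t ^ 2))).
  assert (H : g 0 <= g rho).
  { apply (derive_nonneg_le g dg); [lra|]. intros t Ht.
    assert (HA : 0 < 1 + 2 * t * u + t ^ 2) by nra.
    assert (HB : 0 < 1 - 2 * t * u + t ^ 2) by nra.
    assert (HC : 0 < 1 - t ^ 2) by nra. split.
    - unfold g. auto_derive.
      + repeat split; nra.
      + unfold dg. field. repeat split; nra.
    - unfold dg. apply Rmult_le_pos.
      + apply Rmult_le_pos; [apply Rmult_le_pos; nra|].
        apply ray_poly_nonneg; nra.
      + left. apply Rinv_0_lt_compat. repeat apply Rmult_lt_0_compat; assumption. }
  unfold g in H. replace (1 + 2 * 0 * u + 0 ^ 2) with 1 in H by ring.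
  replace (1 - 2 * 0 * u + 0 ^ 2) with 1 in H by ring.
  rewrite Rplus_0_r, Rminus_0_r, ln_1 in H. lra.
Qed.

Lemma ln_Cmod (z : C) : z <> 0%C -> ln (Cmod z) = / 2 * ln (Re z ^ 2 + Im z ^ 2).
Proof.
  intros H. apply Cmod_gt_0 in H. rewrite <- Cmod2_alt. simpl.
  rewrite Rmult_1_r, ln_mult by assumption. lra.
Qed.

(** The logarithm of [(1 + w) / (1 - w)] starts with [2 w]. By [ray_log_le] the rest has its largest
    real part on the positive axis, so passing from [|w|] to [w] gains at least the difference of
    the linear terms. *)
Lemma factor_ray_le (w : C) : Cmod w < 1 ->
  Cmod ((1 + w) / (1 - w))%C <=
  (1 + Cmod w) / (1 - Cmod w) * exp (2 * Re w - 2 * Cmod w).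
Proof.
  intros Hw. pose proof (Cmod_ge_0 w) as H0.
  pose proof (one_minus_neq0 w Hw) as Hm. pose proof (one_plus_neq0 w Hw) as Hp.
  assert (Hu : exists u, -1 <= u <= 1 /\ Re w = Cmod w * u).
  { destruct (Rle_lt_or_eq_dec _ _ H0) as [H|H].
    - exists (Re w / Cmod w). split; [|field; lra].
      pose proof (re_le_Cmod w) as Hre.
      apply Rabs_le_between in Hre. split.
      + apply Rmult_le_reg_r with (Cmod w); [exact H|].
        replace (Re w / Cmod w * Cmod w) with (Re w) by (field; lra). lra.
      + apply Rmult_le_reg_r with (Cmod w); [exact H|].
        replace (Re w / Cmod w * Cmod w) with (Re w) by (field; lra). lra.
    - exists 0. split; [lra|]. symmetry in H. apply Cmod_eq_0 in H. rewrite H. simpl. ring. }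
  destruct Hu as [u [Hu E]].
  rewrite Cmod_div by exact Hm.
  rewrite <- (exp_ln (Cmod (1 + w)%C)) by (apply Cmod_gt_0, Hp).
  rewrite <- (exp_ln (Cmod (1 - w)%C)) by (apply Cmod_gt_0, Hm).
  rewrite <- (exp_ln (1 + Cmod w)), <- (exp_ln (1 - Cmod w)) by lra.
  unfold Rdiv. rewrite <- !exp_Ropp, <- !exp_plus. apply exp_le.
  rewrite (ln_Cmod _ Hp), (ln_Cmod _ Hm).
  pose proof (ray_log_le u (Cmod w) Hu ltac:(lra)) as H.
  pose proof (Cmod2_alt w) as H2.
  replace (Re (1 + w)%C ^ 2 + Im (1 + w)%C ^ 2) with (1 + 2 * Cmod w * u + Cmod w ^ 2).
  2:{ rewrite H2. replace (2 * Cmod w * u) with (2 * (Cmod w * u)) by ring. rewrite <- E.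
      unfold Re, Im, Cplus, RtoC. simpl. ring. }
  replace (Re (1 - w)%C ^ 2 + Im (1 - w)%C ^ 2) with (1 - 2 * Cmod w * u + Cmod w ^ 2).
  2:{ rewrite H2. replace (2 * Cmod w * u) with (2 * (Cmod w * u)) by ring. rewrite <- E.
      unfold Re, Im, Cminus, Cplus, Copp, RtoC. simpl. ring. }
  rewrite E. lra.
Qed.

Lemma eprod_ray_le (q : C) (n : nat) : Cmod q < 1 ->
  Cmod (eprod all_parts q n) <= Cmod (eprod all_parts (RtoC (Cmod q)) n) *
    exp (2 * Re (Csum (fun i => q ^ S i)%C n) - 2 * Re (Csum (fun i => RtoC (Cmod q) ^ S i)%C n)).
Proof.
  intros Hq. pose proof (Cmod_ge_0 q) as H0.
  induction n as [|n IH].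
  - simpl. rewrite Rmult_0_r, Rminus_0_r, exp_0, Cmod_1. lra.
  - rewrite !Csum_S.
    change (eprod all_parts q (S n)) with (eprod all_parts q n * ((1 + q ^ S n) / (1 - q ^ S n)))%C.
    change (eprod all_parts (RtoC (Cmod q)) (S n)) with
      (eprod all_parts (RtoC (Cmod q)) n * ((1 + RtoC (Cmod q) ^ S n) / (1 - RtoC (Cmod q) ^ S n)))%C.
    rewrite !Cmod_mult. set (w := (q ^ S n)%C).
    assert (Hw : Cmod w < 1) by (apply pow_lt_1_disk, Hq).
    assert (E : (RtoC (Cmod q) ^ S n)%C = RtoC (Cmod w)).
    { unfold w. rewrite Cmod_pow, RtoC_pow. reflexivity. }
    rewrite E. pose proof (factor_ray_le w Hw) as HF.
    rewrite <- !RtoC_plus, <- RtoC_minus, <- RtoC_div by lra.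
    rewrite (Cmod_RtoC_pos ((1 + Cmod w) / (1 - Cmod w))).
    2:{ pose proof (Cmod_ge_0 w). apply Rmult_le_pos; [lra|]. left. apply Rinv_0_lt_compat. lra. }
    eapply Rle_trans; [apply Rmult_le_compat; [apply Cmod_ge_0|apply Cmod_ge_0|exact IH|exact HF]|].
    right. set (s1 := Csum _ n). set (s2 := Csum _ n).
    replace (Re (s1 + w)%C) with (Re s1 + Re w) by reflexivity.
    replace (Re (s2 + RtoC (Cmod w))%C) with (Re s2 + Cmod w) by reflexivity.
    replace (2 * (Re s1 + Re w) - 2 * (Re s2 + Cmod w)) with
      ((2 * Re s1 - 2 * Re s2) + (2 * Re w - 2 * Cmod w)) by ring.
    rewrite exp_plus. ring.
Qed.

Lemma Ccv_Re (u : nat -> C) (l : C) : Ccv u l -> is_lim_seq (fun n => Re (u n)) (Re l).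
Proof.
  intros H. apply Ccv_RtoC_inv. eapply squeeze0; [|exact H]. intros n. split; [apply Cmod_ge_0|].
  rewrite <- RtoC_minus, Cmod_R. apply (re_le_Cmod (u n - l)%C).
Qed.

Lemma geom_cv (q : C) : Cmod q < 1 -> Ccv (Csum (fun i => q ^ S i)%C) (q / (1 - q))%C.
Proof.
  intros Hq. pose proof (Cmod_ge_0 q). pose proof (one_minus_neq0 q Hq) as Hm.
  apply Ccv_ext with (fun n => q / (1 - q) * (1 - q ^ n))%C.
  - intros n. rewrite <- Csum_geom.
    change (Csum (fun i => q ^ S i)%C n) with (Csum (fun i => q * q ^ i)%C n).
    rewrite (Csum_scal q (fun i => q ^ i)%C n). field. exact Hm.
  - replace (q / (1 - q))%C with (q / (1 - q) * (1 - 0))%C at 1 by ring.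
    apply Ccv_scal, (Ccv_minus (fun _ => RtoC 1)); [apply Ccv_const|].
    apply Ccv_squeeze with (fun n => Cmod q ^ n).
    + intros n. unfold Cminus. rewrite Copp_0, Cplus_0_r, Cmod_pow. lra.
    + apply is_lim_seq_pow0. lra.
Qed.

(** The Poisson kernel: [2 q / (1 - q) = (1 + q) / (1 - q) - 1], and the real part of
    [(1 + q) / (1 - q)] is [(1 - |q|^2) / |1 - q|^2]. *)
Lemma Re_geom (q : C) : Cmod q < 1 ->
  2 * Re (q / (1 - q))%C = (1 - Cmod q ^ 2) / Cmod (1 - q)%C ^ 2 - 1.
Proof.
  intros Hq. pose proof (one_minus_neq0 q Hq) as Hm. apply Cmod_gt_0 in Hm.
  pose proof (Cmod2_alt q) as E1. pose proof (Cmod2_alt (1 - q)%C) as E2.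
  assert (Hp : 0 < Cmod (1 - q)%C ^ 2) by (simpl; nra).
  rewrite E1. rewrite E2 in *. clear E1 E2.
  destruct q as [a b]. unfold Re, Im, Cdiv, Cinv, Cminus, Cplus, Copp, Cmult, RtoC in *. simpl in *.
  field. nra.
Qed.

(** The exponent is the sum over [i >= 1] of [2 Re q^i - 2 |q|^i] in closed form. For fixed [|q|] it
    depends on the distance [|1 - q|] only. *)
Lemma theta_inv_le (q : C) : Cmod q < 1 ->
  / Cmod (theta q) <= / Cmod (theta (RtoC (Cmod q))) *
    exp ((1 - Cmod q ^ 2) / Cmod (1 - q)%C ^ 2 - 1 - 2 * Cmod q / (1 - Cmod q)).
Proof.
  intros Hq. pose proof (Cmod_ge_0 q) as H0.
  assert (Hr : Cmod (RtoC (Cmod q)) < 1) by (rewrite Cmod_RtoC_pos; lra).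
  rewrite <- (Cmod_inv (theta q)), <- (Cmod_inv (theta (RtoC (Cmod q)))) by (apply theta_neq0; assumption).
  replace ((1 - Cmod q ^ 2) / Cmod (1 - q)%C ^ 2 - 1 - 2 * Cmod q / (1 - Cmod q))
    with (2 * Re (q / (1 - q))%C - 2 * Re (RtoC (Cmod q) / (1 - RtoC (Cmod q)))%C).
  2:{ rewrite Re_geom by exact Hq. rewrite <- RtoC_minus, <- RtoC_div by lra. simpl. field.
      split; [lra|]. apply Rgt_not_eq, Cmod_gt_0, one_minus_neq0, Hq. }
  pose proof (Ccv_mod _ _ (eprod_cv q Hq)) as L1.
  pose proof (Ccv_mod _ _ (eprod_cv _ Hr)) as L2.
  pose proof (Ccv_Re _ _ (geom_cv q Hq)) as L3.
  pose proof (Ccv_Re _ _ (geom_cv _ Hr)) as L4.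
  assert (L5 : is_lim_seq (fun n => 2 * Re (Csum (fun i => q ^ S i)%C n) -
      2 * Re (Csum (fun i => RtoC (Cmod q) ^ S i)%C n))
      (2 * Re (q / (1 - q))%C - 2 * Re (RtoC (Cmod q) / (1 - RtoC (Cmod q)))%C)).
  { apply is_lim_seq_minus'.
    - apply (is_lim_seq_scal_l _ 2 _ L3).
    - apply (is_lim_seq_scal_l _ 2 _ L4). }
  apply (is_lim_seq_continuous exp) in L5; [|apply derivable_continuous_pt, derivable_pt_exp].
  pose proof (is_lim_seq_mult' _ _ _ _ L2 L5) as L6.
  apply (is_lim_seq_le _ _ _ _ (fun n => eprod_ray_le q n Hq) L1 L6).
Qed.

(** * The theta transformation by discretized Gaussian integrals *)

Lemma gauss_majorant (a b : R) : 0 < a -> 0 <= b -> exists K, 0 < K /\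
  forall t, 0 <= t -> (1 + t) ^ 3 * exp (- a * t ^ 2 + b * (1 + t)) <= K * exp (- t).
Proof.
  (* [(b + 4)^2 / (4 a)] is the maximum of [(b + 4) t - a t^2]; of the 4, three units bound
     [(1 + t)^3] by [exp (3 t)] and one pays for [exp (- t)]. *)
  intros Ha Hb. exists (exp (b + (b + 4) ^ 2 / (4 * a))). split; [apply exp_pos|].
  intros t Ht. pose proof (exp_ineq1_le t) as H1.
  assert (H2 : (1 + t) ^ 3 <= exp (3 * t)).
  { replace (3 * t) with (t + t + t) by ring. rewrite !exp_plus.
    replace ((1 + t) ^ 3) with ((1 + t) * (1 + t) * (1 + t)) by ring.
    apply Rmult_le_compat; try lra; [nra|]. apply Rmult_le_compat; lra. }
  eapply Rle_trans; [apply Rmult_le_compat_r; [left; apply exp_pos|exact H2]|].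
  rewrite <- !exp_plus. apply exp_le.
  assert (H3 : 0 <= a * (t - (b + 4) / (2 * a)) ^ 2) by (apply Rmult_le_pos; [lra|apply pow2_ge_0]).
  replace (a * (t - (b + 4) / (2 * a)) ^ 2) with (a * t ^ 2 - (b + 4) * t + (b + 4) ^ 2 / (4 * a)) in H3
    by (field; lra).
  lra.
Qed.

Definition grid (N j : nat) : R := INR j / INR N - INR N.

(** The Riemann sum of step [1/N] over [[-N, N]]. Its limit is never identified: only differences of
    such sums are shown to vanish. *)
Definition gsum (N : nat) (g : R -> C) : C :=
  (RtoC (/ INR N) * Csum (fun j => g (grid N j)) (2 * (N * N) + 1))%C.

Lemma grid_S (N j : nat) : (0 < N)%nat -> grid N (S j) = grid N j + / INR N.
Proof. intros HN. unfold grid. rewrite S_INR. field. apply not_0_INR. lia. Qed.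

Lemma geom_exp_sum (N n : nat) : (0 < N)%nat ->
  Rsum (fun i => exp (- (INR i / INR N))) n <= INR N + 1.
Proof.
  intros HN. assert (HN' : 0 < INR N) by (apply lt_0_INR; lia).
  set (r := exp (- / INR N)).
  assert (Hi : 0 < / INR N) by (apply Rinv_0_lt_compat; exact HN').
  assert (Hr1 : r <= INR N / (INR N + 1)).
  { unfold r. rewrite exp_Ropp. pose proof (exp_ineq1_le (/ INR N)) as H.
    apply Rle_trans with (/ (1 + / INR N)); [apply Rinv_le_contravar; lra|].
    right. field. lra. }
  assert (Hr0 : 0 < r) by apply exp_pos.
  assert (Hr2 : INR N / (INR N + 1) = 1 - / (INR N + 1)) by (field; lra).
  assert (Hr3 : 0 < / (INR N + 1)) by (apply Rinv_0_lt_compat; lra).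
  rewrite (Rsum_ext _ (fun i => r ^ i)).
  - eapply Rle_trans; [apply Rsum_geom_le; lra|].
    rewrite <- (Rinv_inv (INR N + 1)). apply Rinv_le_contravar; lra.
  - intros i _. unfold r. induction i as [|i IH].
    + simpl. unfold Rdiv. rewrite Rmult_0_l, Ropp_0. apply exp_0.
    + rewrite S_INR. simpl. rewrite <- IH, <- exp_plus. f_equal. field. lra.
Qed.

Lemma Rsum_rev (f : nat -> R) (n : nat) : Rsum (fun i => f (n - 1 - i)%nat) n = Rsum f n.
Proof.
  apply RtoC_inj. rewrite <- !Csum_RtoC. apply (Csum_rev (fun i => RtoC (f i))).
Qed.

Lemma grid_exp_sum (N : nat) : (0 < N)%nat ->
  Rsum (fun j => exp (- Rabs (grid N j))) (2 * (N * N) + 1) <= 4 * INR N.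
Proof.
  intros HN. assert (HN' : 1 <= INR N) by (apply (le_INR 1); lia).
  replace (2 * (N * N) + 1)%nat with (N * N + (N * N + 1))%nat by lia.
  rewrite Rsum_add, <- Rsum_rev.
  assert (H : forall n, Rsum (fun i => exp (- (INR i / INR N))) n <= INR N + 1)
    by (intros; apply geom_exp_sum, HN).
  assert (H1 : Rsum (fun i => exp (- Rabs (grid N (N * N - 1 - i)))) (N * N)
               <= Rsum (fun i => exp (- (INR i / INR N))) (N * N)).
  { apply Rsum_le. intros i Hi. apply exp_le. apply Ropp_le_contravar.
    unfold grid. rewrite !minus_INR, mult_INR by lia. rewrite Rabs_left1.
    - simpl (INR 1). apply Rle_trans with ((INR i + 1) / INR N); [|right; field; lra].
      unfold Rdiv. apply Rmult_le_compat_r; [left; apply Rinv_0_lt_compat; lra|lra].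
    - simpl (INR 1). replace ((INR N * INR N - 1 - INR i) / INR N - INR N)
        with (- ((INR i + 1) / INR N)) by (field; lra).
      apply Ropp_le_cancel. rewrite Ropp_involutive, Ropp_0. apply Rmult_le_pos; [pose proof (pos_INR i); lra|].
      left. apply Rinv_0_lt_compat. lra. }
  assert (H2 : Rsum (fun i => exp (- Rabs (grid N (N * N + i)))) (N * N + 1)
               <= Rsum (fun i => exp (- (INR i / INR N))) (N * N + 1)).
  { apply Rsum_le. intros i Hi. apply exp_le. apply Ropp_le_contravar.
    unfold grid. rewrite plus_INR, mult_INR.
    replace ((INR N * INR N + INR i) / INR N - INR N) with (INR i / INR N) by (field; lra).
    apply Rle_abs. }
  pose proof (H (N * N)%nat). pose proof (H (N * N + 1)%nat). lra.
Qed.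

Lemma grid_sum_le (N : nat) (f : nat -> C) (K : R) : (0 < N)%nat -> 0 <= K ->
  (forall j, (j < 2 * (N * N) + 1)%nat -> Cmod (f j) <= K * exp (- Rabs (grid N j))) ->
  Cmod (Csum f (2 * (N * N) + 1)) <= 4 * K * INR N.
Proof.
  intros HN HK H. eapply Rle_trans; [apply Csum_Cmod|].
  eapply Rle_trans; [apply Rsum_le, H|]. rewrite Rsum_scal.
  pose proof (grid_exp_sum N HN). nra.
Qed.

Definition gauss (z w : C) (u : R) : C := cexp (- (z * ((RtoC u + w) * (RtoC u + w))))%C.

Definition gstep (z w : C) (u h : R) : C := (- (z * (2 * (RtoC u + w) * RtoC h + RtoC (h * h))))%C.

Lemma gauss_shift (z w : C) (u h : R) : gauss z w (u + h) = (gauss z w u * cexp (gstep z w u h))%C.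
Proof.
  unfold gauss, gstep. rewrite <- cexp_plus. f_equal. rewrite RtoC_plus, RtoC_mult. ring.
Qed.

Lemma Re_le_Cmod (z : C) : Re z <= Cmod z.
Proof. eapply Rle_trans; [apply Rle_abs|apply re_le_Cmod]. Qed.

Lemma gauss_bound (z w : C) (B u : R) : Cmod w <= B ->
  Cmod (gauss z w u) <= exp (- Re z * Rabs u ^ 2 + Cmod z * (2 * B + B ^ 2) * (1 + Rabs u)).
Proof.
  intros HB. unfold gauss. rewrite Cmod_cexp. apply exp_le.
  replace (- (z * ((RtoC u + w) * (RtoC u + w))))%C
    with (RtoC (- u ^ 2) * z + - (2 * RtoC u * (z * w) + z * (w * w)))%C.
  2:{ rewrite RtoC_opp. simpl. rewrite Rmult_1_r, RtoC_mult. ring. }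
  replace (Re (RtoC (- u ^ 2) * z + - (2 * RtoC u * (z * w) + z * (w * w)))%C)
    with (- u ^ 2 * Re z + Re (- (2 * RtoC u * (z * w) + z * (w * w)))%C).
  2:{ unfold Re, RtoC, Cplus, Cmult. simpl. ring. }
  pose proof (Re_le_Cmod (- (2 * RtoC u * (z * w) + z * (w * w)))%C) as H.
  rewrite Cmod_opp in H.
  pose proof (Cmod_triangle (2 * RtoC u * (z * w))%C (z * (w * w))%C) as H2.
  rewrite !Cmod_mult, !Cmod_R, (Rabs_pos_eq 2) in H2 by lra.
  rewrite <- (pow2_abs u). pose proof (Cmod_ge_0 z). pose proof (Cmod_ge_0 w). pose proof (Rabs_pos u).
  set (t := Rabs u) in *. set (Z := Cmod z) in *. set (W := Cmod w) in *.
  assert (2 * t * (Z * W) <= 2 * t * (Z * B)).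
  { apply Rmult_le_compat_l; [lra|]. apply Rmult_le_compat_l; lra. }
  assert (Z * (W * W) <= Z * (B * B)) by (apply Rmult_le_compat_l; [lra|nra]).
  assert (0 <= Z * B) by (apply Rmult_le_pos; lra).
  assert (0 <= Z * (B * B) * t) by (repeat apply Rmult_le_pos; lra).
  nra.
Qed.

Lemma gstep_bound (z w : C) (B u h : R) : Cmod w <= B -> 0 <= h <= 1 ->
  Cmod (gstep z w u h) <= h * (Cmod z * (2 * B + 3)) * (1 + Rabs u).
Proof.
  intros HB Hh. unfold gstep. rewrite Cmod_opp, Cmod_mult.
  pose proof (Cmod_triangle (2 * (RtoC u + w) * RtoC h)%C (RtoC (h * h))) as H.
  rewrite !Cmod_mult, !Cmod_R, (Rabs_pos_eq 2), (Rabs_pos_eq h), (Rabs_pos_eq (h * h)) in H by nra.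
  pose proof (Cmod_triangle (RtoC u) w) as H2. rewrite Cmod_R in H2.
  pose proof (Cmod_ge_0 z). pose proof (Cmod_ge_0 w). pose proof (Rabs_pos u).
  set (t := Rabs u) in *. set (X := Cmod (2 * (RtoC u + w) * RtoC h + RtoC (h * h))%C) in *.
  assert (X <= h * ((2 * B + 3) * (1 + t))).
  { eapply Rle_trans; [exact H|].
    assert (2 * Cmod (RtoC u + w)%C * h <= 2 * (t + B) * h) by (apply Rmult_le_compat_r; lra).
    assert (0 <= h * (B * t)) by (repeat apply Rmult_le_pos; lra). nra. }
  replace (h * (Cmod z * (2 * B + 3)) * (1 + t)) with (Cmod z * (h * ((2 * B + 3) * (1 + t)))) by ring.
  apply Rmult_le_compat_l; assumption.
Qed.

(* One majorant for the Gaussian weight times every remainder of its increments over a step [h]. *)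
Lemma gauss_remainders (z : C) (B : R) : 0 < Re z -> 0 <= B ->
  exists K, 0 < K /\ forall w u h, Cmod w <= B -> 0 <= h <= 1 ->
    (1 + Rabs u) * Cmod (gauss z w u) <= K * exp (- Rabs u) /\
    (1 + Rabs u) * Cmod (gauss z w u) * Cmod (cexp (gstep z w u h) - 1)%C
      <= h * K * exp (- Rabs u) /\
    (1 + Rabs u) * Cmod (gauss z w u) * Cmod (cexp (gstep z w u h) - 1 - gstep z w u h)%C
      <= h ^ 2 * K * exp (- Rabs u).
Proof.
  intros Hz HB. set (A := Cmod z * (2 * B + 3)). set (D := Cmod z * (2 * B + B ^ 2)).
  pose proof (Cmod_ge_0 z) as Hz0.
  assert (HA : 0 <= A) by (apply Rmult_le_pos; lra).
  assert (HD : 0 <= D) by (apply Rmult_le_pos; [lra|nra]).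
  destruct (gauss_majorant (Re z) (D + A) Hz ltac:(lra)) as [K [HK H]].
  exists ((1 + A + A ^ 2) * K).
  assert (HK2 : 0 < (1 + A + A ^ 2) * K) by (apply Rmult_lt_0_compat; nra).
  split; [exact HK2|]. intros w u h Hw Hh. pose proof (Rabs_pos u) as Ht.
  pose proof (gauss_bound z w B u Hw) as H1. fold D in H1.
  pose proof (gstep_bound z w B u h Hw Hh) as H2. fold A in H2.
  specialize (H (Rabs u) Ht).
  set (t := Rabs u) in *. set (g := Cmod (gauss z w u)) in *. set (s := gstep z w u h) in *.
  assert (Hg : 0 <= g) by apply Cmod_ge_0.
  pose proof (Cmod_ge_0 s) as Hs.
  set (E := exp (A * (1 + t))).
  assert (HE : 1 <= E).
  { unfold E. apply Rle_trans with (exp 0); [rewrite exp_0; lra|]. apply exp_le, Rmult_le_pos; lra. }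
  assert (HsE : exp (Cmod s) <= E).
  { apply exp_le. eapply Rle_trans; [exact H2|]. rewrite Rmult_assoc.
    rewrite <- (Rmult_1_l (A * (1 + t))) at 2. apply Rmult_le_compat_r; [apply Rmult_le_pos; lra|lra]. }
  assert (HgE : (1 + t) ^ 3 * (g * E) <= K * exp (- t)).
  { eapply Rle_trans; [|exact H]. apply Rmult_le_compat_l; [apply pow_le; lra|].
    replace (- Re z * t ^ 2 + (D + A) * (1 + t)) with ((- Re z * t ^ 2 + D * (1 + t)) + A * (1 + t)) by ring.
    rewrite exp_plus. apply Rmult_le_compat_r; [left; apply exp_pos|exact H1]. }
  assert (HgE0 : 0 <= g * E) by (apply Rmult_le_pos; lra).
  pose proof (exp_pos (- t)) as Het.
  (* All three claims reduce to a bound by [p (1 + t)^3 g E] with [p] equal to [1], [A] or [A^2]. *)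
  assert (G1 : forall p, 0 <= p <= 1 + A + A ^ 2 -> forall v, v <= p * ((1 + t) ^ 3 * (g * E)) ->
     v <= (1 + A + A ^ 2) * K * exp (- t)).
  { intros p Hp v Hv. eapply Rle_trans; [exact Hv|].
    apply Rle_trans with (p * (K * exp (- t))); [apply Rmult_le_compat_l; lra|].
    rewrite Rmult_assoc. apply Rmult_le_compat_r; [nra|lra]. }
  assert (T1 : 1 + t <= (1 + t) ^ 3) by (simpl; nra).
  assert (T2 : (1 + t) ^ 2 <= (1 + t) ^ 3) by (simpl; nra).
  repeat split.
  - apply (G1 1); [nra|]. rewrite Rmult_1_l.
    apply Rmult_le_compat; [lra|exact Hg|exact T1|]. nra.
  - pose proof (cexp_m1 s) as C1.
    assert (C2 : Cmod (cexp s - 1)%C <= (h * A * (1 + t)) * E).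
    { eapply Rle_trans; [exact C1|]. apply Rmult_le_compat; auto. left; apply exp_pos. }
    apply Rle_trans with (h * (A * ((1 + t) ^ 2 * (g * E)))).
    + eapply Rle_trans; [apply Rmult_le_compat_l; [apply Rmult_le_pos; lra|exact C2]|].
      right. ring.
    + rewrite Rmult_assoc. apply Rmult_le_compat_l; [lra|].
      apply (G1 A); [nra|]. apply Rmult_le_compat_l; [lra|]. apply Rmult_le_compat_r; lra.
  - pose proof (cexp_m1m s) as C1.
    assert (C2 : Cmod (cexp s - 1 - s)%C <= (h * A * (1 + t)) ^ 2 * E).
    { eapply Rle_trans; [exact C1|]. apply Rmult_le_compat; auto.
      - apply pow_le; lra.
      - left; apply exp_pos.
      - apply pow_incr. lra. }
    apply Rle_trans with (h ^ 2 * (A ^ 2 * ((1 + t) ^ 3 * (g * E)))).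
    + eapply Rle_trans; [apply Rmult_le_compat_l; [apply Rmult_le_pos; lra|exact C2]|].
      right. ring.
    + rewrite Rmult_assoc. apply Rmult_le_compat_l; [apply pow_le; lra|].
      apply (G1 (A ^ 2)); [nra|]. lra.
Qed.

Lemma grid_telescope (N n : nat) (F : R -> C) (s : R) : (0 < N)%nat ->
  Csum (fun j => F (s * grid N j + s * / INR N)%R - F (s * grid N j)%R)%C n =
  (F (s * grid N n)%R - F (s * grid N 0)%R)%C.
Proof.
  intros HN. rewrite <- (Csum_telescope (fun j => F (s * grid N j))).
  apply Csum_ext. intros j _. rewrite grid_S by exact HN. f_equal. f_equal. ring.
Qed.

Lemma exp_opp_le_inv (N : nat) : (0 < N)%nat -> exp (- INR N) <= / INR N.
Proof.
  intros HN. assert (0 < INR N) by (apply lt_0_INR; lia).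
  rewrite exp_Ropp. apply Rinv_le_contravar; [lra|].
  pose proof (exp_ineq1_le (INR N)). lra.
Qed.

Lemma grid_0 (N : nat) : (0 < N)%nat -> grid N 0 = - INR N.
Proof. intros HN. unfold grid. simpl. field. apply not_0_INR. lia. Qed.

Lemma grid_end (N : nat) : (0 < N)%nat -> grid N (2 * (N * N) + 1) = INR N + / INR N.
Proof.
  intros HN. unfold grid. rewrite plus_INR, !mult_INR. simpl. field. apply not_0_INR. lia.
Qed.

(** This replaces a contour shift. Along [t w] the derivative of the sum is [w] times a grid sum of
    the derivative of the Gaussian, which telescopes to small boundary terms up to [O(1/N^2)] at
    each node, weighted by [exp (-|u|)]; in total [O(1/N)]. *)
Lemma gsum_shift (z w : C) : 0 < Re z -> exists K, forall N, (0 < N)%nat ->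
  Cmod (gsum N (gauss z w) - gsum N (gauss z 0))%C <= K / INR N.
Proof.
  intros Hz. destruct (gauss_remainders z (Cmod w) Hz (Cmod_ge_0 w)) as [K [HK H]].
  exists (Cmod w * (2 * K + 4 * K + Cmod z * (4 * K))). intros N HN.
  assert (HN' : 1 <= INR N) by (apply (le_INR 1); lia).
  set (h := / INR N).
  assert (Hh : 0 < h <= 1).
  { split; [apply Rinv_0_lt_compat; lra|]. unfold h. rewrite <- Rinv_1. apply Rinv_le_contravar; lra. }
  assert (HhN : h * INR N = 1) by (unfold h; field; lra).
  set (f := fun t : R => gsum N (gauss z (RtoC t * w))).
  replace (gsum N (gauss z w)) with (f 1) by (unfold f; rewrite Cmult_1_l; reflexivity).
  replace (gsum N (gauss z 0)) with (f 0) by (unfold f; rewrite Cmult_0_l; reflexivity).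
  apply (Cmean_value_const f (fun t => RtoC h * Csum (fun j =>
    - (2 * z * w * (RtoC (grid N j) + RtoC t * w)) * gauss z (RtoC t * w) (grid N j)) (2 * (N * N) + 1))%C).
  intros t Ht. split.
  - unfold f, gsum. apply Cder_scal.
    apply (Cder_Csum (fun j t => gauss z (RtoC t * w) (grid N j))). intros j _. unfold gauss.
    apply Cder_cexp.
    assert (D : Cder (fun s => RtoC (grid N j) + RtoC s * w)%C t w).
    { eapply Cder_eq.
      - apply (Cder_plus (fun _ => RtoC (grid N j)) (fun s => RtoC s * w)%C); [apply Cder_const|].
        apply (Cder_mult (fun s => RtoC s) (fun _ => w)); [|apply Cder_const].
        apply (Cder_RtoC (fun s => s) t 1), (is_derive_id (K := R_AbsRing)).
      - ring. }
    apply (Cder_ext (fun s => - z * ((RtoC (grid N j) + RtoC s * w) * (RtoC (grid N j) + RtoC s * w)))%C).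
    { intros s. ring. }
    eapply Cder_eq; [apply Cder_scal, (Cder_mult _ _ _ _ _ D D)|]. ring.
  - set (v := (RtoC t * w)%C).
    assert (Hv : Cmod v <= Cmod w).
    { unfold v. rewrite Cmod_mult, Cmod_R, Rabs_pos_eq by lra. pose proof (Cmod_ge_0 w). nra. }
    set (g := fun j => gauss z v (grid N j)). set (s := fun j => gstep z v (grid N j) h).
    (* At each node, [h] times the derivative is the increment of the Gaussian, minus its quadratic
       remainder, plus [z h^2] times the Gaussian. *)
    replace (RtoC h * Csum (fun j => - (2 * z * w * (RtoC (grid N j) + v)) * gauss z v (grid N j))
       (2 * (N * N) + 1))%C with
      (w * (Csum (fun j => gauss z v (1 * grid N j + 1 * / INR N)%R - gauss z v (1 * grid N j)%R) (2 * (N * N) + 1)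
       - Csum (fun j => g j * (cexp (s j) - 1 - s j)) (2 * (N * N) + 1)
       + z * Csum (fun j => RtoC (h * h)%R * g j) (2 * (N * N) + 1)))%C.
    2:{ rewrite <- Csum_minus, <- (Csum_scal z), <- Csum_plus, <- !Csum_scal. apply Csum_ext.
        intros j _. rewrite !Rmult_1_l. fold h. rewrite gauss_shift. unfold g, s, gstep.
        rewrite RtoC_mult. ring. }
    rewrite (grid_telescope N _ (gauss z v) 1 HN), !Rmult_1_l, grid_0, grid_end by exact HN. fold h.
    unfold Rdiv. fold h. rewrite Cmod_mult, Rmult_assoc. apply Rmult_le_compat_l; [apply Cmod_ge_0|].
    pose proof (exp_opp_le_inv N HN) as He. fold h in He.
    assert (B1 : forall u, INR N <= Rabs u -> Cmod (gauss z v u) <= K * h).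
    { intros u Hu. destruct (H v u 0 Hv ltac:(lra)) as [H1 _].
      pose proof (Cmod_ge_0 (gauss z v u)). pose proof (Rabs_pos u).
      assert (exp (- Rabs u) <= exp (- INR N)) by (apply exp_le; lra).
      assert (K * exp (- Rabs u) <= K * h) by (apply Rmult_le_compat_l; lra). nra. }
    assert (B2 : Cmod (Csum (fun j => g j * (cexp (s j) - 1 - s j))%C (2 * (N * N) + 1)) <= 4 * K * h).
    { eapply Rle_trans; [apply (grid_sum_le N _ (h ^ 2 * K) HN)|].
      - apply Rmult_le_pos; [apply pow_le|]; lra.
      - intros j _. destruct (H v (grid N j) h Hv ltac:(lra)) as [_ [_ H1]].
        eapply Rle_trans; [|exact H1]. rewrite Cmod_mult.
        fold (s j). change (gauss z v (grid N j)) with (g j).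
        pose proof (Rmult_le_pos _ _ (Cmod_ge_0 (g j)) (Cmod_ge_0 (cexp (s j) - 1 - s j)%C)).
        pose proof (Rabs_pos (grid N j)). nra.
      - right. replace (4 * (h ^ 2 * K) * INR N) with (4 * K * h * (h * INR N)) by ring.
        rewrite HhN. ring. }
    assert (B3 : Cmod (Csum (fun j => RtoC (h * h)%R * g j)%C (2 * (N * N) + 1)) <= 4 * K * h).
    { eapply Rle_trans; [apply (grid_sum_le N _ (h ^ 2 * K) HN)|].
      - apply Rmult_le_pos; [apply pow_le|]; lra.
      - intros j _. destruct (H v (grid N j) h Hv ltac:(lra)) as [H1 _].
        rewrite Cmod_mult, Cmod_RtoC_pos by nra.
        replace (h ^ 2 * K * exp (- Rabs (grid N j))) with ((h * h) * (K * exp (- Rabs (grid N j)))) by ring.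
        apply Rmult_le_compat_l; [nra|]. eapply Rle_trans; [|exact H1].
        pose proof (Cmod_ge_0 (g j)). pose proof (Rabs_pos (grid N j)). unfold g in *. nra.
      - right. replace (4 * (h ^ 2 * K) * INR N) with (4 * K * h * (h * INR N)) by ring.
        rewrite HhN. ring. }
    set (X1 := gauss z v (INR N + h)). set (X2 := gauss z v (- INR N)).
    assert (HX1 : Cmod X1 <= K * h) by (apply B1; rewrite Rabs_pos_eq; lra).
    assert (HX2 : Cmod X2 <= K * h) by (apply B1; rewrite Rabs_Ropp, Rabs_pos_eq; lra).
    set (Y := Csum _ _) in *. set (Z := Csum (fun j => RtoC (h * h)%R * g j)%C _) in *.
    eapply Rle_trans; [apply Cmod_triangle|]. rewrite Cmod_mult.
    pose proof (Cmod_minus_le (X1 - X2)%C Y). pose proof (Cmod_minus_le X1 X2).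
    assert (Cmod z * Cmod Z <= Cmod z * (4 * K * h)) by (apply Rmult_le_compat_l; [apply Cmod_ge_0|exact B3]).
    lra.
Qed.

(** The substitution rule: the [s]-derivative of [s g (s u)] is the [u]-derivative of [u g (s u)],
    so the grid sum telescopes again up to [O(1/N)]. *)
Lemma gsum_scale (z : C) (kap : R) : 0 < Re z -> 1 <= kap -> exists K, forall N,
  kap <= INR N ->
  Cmod (RtoC kap * gsum N (fun u => gauss z 0 (kap * u)%R) - gsum N (gauss z 0))%C <= K / INR N.
Proof.
  intros Hz Hk. destruct (gauss_remainders z 0 Hz ltac:(lra)) as [K [HK H]].
  exists ((kap - 1) * (2 * K + 4 * K * kap ^ 2 * (2 + Cmod z))). intros N HkN.
  assert (HN' : 1 <= INR N) by lra.
  assert (HN : (0 < N)%nat) by (apply INR_lt; simpl; lra).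
  set (h := / INR N).
  assert (Hh : 0 < h <= 1).
  { split; [apply Rinv_0_lt_compat; lra|]. unfold h. rewrite <- Rinv_1. apply Rinv_le_contravar; lra. }
  assert (HhN : h * INR N = 1) by (unfold h; field; lra).
  (* Because of [kap <= INR N] the dilated step [s h] stays in [[0, 1]], as [gauss_remainders]
     requires. *)
  assert (Hkh : kap * h <= 1).
  { rewrite <- HhN, Rmult_comm. apply Rmult_le_compat_l; lra. }
  set (sg := fun t : R => 1 + t * (kap - 1)).
  set (f := fun t : R => (RtoC (sg t) * gsum N (fun u => gauss z 0 (sg t * u)%R))%C).
  replace (RtoC kap * gsum N (fun u => gauss z 0 (kap * u)%R))%C with (f 1).
  2:{ unfold f. replace (sg 1) with kap by (unfold sg; ring). reflexivity. }
  replace (gsum N (gauss z 0)) with (f 0).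
  2:{ unfold f. replace (sg 0) with 1 by (unfold sg; ring). rewrite Cmult_1_l. unfold gsum. f_equal.
      apply Csum_ext. intros j _. rewrite Rmult_1_l. reflexivity. }
  apply (Cmean_value_const f (fun t => RtoC (kap - 1)%R * (RtoC h * Csum (fun j =>
    (1 - 2 * z * RtoC (sg t * grid N j)%R * RtoC (sg t * grid N j)%R) * gauss z 0 (sg t * grid N j)%R) (2 * (N * N) + 1)))%C).
  intros t Ht.
  assert (Hs : 1 <= sg t <= kap) by (unfold sg; split; nra). split.
  - unfold f, gsum.
    assert (Dsg : Cder (fun s => RtoC (sg s)) t (RtoC (kap - 1)%R)).
    { apply Cder_RtoC. unfold sg. auto_derive; [exact I|ring]. }
    eapply Cder_eq.
    { eapply (Cder_mult _ (fun s => RtoC (/ INR N) *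
        Csum (fun j => gauss z 0 (sg s * grid N j)%R) (2 * (N * N) + 1))%C _ _ _ Dsg).
      apply Cder_scal.
      apply (Cder_Csum (fun j s => gauss z 0 (sg s * grid N j)%R) (fun j =>
        RtoC (kap - 1)%R * (- (2 * z * RtoC (sg t) * RtoC (grid N j) * RtoC (grid N j)) * gauss z 0 (sg t * grid N j)%R))%C).
      intros j _. unfold gauss.
      eapply Cder_eq.
      - apply Cder_cexp.
        apply (Cder_ext (fun s => (- z * RtoC (grid N j) * RtoC (grid N j)) * (RtoC (sg s) * RtoC (sg s)))%C).
        { intros s. rewrite RtoC_mult. ring. }
        apply Cder_scal, (Cder_mult _ _ _ _ _ Dsg Dsg).
      - cbv beta. ring. }
    fold h. cbv beta. rewrite <- !Csum_scal, <- Csum_plus. apply Csum_ext. intros j _.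
    rewrite RtoC_mult. ring.
  - set (s := sg t) in *. set (eta := s * h).
    assert (He : 0 < eta <= 1).
    { unfold eta. split; [apply Rmult_lt_0_compat; lra|].
      eapply Rle_trans; [|exact Hkh]. apply Rmult_le_compat_r; lra. }
    set (v := fun j => s * grid N j). set (g := fun j => gauss z 0 (v j)).
    set (st := fun j => gstep z 0 (v j) eta). set (G := fun u : R => (RtoC u * gauss z 0 u)%C).
    assert (H0 : Cmod 0%C <= 0) by (rewrite Cmod_0; lra).
    assert (Hsc : (RtoC s <> 0)%C) by (apply RtoC_neq; lra).
    replace (RtoC h * Csum (fun j => (1 - 2 * z * RtoC (s * grid N j)%R * RtoC (s * grid N j)%R) *
        gauss z 0 (s * grid N j)%R) (2 * (N * N) + 1))%C with
      (RtoC (/ s) * (Csum (fun j => G (s * grid N j + s * / INR N)%R - G (s * grid N j)%R) (2 * (N * N) + 1)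
       - Csum (fun j => RtoC (v j) * (g j * (cexp (st j) - 1 - st j)) + RtoC eta * (g j * (cexp (st j) - 1))
           - z * RtoC (eta * eta)%R * (RtoC (v j) * g j)) (2 * (N * N) + 1)))%C.
    2:{ rewrite <- Csum_minus, <- !Csum_scal. apply Csum_ext. intros j _. fold h. fold (v j).
        fold eta. unfold G. rewrite gauss_shift. fold (g j). fold (st j).
        replace (RtoC (/ s)) with (/ RtoC s)%C by (symmetry; apply RtoC_inv; lra).
        rewrite RtoC_plus. unfold st, gstep. rewrite RtoC_mult.
        replace (RtoC h) with (RtoC eta / RtoC s)%C.
        2:{ rewrite <- RtoC_div by lra. f_equal. unfold eta. field. lra. }
        field. exact Hsc. }
    rewrite (grid_telescope N _ G s HN), grid_0, grid_end by exact HN. fold h.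
    rewrite Cmod_mult, Cmod_R, Rabs_pos_eq by lra. unfold Rdiv. rewrite Rmult_assoc.
    apply Rmult_le_compat_l; [lra|]. fold h.
    rewrite Cmod_mult, Cmod_RtoC_pos by (left; apply Rinv_0_lt_compat; lra).
    assert (Hsi : / s <= 1) by (rewrite <- Rinv_1; apply Rinv_le_contravar; lra).
    match goal with |- / s * ?X <= _ => assert (HX : X <= (2 * K + 4 * K * kap ^ 2 * (2 + Cmod z)) * h) end.
    2:{
        match goal with |- / s * Cmod ?X <= _ => pose proof (Cmod_ge_0 X) end. nra. }
    pose proof (exp_opp_le_inv N HN) as Hen. fold h in Hen.
    assert (B1 : forall u, INR N <= Rabs u -> Cmod (G u) <= K * h).
    { intros u Hu. destruct (H 0%C u 0 H0 ltac:(lra)) as [H1 _]. unfold G. rewrite Cmod_mult, Cmod_R.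
      pose proof (Cmod_ge_0 (gauss z 0 u)).
      assert (exp (- Rabs u) <= exp (- INR N)) by (apply exp_le; lra).
      assert (K * exp (- Rabs u) <= K * h) by (apply Rmult_le_compat_l; lra). nra. }
    assert (B2 : Cmod (Csum (fun j => RtoC (v j) * (g j * (cexp (st j) - 1 - st j)) + RtoC eta * (g j * (cexp (st j) - 1))
           - z * RtoC (eta * eta)%R * (RtoC (v j) * g j))%C (2 * (N * N) + 1)) <= 4 * K * kap ^ 2 * (2 + Cmod z) * h).
    { eapply Rle_trans; [apply (grid_sum_le N _ (eta ^ 2 * K * (2 + Cmod z)) HN)|].
      - pose proof (Cmod_ge_0 z). apply Rmult_le_pos; [apply Rmult_le_pos; [apply pow_le|]; lra|lra].
      - intros j _. destruct (H 0%C (v j) eta H0 ltac:(lra)) as [H1 [H2 H3]].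
        fold (g j) in H1, H2, H3. fold (st j) in H2, H3.
        assert (Hexp : exp (- Rabs (v j)) <= exp (- Rabs (grid N j))).
        { apply exp_le. apply Ropp_le_contravar. unfold v. rewrite Rabs_mult, (Rabs_pos_eq s) by lra.
          pose proof (Rabs_pos (grid N j)). nra. }
        set (ex := exp (- Rabs (v j))) in *. set (ex' := exp (- Rabs (grid N j))) in *.
        pose proof (Rabs_pos (v j)) as Hv. pose proof (Cmod_ge_0 z) as Hz0.
        set (m1 := Cmod (cexp (st j) - 1 - st j)%C) in *. set (m2 := Cmod (cexp (st j) - 1)%C) in *.
        assert (0 <= m1) by apply Cmod_ge_0. assert (0 <= m2) by apply Cmod_ge_0.
        set (a := Cmod (g j)) in *. assert (0 <= a) by apply Cmod_ge_0.
        assert (0 <= a * m1) by (apply Rmult_le_pos; assumption).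
        assert (0 <= a * m2) by (apply Rmult_le_pos; assumption).
        apply Rle_trans with (eta ^ 2 * K * (2 + Cmod z) * ex).
        2:{ apply Rmult_le_compat_l; [|exact Hexp]. apply Rmult_le_pos; [|lra].
            apply Rmult_le_pos; [apply pow_le|]; lra. }
        eapply Rle_trans; [apply Cmod_minus_le|].
        eapply Rle_trans; [apply Rplus_le_compat_r, Cmod_triangle|].
        rewrite !Cmod_mult, !Cmod_R, (Rabs_pos_eq eta), (Rabs_pos_eq (eta * eta)) by nra.
        fold a m1 m2.
        assert (E1 : Rabs (v j) * (a * m1) <= eta ^ 2 * K * ex) by nra.
        assert (E2 : eta * (a * m2) <= eta ^ 2 * K * ex).
        { replace (eta ^ 2 * K * ex) with (eta * (eta * K * ex)) by ring.
          apply Rmult_le_compat_l; [lra|]. nra. }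
        assert (E3 : Cmod z * (eta * eta) * (Rabs (v j) * a) <= Cmod z * (eta * eta) * (K * ex)).
        { apply Rmult_le_compat_l; [apply Rmult_le_pos; nra|]. nra. }
        nra.
      - replace (4 * (eta ^ 2 * K * (2 + Cmod z)) * INR N)
          with (4 * K * (s ^ 2) * (2 + Cmod z) * h * (h * INR N)) by (unfold eta; ring).
        rewrite HhN, Rmult_1_r. apply Rmult_le_compat_r; [lra|]. pose proof (Cmod_ge_0 z).
        apply Rmult_le_compat_r; [lra|]. apply Rmult_le_compat_l; [lra|]. apply pow_incr. lra. }
    assert (HX1 : Cmod (G (s * (INR N + h))) <= K * h).
    { apply B1. rewrite Rabs_pos_eq; nra. }
    assert (HX2 : Cmod (G (s * - INR N)) <= K * h).
    { apply B1. rewrite Rabs_mult, Rabs_Ropp, !Rabs_pos_eq by lra. nra. }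
    eapply Rle_trans; [apply Cmod_minus_le|].
    pose proof (Cmod_minus_le (G (s * (INR N + h))) (G (s * - INR N))). lra.
Qed.

(** * Decay of the discrete Fourier transform of the Gaussian *)

Lemma sin_ge_cubic (x : R) : 0 <= x -> x - x ^ 3 / 6 <= sin x.
Proof.
  assert (S1 : forall x, 0 <= x -> sin x <= x).
  { intros t [Ht|Ht]; [left; apply sin_lt_x, Ht|rewrite <- Ht, sin_0; lra]. }
  assert (S2 : forall x, 0 <= x -> 1 - x ^ 2 / 2 <= cos x).
  { intros t Ht.
    assert (H : 0 - 1 + 0 ^ 2 / 2 + 1 <= cos t - 1 + t ^ 2 / 2).
    { replace (0 - 1 + 0 ^ 2 / 2 + 1) with (cos 0 - 1 + 0 ^ 2 / 2) by (rewrite cos_0; ring).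
      apply (derive_nonneg_le (fun x => cos x - 1 + x ^ 2 / 2) (fun x => - sin x + x)); [exact Ht|].
      intros s Hs. split; [auto_derive; [exact I|field]|]. pose proof (S1 s). lra. }
    lra. }
  intros Hx.
  assert (H : 0 <= sin x - x + x ^ 3 / 6).
  { replace 0 with (sin 0 - 0 + 0 ^ 3 / 6) by (rewrite sin_0; field).
    apply (derive_nonneg_le (fun x => sin x - x + x ^ 3 / 6) (fun x => cos x - 1 + x ^ 2 / 2)); [exact Hx|].
    intros s Hs. split; [auto_derive; [exact I|field]|]. pose proof (S2 s). lra. }
  lra.
Qed.

Lemma sin_ge_third (x : R) : 0 <= x <= 2 -> x / 3 <= sin x.
Proof. intros Hx. eapply Rle_trans; [|apply sin_ge_cubic; lra]. nra. Qed.

Lemma one_minus_cos_ge (t : R) : 0 <= t <= PI -> t ^ 2 / 18 <= 1 - cos t.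
Proof.
  intros Ht. pose proof PI_4 as P4.
  replace t with (2 * (t / 2)) at 2 by field. rewrite cos_2a_sin.
  set (x := t / 2). replace t with (2 * x) by (unfold x; field).
  assert (Hx : 0 <= x <= 2) by (unfold x; lra).
  pose proof (sin_ge_third x Hx). nra.
Qed.

Definition phase (xi u : R) : C := cexp (Ci * RtoC (xi * u))%C.

Lemma Cmod_phase (xi u : R) : Cmod (phase xi u) = 1.
Proof.
  unfold phase. rewrite Cmod_cexp, <- exp_0. f_equal. unfold Re, Ci, Cmult, RtoC. simpl. ring.
Qed.

Lemma phase_plus (xi u v : R) : phase xi (u + v) = (phase xi u * phase xi v)%C.
Proof.
  unfold phase. rewrite <- cexp_plus. f_equal. rewrite Rmult_plus_distr_l, RtoC_plus. ring.
Qed.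

Lemma phase_sum (xi u : R) : (phase xi u + phase (- xi) u)%C = RtoC (2 * cos (xi * u)).
Proof.
  unfold phase, cexp, Ci, Cmult, Cplus, RtoC, Re, Im. simpl.
  replace (0 * (xi * u) - 1 * 0) with 0 by ring. replace (0 * (- xi * u) - 1 * 0) with 0 by ring.
  replace (0 * 0 + 1 * (xi * u)) with (xi * u) by ring.
  replace (0 * 0 + 1 * (- xi * u)) with (- (xi * u)) by ring.
  rewrite cos_neg, sin_neg, exp_0. f_equal; ring.
Qed.

(** Two summations by parts: the factor [2 - 2 cos (xi h)], at least [xi^2 h^2 / 9] up to the
    sampling limit [pi N], trades the Gaussian for its second difference, which is [O(h^2)]. The
    constant is independent of the grid, so that it can serve as a majorant. *)
Lemma gsum_decay (z : C) : 0 < Re z -> exists K, 0 < K /\ forall N xi, (2 <= N)%nat ->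
  0 < Rabs xi <= PI * INR N ->
  Cmod (gsum N (fun u => gauss z 0 u * phase xi u))%C <= K / xi ^ 2.
Proof.
  intros Hz. destruct (gauss_remainders z 0 Hz ltac:(lra)) as [K [HK H]].
  pose proof (Cmod_ge_0 z) as Hz0.
  set (K2 := 3 * K * (6 + 2 * Cmod z)).
  exists (9 * (4 * K2 + 4 * K)). split; [unfold K2; nra|]. intros N xi HN2 Hxi.
  assert (HN : (0 < N)%nat) by lia.
  assert (HN' : 2 <= INR N) by (apply (le_INR 2); lia).
  set (h := / INR N).
  assert (Hh : 0 < h <= / 2).
  { split; [apply Rinv_0_lt_compat; lra|]. apply Rinv_le_contravar; lra. }
  assert (HhN : h * INR N = 1) by (unfold h; field; lra).
  assert (H0 : Cmod 0%C <= 0) by (rewrite Cmod_0; lra).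
  set (g := gauss z 0). set (M := (2 * (N * N) + 1)%nat).
  set (T := Csum (fun j => g (grid N j) * phase xi (grid N j))%C M).
  set (rho := phase xi h). set (rho' := phase xi (- h)).
  set (a := fun j => (g (grid N j - h)%R * phase xi (grid N j))%C).
  set (b := fun j => (g (grid N j) * phase xi (grid N j - h)%R)%C).
  assert (Hgr : forall j, grid N (S j) = grid N j + h) by (intros; apply grid_S, HN).
  (* The second difference moves from the phase to the Gaussian, at the cost of four boundary
     terms. *)
  assert (E : ((2 - rho - rho') * T =
     Csum (fun j => (2 * g (grid N j) - g (grid N j - h)%R - g (grid N j + h)%R) * phase xi (grid N j)) M
     - (a M - a O) + (b M - b O))%C).
  { rewrite <- !(Csum_telescope _ M), <- Csum_minus, <- Csum_plus. unfold T. rewrite <- Csum_scal.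
    apply Csum_ext. intros j _. unfold a, b. rewrite Hgr.
    replace (grid N j + h - h) with (grid N j) by ring.
    replace (grid N j - h) with (grid N j + - h) by ring.
    rewrite !phase_plus. fold rho rho'. ring. }
  assert (Hrho : (2 - rho - rho')%C = RtoC (2 - 2 * cos (xi * h))).
  { replace (2 - rho - rho')%C with (2 - (phase xi h + phase (- xi) h))%C.
    - rewrite phase_sum, <- RtoC_minus. reflexivity.
    - unfold rho, rho'. replace (phase (- xi) h) with (phase xi (- h)); [ring|].
      unfold phase. f_equal. f_equal. f_equal. ring. }
  assert (Hcos : xi ^ 2 * h ^ 2 / 9 <= 2 - 2 * cos (xi * h)).
  { pose proof (one_minus_cos_ge (Rabs xi * h)) as Hc.
    assert (Hr : 0 <= Rabs xi * h <= PI).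
    { split; [apply Rmult_le_pos; lra|]. replace PI with (PI * INR N * h) by (rewrite Rmult_assoc, (Rmult_comm _ h), HhN; ring).
      apply Rmult_le_compat_r; lra. }
    specialize (Hc Hr).
    replace (cos (xi * h)) with (cos (Rabs xi * h)).
    - rewrite Rpow_mult_distr, pow2_abs in Hc. lra.
    - unfold Rabs. destruct (Rcase_abs xi); [|reflexivity].
      rewrite <- cos_neg. f_equal. ring. }
  pose proof (exp_opp_le_inv N HN) as Hen. fold h in Hen.
  assert (B1 : forall u, INR N <= Rabs u -> Cmod (g u) <= K * h).
  { intros u Hu. destruct (H 0%C u 0 H0 ltac:(lra)) as [H1 _]. unfold g.
    pose proof (Cmod_ge_0 (gauss z 0 u)). pose proof (Rabs_pos u).
    assert (exp (- Rabs u) <= exp (- INR N)) by (apply exp_le; lra).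
    assert (K * exp (- Rabs u) <= K * h) by (apply Rmult_le_compat_l; lra). nra. }
  assert (B2 : Cmod (Csum (fun j => (2 * g (grid N j) - g (grid N j - h)%R - g (grid N j + h)%R) *
      phase xi (grid N j))%C M) <= 4 * K2 * h).
  { eapply Rle_trans; [apply (grid_sum_le N _ (h ^ 2 * K2) HN)|].
    - unfold K2. apply Rmult_le_pos; [apply pow_le; lra|nra].
    - intros j _. set (u := grid N j). rewrite Cmod_mult, Cmod_phase, Rmult_1_r.
      set (v := u - h).
      destruct (H 0%C v h H0 ltac:(lra)) as [R1 [_ R2]].
      destruct (H 0%C v (2 * h) H0 ltac:(lra)) as [_ [_ R3]].
      set (s1 := gstep z 0 v h) in *. set (s2 := gstep z 0 v (2 * h)) in *.
      (* Expanded at the left node [v], the linear parts of the two increments cancel up to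
         [2 z h^2]. *)
      replace (2 * g u - g v - g (u + h)%R)%C with
        (- (g v * (cexp s2 - 1 - s2)) + 2 * (g v * (cexp s1 - 1 - s1)) + 2 * z * RtoC (h * h)%R * g v)%C.
      2:{ replace u with (v + h) at 1 by (unfold v; ring).
          replace (u + h)%R with (v + 2 * h) by (unfold v; ring).
          unfold g. rewrite !gauss_shift. fold s1 s2.
          assert (Es : (s2 = 2 * s1 - 2 * z * RtoC (h * h)%R)%C).
          { unfold s1, s2, gstep. rewrite !RtoC_mult. ring. }
          rewrite Es at 2. ring. }
      set (m1 := Cmod (cexp s1 - 1 - s1)%C) in *. set (m2 := Cmod (cexp s2 - 1 - s2)%C) in *.
      set (gv := Cmod (gauss z 0 v)) in *. set (ex := exp (- Rabs v)) in *.
      assert (0 <= gv) by apply Cmod_ge_0. assert (0 <= m1) by apply Cmod_ge_0.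
      assert (0 <= m2) by apply Cmod_ge_0. pose proof (Rabs_pos v) as Hv.
      eapply Rle_trans; [apply Cmod_triangle|].
      eapply Rle_trans; [apply Rplus_le_compat_r, Cmod_triangle|].
      rewrite Cmod_opp, !Cmod_mult, !Cmod_R, (Rabs_pos_eq 2), (Rabs_pos_eq (h * h)) by nra.
      fold m1 m2. change (Cmod (g v)) with gv.
      assert (0 <= gv * m1) by (apply Rmult_le_pos; assumption).
      assert (0 <= gv * m2) by (apply Rmult_le_pos; assumption).
      assert (F1 : gv * m1 <= h ^ 2 * K * ex) by nra.
      assert (F2 : gv * m2 <= (2 * h) ^ 2 * K * ex) by nra.
      assert (F3 : gv <= K * ex) by nra.
      assert (F4 : 2 * Cmod z * (h * h) * gv <= 2 * Cmod z * (h * h) * (K * ex)).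
      { apply Rmult_le_compat_l; [|exact F3]. apply Rmult_le_pos; nra. }
      assert (F5 : ex <= 3 * exp (- Rabs u)).
      { apply Rle_trans with (exp 1 * exp (- Rabs u)).
        - rewrite <- exp_plus. apply exp_le. 
          pose proof (Rabs_triang v h) as Htr. replace (v + h) with u in Htr by (unfold v; ring).
          rewrite (Rabs_pos_eq h) in Htr by lra. lra.
        - apply Rmult_le_compat_r; [left; apply exp_pos|apply exp_le_3]. }
      apply Rle_trans with (h ^ 2 * (K * (6 + 2 * Cmod z)) * ex); [lra|].
      unfold K2. replace (h ^ 2 * (3 * K * (6 + 2 * Cmod z)) * exp (- Rabs u)) with
        (h ^ 2 * (K * (6 + 2 * Cmod z)) * (3 * exp (- Rabs u))) by ring.
      apply Rmult_le_compat_l; [|exact F5]. apply Rmult_le_pos; [apply pow_le; lra|nra].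
    - right. replace (4 * (h ^ 2 * K2) * INR N) with (4 * K2 * h * (h * INR N)) by ring.
      rewrite HhN. ring. }
  assert (Hend : grid N M = INR N + h) by apply (grid_end N HN).
  assert (Hbeg : grid N 0 = - INR N) by apply (grid_0 N HN).
  assert (Ha : Cmod (a M) <= K * h /\ Cmod (a O) <= K * h /\ Cmod (b M) <= K * h /\ Cmod (b O) <= K * h).
  { unfold a, b. rewrite !Cmod_mult, !Cmod_phase, !Rmult_1_r, Hend, Hbeg.
    repeat split; apply B1.
    - replace (INR N + h - h) with (INR N) by ring. apply Rle_abs.
    - rewrite Rabs_left by lra. lra.
    - rewrite Rabs_pos_eq; lra.
    - rewrite Rabs_Ropp. apply Rle_abs. }
  destruct Ha as [A1 [A2 [A3 A4]]].
  assert (HT : (2 - 2 * cos (xi * h)) * Cmod T <= (4 * K2 + 4 * K) * h).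
  { assert (Hc0 : 0 <= 2 - 2 * cos (xi * h)) by (pose proof (COS_bound (xi * h)); lra).
    rewrite <- (Cmod_RtoC_pos _ Hc0), <- Hrho, <- Cmod_mult, E.
    eapply Rle_trans; [apply Cmod_triangle|].
    pose proof (Cmod_minus_le (b M) (b O)). pose proof (Cmod_minus_le (a M) (a O)).
    match goal with |- Cmod (?x - ?y)%C + _ <= _ => pose proof (Cmod_minus_le x y) end. lra. }
  unfold gsum. fold M. change (Csum _ M) with T. fold h.
  rewrite Cmod_mult, Cmod_RtoC_pos by lra.
  assert (Hxi2 : 0 < xi ^ 2) by (rewrite <- pow2_abs; apply pow_lt; lra).
  pose proof (Cmod_ge_0 T) as HT0.
  assert (HT2 : xi ^ 2 * h ^ 2 / 9 * Cmod T <= (4 * K2 + 4 * K) * h).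
  { eapply Rle_trans; [apply Rmult_le_compat_r; [exact HT0|exact Hcos]|exact HT]. }
  apply Rmult_le_reg_r with (xi ^ 2); [exact Hxi2|].
  replace (9 * (4 * K2 + 4 * K) / xi ^ 2 * xi ^ 2) with (9 * (4 * K2 + 4 * K)) by (field; intros Hc; rewrite Hc in Hxi2; simpl in Hxi2; lra).
  apply Rmult_le_reg_l with h; [lra|].
  replace (h * (h * Cmod T * xi ^ 2)) with (9 * (xi ^ 2 * h ^ 2 / 9 * Cmod T)) by field. lra.
Qed.

Lemma Csum_multiples (N L : nat) (F : nat -> C) : (0 < N)%nat ->
  (forall j, (j mod N <> 0)%nat -> F j = 0%C) ->
  Csum F (N * L + 1) = Csum (fun l => F (N * l)%nat) (L + 1).
Proof.
  intros HN HF. induction L as [|L IH].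
  - rewrite Nat.mul_0_r. simpl. rewrite Nat.mul_0_r. reflexivity.
  - replace (N * S L + 1)%nat with ((N * L + 1) + (N - 1 + 1))%nat by lia.
    rewrite Csum_add, IH. replace (S L + 1)%nat with (S (L + 1)) by lia. rewrite Csum_S. f_equal.
    rewrite Csum_add, (Csum_ext _ (fun _ => RtoC 0) (N - 1)), Csum_zero.
    + simpl. rewrite !Cplus_0_l. f_equal. lia.
    + intros i Hi. apply HF. replace (N * L + 1 + i)%nat with (S i + L * N)%nat by lia.
      rewrite Nat.Div0.mod_add, Nat.mod_small by lia. lia.
Qed.

(** * Finite Poisson summation *)

Definition freq (m : nat) : R := PI * (2 * INR m + 1).

(** Dirichlet's kernel for the odd multiples of [pi], the frequencies dual to the sign [(-1)^j]:
    each product with the sine is a difference of two sines, and the sum telescopes. *)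
Lemma cos_sum_sin (u : R) (H : nat) :
  sin (PI * u) * Rsum (fun m => 2 * cos (freq m * u)) H = sin (2 * INR H * (PI * u)).
Proof.
  induction H as [|H IH]; [replace (2 * INR 0 * (PI * u)) with 0 by (simpl; ring); rewrite sin_0; simpl; ring|].
  change (Rsum (fun m => 2 * cos (freq m * u)) (S H)) with
    (Rsum (fun m => 2 * cos (freq m * u)) H + 2 * cos (freq H * u)).
  rewrite Rmult_plus_distr_l, IH, S_INR.
  replace (2 * (INR H + 1) * (PI * u)) with (freq H * u + PI * u) by (unfold freq; ring).
  replace (2 * INR H * (PI * u)) with (freq H * u - PI * u) by (unfold freq; ring).
  rewrite sin_plus, sin_minus. ring.
Qed.

Lemma cos_INR_PI (i : nat) : cos (INR i * PI) = (-1) ^ i.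
Proof.
  induction i as [|i IH]; [simpl; rewrite Rmult_0_l; apply cos_0|].
  rewrite S_INR, Rmult_plus_distr_r, Rmult_1_l, neg_cos, IH. simpl. ring.
Qed.

Lemma cos_freq_INR (m i : nat) : cos (freq m * INR i) = (-1) ^ i.
Proof.
  unfold freq. rewrite <- cos_INR_PI.
  replace (PI * (2 * INR m + 1) * INR i) with (INR i * PI + 2 * INR (m * i) * PI)
    by (rewrite mult_INR; ring).
  apply cos_period.
Qed.

(** An exact form of Poisson summation. With [N = 2 H] grid points per unit, the kernel of the first
    [H] odd frequencies vanishes at grid points that are not integers and equals [N (-1)^i] at the
    integer [i], which leaves the truncated theta series. *)
Lemma gsum_dft (z : C) (H : nat) : (0 < H)%nat ->
  Csum (fun m => gsum (2 * H) (fun u => gauss z 0 u * phase (freq m) u) +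
                 gsum (2 * H) (fun u => gauss z 0 u * phase (- freq m) u))%C H =
  theta_sum (cexp (- z)) (2 * H).
Proof.
  intros HH. set (N := (2 * H)%nat). assert (HN : (0 < N)%nat) by (unfold N; lia).
  assert (HN' : INR N <> 0) by (apply not_0_INR; lia).
  assert (HNH : INR N = 2 * INR H) by (unfold N; rewrite mult_INR; reflexivity).
  set (D := fun u => Rsum (fun m => 2 * cos (freq m * u)) H).
  transitivity (RtoC (/ INR N) * Csum (fun j => gauss z 0 (grid N j) * RtoC (D (grid N j))) (N * (2 * N) + 1))%C.
  { unfold gsum. replace (N * (2 * N) + 1)%nat with (2 * (N * N) + 1)%nat by lia.
    rewrite (Csum_ext _ (fun m => RtoC (/ INR N) *
      Csum (fun j => gauss z 0 (grid N j) * RtoC (2 * cos (freq m * grid N j))%R) (2 * (N * N) + 1))%C).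
    - rewrite Csum_scal, Csum_swap. f_equal. apply Csum_ext. intros j _.
      unfold D. rewrite <- Csum_RtoC, <- Csum_scal. reflexivity.
    - intros m _. rewrite <- Cmult_plus_distr_l, <- Csum_plus. f_equal. apply Csum_ext. intros j _.
      rewrite <- phase_sum. ring. }
  rewrite Csum_multiples; [|exact HN|].
  2:{ intros j Hj.
      assert (HD : D (grid N j) = 0); [|rewrite HD; ring].
      destruct (Req_dec (sin (PI * grid N j)) 0) as [Hs|Hs].
      - exfalso. apply sin_eq_0_0 in Hs. destruct Hs as [k Hk].
        apply Hj. pose proof PI_RGT_0.
        assert (Hg : grid N j = IZR k) by (apply Rmult_eq_reg_l with PI; lra).
        unfold grid in Hg. assert (Hj2 : INR j = INR N * (IZR k + INR N)) by (rewrite <- Hg; field; exact HN').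
        rewrite !INR_IZR_INZ, <- plus_IZR, <- mult_IZR in Hj2. apply eq_IZR in Hj2.
        assert (0 <= k + Z.of_nat N)%Z by nia.
        assert (j = (Z.to_nat (k + Z.of_nat N) * N)%nat) as -> by nia.
        apply Nat.Div0.mod_mul.
      - pose proof (cos_sum_sin (grid N j) H) as Hc. fold (D (grid N j)) in Hc.
        rewrite (sin_eq_0_1 (2 * INR H * (PI * grid N j))) in Hc.
        + apply Rmult_integral in Hc. tauto.
        + exists (Z.of_nat j - Z.of_nat (N * N))%Z. rewrite <- HNH. unfold grid.
          rewrite minus_IZR, <- !INR_IZR_INZ, mult_INR. field. exact HN'. }
  assert (Hint : forall i, D (INR i) = INR N * (-1) ^ i).
  { intros i. unfold D. rewrite (Rsum_ext _ (fun _ => 2 * (-1) ^ i)).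
    - rewrite Rsum_const, HNH. ring.
    - intros m _. rewrite cos_freq_INR. reflexivity. }
  assert (Hneg : forall u, D (- u) = D u).
  { intros u. apply Rsum_ext. intros m _. rewrite <- cos_neg. f_equal. f_equal. ring. }
  assert (Hg : forall u, gauss z 0 u = cexp (RtoC (u * u)%R * - z)%C).
  { intros u. unfold gauss. f_equal. rewrite RtoC_mult. ring. }
  set (q := cexp (- z)).
  assert (Hterm : forall i, (gauss z 0 (INR i) * RtoC (D (INR i)) = RtoC (INR N) * ((-1) ^ i * q ^ (i * i)))%C).
  { intros i. rewrite Hint, Hg. unfold q. rewrite cexp_pow, mult_INR, (RtoC_mult (INR N)), RtoC_pow. ring. }
  replace (2 * N + 1)%nat with (N + S N)%nat by lia. rewrite Csum_add.
  assert (HL : Csum (fun l => gauss z 0 (grid N (N * l)) * RtoC (D (grid N (N * l))))%C N =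
     Csum (fun i => RtoC (INR N) * ((-1) ^ S i * q ^ (S i * S i)))%C N).
  { rewrite <- Csum_rev. apply Csum_ext. intros i Hi.
    assert (Hgr : grid N (N * (N - 1 - i)) = - INR (S i)).
    { unfold grid. rewrite mult_INR, !minus_INR, (S_INR i) by lia. simpl (INR 1). field. exact HN'. }
    rewrite Hgr, Hneg, <- Hterm, !Hg. f_equal. f_equal. f_equal. f_equal. ring. }
  rewrite HL.
  assert (HR : Csum (fun i => gauss z 0 (grid N (N * (N + i))) * RtoC (D (grid N (N * (N + i)))))%C (S N) =
     Csum (fun i => RtoC (INR N) * ((-1) ^ i * q ^ (i * i)))%C (S N)).
  { apply Csum_ext. intros i _.
    assert (Hgr : grid N (N * (N + i)) = INR i).
    { unfold grid. rewrite mult_INR, plus_INR. field. exact HN'. }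
    rewrite Hgr. apply Hterm. }
  rewrite HR, Csum_S0, !Csum_scal. unfold theta_sum.
  rewrite RtoC_inv by exact HN'.
  change ((-1) ^ 0)%C with (RtoC 1). change (q ^ (0 * 0))%C with (RtoC 1).
  field. apply RtoC_neq. exact HN'.
Qed.

(** * Passage to the limit in the Poisson summation *)

Lemma Tannery (a : nat -> nat -> R) (b : nat -> R) (B : R) :
  (forall m, is_lim_seq (fun n => a n m) 0) ->
  (forall n m, (m < n)%nat -> 0 <= a n m <= b m) ->
  (forall m, 0 <= b m) -> (forall n, Rsum b n <= B) ->
  is_lim_seq (fun n => Rsum (a n) n) 0.
Proof.
  intros Ha Hab Hb HB.
  destruct (Rseries_bounded b B Hb HB) as [l [Hl [_ Hl2]]].
  apply is_lim_seq_spec. intros eps.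
  apply is_lim_seq_spec in Hl. destruct (Hl (pos_div_2 eps)) as [M HM].
  specialize (HM M (le_n _)). simpl in HM. apply Rabs_def2 in HM.
  assert (HF : is_lim_seq (fun n => Rsum (a n) M) 0).
  { clear HM. induction M as [|M IH]; [apply is_lim_seq_const|].
    simpl. replace (Finite 0) with (Finite (0 + 0)) by (f_equal; ring).
    apply is_lim_seq_plus'; auto. }
  apply is_lim_seq_spec in HF. destruct (HF (pos_div_2 eps)) as [M2 HM2]. simpl in HM2.
  exists (M + M2)%nat. intros n Hn. specialize (HM2 n ltac:(lia)). apply Rabs_def2 in HM2.
  replace n with (M + (n - M))%nat at 2 by lia. rewrite Rsum_add.
  assert (H1 : 0 <= Rsum (fun i => a n (M + i)%nat) (n - M)).
  { apply Rsum_ge0. intros i Hi. apply Hab. lia. }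
  assert (H2 : Rsum (fun i => a n (M + i)%nat) (n - M) <= Rsum (fun i => b (M + i)%nat) (n - M)).
  { apply Rsum_le. intros i Hi. apply Hab. lia. }
  pose proof (Rsum_add b M (n - M)) as H3. pose proof (Hl2 (M + (n - M))%nat) as H4.
  assert (H5 : 0 <= Rsum (a n) M).
  { apply Rsum_ge0. intros i Hi. apply Hab. lia. }
  apply Rabs_def1; lra.
Qed.

(** The Fourier transform of [exp (- z u^2)] at the frequency [freq m], relative to its value at
    frequency 0. Opposite frequencies agree, so [wsum] is half of the dual theta series. *)
Definition wterm (z : C) (m : nat) : C := cexp (- (RtoC (freq m ^ 2) / (4 * z)))%C.

Definition wsum (z : C) : C := Clim (Csum (wterm z)).

Lemma Re_neq0 (z : C) : 0 < Re z -> z <> 0%C.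
Proof. intros H E. rewrite E in H. simpl in H. lra. Qed.

Lemma Re_inv (z : C) : Re (/ z)%C = Re z / Cmod z ^ 2.
Proof. rewrite Cmod2_alt. unfold Cinv, Re, Im. reflexivity. Qed.

Lemma Re_inv_pos (z : C) : 0 < Re z -> 0 < Re (/ z)%C.
Proof.
  intros H. rewrite Re_inv. pose proof (Re_neq0 z H) as Hn. apply Cmod_gt_0 in Hn.
  apply Rmult_lt_0_compat; [exact H|]. apply Rinv_0_lt_compat, pow_lt, Hn.
Qed.

Lemma Cmod_wterm (z : C) (m : nat) : 0 < Re z ->
  Cmod (wterm z m) = exp (- (freq m ^ 2 / 4 * Re (/ z)%C)).
Proof.
  intros Hz. unfold wterm. rewrite Cmod_cexp. f_equal.
  pose proof (Re_neq0 z Hz) as Hn.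
  replace (RtoC (freq m ^ 2) / (4 * z))%C with (RtoC (freq m ^ 2 / 4) * / z)%C.
  - unfold Re, Copp, Cmult, RtoC. simpl. ring.
  - rewrite RtoC_div by lra. field. exact Hn.
Qed.

(** A weak bound, chosen because the sum of its reciprocals telescopes. *)
Lemma freq_ge (m : nat) : (INR m + 1) * (INR m + 2) / 2 <= freq m ^ 2.
Proof.
  unfold freq. rewrite Rpow_mult_distr.
  assert (1 <= PI ^ 2) by (pose proof PI2_3_2; unfold PI2 in *; pose proof PI_RGT_0; nra).
  pose proof (pos_INR m). pose proof (pow2_ge_0 (2 * INR m + 1)). nra.
Qed.

Lemma freq_pos (m : nat) : 0 < freq m.
Proof. unfold freq. pose proof PI_RGT_0. pose proof (pos_INR m). nra. Qed.

Lemma Rsum_inv_freq (n : nat) : Rsum (fun m => / freq m ^ 2) n <= 2.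
Proof.
  apply Rle_trans with (Rsum (fun m => 2 * (/ (INR m + 1) - / (INR (S m) + 1))) n).
  - apply Rsum_le. intros m _. rewrite S_INR. pose proof (pos_INR m).
    replace (2 * (/ (INR m + 1) - / (INR m + 1 + 1))) with (/ ((INR m + 1) * (INR m + 2) / 2)) by (field; lra).
    apply Rinv_le_contravar; [nra|apply freq_ge].
  - rewrite Rsum_scal.
    assert (H : Rsum (fun m => / (INR m + 1) - / (INR (S m) + 1)) n = 1 - / (INR n + 1)).
    { induction n as [|n IH]; [simpl; field|].
      change (Rsum (fun m => / (INR m + 1) - / (INR (S m) + 1)) (S n)) with
        (Rsum (fun m => / (INR m + 1) - / (INR (S m) + 1)) n + (/ (INR n + 1) - / (INR (S n) + 1))).
      rewrite IH. ring. }
    replace (Rsum _ n) with (1 - / (INR n + 1)) by (symmetry; exact H).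
    assert (0 < / (INR n + 1)) by (apply Rinv_0_lt_compat; pose proof (pos_INR n); lra). lra.
Qed.

Lemma exp_opp_le (x : R) : 0 < x -> exp (- x) <= / x.
Proof.
  intros H. rewrite exp_Ropp. apply Rinv_le_contravar; [exact H|].
  pose proof (exp_ineq1_le x). lra.
Qed.

Lemma wterm_le (z : C) : 0 < Re z -> forall m,
  Cmod (wterm z m) <= 4 / Re (/ z)%C * / freq m ^ 2.
Proof.
  intros Hz m. rewrite Cmod_wterm by exact Hz.
  pose proof (Re_inv_pos z Hz) as Hr. pose proof (freq_pos m) as Hf.
  assert (0 < freq m ^ 2) by (apply pow_lt; lra).
  eapply Rle_trans; [apply exp_opp_le|].
  - apply Rmult_lt_0_compat; [lra|exact Hr].
  - right. field. lra.
Qed.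

Lemma wsum_cv (z : C) : 0 < Re z -> Ccv (Csum (wterm z)) (wsum z).
Proof.
  intros Hz. destruct (Cseries_abs (wterm z) (4 / Re (/ z)%C * 2)) as [l Hl].
  - intros n. eapply Rle_trans; [apply Rsum_le; intros i _; apply wterm_le, Hz|].
    rewrite Rsum_scal. apply Rmult_le_compat_l; [|apply Rsum_inv_freq].
    apply Rmult_le_pos; [lra|]. left. apply Rinv_0_lt_compat, Re_inv_pos, Hz.
  - unfold wsum. rewrite (Clim_eq _ _ Hl). exact Hl.
Qed.

Lemma gsum_bounded (z : C) : 0 < Re z -> exists K, 0 < K /\ forall N, (0 < N)%nat ->
  Cmod (gsum N (gauss z 0)) <= K.
Proof.
  intros Hz. destruct (gauss_remainders z 0 Hz ltac:(lra)) as [K [HK H]].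
  exists (4 * K). split; [lra|]. intros N HN. unfold gsum.
  assert (HN' : 0 < INR N) by (apply lt_0_INR; lia).
  rewrite Cmod_mult, Cmod_RtoC_pos by (left; apply Rinv_0_lt_compat; lra).
  apply Rmult_le_reg_l with (INR N); [exact HN'|]. rewrite <- Rmult_assoc, Rinv_r, Rmult_1_l by lra.
  replace (INR N * (4 * K)) with (4 * K * INR N) by ring.
  apply grid_sum_le; [exact HN|lra|]. intros j _.
  destruct (H 0%C (grid N j) 0) as [H1 _]; [rewrite Cmod_0; lra|lra|].
  pose proof (Cmod_ge_0 (gauss z 0 (grid N j))). pose proof (Rabs_pos (grid N j)). nra.
Qed.

(** Completing the square: a phase is an imaginary shift of the Gaussian, which [gsum_shift] then
    removes. *)
Lemma gauss_phase (z : C) (xi u : R) : 0 < Re z ->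
  (gauss z 0 u * phase xi u)%C =
  (cexp (- (RtoC (xi ^ 2) / (4 * z))) * gauss z (- (Ci * RtoC xi / (2 * z))) u)%C.
Proof.
  intros Hz. pose proof (Re_neq0 z Hz) as Hn. unfold gauss, phase. rewrite <- !cexp_plus. f_equal.
  rewrite RtoC_mult. replace (RtoC (xi ^ 2)) with (- (Ci * Ci) * (RtoC xi * RtoC xi))%C.
  - field. exact Hn.
  - replace (xi ^ 2) with (xi * xi) by ring. rewrite RtoC_mult. replace (Ci * Ci)%C with (RtoC (-1)).
    + rewrite <- RtoC_opp. replace (- -1) with 1 by ring. ring.
    + unfold Ci, Cmult, RtoC. simpl. f_equal; ring.
Qed.

Lemma gsum_phase_cv (z : C) (xi : R) : 0 < Re z -> exists K, forall N, (0 < N)%nat ->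
  Cmod (gsum N (fun u => gauss z 0 u * phase xi u) -
        cexp (- (RtoC (xi ^ 2) / (4 * z))) * gsum N (gauss z 0))%C <= K / INR N.
Proof.
  intros Hz. destruct (gsum_shift z (- (Ci * RtoC xi / (2 * z))) Hz) as [K H].
  exists (Cmod (cexp (- (RtoC (xi ^ 2) / (4 * z)))) * K). intros N HN.
  replace (gsum N (fun u => gauss z 0 u * phase xi u)%C) with
    (cexp (- (RtoC (xi ^ 2) / (4 * z))) * gsum N (gauss z (- (Ci * RtoC xi / (2 * z)))))%C.
  - match goal with |- Cmod (?w * ?a - ?w * ?b)%C <= _ => replace (w * a - w * b)%C with (w * (a - b))%C by ring end.
    rewrite Cmod_mult. unfold Rdiv. rewrite Rmult_assoc. apply Rmult_le_compat_l; [apply Cmod_ge_0|apply H, HN].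
  - unfold gsum.
    rewrite (Csum_ext (fun j => gauss z 0 (grid N j) * phase xi (grid N j))%C
      (fun j => cexp (- (RtoC (xi ^ 2) / (4 * z))) * gauss z (- (Ci * RtoC xi / (2 * z))) (grid N j))%C).
    + rewrite Csum_scal. ring.
    + intros j _. apply gauss_phase, Hz.
Qed.

Lemma is_lim_seq_div_INR (K : R) : is_lim_seq (fun H => K / INR (2 * S H)) 0.
Proof.
  apply (is_lim_seq_ext (fun H => K / 2 * / INR (S H))).
  { intros n. rewrite mult_INR. simpl (INR 2). pose proof (not_0_INR (S n) ltac:(lia)). field. lra. }
  apply is_lim_seq_scal0. apply (is_lim_seq_incr_1 (fun n => / INR n)).
  replace (Finite 0) with (Rbar_inv p_infty) by reflexivity.
  apply is_lim_seq_inv; [apply is_lim_seq_INR|discriminate].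
Qed.

(** Each pair of opposite frequencies in [gsum_dft] tends to [2 wterm z m] times the Gaussian sum by
    [gsum_phase_cv], and [gsum_decay] gives a summable majorant independent of the grid; hence
    Tannery's theorem. *)
Lemma theta_gauss (z : C) : 0 < Re z ->
  Ccv (fun n => theta_sum (cexp (- z)) (2 * S n) - 2 * gsum (2 * S n) (gauss z 0) * wsum z)%C 0.
Proof.
  intros Hz.
  destruct (gsum_decay z Hz) as [K1 [HK1 H1]]. destruct (gsum_bounded z Hz) as [K2 [HK2 H2]].
  set (s := fun n => gsum (2 * n) (gauss z 0)).
  set (S1 := fun n m => gsum (2 * n) (fun u => gauss z 0 u * phase (freq m) u)%C).
  set (S2 := fun n m => gsum (2 * n) (fun u => gauss z 0 u * phase (- freq m) u)%C).
  set (a := fun n m => Cmod (S1 n m + S2 n m - 2 * wterm z m * s n)%C).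
  pose proof (Re_inv_pos z Hz) as Hr.
  set (B := 2 * K1 + 2 * (4 / Re (/ z)%C) * K2).
  assert (HB0 : 0 <= 4 / Re (/ z)%C).
  { apply Rmult_le_pos; [lra|]. left. apply Rinv_0_lt_compat, Hr. }
  assert (HB : 0 <= B) by (unfold B; nra).
  assert (HT : is_lim_seq (fun n => Rsum (a n) n) 0).
  { apply (Tannery a (fun m => B * / freq m ^ 2) (B * 2)).
    - intros m. destruct (gsum_phase_cv z (freq m) Hz) as [L1 G1].
      destruct (gsum_phase_cv z (- freq m) Hz) as [L2 G2].
      apply is_lim_seq_incr_1. apply (squeeze0 _ (fun n => (L1 + L2) / INR (2 * S n)));
        [|apply is_lim_seq_div_INR].
      intros n. split; [apply Cmod_ge_0|].
      specialize (G1 (2 * S n)%nat ltac:(lia)). specialize (G2 (2 * S n)%nat ltac:(lia)).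
      replace ((- freq m) ^ 2) with (freq m ^ 2) in G2 by ring.
      fold (wterm z m) in G1, G2. fold (s (S n)) in G1, G2. fold (S1 (S n) m) in G1. fold (S2 (S n) m) in G2.
      unfold a. replace (S1 (S n) m + S2 (S n) m - 2 * wterm z m * s (S n))%C with
        ((S1 (S n) m - wterm z m * s (S n)) + (S2 (S n) m - wterm z m * s (S n)))%C by ring.
      eapply Rle_trans; [apply Cmod_triangle|]. unfold Rdiv in *. lra.
    - intros n m Hm. split; [apply Cmod_ge_0|].
      (* [m < n] keeps [freq m] below the sampling limit [pi N] for [N = 2 n]. *)
      assert (Hf : 0 < Rabs (freq m) <= PI * INR (2 * n)).
      { pose proof (freq_pos m). rewrite Rabs_pos_eq by lra. split; [lra|].
        unfold freq. apply Rmult_le_compat_l; [pose proof PI_RGT_0; lra|].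
        rewrite mult_INR. simpl (INR 2). assert (INR (S m) <= INR n) by (apply le_INR; lia).
        rewrite S_INR in *. lra. }
      assert (Hf2 : 0 < Rabs (- freq m) <= PI * INR (2 * n)) by (rewrite Rabs_Ropp; exact Hf).
      pose proof (H1 (2 * n)%nat (freq m) ltac:(lia) Hf) as G1.
      pose proof (H1 (2 * n)%nat (- freq m) ltac:(lia) Hf2) as G2.
      replace ((- freq m) ^ 2) with (freq m ^ 2) in G2 by ring.
      fold (S1 n m) in G1. fold (S2 n m) in G2.
      pose proof (H2 (2 * n)%nat ltac:(lia)) as G3. fold (s n) in G3.
      pose proof (wterm_le z Hz m) as G4. pose proof (Cmod_ge_0 (wterm z m)). pose proof (Cmod_ge_0 (s n)).
      unfold a. eapply Rle_trans; [apply Cmod_minus_le|].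
      pose proof (Cmod_triangle (S1 n m) (S2 n m)). rewrite !Cmod_mult, (Cmod_RtoC_pos 2) by lra.
      assert (Cmod (wterm z m) * Cmod (s n) <= 4 / Re (/ z)%C * / freq m ^ 2 * K2) by (apply Rmult_le_compat; auto).
      unfold B. unfold Rdiv in *. lra.
    - intros m. apply Rmult_le_pos; [exact HB|]. left. apply Rinv_0_lt_compat, pow_lt, freq_pos.
    - intros n. rewrite Rsum_scal. apply Rmult_le_compat_l; [exact HB|apply Rsum_inv_freq]. }
  apply (is_lim_seq_incr_1 (fun n => Rsum (a n) n)) in HT.
  pose proof (wsum_cv z Hz) as HW. apply (is_lim_seq_incr_1 (fun n => Cmod (Csum (wterm z) n - wsum z)%C)) in HW.
  apply Ccv_squeeze with (fun n => Rsum (a (S n)) (S n) + 2 * K2 * Cmod (Csum (wterm z) (S n) - wsum z)%C).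
  - intros n. rewrite <- gsum_dft by lia. fold (s (S n)).
    set (A := Csum _ (S n)).
    replace (A - 2 * s (S n) * wsum z - 0)%C with
      ((A - 2 * s (S n) * Csum (wterm z) (S n)) + 2 * s (S n) * (Csum (wterm z) (S n) - wsum z))%C by ring.
    eapply Rle_trans; [apply Cmod_triangle|]. apply Rplus_le_compat.
    + unfold A. rewrite <- Csum_scal, <- Csum_minus. eapply Rle_trans; [apply Csum_Cmod|].
      right. apply Rsum_ext. intros m _. unfold a, S1, S2. f_equal. ring.
    + rewrite !Cmod_mult, (Cmod_RtoC_pos 2) by lra. apply Rmult_le_compat_r; [apply Cmod_ge_0|].
      apply Rmult_le_compat_l; [lra|]. apply H2. lia.
  - replace 0 with (0 + 2 * K2 * 0) by ring. apply is_lim_seq_plus'; [exact HT|].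
    apply (is_lim_seq_scal_l _ (2 * K2) 0 HW).
Qed.

Lemma gauss_dilate (z : C) (kap u : R) : gauss z 0 (kap * u) = gauss (RtoC (kap ^ 2) * z) 0 u.
Proof.
  unfold gauss. f_equal. replace (kap ^ 2) with (kap * kap) by ring. rewrite !RtoC_mult. ring.
Qed.

Lemma Cmod_cexp_opp_lt1 (z : C) : 0 < Re z -> Cmod (cexp (- z)) < 1.
Proof.
  intros H. rewrite Cmod_cexp, <- exp_0. apply exp_increasing.
  replace (Re (- z)%C) with (- Re z) by reflexivity. lra.
Qed.

Lemma Re_scale (x : R) (z : C) : Re (RtoC x * z)%C = x * Re z.
Proof. unfold Re, RtoC, Cmult. simpl. ring. Qed.

(* The unknown Gaussian integrals at [z] and [k z] differ by the factor [sqrt k] and drop out. *)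
Theorem theta_transform (kap : R) (z : C) : 0 < Re z -> 1 <= kap ->
  (RtoC kap * theta (cexp (- (RtoC (kap ^ 2) * z))) * wsum z =
   theta (cexp (- z)) * wsum (RtoC (kap ^ 2) * z))%C.
Proof.
  intros Hz Hk. set (y := (RtoC (kap ^ 2) * z)%C).
  assert (Hy : 0 < Re y) by (unfold y; rewrite Re_scale; apply Rmult_lt_0_compat; [apply pow_lt; lra|exact Hz]).
  pose proof (theta_gauss z Hz) as Tz. pose proof (theta_gauss y Hy) as Ty.
  pose proof (Ccv_subseq _ _ (fun n => 2 * S n)%nat ltac:(intros; simpl; lia) (theta_cv _ (Cmod_cexp_opp_lt1 z Hz))) as Uz.
  pose proof (Ccv_subseq _ _ (fun n => 2 * S n)%nat ltac:(intros; simpl; lia) (theta_cv _ (Cmod_cexp_opp_lt1 y Hy))) as Uy.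
  pose proof (Ccv_minus _ _ _ _ Uz Tz) as Vz. pose proof (Ccv_minus _ _ _ _ Uy Ty) as Vy.
  destruct (gsum_scale z kap Hz Hk) as [K HK].
  assert (HS : Ccv (fun n => RtoC kap * gsum (2 * S n) (gauss y 0) - gsum (2 * S n) (gauss z 0))%C 0%C).
  { pose proof (is_lim_seq_div_INR K) as HL.
    destruct (nfloor_ex kap ltac:(lra)) as [N0 HN0].
    apply (squeeze0_ev _ (fun n => K / INR (2 * S n)) N0); [|exact HL].
    intros n Hn. split; [apply Cmod_ge_0|].
    assert (HN : kap <= INR (2 * S n)).
    { assert (INR N0 <= INR n) by (apply le_INR; lia). rewrite mult_INR, (S_INR n). simpl (INR 2).
      pose proof (pos_INR n). lra. }
    specialize (HK _ HN). unfold Cminus at 1. rewrite Copp_0, Cplus_0_r.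
    eapply Rle_trans; [|exact HK]. right. f_equal. f_equal. f_equal. unfold gsum. f_equal.
    apply Csum_ext. intros j _. symmetry. apply gauss_dilate. }
  apply (Ccv_scal (2 * wsum z * wsum y)) in HS.
  apply (Ccv_scal (RtoC kap * wsum z)) in Vy. apply (Ccv_scal (wsum y)) in Vz.
  pose proof (Ccv_minus _ _ _ _ (Ccv_minus _ _ _ _ Vy Vz) HS) as HF.
  assert (E : (RtoC kap * wsum z * (theta (cexp (- y)) - 0) - wsum y * (theta (cexp (- z)) - 0)
     - 2 * wsum z * wsum y * 0)%C = 0%C).
  { apply (Ccv_unique _ _ _ HF). eapply Ccv_ext; [|apply (Ccv_const 0)].
    intros n. cbv beta. ring. }
  transitivity (RtoC kap * wsum z * (theta (cexp (- y)) - 0) - wsum y * (theta (cexp (- z)) - 0)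
     - 2 * wsum z * wsum y * 0 + theta (cexp (- z)) * wsum y)%C; [ring|]. rewrite E. ring.
Qed.

(** * Polylogarithms *)

Definition conv (a b : nat -> C) (i : nat) : C := Csum (fun l => a l * b (i - l)%nat)%C (S i).

Definition delta0 (i : nat) : C := match i with O => RtoC 1 | S _ => RtoC 0 end.

(* Multiplication of a formal power series in [w] by [z - w]. *)
Definition lin_mul (z : C) (a : nat -> C) (i : nat) : C :=
  (z * a i - match i with O => RtoC 0 | S j => a j end)%C.

Lemma conv_lin_mul_l (z : C) (a b : nat -> C) (i : nat) :
  conv (lin_mul z a) b i = lin_mul z (conv a b) i.
Proof.
  unfold conv, lin_mul.
  rewrite (Csum_ext _ (fun l => z * (a l * b (i - l)%nat) -
    match l with O => RtoC 0 | S j => a j end * b (i - l)%nat)%C) by (intros; ring).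
  rewrite Csum_minus, Csum_scal. f_equal. rewrite Csum_S0. destruct i as [|i].
  - simpl. ring.
  - rewrite Cmult_0_l, Cplus_0_l. apply Csum_ext. intros l _. reflexivity.
Qed.

Lemma conv_lin_mul_r (z : C) (a b : nat -> C) (i : nat) :
  conv a (lin_mul z b) i = lin_mul z (conv a b) i.
Proof.
  unfold conv, lin_mul.
  rewrite (Csum_ext _ (fun l => z * (a l * b (i - l)%nat) -
    a l * match (i - l)%nat with O => RtoC 0 | S j => b j end)%C) by (intros; ring).
  rewrite Csum_minus, Csum_scal. f_equal. rewrite Csum_S, Nat.sub_diag. destruct i as [|i].
  - simpl. ring.
  - rewrite Cmult_0_r, Cplus_0_r. apply Csum_ext. intros l Hl.
    replace (S i - l)%nat with (S (i - l)) by lia. reflexivity.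
Qed.

(** As a formal power series in [w], [z - w] is invertible because its constant term is nonzero. *)
Lemma lin_mul_inj (z : C) (a b : nat -> C) : z <> 0%C ->
  (forall i, lin_mul z a i = lin_mul z b i) -> forall i, a i = b i.
Proof.
  intros Hz H. induction i as [|i IH].
  - specialize (H O). unfold lin_mul in H.
    replace (a O) with ((z * a O - 0) / z)%C by (field; exact Hz). rewrite H. field. exact Hz.
  - specialize (H (S i)). unfold lin_mul in H. rewrite IH in H.
    replace (a (S i)) with ((z * a (S i) - b i + b i) / z)%C by (field; exact Hz).
    rewrite H. field. exact Hz.
Qed.

Section Lipschitz.

Variable z : C.
Hypothesis Hz : 0 < Re z.

Let q : C := cexp (- z).

Lemma z_neq0 : z <> 0%C.
Proof. intros E. rewrite E in Hz. simpl in Hz. lra. Qed.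

Lemma Cmod_q : Cmod q = exp (- Re z).
Proof. unfold q. rewrite Cmod_cexp. reflexivity. Qed.

(** Summed over [n] this is the polylogarithm of order [-i] at [e^(-z)], divided by [i!]. Since
    [0^0 = 1], the series for [i = 0] starts with 1. *)
Definition pterm (i n : nat) : C := (RtoC (INR n ^ i / INR (fact i)) * cexp (- z) ^ n)%C.

Lemma pow_fact_le_exp (x : R) (i : nat) : 0 <= x -> x ^ i / INR (fact i) <= exp x.
Proof.
  intros Hx. eapply Rle_trans; [|apply (Rsum_exp_le x (S i) Hx)].
  simpl. assert (0 <= Rsum (fun j => x ^ j / INR (fact j)) i); [|lra].
  apply Rsum_ge0. intros j _. apply Rmult_le_pos; [apply pow_le, Hx|].
  left. apply Rinv_0_lt_compat, INR_fact_lt_0.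
Qed.

Lemma pterm_bound (i : nat) :
  absbd (pterm i) ((2 / Re z) ^ i * / (1 - exp (- (Re z / 2)))).
Proof.
  assert (He : 0 < exp (- (Re z / 2)) < 1).
  { split; [apply exp_pos|]. rewrite <- exp_0. apply exp_increasing. lra. }
  intros N. apply Rle_trans with (Rsum (fun n => (2 / Re z) ^ i * exp (- (Re z / 2)) ^ n) N).
  - apply Rsum_le. intros n _. unfold pterm. rewrite Cmod_mult, Cmod_pow, Cmod_cexp.
    replace (Re (- z)%C) with (- Re z) by reflexivity.
    pose proof (pos_INR n) as Hn.
    rewrite Cmod_RtoC_pos.
    2:{ apply Rmult_le_pos; [apply pow_le, Hn|]. left. apply Rinv_0_lt_compat, INR_fact_lt_0. }
    (* Half of the decay [e^(- n Re z)] absorbs [n^i / i!]; the other half is left for a geometric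
       series. *)
    pose proof (pow_fact_le_exp (INR n * (Re z / 2)) i ltac:(apply Rmult_le_pos; lra)) as H1.
    assert (Hep : forall y, exp y ^ n = exp (INR n * y)).
    { intros y. clear. induction n as [|n IH]; [simpl; rewrite Rmult_0_l, exp_0; reflexivity|].
      rewrite S_INR. simpl pow. rewrite IH, <- exp_plus. f_equal. ring. }
    rewrite !Hep.
    replace (INR n * - Re z) with (INR n * - (Re z / 2) + INR n * - (Re z / 2)) by field.
    rewrite exp_plus, <- Rmult_assoc. apply Rmult_le_compat_r; [left; apply exp_pos|].
    replace (INR n * - (Re z / 2)) with (- (INR n * (Re z / 2))) by ring.
    rewrite exp_Ropp.
    pose proof (exp_pos (INR n * (Re z / 2))) as Hp.
    apply Rmult_le_reg_r with (exp (INR n * (Re z / 2))); [exact Hp|].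
    rewrite Rmult_assoc, Rinv_l, Rmult_1_r by lra.
    replace (INR n ^ i / INR (fact i)) with
      ((2 / Re z) ^ i * ((INR n * (Re z / 2)) ^ i / INR (fact i))).
    + apply Rmult_le_compat_l; [|exact H1]. apply pow_le, Rmult_le_pos; [lra|].
      left. apply Rinv_0_lt_compat, Hz.
    + unfold Rdiv at 2. rewrite <- Rmult_assoc, <- Rpow_mult_distr.
      replace (2 / Re z * (INR n * (Re z / 2))) with (INR n) by (field; lra). reflexivity.
  - rewrite Rsum_scal. apply Rmult_le_compat_l.
    + apply pow_le, Rmult_le_pos; [lra|]. left. apply Rinv_0_lt_compat, Hz.
    + apply Rsum_geom_le. lra.
Qed.

Definition polylog (i : nat) : C := Clim (Csum (pterm i)).

Lemma polylog_cv (i : nat) : Ccv (Csum (pterm i)) (polylog i).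
Proof.
  destruct (Cseries_abs _ _ (pterm_bound i)) as [l Hl].
  unfold polylog. rewrite (Clim_eq _ _ Hl). exact Hl.
Qed.

Lemma sum_f_R0_Rsum (f : nat -> R) (n : nat) : sum_f_R0 f n = Rsum f (S n).
Proof. induction n as [|n IH]; [simpl; ring|]. simpl sum_f_R0. rewrite IH. reflexivity. Qed.

Lemma binomial_fact (x : R) (i : nat) :
  (x + 1) ^ i / INR (fact i) =
  Rsum (fun l => / INR (fact l) * (x ^ (i - l) / INR (fact (i - l)))) (S i).
Proof.
  rewrite Rplus_comm, (binomial 1 x i), sum_f_R0_Rsum. unfold Rdiv.
  rewrite Rmult_comm, <- Rsum_scal. apply Rsum_ext. intros l Hl.
  unfold Binomial.C. rewrite pow1. field.
  repeat split; apply INR_fact_neq_0.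
Qed.

Lemma pterm_S (i n : nat) :
  pterm i (S n) = (q * Csum (fun l => RtoC (/ INR (fact l)) * pterm (i - l) n) (S i))%C.
Proof.
  unfold pterm. rewrite S_INR, binomial_fact, <- Csum_RtoC. fold q.
  change (q ^ S n)%C with (q * q ^ n)%C.
  transitivity (q * (q ^ n * Csum (fun l => RtoC (/ INR (fact l) * (INR n ^ (i - l) / INR (fact (i - l))))) (S i)))%C;
    [ring|].
  f_equal. rewrite <- Csum_scal. apply Csum_ext. intros l _. rewrite (RtoC_mult (/ INR (fact l))). ring.
Qed.

(** The coefficient of [w^i] in [F = 1 + exp (w - z) F], where [F] is the sum over [n] of
    [exp (n (w - z))]. *)
Lemma polylog_rec (i : nat) :
  polylog i = (delta0 i + q * Csum (fun l => RtoC (/ INR (fact l)) * polylog (i - l)) (S i))%C.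
Proof.
  apply (Ccv_unique (fun N => Csum (pterm i) (S N))).
  - apply (Ccv_subseq (Csum (pterm i)) _ S); [intros; lia|apply polylog_cv].
  - apply Ccv_ext with (fun N => delta0 i +
      q * Csum (fun l => RtoC (/ INR (fact l)) * Csum (pterm (i - l)) N) (S i))%C.
    { intros N. rewrite (Csum_S0 (pterm i) N). f_equal.
      - unfold pterm. destruct i as [|i]; simpl.
        + unfold Rdiv. rewrite Rinv_1, Rmult_1_l. ring.
        + unfold Rdiv. rewrite !Rmult_0_l. ring.
      - rewrite (Csum_ext (fun n => pterm i (S n)) _ N (fun n _ => pterm_S i n)).
        rewrite Csum_scal, Csum_swap. f_equal. apply Csum_ext. intros l _. rewrite Csum_scal. reflexivity. }
    apply Ccv_plus; [apply Ccv_const|]. apply Ccv_scal.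
    generalize (S i) as m. induction m as [|m IH]; [exact (Ccv_const 0)|].
    apply (Ccv_plus (fun N => Csum (fun l => RtoC (/ INR (fact l)) * Csum (pterm (i - l)) N)%C m)
      (fun N => RtoC (/ INR (fact m)) * Csum (pterm (i - m)) N)%C); [exact IH|].
    apply Ccv_scal, polylog_cv.
Qed.

Lemma Cmod_inv_fact (l : nat) : Cmod (RtoC (/ INR (fact l))) = / INR (fact l).
Proof. apply Cmod_RtoC_pos. left. apply Rinv_0_lt_compat, INR_fact_lt_0. Qed.

Lemma q_lt1 : Cmod q < 1.
Proof. rewrite Cmod_q, <- exp_0. apply exp_increasing. lra. Qed.

(** The generating series [1 / (1 - q e^w)] has no pole in [|w| < lam], because there
    [|q (e^w - 1)| < |1 - q|]. The corresponding coefficient bound follows from the recurrence by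
    strong induction. *)
Lemma polylog_bound (lam : R) : 0 < lam -> exp lam - 1 <= Cmod (1 - q)%C ->
  forall i, Cmod (polylog i) <= (/ lam) ^ S i.
Proof.
  intros Hl HL.
  pose proof (one_minus_neq0 q q_lt1) as Hn. pose proof (proj1 (Cmod_gt_0 _) Hn) as Hm.
  assert (Hlam : lam <= Cmod (1 - q)%C) by (pose proof (exp_ineq1_le lam); lra).
  assert (Hil : 0 < / lam) by (apply Rinv_0_lt_compat, Hl).
  intros i. induction i as [i IH] using (well_founded_induction lt_wf).
  destruct i as [|i].
  - pose proof (polylog_rec O) as E. simpl in E. rewrite Rinv_1 in E.
    assert (E2 : polylog 0 = (/ (1 - q))%C).
    { replace (polylog 0) with ((polylog 0 - q * polylog 0) / (1 - q))%C by (field; exact Hn).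
      rewrite E at 1. field. exact Hn. }
    rewrite E2, Cmod_inv by exact Hn. simpl. rewrite Rmult_1_r. apply Rinv_le_contravar; assumption.
  - pose proof (polylog_rec (S i)) as E. rewrite Csum_S0 in E.
    set (X := Csum (fun l => RtoC (/ INR (fact (S l))) * polylog (S i - S l))%C (S i)) in *.
    change (delta0 (S i)) with (RtoC 0) in E. change (S i - 0)%nat with (S i) in E.
    change (INR (fact 0)) with 1 in E. rewrite Rinv_1 in E.
    assert (E2 : ((1 - q) * polylog (S i) = q * X)%C).
    { replace ((1 - q) * polylog (S i))%C with (polylog (S i) - q * polylog (S i))%C by ring.
      rewrite E at 1. ring. }
    apply Rmult_le_reg_l with (Cmod (1 - q)%C); [exact Hm|].
    rewrite <- Cmod_mult, E2, Cmod_mult.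
    assert (HX : Cmod X <= (/ lam) ^ S (S i) * (exp lam - 1)).
    { apply Rle_trans with ((/ lam) ^ S (S i) * Rsum (fun l => lam ^ S l / INR (fact (S l))) (S i)).
      - rewrite <- Rsum_scal. eapply Rle_trans; [apply Csum_Cmod|]. apply Rsum_le. intros l Hl2.
        rewrite Cmod_mult, Cmod_inv_fact.
        assert (HP : (/ lam) ^ S (S i) * lam ^ S l = (/ lam) ^ S (S i - S l)).
        { replace (S (S i)) with (S (S i - S l) + S l)%nat at 1 by lia.
          rewrite pow_add, Rmult_assoc, <- Rpow_mult_distr, Rinv_l, pow1 by lra. ring. }
        unfold Rdiv. rewrite <- Rmult_assoc, HP, Rmult_comm.
        apply Rmult_le_compat_r; [left; apply Rinv_0_lt_compat, INR_fact_lt_0|]. apply IH. lia.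
      - apply Rmult_le_compat_l; [apply pow_le; lra|].
        pose proof (Rsum_exp_le lam (S (S i)) ltac:(lra)) as H. rewrite Rsum_S0 in H.
        simpl (lam ^ 0 / INR (fact 0)) in H. lra. }
    pose proof q_lt1 as Hq. pose proof (Cmod_ge_0 q). pose proof (Cmod_ge_0 X).
    assert (0 <= (/ lam) ^ S (S i)) by (apply pow_le; lra).
    apply Rle_trans with (1 * Cmod X); [apply Rmult_le_compat_r; lra|].
    rewrite Rmult_1_l. eapply Rle_trans; [exact HX|].
    rewrite Rmult_comm. apply Rmult_le_compat_r; assumption.
Qed.

(** * Distance of the polylogarithms from the powers of [1/z] *)

Definition vterm (al : nat -> R) (i : nat) : C := (RtoC (al i) * ((- z) ^ i / RtoC (INR (fact i))))%C.
Definition vsum (al : nat -> R) : C := Clim (Csum (vterm al)).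

Lemma vterm_bound (al : nat -> R) (M : R) : (forall i, 0 <= al i <= M) ->
  absbd (vterm al) (M * exp (Cmod z)).
Proof.
  intros H. assert (HM : 0 <= M) by (pose proof (H O); lra).
  pose proof (Cmod_ge_0 z) as Hz0. intros N.
  apply Rle_trans with (Rsum (fun i => M * (Cmod z ^ i / INR (fact i))) N).
  - apply Rsum_le. intros i _. unfold vterm.
    rewrite Cmod_mult, Cmod_div, Cmod_pow, Cmod_opp by apply RtoC_fact_neq0.
    rewrite (Cmod_RtoC_pos (INR _)), Cmod_RtoC_pos by (try apply H; apply pos_INR).
    apply Rmult_le_compat_r; [|apply H]. apply Rmult_le_pos; [apply pow_le, Hz0|].
    left. apply Rinv_0_lt_compat, INR_fact_lt_0.
  - rewrite Rsum_scal. apply Rmult_le_compat_l; [exact HM|apply Rsum_exp_le, Hz0].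
Qed.

Lemma vsum_cv (al : nat -> R) (M : R) : (forall i, 0 <= al i <= M) ->
  Ccv (Csum (vterm al)) (vsum al).
Proof.
  intros H. destruct (Cseries_abs _ _ (vterm_bound al M H)) as [l Hl].
  unfold vsum. rewrite (Clim_eq _ _ Hl). exact Hl.
Qed.

Lemma vsum_le (al : nat -> R) (M : R) : (forall i, 0 <= al i <= M) ->
  Cmod (vsum al) <= M * exp (Cmod z).
Proof. intros H. apply (Cseries_mod_le _ _ _ (vterm_bound al M H) (vsum_cv al M H)). Qed.

(** Multiplication by [z] shifts the series: [- z (- z)^i / i! = (i + 1) (- z)^(i + 1) / (i +
    1)!]. *)
Lemma vsum_mul_z (al be : nat -> R) (M : R) : (forall i, 0 <= al i <= M) -> (forall i, 0 <= be i <= M) ->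
  be O = 0 -> (forall i, be (S i) = INR (S i) * al i) ->
  (z * vsum al = - vsum be)%C.
Proof.
  intros Ha Hb H0 HS.
  apply (Ccv_unique (fun N => z * Csum (vterm al) N)%C); [apply Ccv_scal, (vsum_cv al M Ha)|].
  apply Ccv_ext with (fun N => -1 * Csum (vterm be) (S N))%C.
  - intros N. rewrite Csum_S0, Cmult_plus_distr_l, <- !Csum_scal.
    replace (vterm be 0) with (RtoC 0) by (unfold vterm; rewrite H0; ring).
    rewrite Cmult_0_r, Cplus_0_l. apply Csum_ext. intros i _. unfold vterm.
    rewrite HS, fact_simpl, mult_INR, !RtoC_mult. change ((- z) ^ S i)%C with (- z * (- z) ^ i)%C.
    field. split; [apply RtoC_fact_neq0|]. intros E. apply RtoC_inj in E. apply (not_0_INR (S i)); auto.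
  - replace (- vsum be)%C with (-1 * vsum be)%C by ring. apply Ccv_scal.
    apply (Ccv_subseq (Csum (vterm be)) _ S); [intros; lia|apply (vsum_cv be M Hb)].
Qed.

Lemma vsum_lin (al be ga : nat -> R) (M c : R) :
  (forall i, 0 <= al i <= M) -> (forall i, 0 <= be i <= M) -> (forall i, 0 <= ga i <= M) ->
  (forall i, ga i = al i + c * be i) -> (vsum ga = vsum al + RtoC c * vsum be)%C.
Proof.
  intros Ha Hb Hg H. apply (Ccv_unique (Csum (vterm ga))); [apply (vsum_cv ga M Hg)|].
  apply Ccv_ext with (fun N => Csum (vterm al) N + RtoC c * Csum (vterm be) N)%C.
  - intros N. rewrite <- Csum_scal, <- Csum_plus. apply Csum_ext. intros i _.
    unfold vterm. rewrite H, RtoC_plus, RtoC_mult. ring.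
  - apply Ccv_plus; [apply (vsum_cv al M Ha)|]. apply Ccv_scal, (vsum_cv be M Hb).
Qed.

Lemma vsum_1 : vsum (fun _ => 1) = q.
Proof.
  unfold vsum. apply Clim_eq. unfold q.
  eapply Ccv_ext; [|apply (cexp_series (- z))]. intros N. apply Csum_ext. intros i _.
  unfold vterm. ring.
Qed.

(** The coefficient of [w^l] in [(1 - exp (w - z)) / (z - w)], that is, the integral of
    [t^l exp (- t z) / l!] over [[0, 1]], with the exponential expanded to avoid integrals. In
    [eta_c] the weight [1 - t] is added; its series is [1] minus that of [eps_c], divided by
    [z - w]. *)
Definition eps_c (l : nat) : C := (RtoC (/ INR (fact l)) * vsum (fun i => (/ INR (i + l + 1))%R))%C.
Definition eta_c (l : nat) : C :=
  (RtoC (/ INR (fact l)) * vsum (fun i => (/ (INR (i + l + 1) * INR (i + l + 2)))%R))%C.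

Lemma inv_INR_S (n : nat) : 0 <= / INR (n + 1) <= 1.
Proof.
  assert (1 <= INR (n + 1)) by (apply (le_INR 1); lia). split.
  - left. apply Rinv_0_lt_compat. lra.
  - rewrite <- Rinv_1. apply Rinv_le_contravar; lra.
Qed.

Lemma INR_S_pos (n : nat) : 0 < INR (n + 1).
Proof. apply lt_0_INR. lia. Qed.

Lemma inv_prod_le (n : nat) : 0 <= / (INR (n + 1) * INR (n + 2)) <= / INR (n + 1).
Proof.
  pose proof (INR_S_pos n). assert (1 <= INR (n + 2)) by (apply (le_INR 1); lia). split.
  - left. apply Rinv_0_lt_compat. nra.
  - apply Rinv_le_contravar; nra.
Qed.

Lemma ratio_le_1 (i m : nat) : 0 <= INR i * / INR (i + m) <= 1.
Proof.
  destruct i as [|i]; [simpl; rewrite Rmult_0_l; lra|].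
  assert (0 < INR (S i)) by (apply lt_0_INR; lia).
  assert (INR (S i) <= INR (S i + m)) by (apply le_INR; lia). split.
  - apply Rmult_le_pos; [lra|]. left. apply Rinv_0_lt_compat. lra.
  - apply Rmult_le_reg_r with (INR (S i + m)); [lra|]. rewrite Rmult_assoc, Rinv_l by lra. lra.
Qed.

Lemma lin_mul_eps (l : nat) : lin_mul z eps_c l = (delta0 l - q * RtoC (/ INR (fact l)))%C.
Proof.
  unfold lin_mul, eps_c.
  assert (HM : (z * vsum (fun i => (/ INR (i + l + 1))%R) = - vsum (fun i => (INR i * / INR (i + l))%R))%C).
  { apply vsum_mul_z with 1.
    - intros i. apply inv_INR_S.
    - intros i. apply ratio_le_1.
    - simpl. ring.
    - intros i. replace (S i + l)%nat with (i + l + 1)%nat by lia. reflexivity. }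
  destruct l as [|l].
  - assert (E : vsum (fun i => (INR i * / INR (i + 0))%R) = (q - 1)%C).
    (* The coefficient [i * / i] is 1 except at [i = 0], where it is 0; the constant term makes up
       for it. *)
    { assert (EV : (vsum (fun _ => 1%R) = vsum (fun i => (INR i * / INR (i + 0))%R) +
         RtoC 1 * vsum (fun i => match i with O => 1%R | _ => 0%R end))%C).
      { apply vsum_lin with 1; try (intros; lra).
        - intros i. apply ratio_le_1.
        - intros [|i]; lra.
        - intros [|i]; [simpl; ring|]. rewrite Nat.add_0_r, Rinv_r by (apply not_0_INR; lia). ring. }
      assert (ED : vsum (fun i => match i with O => 1%R | _ => 0%R end) = 1%C).
      { apply Clim_eq. apply (squeeze0_ev _ (fun _ => 0) 1); [|apply is_lim_seq_const].
        intros n Hn. split; [apply Cmod_ge_0|]. destruct n as [|n]; [lia|].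
        rewrite Csum_S0, (Csum_ext _ (fun _ => RtoC 0)), Csum_zero.
        - unfold vterm. simpl. replace (1 * (1 / 1) + 0 - 1)%C with (RtoC 0) by field.
          rewrite Cmod_0. lra.
        - intros i _. unfold vterm. simpl. ring. }
      rewrite vsum_1, ED in EV. rewrite EV. ring. }
    rewrite E in HM. change (INR (fact 0)) with 1. rewrite Rinv_1.
    change (delta0 0) with (RtoC 1).
    transitivity (z * vsum (fun i => (/ INR (i + 0 + 1))%R))%C; [ring|]. rewrite HM. ring.
  (* The splitting [1 = i / (i + l + 1) + (l + 1) / (i + l + 1)] plays the part of an integration by
     parts. *)
  - assert (EV : (vsum (fun _ => 1%R) = vsum (fun i => (INR i * / INR (i + S l))%R) +
         RtoC (INR (S l)) * vsum (fun i => (/ INR (i + l + 1))%R))%C).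
    { apply vsum_lin with 1; try (intros; lra).
      - intros i. apply ratio_le_1.
      - intros i. apply inv_INR_S.
      - intros i. replace (i + l + 1)%nat with (i + S l)%nat by lia.
        rewrite <- Rmult_plus_distr_r, <- plus_INR, Rinv_r; [reflexivity|]. apply not_0_INR. lia. }
    rewrite vsum_1 in EV. change (delta0 (S l)) with (RtoC 0).
    set (V1 := vsum (fun i => (/ INR (i + S l + 1))%R)) in *.
    set (V2 := vsum (fun i => (INR i * / INR (i + S l))%R)) in *.
    set (V3 := vsum (fun i => (/ INR (i + l + 1))%R)) in *.
    rewrite fact_simpl, mult_INR. rewrite EV.
    transitivity (RtoC (/ (INR (S l) * INR (fact l))) * (z * V1) - RtoC (/ INR (fact l)) * V3)%C; [ring|].
    rewrite HM. 
    assert (Hl0 : INR (S l) <> 0) by (apply not_0_INR; lia). pose proof (INR_fact_neq_0 l) as Hf.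
    rewrite !RtoC_inv, RtoC_mult by (try apply Rmult_integral_contrapositive; auto).
    field. split; apply RtoC_neq; assumption.
Qed.

Lemma lin_mul_eta (l : nat) : lin_mul z eta_c l = (delta0 l - eps_c l)%C.
Proof.
  unfold lin_mul, eta_c, eps_c.
  assert (HR : forall i m, 0 <= INR i * / (INR (i + m) * INR (i + m + 1)) <= 1).
  { intros i m. rewrite Rinv_mult, <- Rmult_assoc. pose proof (ratio_le_1 i m). pose proof (inv_INR_S (i + m)).
    split; [apply Rmult_le_pos; lra|]. nra. }
  assert (HM : (z * vsum (fun i => (/ (INR (i + l + 1) * INR (i + l + 2)))%R) =
     - vsum (fun i => (INR i * / (INR (i + l) * INR (i + l + 1)))%R))%C).
  { apply vsum_mul_z with 1.
    - intros i. pose proof (inv_prod_le (i + l)). pose proof (inv_INR_S (i + l)). lra.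
    - intros i. apply HR.
    - simpl. ring.
    - intros i. replace (S i + l)%nat with (i + l + 1)%nat by lia.
      replace (i + l + 1 + 1)%nat with (i + l + 2)%nat by lia. reflexivity. }
  destruct l as [|l].
  - assert (E : vsum (fun i => (INR i * / (INR (i + 0) * INR (i + 0 + 1)))%R) =
       (vsum (fun i => (/ INR (i + 0 + 1))%R) - 1)%C).
    { assert (EV : (vsum (fun i => (/ INR (i + 0 + 1))%R) =
         vsum (fun i => (INR i * / (INR (i + 0) * INR (i + 0 + 1)))%R) +
         RtoC 1 * vsum (fun i => match i with O => 1%R | _ => 0%R end))%C).
      { apply vsum_lin with 1.
        - intros i. apply HR.
        - intros [|i]; lra.
        - intros i. apply inv_INR_S.
        - intros [|i]; [simpl; rewrite Rinv_1; ring|]. rewrite Nat.add_0_r. field.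
          split; apply not_0_INR; lia. }
      assert (ED : vsum (fun i => match i with O => 1%R | _ => 0%R end) = 1%C).
      { apply Clim_eq. apply (squeeze0_ev _ (fun _ => 0) 1); [|apply is_lim_seq_const].
        intros n Hn. split; [apply Cmod_ge_0|]. destruct n as [|n]; [lia|].
        rewrite Csum_S0, (Csum_ext _ (fun _ => RtoC 0)), Csum_zero.
        - unfold vterm. simpl. replace (1 * (1 / 1) + 0 - 1)%C with (RtoC 0) by field.
          rewrite Cmod_0. lra.
        - intros i _. unfold vterm. simpl. ring. }
      rewrite ED in EV. rewrite EV. ring. }
    rewrite E in HM. change (INR (fact 0)) with 1. rewrite Rinv_1.
    change (delta0 0) with (RtoC 1).
    transitivity (z * vsum (fun i => (/ (INR (i + 0 + 1) * INR (i + 0 + 2)))%R))%C; [ring|]. rewrite HM. ring.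
  - assert (EV : (vsum (fun i => (/ INR (i + S l + 1))%R) =
        vsum (fun i => (INR i * / (INR (i + S l) * INR (i + S l + 1)))%R) +
        RtoC (INR (S l)) * vsum (fun i => (/ (INR (i + l + 1) * INR (i + l + 2)))%R))%C).
    { apply vsum_lin with 1.
      - intros i. apply HR.
      - intros i. pose proof (inv_prod_le (i + l)). pose proof (inv_INR_S (i + l)). lra.
      - intros i. apply inv_INR_S.
      - intros i. replace (i + l + 1)%nat with (i + S l)%nat by lia.
        replace (i + l + 2)%nat with (i + S l + 1)%nat by lia.
        rewrite <- Rmult_plus_distr_r, <- plus_INR. field.
        split; apply not_0_INR; lia. }
    change (delta0 (S l)) with (RtoC 0).
    set (V1 := vsum (fun i => (/ (INR (i + S l + 1) * INR (i + S l + 2)))%R)) in *.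
    set (V2 := vsum (fun i => (INR i * / (INR (i + S l) * INR (i + S l + 1)))%R)) in *.
    set (V3 := vsum (fun i => (/ (INR (i + l + 1) * INR (i + l + 2)))%R)) in *.
    rewrite EV, fact_simpl, mult_INR.
    transitivity (RtoC (/ (INR (S l) * INR (fact l))) * (z * V1) - RtoC (/ INR (fact l)) * V3)%C; [ring|].
    rewrite HM.
    assert (Hl0 : INR (S l) <> 0) by (apply not_0_INR; lia). pose proof (INR_fact_neq_0 l) as Hf.
    rewrite !RtoC_inv, RtoC_mult by (try apply Rmult_integral_contrapositive; auto).
    field. split; apply RtoC_neq; assumption.
Qed.

(* [polylog i] and [z^(-i-1)] are the coefficients of [w^i] in [1 / (1 - exp (w - z))] and [1 / (z - w)]. *)
Definition polylog_err (i : nat) : C := (polylog i - (/ z) ^ S i)%C.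

(** Moving [z - w] onto the first factor turns it into [1 - exp (w - z)], the inverse of the
    polylogarithm series by [polylog_rec]. *)
Lemma conv_eps_polylog (i : nat) : conv eps_c (lin_mul z polylog) i = delta0 i.
Proof.
  rewrite conv_lin_mul_r, <- conv_lin_mul_l. unfold conv.
  rewrite (Csum_ext _ (fun l => delta0 l * polylog (i - l) - q * (RtoC (/ INR (fact l)) * polylog (i - l)))%C).
  2:{ intros l _. rewrite lin_mul_eps. ring. }
  rewrite Csum_minus, Csum_scal, Csum_S0, (Csum_ext _ (fun _ => RtoC 0)), Csum_zero.
  2:{ intros l _. simpl. ring. }
  rewrite Nat.sub_0_r. change (delta0 0) with (RtoC 1). rewrite (polylog_rec i). ring.
Qed.

Lemma lin_mul_inv_pow (i : nat) : lin_mul z (fun j => (/ z) ^ S j)%C i = delta0 i.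
Proof.
  pose proof z_neq0 as Hn. unfold lin_mul. destruct i as [|i].
  - change (delta0 0) with (RtoC 1). simpl. field. exact Hn.
  - change (delta0 (S i)) with (RtoC 0). change ((/ z) ^ S (S i))%C with (/ z * (/ z) ^ S i)%C.
    field. exact Hn.
Qed.

(** After multiplication by [z - w], which can be cancelled, both sides are [1] minus the series of
    [eps_c]. *)
Lemma conv_eps_err (i : nat) : conv eps_c polylog_err i = eta_c i.
Proof.
  revert i. apply (lin_mul_inj z _ _ z_neq0). intros i.
  rewrite <- conv_lin_mul_r.
  transitivity (conv eps_c (lin_mul z polylog) i - conv eps_c delta0 i)%C.
  - unfold conv. rewrite <- Csum_minus. apply Csum_ext. intros l _.
    assert (E : lin_mul z polylog_err (i - l) = (lin_mul z polylog (i - l) - delta0 (i - l))%C).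
    { rewrite <- lin_mul_inv_pow. unfold lin_mul, polylog_err. destruct (i - l)%nat; ring. }
    rewrite E. ring.
  - rewrite conv_eps_polylog, lin_mul_eta. f_equal. unfold conv.
    rewrite Csum_S, Nat.sub_diag, (Csum_ext _ (fun _ => RtoC 0)), Csum_zero.
    + change (delta0 0) with (RtoC 1). ring.
    + intros l Hl. replace (i - l)%nat with (S (i - l - 1)) by lia. simpl. ring.
Qed.

Lemma inv_fact_sum (n : nat) : Rsum (fun l => (/ 2) ^ S l / INR (fact (S (S l)))) n <= 3 / 10.
Proof.
  assert (HF : forall l, 2 * 3 ^ l <= INR (fact (S (S l)))).
  { induction l as [|l IH]; [simpl; lra|].
    rewrite fact_simpl, mult_INR. change (3 ^ S l) with (3 * 3 ^ l).
    assert (3 <= INR (S (S (S l)))) by (replace 3 with (INR 3) by (simpl; ring); apply le_INR; lia).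
    assert (0 < 3 ^ l) by (apply pow_lt; lra). nra. }
  apply Rle_trans with (Rsum (fun l => / 4 * (/ 6) ^ l) n).
  - apply Rsum_le. intros l _. assert (0 < 3 ^ l) by (apply pow_lt; lra).
    replace (/ 4 * (/ 6) ^ l) with ((/ 2) ^ S l * / (2 * 3 ^ l)).
    + apply Rmult_le_compat_l; [apply pow_le; lra|]. apply Rinv_le_contravar; [lra|apply HF].
    + simpl. rewrite Rinv_mult, <- pow_inv. replace (/ 6) with (/ 2 * / 3) by field.
      rewrite Rpow_mult_distr. field.
  - rewrite Rsum_scal. apply Rle_trans with (/ 4 * (6 / 5)); [|lra]. apply Rmult_le_compat_l; [lra|].
    replace (6 / 5) with (/ (1 - / 6)) by field. apply Rsum_geom_le. lra.
Qed.

Lemma eps_c_le (l : nat) : Cmod (eps_c l) <= exp (Cmod z) / INR (fact (S l)).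
Proof.
  unfold eps_c. rewrite Cmod_mult, Cmod_inv_fact.
  eapply Rle_trans; [apply Rmult_le_compat_l; [left; apply Rinv_0_lt_compat, INR_fact_lt_0|]|].
  - apply (vsum_le _ (/ INR (l + 1))). intros i. split; [apply inv_INR_S|].
    apply Rinv_le_contravar; [apply INR_S_pos|]. apply le_INR. lia.
  - right. rewrite fact_simpl, mult_INR. replace (l + 1)%nat with (S l) by lia.
    field. split; [apply INR_fact_neq_0|apply not_0_INR; lia].
Qed.

Lemma eta_c_le (l : nat) : Cmod (eta_c l) <= exp (Cmod z) / INR (fact (S (S l))).
Proof.
  unfold eta_c. rewrite Cmod_mult, Cmod_inv_fact.
  eapply Rle_trans; [apply Rmult_le_compat_l; [left; apply Rinv_0_lt_compat, INR_fact_lt_0|]|].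
  - apply (vsum_le _ (/ (INR (l + 1) * INR (l + 2)))). intros i. split; [apply inv_prod_le|].
    assert (0 < INR (l + 1)) by apply INR_S_pos. assert (0 < INR (l + 2)) by (apply lt_0_INR; lia).
    apply Rinv_le_contravar; [nra|]. apply Rmult_le_compat; try lra; apply le_INR; lia.
  - right. rewrite !fact_simpl, !mult_INR. replace (l + 1)%nat with (S l) by lia.
    replace (l + 2)%nat with (S (S l)) by lia.
    field. repeat split; try apply INR_fact_neq_0; apply not_0_INR; lia.
Qed.

(** [conv_eps_err] is solved for its last unknown by strong induction. For [|z| <= 1/2],
    [eps_c 0 = 1 - z eta_c 0] has modulus at least [1 - 7/16 = 9/16], while the other terms add up
    to at most [7/4 * 3/10 = 0.525] times [2^(i+1)]. *)
Lemma polylog_err_le : Cmod z <= / 2 -> forall i, Cmod (polylog_err i) <= 2 ^ S i.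
Proof.
  intros Hsm.
  assert (HE : exp (Cmod z) <= 7 / 4).
  { apply Rle_trans with (exp (/ 2)); [apply exp_le, Hsm|].
    assert (exp (/ 2) * exp (/ 2) <= 3) by (rewrite <- exp_plus; replace (/ 2 + / 2) with 1 by field; apply exp_le_3).
    pose proof (exp_pos (/ 2)). nra. }
  pose proof (exp_pos (Cmod z)) as HEp. pose proof (Cmod_ge_0 z) as Hz0.
  assert (H0 : 9 / 16 <= Cmod (eps_c 0)).
  { pose proof (lin_mul_eta 0) as E. unfold lin_mul in E. change (delta0 0) with (RtoC 1) in E.
    pose proof (eta_c_le 0) as H. simpl in H.
    pose proof (Cmod_triangle_sub 1 (eps_c 0)) as H1. rewrite <- E in H1. rewrite Cmod_1 in H1.
    replace (z * eta_c 0 - 0)%C with (z * eta_c 0)%C in H1 by ring. rewrite Cmod_mult in H1.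
    assert (Cmod z * Cmod (eta_c 0) <= / 2 * (7 / 8)).
    { apply Rmult_le_compat; [exact Hz0|apply Cmod_ge_0|exact Hsm|]. lra. }
    lra. }
  intros i. induction i as [i IH] using (well_founded_induction lt_wf).
  pose proof (conv_eps_err i) as E. unfold conv in E. rewrite Csum_S0, Nat.sub_0_r in E.
  set (X := Csum _ i) in E.
  assert (HX : Cmod (eps_c 0 * polylog_err i)%C <= Cmod (eta_c i) + Cmod X).
  { replace (eps_c 0 * polylog_err i)%C with (eta_c i - X)%C by (rewrite <- E; ring). apply Cmod_minus_le. }
  assert (HX2 : Cmod (eta_c i) + Cmod X <= 2 ^ S i * (7 / 4 * (3 / 10))).
  { apply Rle_trans with (2 ^ S i * (7 / 4 * Rsum (fun l => (/ 2) ^ S l / INR (fact (S (S l)))) (S i))).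
    - rewrite Rsum_S, Rplus_comm, !Rmult_plus_distr_l. apply Rplus_le_compat.
      + rewrite <- !Rsum_scal. unfold X. eapply Rle_trans; [apply Csum_Cmod|]. apply Rsum_le.
        intros l Hl. rewrite Cmod_mult.
        apply Rle_trans with (7 / 4 / INR (fact (S (S l))) * 2 ^ S (i - S l)).
        * apply Rmult_le_compat; [apply Cmod_ge_0|apply Cmod_ge_0| |apply IH; lia].
          eapply Rle_trans; [apply eps_c_le|]. apply Rmult_le_compat_r; [|exact HE].
          left. apply Rinv_0_lt_compat, INR_fact_lt_0.
        * right. assert (Hq : 2 ^ S i = 2 ^ S (i - S l) * 2 ^ S l) by (rewrite <- pow_add; f_equal; lia). rewrite Hq.
          assert (Hp : 2 ^ S l * (/ 2) ^ S l = 1) by (rewrite <- Rpow_mult_distr, Rinv_r, pow1 by lra; reflexivity).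
          transitivity (7 / 4 / INR (fact (S (S l))) * 2 ^ S (i - S l) * (2 ^ S l * (/ 2) ^ S l)).
          -- rewrite Hp. ring.
          -- unfold Rdiv. ring.
      + eapply Rle_trans; [apply eta_c_le|].
        assert (Hp : 2 ^ S i * (/ 2) ^ S i = 1) by (rewrite <- Rpow_mult_distr, Rinv_r, pow1 by lra; reflexivity).
        apply Rle_trans with (7 / 4 / INR (fact (S (S i))) * (2 ^ S i * (/ 2) ^ S i)).
        * rewrite Hp, Rmult_1_r. apply Rmult_le_compat_r; [|exact HE].
          left. apply Rinv_0_lt_compat, INR_fact_lt_0.
        * right. unfold Rdiv. ring.
    - apply Rmult_le_compat_l; [apply pow_le; lra|]. apply Rmult_le_compat_l; [lra|apply inv_fact_sum]. }
  rewrite Cmod_mult in HX. pose proof (Cmod_ge_0 (polylog_err i)).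
  assert (0 < 2 ^ S i) by (apply pow_lt; lra). nra.
Qed.

End Lipschitz.

(** * Cauchy's coefficient bound on a grid *)

Definition root (N : nat) : C := phase (2 * PI / INR N) 1.

Lemma phase_pow (xi u : R) (n : nat) : (phase xi u ^ n)%C = phase xi (INR n * u).
Proof.
  unfold phase. rewrite cexp_pow. f_equal. rewrite !RtoC_mult. ring.
Qed.

Lemma root_pow_N (N : nat) : (0 < N)%nat -> (root N ^ N = 1)%C.
Proof.
  intros HN. assert (HN' : INR N <> 0) by (apply not_0_INR; lia).
  unfold root. rewrite phase_pow. unfold phase, cexp, Ci, Cmult, RtoC, Re, Im. simpl.
  replace (2 * PI / INR N * (INR N * 1)) with (2 * PI) by (field; exact HN').
  replace (0 * (2 * PI) - 1 * 0) with 0 by ring. replace (0 * 0 + 1 * (2 * PI)) with (2 * PI) by ring.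
  rewrite exp_0, cos_2PI, sin_2PI. f_equal; ring.
Qed.

Lemma root_pow_neq1 (N p : nat) : (0 < N)%nat -> (p mod N <> 0)%nat -> (root N ^ p <> 1)%C.
Proof.
  intros HN Hp E. assert (HN' : 0 < INR N) by (apply lt_0_INR; lia).
  unfold root in E. rewrite phase_pow in E. apply (f_equal Re) in E.
  unfold phase, cexp, Ci, Cmult, RtoC, Re, Im in E. simpl in E.
  set (t := PI * INR p / INR N).
  replace (2 * PI / INR N * (INR p * 1)) with (2 * t) in E by (unfold t; field; lra).
  replace (0 * (2 * t) - 1 * 0) with 0 in E by ring. replace (0 * 0 + 1 * (2 * t)) with (2 * t) in E by ring.
  rewrite exp_0, Rmult_1_l, cos_2a_sin in E.
  assert (Hs : sin t = 0) by nra.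
  apply sin_eq_0_0 in Hs. destruct Hs as [k Hk]. pose proof PI_RGT_0.
  assert (Hg : INR p = IZR k * INR N).
  { apply Rmult_eq_reg_l with (PI / INR N); [|apply Rgt_not_eq, Rmult_lt_0_compat; [lra|apply Rinv_0_lt_compat; lra]].
    transitivity t; [unfold t; field; lra|]. rewrite Hk. field. lra. }
  rewrite !INR_IZR_INZ, <- mult_IZR in Hg. apply eq_IZR in Hg.
  assert (0 <= k)%Z by nia.
  apply Hp. assert (p = (Z.to_nat k * N)%nat) as -> by nia. apply Nat.Div0.mod_mul.
Qed.

Lemma root_sum (N p : nat) : (0 < N)%nat ->
  Csum (fun j => (root N ^ p) ^ j)%C N = if (p mod N =? 0)%nat then RtoC (INR N) else 0%C.
Proof.
  intros HN. destruct (Nat.eqb_spec (p mod N) 0) as [E|E].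
  - assert (H1 : (root N ^ p = 1)%C).
    { apply Nat.Div0.mod_divides in E. destruct E as [k ->]. rewrite Cpow_mul, root_pow_N by exact HN.
      induction k as [|k IH]; [reflexivity|]. simpl. rewrite IH. ring. }
    rewrite H1, (Csum_ext _ (fun _ => RtoC 1)), Csum_RtoC, Rsum_const; [f_equal; ring|].
    intros i _. clear. induction i as [|i IH]; [reflexivity|]. simpl. rewrite IH. ring.
  - pose proof (root_pow_neq1 N p HN E) as H1.
    pose proof (Csum_geom (root N ^ p) N) as H2.
    rewrite <- Cpow_mul, Nat.mul_comm, Cpow_mul, root_pow_N in H2 by exact HN.
    assert (Hn : (1 - root N ^ p)%C <> 0%C).
    { intros H. apply H1. replace (root N ^ p)%C with (1 - (1 - root N ^ p))%C by ring. rewrite H. ring. }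
    assert (H3 : (1 ^ p = 1)%C) by (clear; induction p as [|p IH]; [reflexivity|]; simpl; rewrite IH; ring).
    rewrite H3 in H2.
    set (X := Csum _ N) in *.
    replace X with ((1 - root N ^ p) * X / (1 - root N ^ p))%C by (field; exact Hn).
    assert (HX : ((1 - root N ^ p) * X = 1 - 1)%C) by exact H2. rewrite HX. field. exact Hn.
Qed.

(** Discrete Fourier inversion; the exponent [N - n] stands for [-n], the [N]-th power of the root
    being 1. *)
Lemma root_extract (N n : nat) (g : nat -> C) : (n < N)%nat ->
  Csum (fun j => Csum (fun m => g m * (root N ^ j) ^ m) N * (root N ^ j) ^ (N - n))%C N =
  (RtoC (INR N) * g n)%C.
Proof.
  intros Hn. assert (HN : (0 < N)%nat) by lia.
  rewrite (Csum_ext _ (fun j => Csum (fun m => g m * (root N ^ (m + (N - n))) ^ j) N)%C).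
  2:{ intros j _. rewrite Cmult_comm, <- Csum_scal. apply Csum_ext. intros m _.
      rewrite <- !Cpow_mul, Nat.mul_add_distr_r, Cpow_add, (Nat.mul_comm m j), (Nat.mul_comm (N - n) j). ring. }
  rewrite Csum_swap.
  rewrite (Csum_ext _ (fun m => g m * if (m =? n)%nat then RtoC (INR N) else 0)%C).
  2:{ intros m Hm. rewrite Csum_scal, root_sum by exact HN. f_equal.
      destruct (Nat.eqb_spec m n) as [->|E].
      - replace (n + (N - n))%nat with N by lia. rewrite Nat.Div0.mod_same. reflexivity.
      - destruct (Nat.eqb_spec ((m + (N - n)) mod N) 0) as [E2|E2]; [|reflexivity].
        exfalso. apply Nat.Div0.mod_divides in E2. destruct E2 as [k Hk].
        destruct k as [|[|k]]; [lia|lia|]. nia. }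
  match goal with |- Csum ?f N = _ =>
    replace (Csum f N) with (Csum f (n + S (N - n - 1))) by (f_equal; lia) end.
  rewrite Csum_add, Csum_S0.
  rewrite Nat.add_0_r, Nat.eqb_refl.
  rewrite (Csum_ext _ (fun _ => RtoC 0) n), Csum_zero.
  2:{ intros i Hi. destruct (Nat.eqb_spec i n); [lia|]. ring. }
  rewrite (Csum_ext _ (fun _ => RtoC 0) (N - n - 1)), Csum_zero.
  2:{ intros i Hi. destruct (Nat.eqb_spec (n + S i) n); [lia|]. ring. }
  ring.
Qed.

(** The angle is reduced to [[-pi, pi]], the range on which the arc estimates read off the distance
    from [q = 1]. *)
Lemma root_pow_cexp (N j : nat) : (j < N)%nat ->
  exists y, Rabs y <= PI /\ (root N ^ j)%C = cexp (Ci * RtoC y).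
Proof.
  intros Hj. assert (HN : 0 < INR N) by (apply lt_0_INR; lia). pose proof PI_RGT_0 as Hpi.
  assert (HjN : 0 <= INR j <= INR N) by (split; [apply pos_INR|apply le_INR; lia]).
  set (t := INR j / INR N).
  assert (Ht : 0 <= t <= 1).
  { split; [apply Rmult_le_pos; [lra|left; apply Rinv_0_lt_compat; lra]|].
    apply Rmult_le_reg_r with (INR N); [lra|]. unfold t, Rdiv. rewrite Rmult_assoc, Rinv_l by lra. lra. }
  assert (E : (root N ^ j)%C = cexp (Ci * RtoC (2 * PI * t))%C).
  { unfold root. rewrite phase_pow. unfold phase. f_equal. f_equal. f_equal. unfold t. field. lra. }
  destruct (Rle_dec t (/ 2)) as [H|H].
  - exists (2 * PI * t). split; [|exact E]. rewrite Rabs_pos_eq; nra.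
  - exists (2 * PI * t - 2 * PI). split; [rewrite Rabs_left1; nra|]. rewrite E.
    unfold cexp, Ci, Cmult, RtoC, Re, Im. simpl.
    replace (0 * (2 * PI * t - 2 * PI) - 1 * 0) with 0 by ring.
    replace (0 * (2 * PI * t) - 1 * 0) with 0 by ring.
    replace (0 * 0 + 1 * (2 * PI * t)) with (2 * PI * t) by ring.
    replace (0 * 0 + 1 * (2 * PI * t - 2 * PI)) with (- (2 * PI - 2 * PI * t)) by ring.
    rewrite cos_neg, sin_neg, cos_minus, sin_minus, cos_2PI, sin_2PI. f_equal; ring.
Qed.

(** Cauchy's inequality. For [N > n] the average over the [N]-th roots of unity isolates the
    coefficient in the partial sum of length [N]. The full sums are bounded by [S0], and the missing
    tail, uniform on the circle, tends to 0 with [N]. *)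
Theorem coefficient_bound (h : nat -> C) (x A S0 : R) :
  absbd (fun n => h n * RtoC (exp (- x)) ^ n)%C A ->
  (forall z l, Re z = x -> Rabs (Im z) <= PI ->
     Ccv (Csum (fun n => h n * cexp (- z) ^ n)%C) l -> Cmod l <= S0) ->
  forall n, Cmod (h n) * exp (- x) ^ n <= S0.
Proof.
  intros HA HS n. set (r := exp (- x)).
  assert (Hr : 0 < r) by apply exp_pos.
  set (g := fun m => (h m * RtoC r ^ m)%C).
  destruct (Rseries_bounded (fun m => Cmod (g m)) A (fun i => Cmod_ge_0 _) HA) as [L [HL [_ HL2]]].
  replace (Cmod (h n) * r ^ n) with (Cmod (g n)).
  2:{ unfold g. rewrite Cmod_mult, Cmod_pow, Cmod_RtoC_pos by lra. reflexivity. }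
  assert (HB : forall N, (n < N)%nat -> Cmod (g n) <= S0 + (L - Rsum (fun m => Cmod (g m)) N)).
  { intros N Hn. assert (HN : 0 < INR N) by (apply lt_0_INR; lia).
    apply Rmult_le_reg_l with (INR N); [exact HN|].
    rewrite <- (Cmod_RtoC_pos (INR N)) at 1 by lra. rewrite <- Cmod_mult, <- root_extract by exact Hn.
    eapply Rle_trans; [apply Csum_Cmod|].
    rewrite <- Rsum_const. apply Rsum_le. intros j Hj.
    destruct (root_pow_cexp N j Hj) as [y [Hy Ey]].
    assert (H1 : Cmod (root N ^ j)%C = 1).
    { rewrite Ey, Cmod_cexp, <- exp_0. f_equal. unfold Re, Ci, Cmult, RtoC. simpl. ring. }
    rewrite Cmod_mult, (Cmod_pow _ (N - n)), H1, pow1, Rmult_1_r.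
    set (z := (RtoC x - Ci * RtoC y)%C).
    assert (Hterm : forall m, (g m * (root N ^ j) ^ m)%C = (h m * cexp (- z) ^ m)%C).
    { intros m. unfold g, r. rewrite <- cexp_RtoC, Ey, <- Cmult_assoc. f_equal.
      rewrite !cexp_pow, <- cexp_plus. f_equal. unfold z. rewrite RtoC_opp. ring. }
    rewrite (Csum_ext _ (fun m => h m * cexp (- z) ^ m)%C) by (intros; apply Hterm).
    assert (Habs : forall m, Cmod (h m * cexp (- z) ^ m)%C = Cmod (g m)).
    { intros m. rewrite <- Hterm, Cmod_mult, Cmod_pow, H1, pow1. ring. }
    assert (HA2 : absbd (fun m => h m * cexp (- z) ^ m)%C A).
    { intros M. rewrite (Rsum_ext _ (fun m => Cmod (g m))) by (intros; apply Habs). apply HA. }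
    destruct (Cseries_abs _ _ HA2) as [l Hl].
    pose proof (HS z l) as HSz. 
    assert (Hl0 : Cmod l <= S0).
    { apply HSz; [| |exact Hl].
      - unfold z, Re, Ci, Cminus, Cplus, Copp, Cmult, RtoC. simpl. ring.
      - replace (Im z) with (- y); [rewrite Rabs_Ropp; exact Hy|].
        unfold z, Im, Ci, Cminus, Cplus, Copp, Cmult, RtoC. simpl. ring. }
    eapply Rle_trans; [apply (Cmod_triangle_sub _ l)|]. apply Rplus_le_compat; [exact Hl0|].
    rewrite Cmod_sub_sym.
    apply (Ccv_mod_le (fun M => Csum (fun m => h m * cexp (- z) ^ m) M - Csum (fun m => h m * cexp (- z) ^ m) N)%C _ _ N).
    - apply Ccv_minus; [exact Hl|apply Ccv_const].
    - intros M HM. eapply Rle_trans; [apply Csum_tail, HM|].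
      assert (HR : forall K, Rsum (fun m => Cmod (h m * cexp (- z) ^ m)%C) K = Rsum (fun m => Cmod (g m)) K)
        by (intros; apply Rsum_ext; intros; apply Habs).
      rewrite !HR. specialize (HL2 M). lra. }
  apply (is_lim_seq_le_loc (fun _ => Cmod (g n)) (fun N => S0 + (L - Rsum (fun m => Cmod (g m)) N))
    (Cmod (g n)) S0).
  - exists (S n). intros N HN. apply HB. lia.
  - apply is_lim_seq_const.
  - replace S0 with (S0 + (L - L)) at 1 by ring.
    apply is_lim_seq_plus'; [apply is_lim_seq_const|]. apply is_lim_seq_minus'; [apply is_lim_seq_const|exact HL].
Qed.

(** * The Bessel function *)

Definition bcoef (j : nat) : R := / (INR (fact (S j)) * INR (fact j)).

Lemma bcoef_pos (j : nat) : 0 < bcoef j.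
Proof. apply Rinv_0_lt_compat, Rmult_lt_0_compat; apply INR_fact_lt_0. Qed.

Lemma bcoef_S (j : nat) : bcoef (S j) * (INR (S (S j)) * INR (S j)) = bcoef j.
Proof.
  unfold bcoef. rewrite (fact_simpl (S j)), mult_INR. rewrite (fact_simpl j) at 2. rewrite mult_INR.
  field. repeat split; try apply INR_fact_neq_0; apply not_0_INR; lia.
Qed.

Lemma CV_radius_bcoef : CV_radius bcoef = p_infty.
Proof.
  apply CV_radius_infinite_DAlembert.
  - intros n. apply Rgt_not_eq, bcoef_pos.
  - apply (squeeze0 _ (fun n => / INR (S n))).
    + intros n. split; [apply Rabs_pos|]. rewrite <- (bcoef_S n).
      pose proof (bcoef_pos (S n)). assert (H1 : 1 <= INR (S n)) by (apply (le_INR 1); lia).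
      assert (H2 : 1 <= INR (S (S n))) by (apply (le_INR 1); lia).
      replace (bcoef (S n) / (bcoef (S n) * (INR (S (S n)) * INR (S n)))) with (/ (INR (S (S n)) * INR (S n)))
        by (field; lra).
      rewrite Rabs_pos_eq by (left; apply Rinv_0_lt_compat; nra).
      apply Rinv_le_contravar; nra.
    + apply (is_lim_seq_incr_1 (fun n => / INR n)).
      replace (Finite 0) with (Rbar_inv p_infty) by reflexivity.
      apply is_lim_seq_inv; [apply is_lim_seq_INR|discriminate].
Qed.

(* [bes x = I_1 (2 sqrt x) / sqrt x]. *)
Definition bes (x : R) : R := PSeries bcoef x.
Definition bes1 (x : R) : R := PSeries (PS_derive bcoef) x.
Definition bes2 (x : R) : R := PSeries (PS_derive (PS_derive bcoef)) x.

Lemma bes_der (x : R) : is_derive bes x (bes1 x).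
Proof. apply is_derive_PSeries. rewrite CV_radius_bcoef. exact I. Qed.

Lemma bes1_der (x : R) : is_derive bes1 x (bes2 x).
Proof. apply is_derive_PSeries. rewrite CV_radius_derive, CV_radius_bcoef. exact I. Qed.

Lemma Derive_bes (x : R) : Derive (fun t : R => bes t) x = bes1 x.
Proof. apply is_derive_unique, bes_der. Qed.

Lemma Derive_bes1 (x : R) : Derive (fun t : R => bes1 t) x = bes2 x.
Proof. apply is_derive_unique, bes1_der. Qed.

Lemma ex_pseries_bcoef (x : R) : ex_pseries bcoef x.
Proof. apply CV_radius_inside. rewrite CV_radius_bcoef. exact I. Qed.

Lemma ex_pseries_bcoef1 (x : R) : ex_pseries (PS_derive bcoef) x.
Proof. apply CV_radius_inside. rewrite CV_radius_derive, CV_radius_bcoef. exact I. Qed.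

Lemma ex_pseries_bcoef2 (x : R) : ex_pseries (PS_derive (PS_derive bcoef)) x.
Proof. apply CV_radius_inside. rewrite !CV_radius_derive, CV_radius_bcoef. exact I. Qed.

Lemma bes_ode (x : R) : x * bes2 x + 2 * bes1 x = bes x.
Proof.
  unfold bes, bes1, bes2. rewrite <- PSeries_incr_1, <- (PSeries_scal 2), <- PSeries_plus.
  - apply PSeries_ext. intros [|j]; unfold PS_plus, PS_incr_1, PS_scal, PS_derive, plus, scal; simpl;
      unfold mult; simpl.
    + unfold zero. simpl. rewrite <- (bcoef_S 0). simpl. ring.
    + change (match j with O => 1 | S _ => INR j + 1 end) with (INR (S j)).
      rewrite <- (bcoef_S (S j)). rewrite !S_INR. ring.
  - apply ex_pseries_incr_1, ex_pseries_bcoef2.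
  - apply ex_pseries_scal; [apply Rmult_comm|apply ex_pseries_bcoef1].
Qed.

Lemma PSeries_ge_first (a : nat -> R) (x : R) : (forall n, 0 <= a n) -> 0 <= x -> ex_pseries a x ->
  a O + a 1%nat * x <= PSeries a x.
Proof.
  intros Ha Hx He. apply ex_pseries_R in He. unfold PSeries.
  rewrite (Series_incr_1 _ He). apply ex_series_incr_1 in He. rewrite (Series_incr_1 _ He).
  apply ex_series_incr_1 in He. simpl.
  assert (H : 0 <= Series (fun k => a (S (S k)) * (x * (x * x ^ k)))).
  { replace 0 with (Series (fun _ => 0 * 0)).
    - apply Series_le; [|exact He]. intros n. split; [lra|].
      rewrite Rmult_0_l. apply Rmult_le_pos; [apply Ha|]. repeat apply Rmult_le_pos; auto. apply pow_le, Hx.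
    - rewrite Series_scal_l. ring. }
  lra.
Qed.

Lemma bes_ge (x : R) : 0 <= x -> 1 + x / 2 <= bes x.
Proof.
  intros Hx.
  pose proof (PSeries_ge_first bcoef x (fun n => Rlt_le _ _ (bcoef_pos n)) Hx (ex_pseries_bcoef x)) as H.
  unfold bes. eapply Rle_trans; [|exact H]. unfold bcoef. simpl. right. field.
Qed.

Lemma bes_pos (x : R) : 0 <= x -> 0 < bes x.
Proof. intros Hx. pose proof (bes_ge x Hx). lra. Qed.

Lemma bes1_pos (x : R) : 0 <= x -> 0 < bes1 x.
Proof.
  intros Hx.
  assert (Ha : forall n, 0 < PS_derive bcoef n).
  { intros n. unfold PS_derive. apply Rmult_lt_0_compat; [apply lt_0_INR; lia|apply bcoef_pos]. }
  pose proof (PSeries_ge_first (PS_derive bcoef) x (fun n => Rlt_le _ _ (Ha n)) Hx (ex_pseries_bcoef1 x)) as H.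
  pose proof (Ha O). pose proof (Ha 1%nat).
  assert (0 <= PS_derive bcoef 1 * x) by (apply Rmult_le_pos; lra).
  unfold bes1. lra.
Qed.

(** The first three terms of the expansion of [bes1 / bes] at [s^2] in powers of [1/s]. *)
Definition lbar (s : R) : R := / s - 3 / 4 / s ^ 2 + 3 / 32 / s ^ 3.

(* [lbar (sqrt x)] is a strict subsolution of the Riccati equation [u' = 1/x - 2u/x - u^2] of [bes1 / bes]. *)
Lemma bes_riccati_lower (s : R) : / 2 <= s -> lbar s * bes (s ^ 2) <= bes1 (s ^ 2).
Proof.
  intros Hs.
  set (A := fun t => bes (t ^ 2)). set (B := fun t => bes1 (t ^ 2)).
  assert (HA : forall t, is_derive A t (2 * t * B t)).
  { intros t. unfold A, B. replace (2 * t * bes1 (t ^ 2)) with (scal (2 * t) (bes1 (t ^ 2))) by reflexivity.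
    apply (is_derive_comp bes (fun t => t ^ 2)); [apply bes_der|]. auto_derive; [exact I|ring]. }
  assert (HB : forall t, 0 < t -> is_derive B t (2 * (A t - 2 * B t) / t)).
  { intros t Ht. unfold A, B. 
    replace (2 * (bes (t ^ 2) - 2 * bes1 (t ^ 2)) / t) with (scal (2 * t) (bes2 (t ^ 2))).
    - apply (is_derive_comp bes1 (fun t => t ^ 2)); [apply bes1_der|]. auto_derive; [exact I|ring].
    - rewrite <- (bes_ode (t ^ 2)). unfold scal. simpl. unfold mult. simpl. field. lra. }
  (* An integrating factor for [B - lbar A]: the logarithmic derivative of [w] is
     [4/t + 2 t lbar t], and what remains of the derivative is the positive defect of the
     subsolution times [A w]. *)
  set (w := fun t => t ^ 4 * exp (2 * t - 3 / 2 * ln t - 3 / 16 / t)).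
  set (E := fun t => (B t - lbar t * A t) * w t).
  assert (Hw : forall t, 0 < t -> 0 < w t).
  { intros t Ht. apply Rmult_lt_0_compat; [apply pow_lt, Ht|apply exp_pos]. }
  assert (HE : E (/ 2) <= E s).
  { apply (derive_nonneg_le E (fun t => 2 * t * w t * A t * (3 / 32 * (t - 3 / 32) / t ^ 6))); [exact Hs|].
    intros t Ht. assert (Ht0 : 0 < t) by lra. split.
    - unfold E, w, lbar. auto_derive.
      + repeat split; try lra; try (apply pow_nonzero; lra); try (exists (2 * t * B t); apply HA).
        * exists (2 * (A t - 2 * B t) / t). apply HB, Ht0.
        * apply Rgt_not_eq. repeat apply Rmult_lt_0_compat; lra.
        * apply Rgt_not_eq. repeat apply Rmult_lt_0_compat; lra.
      + replace (Derive (fun x : R => A x) t) with (2 * t * B t) by (symmetry; apply is_derive_unique, HA).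
        replace (Derive (fun x : R => B x) t) with (2 * (A t - 2 * B t) / t)
          by (symmetry; apply is_derive_unique, HB, Ht0).
        change (2 * t - 3 / 2 * ln t - 3 / 16 / t) with (2 * t + - (3 / 2 * ln t) + - (3 / 16 * / t)).
        generalize (exp (2 * t + - (3 / 2 * ln t) + - (3 / 16 * / t))). intros e. field. lra.
    - pose proof (Hw t Ht0). pose proof (bes_pos (t ^ 2) (pow2_ge_0 t)) as Hb.
      apply Rmult_le_pos.
      + apply Rmult_le_pos; [apply Rmult_le_pos; [lra|left; exact H]|left; exact Hb].
      + apply Rmult_le_pos; [lra|]. left. apply Rinv_0_lt_compat, pow_lt, Ht0. }
  (* [lbar (1/2) = -1/4] is negative, so positivity at the starting point is free. *)
  assert (H0 : 0 < E (/ 2)).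
  { unfold E. apply Rmult_lt_0_compat; [|apply Hw; lra].
    pose proof (bes_pos ((/ 2) ^ 2) (pow2_ge_0 _)) as Hb. pose proof (bes1_pos ((/ 2) ^ 2) (pow2_ge_0 _)) as Hb1.
    unfold A, B. replace (lbar (/ 2)) with (- (1 / 4)) by (unfold lbar; field). lra. }
  assert (H1 : 0 < B s - lbar s * A s).
  { apply Rmult_lt_reg_r with (w s); [apply Hw; lra|]. rewrite Rmult_0_l. unfold E in HE, H0. lra. }
  unfold A, B in H1. lra.
Qed.

(** By the bound on the logarithmic derivative, [ln (bes (t^2)) - 2 t + 3/2 ln t] increases, with
    derivative at least [3 / (16 t^2)]. The constant [1/6] comes from [t = 1], where [bes 1 >= 3/2],
    and from [e^2 <= 9]. *)
Lemma bes_lower (s : R) : 1 <= s -> / 6 * exp (2 * s) <= bes (s ^ 2) * (s * sqrt s).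
Proof.
  intros Hs.
  set (g := fun t => ln (bes (t ^ 2)) - 2 * t + 3 / 2 * ln t).
  assert (Hp : forall t, 0 < bes (t ^ 2)) by (intros; apply bes_pos, pow2_ge_0).
  assert (Hg : g 1 <= g s).
  { apply (derive_nonneg_le g (fun t => 2 * t * (bes1 (t ^ 2) / bes (t ^ 2)) - 2 + 3 / 2 / t)); [exact Hs|].
    intros t Ht. split.
    - unfold g. auto_derive.
      + repeat split; try lra; [exists (bes1 (t * (t * 1))); apply bes_der|].
        apply (Hp t).
      + rewrite Derive_bes. change (t * (t * 1)) with (t ^ 2).
        pose proof (Hp t). field. lra.
    - pose proof (bes_riccati_lower t ltac:(lra)) as H.
      assert (Hl : lbar t <= bes1 (t ^ 2) / bes (t ^ 2)).
      { apply Rmult_le_reg_r with (bes (t ^ 2)); [apply Hp|]. unfold Rdiv at 1.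
        rewrite Rmult_assoc, Rinv_l by (apply Rgt_not_eq, Hp). lra. }
      assert (H2 : 2 * t * lbar t <= 2 * t * (bes1 (t ^ 2) / bes (t ^ 2))) by (apply Rmult_le_compat_l; lra).
      assert (H3 : 2 * t * lbar t - 2 + 3 / 2 / t = 3 / 16 / t ^ 2) by (unfold lbar; field; lra).
      assert (0 <= 3 / 16 / t ^ 2) by (apply Rmult_le_pos; [lra|left; apply Rinv_0_lt_compat, pow_lt; lra]).
      lra. }
  unfold g in Hg. rewrite ln_1 in Hg.
  assert (H1 : 3 / 2 <= bes (1 ^ 2)) by (pose proof (bes_ge (1 ^ 2)); lra).
  assert (Hss : s * sqrt s = exp (3 / 2 * ln s)).
  { replace (3 / 2 * ln s) with (ln s + / 2 * ln s) by field. rewrite exp_plus, exp_ln by lra.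
    f_equal. apply sqrt_lem_1; [lra|left; apply exp_pos|]. rewrite <- exp_plus.
    replace (/ 2 * ln s + / 2 * ln s) with (ln s) by field. apply exp_ln. lra. }
  rewrite Hss, <- (exp_ln (bes (s ^ 2))) by apply Hp. rewrite <- exp_plus.
  apply Rle_trans with (exp (ln (bes (1 ^ 2)) - 2 + 2 * s)); [|apply exp_le; lra].
  rewrite exp_plus. apply Rmult_le_compat_r; [left; apply exp_pos|].
  unfold Rminus. rewrite exp_plus, exp_ln, exp_Ropp by apply Hp.
  assert (He : exp 2 <= 9).
  { replace 2 with (1 + 1) by ring. rewrite exp_plus. pose proof exp_le_3. pose proof (exp_pos 1). nra. }
  assert (/ 9 <= / exp 2) by (apply Rinv_le_contravar; [apply exp_pos|exact He]).
  nra.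
Qed.

(** * Derivatives of the logarithm of the Bessel function *)

Definition lder (x : R) : R := bes1 x / bes x.
(** [lder1] and [lder2] are the first two derivatives of [lder], with [bes_ode] used to eliminate
    higher derivatives of [bes]; a lower bound for [lder] thus controls both. *)
Definition lder1 (x : R) : R := / x - 2 * lder x / x - lder x ^ 2.
Definition lder2 (x : R) : R :=
  2 * lder x ^ 3 + 6 * lder x ^ 2 / x + (6 / x ^ 2 - 2 / x) * lder x - 3 / x ^ 2.

Lemma ln_bes_der (x : R) : 0 < x -> is_derive (fun t => ln (bes t)) x (lder x).
Proof.
  intros Hx. pose proof (bes_pos x ltac:(lra)). unfold lder. auto_derive.
  - repeat split; [exists (bes1 x); apply bes_der|assumption].
  - rewrite Derive_bes. field. lra.
Qed.

Lemma lder_der (x : R) : 0 < x -> is_derive lder x (lder1 x).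
Proof.
  intros Hx. pose proof (bes_pos x ltac:(lra)). unfold lder1, lder. auto_derive.
  - repeat split; [exists (bes2 x); apply bes1_der|exists (bes1 x); apply bes_der|lra].
  - rewrite !Derive_bes, !Derive_bes1.
    replace (bes2 x) with ((bes x - 2 * bes1 x) / x).
    + field. lra.
    + rewrite <- (bes_ode x). field. lra.
Qed.

Lemma lder1_der (x : R) : 0 < x -> is_derive lder1 x (lder2 x).
Proof.
  intros Hx. unfold lder1 at 1. auto_derive.
  - repeat split; try lra; exists (lder1 x); apply lder_der, Hx.
  - replace (Derive (fun t : R => lder t) x) with (lder1 x) by (symmetry; apply is_derive_unique, lder_der, Hx). unfold lder2, lder1. field. lra.
Qed.

Lemma lder_ge (s : R) : / 2 <= s -> lbar s <= lder (s ^ 2).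
Proof.
  intros Hs. pose proof (bes_riccati_lower s Hs). pose proof (bes_pos (s ^ 2) (pow2_ge_0 s)) as Hp.
  unfold lder. apply Rmult_le_reg_r with (bes (s ^ 2)); [exact Hp|].
  unfold Rdiv. rewrite Rmult_assoc, Rinv_l by lra. lra.
Qed.

(** The expression decreases in [lder >= 0], so [lbar] may be inserted. This gives [-1 / (2 s^3)]
    plus smaller terms, which for [s >= 40] fit between [1/2] and [2/5]. *)
Lemma lder1_le (s : R) : 40 <= s -> lder1 (s ^ 2) <= - (2 / 5) / s ^ 3.
Proof.
  intros Hs. pose proof (lder_ge s ltac:(lra)) as H. unfold lder1.
  set (u := lder (s ^ 2)) in *.
  assert (Hs2 : 0 < s ^ 2) by (apply pow_lt; lra).
  assert (HL : 0 <= lbar s).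
  { unfold lbar. replace (/ s - 3 / 4 / s ^ 2 + 3 / 32 / s ^ 3) with ((s ^ 2 - 3 / 4 * s + 3 / 32) / s ^ 3) by (field; lra).
    apply Rmult_le_pos; [nra|]. left. apply Rinv_0_lt_compat, pow_lt. lra. }
  apply Rle_trans with (/ s ^ 2 - 2 * lbar s / s ^ 2 - lbar s ^ 2).
  - assert (2 * lbar s / s ^ 2 <= 2 * u / s ^ 2).
    { apply Rmult_le_compat_r; [left; apply Rinv_0_lt_compat, Hs2|lra]. }
    assert (lbar s ^ 2 <= u ^ 2) by (apply pow_incr; lra). lra.
  - replace (/ s ^ 2 - 2 * lbar s / s ^ 2 - lbar s ^ 2) with
      ((- (1 / 2) * s ^ 3 + 3 / 4 * s ^ 2 - 3 / 64 * s - 9 / 1024) / s ^ 6) by (unfold lbar; field; lra).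
    replace (- (2 / 5) / s ^ 3) with ((- (2 / 5) * s ^ 3) / s ^ 6) by (field; lra).
    apply Rmult_le_compat_r; [left; apply Rinv_0_lt_compat, pow_lt; lra|]. nra.
Qed.

(** The values at [u = lder] and [L = lbar] differ by [u - L] times a positive factor, because
    [u^2 + u L + L^2 >= 3 L^2] and [L] is at least [0.9 / s]. At [L] the value is [3/4 s^-5] plus
    smaller terms. *)
Lemma lder2_ge (s : R) : 40 <= s -> 7 / 10 / s ^ 5 <= lder2 (s ^ 2).
Proof.
  intros Hs. pose proof (lder_ge s ltac:(lra)) as H. unfold lder2.
  set (u := lder (s ^ 2)) in *.
  assert (Hs2 : 0 < s ^ 2) by (apply pow_lt; lra).
  set (L := lbar s) in *.
  assert (HL : 9 / 10 / s <= L).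
  { unfold L, lbar. replace (/ s - 3 / 4 / s ^ 2 + 3 / 32 / s ^ 3) with ((s ^ 2 - 3 / 4 * s + 3 / 32) / s ^ 3) by (field; lra).
    replace (9 / 10 / s) with ((9 / 10 * s ^ 2) / s ^ 3) by (field; lra).
    apply Rmult_le_compat_r; [left; apply Rinv_0_lt_compat, pow_lt; lra|]. nra. }
  assert (Hi : 0 < / s) by (apply Rinv_0_lt_compat; lra).
  assert (HL2 : 81 / 100 * (/ s ^ 2) <= L ^ 2).
  { replace (81 / 100 * / s ^ 2) with ((9 / 10 / s) ^ 2) by (field; lra). apply pow_incr. split; [|exact HL].
    unfold Rdiv. nra. }
  apply Rle_trans with (2 * L ^ 3 + 6 * L ^ 2 / s ^ 2 + (6 / (s ^ 2) ^ 2 - 2 / s ^ 2) * L - 3 / (s ^ 2) ^ 2).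
  - replace (2 * L ^ 3 + 6 * L ^ 2 / s ^ 2 + (6 / (s ^ 2) ^ 2 - 2 / s ^ 2) * L - 3 / (s ^ 2) ^ 2)
      with ((3 / 4 * s ^ 4 - 27 / 16 * s ^ 3 + 45 / 512 * s ^ 2 + 27 / 2048 * s + 27 / 16384) / s ^ 9)
      by (unfold L, lbar; field; lra).
    replace (7 / 10 / s ^ 5) with ((7 / 10 * s ^ 4) / s ^ 9) by (field; lra).
    apply Rmult_le_compat_r; [left; apply Rinv_0_lt_compat, pow_lt; lra|].
    assert (27 / 16 * s ^ 3 <= 27 / 640 * s ^ 4).
    { replace (27 / 640 * s ^ 4) with (27 / 640 * s * s ^ 3) by ring.
      apply Rmult_le_compat_r; [apply pow_le; lra|lra]. }
    assert (0 <= s ^ 4) by (apply pow_le; lra). lra.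
  - apply Rminus_le_0.
    replace (2 * u ^ 3 + 6 * u ^ 2 / s ^ 2 + (6 / (s ^ 2) ^ 2 - 2 / s ^ 2) * u - 3 / (s ^ 2) ^ 2 -
        (2 * L ^ 3 + 6 * L ^ 2 / s ^ 2 + (6 / (s ^ 2) ^ 2 - 2 / s ^ 2) * L - 3 / (s ^ 2) ^ 2))
      with ((u - L) * (2 * (u ^ 2 + u * L + L ^ 2) - 2 * / s ^ 2 + (6 * (u + L) + 6 * / s ^ 2) * / s ^ 2))
      by (field; lra).
    assert (HL0 : 0 < L) by (eapply Rlt_le_trans; [|exact HL]; unfold Rdiv; nra).
    assert (Hi2 : 0 < / s ^ 2) by (apply Rinv_0_lt_compat, Hs2).
    apply Rmult_le_pos; [lra|]. apply Rplus_le_le_0_compat; [nra|].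
    apply Rmult_le_pos; lra.
Qed.

(** * Finite differences of the logarithm of the model *)

Lemma difference_ge (f df : R -> R) (a m : R) :
  (forall t, a <= t <= a + 1 -> is_derive f t (df t) /\ m <= df t) -> m <= f (a + 1) - f a.
Proof.
  intros H.
  assert (f a - m * a <= f (a + 1) - m * (a + 1)); [|lra].
  apply (derive_nonneg_le (fun t => f t - m * t) (fun t => df t - m)); [lra|].
  intros t Ht. destruct (H t Ht) as [H1 H2]. split; [|lra].
  apply (is_derive_minus f (fun t => m * t)); [exact H1|]. auto_derive; [exact I|ring].
Qed.

Lemma is_derive_shift (f df : R -> R) (r t : R) :
  is_derive f (t + r) (df (t + r)) -> is_derive (fun s => f (s + r)) t (df (t + r)).
Proof.
  intros H. replace (df (t + r)) with (scal 1 (df (t + r))) by (unfold scal; simpl; unfold mult; simpl; ring).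
  apply (is_derive_comp f (fun s => s + r)); [exact H|]. auto_derive; [exact I|ring].
Qed.

Lemma second_difference_ge (f f1 f2 : R -> R) (a m : R) :
  (forall t, a <= t <= a + 2 -> is_derive f t (f1 t) /\ is_derive f1 t (f2 t) /\ m <= f2 t) ->
  m <= f (a + 2) - 2 * f (a + 1) + f a.
Proof.
  intros H.
  replace (f (a + 2) - 2 * f (a + 1) + f a) with ((f (a + 1 + 1) - f (a + 1)) - (f (a + 1) - f a))
    by (replace (a + 1 + 1) with (a + 2) by ring; ring).
  apply (difference_ge (fun t => f (t + 1) - f t) (fun t => f1 (t + 1) - f1 t)).
  intros t Ht. split.
  - apply (is_derive_minus (fun t => f (t + 1)) f); [apply is_derive_shift|]; apply H; lra.
  - apply (difference_ge f1 f2). intros s Hs. destruct (H s) as [_ [H1 H2]]; [lra|]. split; assumption.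
Qed.

Lemma third_difference_ge (f f1 f2 f3 : R -> R) (a m : R) :
  (forall t, a <= t <= a + 3 ->
     is_derive f t (f1 t) /\ is_derive f1 t (f2 t) /\ is_derive f2 t (f3 t) /\ m <= f3 t) ->
  m <= f (a + 3) - 3 * f (a + 2) + 3 * f (a + 1) - f a.
Proof.
  intros H.
  replace (f (a + 3) - 3 * f (a + 2) + 3 * f (a + 1) - f a) with
    ((f (a + 1 + 2) - 2 * f (a + 1 + 1) + f (a + 1)) - (f (a + 2) - 2 * f (a + 1) + f a)).
  2:{ replace (a + 1 + 1) with (a + 2) by ring. replace (a + 1 + 2) with (a + 3) by ring. ring. }
  apply (difference_ge (fun t => f (t + 2) - 2 * f (t + 1) + f t)
    (fun t => f1 (t + 2) - 2 * f1 (t + 1) + f1 t)).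
  intros t Ht. split.
  - apply (is_derive_plus (fun t => f (t + 2) - 2 * f (t + 1)) f); [|apply H; lra].
    apply (is_derive_minus (fun t => f (t + 2)) (fun t => 2 * f (t + 1))).
    + apply is_derive_shift, H. lra.
    + apply (is_derive_scal (fun t => f (t + 1))). apply is_derive_shift, H. lra.
  - apply (second_difference_ge f1 f2 f3). intros s Hs.
    destruct (H s) as [_ [H1 [H2 H3]]]; [lra|]. split; [|split]; assumption.
Qed.

Section Model.

Variable c : R.
Hypothesis Hc : 0 < c.

Definition lmod (t : R) : R := ln (bes (c * t)).

Lemma is_derive_dilate (f df : R -> R) (t : R) :
  is_derive f (c * t) (df (c * t)) -> is_derive (fun s => f (c * s)) t (c * df (c * t)).
Proof.
  intros H. apply (is_derive_comp f (fun s => c * s)); [exact H|]. auto_derive; [exact I|ring].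
Qed.

(** The threshold [1600 = 40^2] is that of [lder2_ge]. The lower bound for the third derivative
    decreases, so it is taken at the right end [a + 3]. *)
Lemma lmod_third (a : R) : 1600 <= c * a ->
  c ^ 3 * (7 / 10) / sqrt (c * (a + 3)) ^ 5 <= lmod (a + 3) - 3 * lmod (a + 2) + 3 * lmod (a + 1) - lmod a.
Proof.
  intros Ha.
  assert (Hpos : forall t, a <= t -> 1600 <= c * t).
  { intros t Ht. eapply Rle_trans; [exact Ha|]. apply Rmult_le_compat_l; lra. }
  apply (third_difference_ge lmod (fun t => c * lder (c * t)) (fun t => c * (c * lder1 (c * t)))
    (fun t => c * (c * (c * lder2 (c * t))))).
  intros t Ht. pose proof (Hpos t ltac:(lra)) as Hp. split; [|split; [|split]].
  - apply (is_derive_dilate (fun x => ln (bes x)) lder), ln_bes_der. lra.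
  - apply (is_derive_scal (fun s => lder (c * s))), is_derive_dilate, lder_der. lra.
  - apply (is_derive_scal (fun s => c * lder1 (c * s))), (is_derive_scal (fun s => lder1 (c * s))),
      is_derive_dilate, lder1_der. lra.
  - set (s := sqrt (c * t)).
    assert (Hs2 : s ^ 2 = c * t) by (unfold s; apply pow2_sqrt; lra).
    assert (Hs : 40 <= s) by (apply Rsqr_incr_0_var; [|apply sqrt_pos]; unfold Rsqr; nra).
    assert (Hs3 : s <= sqrt (c * (a + 3))) by (apply sqrt_le_1; nra).
    rewrite <- Hs2. pose proof (lder2_ge s Hs) as H.
    replace (c * (c * (c * lder2 (s ^ 2)))) with (c ^ 3 * lder2 (s ^ 2)) by ring.
    unfold Rdiv. rewrite Rmult_assoc. apply Rmult_le_compat_l; [apply pow_le; lra|].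
    eapply Rle_trans; [|exact H]. apply Rmult_le_compat_l; [lra|].
    apply Rinv_le_contravar; [apply pow_lt; lra|]. apply pow_incr. lra.
Qed.

Lemma lmod_second (a : R) : 1600 <= c * a ->
  lmod (a + 2) - 2 * lmod (a + 1) + lmod a <= - (c ^ 2 * (2 / 5) / sqrt (c * (a + 2)) ^ 3).
Proof.
  intros Ha.
  assert (Hpos : forall t, a <= t -> 1600 <= c * t).
  { intros t Ht. eapply Rle_trans; [exact Ha|]. apply Rmult_le_compat_l; lra. }
  pose proof (second_difference_ge (fun t => - lmod t) (fun t => - (c * lder (c * t)))
    (fun t => - (c * (c * lder1 (c * t)))) a (c ^ 2 * (2 / 5) / sqrt (c * (a + 2)) ^ 3)) as H.
  cbv beta in H. enough (HH : c ^ 2 * (2 / 5) / sqrt (c * (a + 2)) ^ 3 <=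
      - lmod (a + 2) - 2 * - lmod (a + 1) + - lmod a) by lra.
  apply H. intros t Ht. pose proof (Hpos t ltac:(lra)) as Hp. split; [|split].
  - apply (is_derive_opp lmod). apply (is_derive_dilate (fun x => ln (bes x)) lder), ln_bes_der. lra.
  - apply (is_derive_opp (fun t => c * lder (c * t))).
    apply (is_derive_scal (fun s => lder (c * s))), is_derive_dilate, lder_der. lra.
  - set (s := sqrt (c * t)).
    assert (Hs2 : s ^ 2 = c * t) by (unfold s; apply pow2_sqrt; lra).
    assert (Hs : 40 <= s) by (apply Rsqr_incr_0_var; [|apply sqrt_pos]; unfold Rsqr; nra).
    assert (Hs3 : s <= sqrt (c * (a + 2))) by (apply sqrt_le_1; nra).
    rewrite <- Hs2. pose proof (lder1_le s Hs) as H1.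
    replace (- (c * (c * lder1 (s ^ 2)))) with (c ^ 2 * - lder1 (s ^ 2)) by ring.
    unfold Rdiv. rewrite Rmult_assoc. apply Rmult_le_compat_l; [apply pow_le; lra|].
    apply Rle_trans with (2 / 5 * / s ^ 3); [|unfold Rdiv in *; lra].
    apply Rmult_le_compat_l; [lra|].
    apply Rinv_le_contravar; [apply pow_lt; lra|]. apply pow_incr. lra.
Qed.

End Model.

(** * Numerical bounds, and the theta function on the positive real axis *)

Lemma PI_bounds : 31415 / 10000 <= PI <= 31416 / 10000.
Proof.
  pose proof (PI_2_3_7_ineq 2) as [H1 H2].
  unfold tg_alt, PI_2_3_7_tg, Ratan_seq in *. simpl in H1, H2. split; lra.
Qed.

Lemma wterm_RtoC (x : R) (m : nat) : 0 < x -> wterm (RtoC x) m = RtoC (exp (- (freq m ^ 2 / (4 * x)))).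
Proof.
  intros Hx. unfold wterm. rewrite <- cexp_RtoC. f_equal.
  rewrite RtoC_opp, RtoC_div, RtoC_mult by lra. reflexivity.
Qed.

Lemma wsum_ge (x : R) : 0 < x -> exp (- (PI ^ 2 / (4 * x))) <= Cmod (wsum (RtoC x)).
Proof.
  intros Hx.
  pose proof (Ccv_mod _ _ (wsum_cv (RtoC x) Hx)) as H.
  apply (is_lim_seq_le_loc (fun _ => exp (- (PI ^ 2 / (4 * x)))) (fun n => Cmod (Csum (wterm (RtoC x)) n))
    (exp (- (PI ^ 2 / (4 * x)))) (Cmod (wsum (RtoC x)))); [|apply is_lim_seq_const|exact H].
  exists 1%nat. intros n Hn.
  rewrite (Csum_ext _ (fun m => RtoC (exp (- (freq m ^ 2 / (4 * x)))))) by (intros; apply wterm_RtoC, Hx).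
  rewrite Csum_RtoC.
  assert (Hp : forall m, 0 <= exp (- (freq m ^ 2 / (4 * x)))) by (intros; left; apply exp_pos).
  rewrite Cmod_RtoC_pos by (apply Rsum_ge0; auto).
  eapply Rle_trans; [|apply (Rsum_mono _ 1 n Hp Hn)].
  simpl. rewrite Rplus_0_l. right. f_equal. unfold freq. simpl. f_equal. f_equal. ring.
Qed.

Lemma wsum_2_le : Cmod (wsum (RtoC 2)) <= 1.
Proof.
  apply (Cseries_mod_le (wterm (RtoC 2))); [|apply wsum_cv; simpl; lra].
  assert (H1 : exp (-2) <= / 7).
  { pose proof (Rsum_exp_le 2 5 ltac:(lra)) as H. simpl in H.
    replace (-2) with (Ropp 2) by ring. rewrite exp_Ropp. apply Rinv_le_contravar; lra. }
  assert (H2 : exp (-1) <= / 2).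
  { replace (-1) with (Ropp 1) by ring. rewrite exp_Ropp. apply Rinv_le_contravar; [lra|]. pose proof (exp_ineq1_le 1). lra. }
  pose proof (exp_pos (-1)). pose proof (exp_pos (-2)).
  intros n. apply Rle_trans with (Rsum (fun m => exp (-1) * exp (-2) ^ m) n).
  - apply Rsum_le. intros m _. rewrite wterm_RtoC by lra.
    rewrite Cmod_RtoC_pos by (left; apply exp_pos).
    apply Rle_trans with (exp (-1 + INR m * -2)).
    + apply exp_le. unfold freq. pose proof PI_bounds. pose proof (pos_INR m).
      assert (8 <= PI ^ 2) by nra.
      assert (8 * (2 * INR m + 1) ^ 2 <= (PI * (2 * INR m + 1)) ^ 2).
      { rewrite Rpow_mult_distr. apply Rmult_le_compat_r; [apply pow2_ge_0|lra]. }
      nra.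
    + rewrite exp_plus. right. f_equal. clear. induction m as [|m IH]; [simpl; rewrite Rmult_0_l; apply exp_0|].
      rewrite S_INR, Rmult_plus_distr_r, exp_plus, IH. simpl. rewrite Rmult_1_l. ring.
  - rewrite Rsum_scal. pose proof (Rsum_geom_le (exp (-2)) n ltac:(lra)) as Hg.
    assert (/ (1 - exp (-2)) <= 7 / 6).
    { replace (7 / 6) with (/ (1 - / 7)) by field. apply Rinv_le_contravar; lra. }
    apply Rle_trans with (exp (-1) * (7 / 6)); [|lra]. apply Rmult_le_compat_l; [lra|].
    eapply Rle_trans; [exact Hg|assumption].
Qed.

Lemma theta_2_ge : 2 / 3 <= Cmod (theta (cexp (- RtoC 2))).
Proof.
  set (q := cexp (- RtoC 2)).
  assert (Eq : q = RtoC (exp (-2))) by (unfold q; rewrite <- RtoC_opp, cexp_RtoC; reflexivity).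
  assert (H1 : exp (-2) <= / 7).
  { pose proof (Rsum_exp_le 2 5 ltac:(lra)) as H. simpl in H.
    replace (-2) with (Ropp 2) by ring. rewrite exp_Ropp. apply Rinv_le_contravar; lra. }
  pose proof (exp_pos (-2)) as H0.
  assert (Hq : Cmod q = exp (-2)) by (rewrite Eq; apply Cmod_RtoC_pos; lra).
  assert (Hq1 : Cmod q < 1) by (rewrite Hq; lra).
  assert (H : Cmod (theta q - 1)%C <= / 3).
  { apply (Ccv_mod_le (fun n => theta_sum q n - 1)%C _ _ 0).
    - apply Ccv_minus; [apply theta_cv, Hq1|apply Ccv_const].
    - intros n _. unfold theta_sum.
      match goal with |- Cmod (Cminus (Cplus _ ?x) _) <= _ => replace (1 + x - 1)%C with x by ring end.
      rewrite Cmod_mult, Cmod_RtoC_pos by lra.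
      apply Rle_trans with (2 * Rsum (fun j => exp (-2) * exp (-2) ^ j) n).
      + apply Rmult_le_compat_l; [lra|]. eapply Rle_trans; [apply Csum_Cmod|]. apply Rsum_le. intros j _.
        rewrite Cmod_mult, Cmod_sign, Cmod_pow, Rmult_1_l, Hq.
        change (exp (-2) * exp (-2) ^ j) with (exp (-2) ^ S j).
        replace (S j * S j)%nat with (S j + j * S j)%nat by lia. rewrite pow_add.
        rewrite <- (Rmult_1_r (exp (-2) ^ S j)) at 2. apply Rmult_le_compat_l; [apply pow_le; lra|].
        rewrite <- (pow1 (j * S j)). apply pow_incr. lra.
      + rewrite Rsum_scal. pose proof (Rsum_geom_le (exp (-2)) n ltac:(lra)) as Hg.
        assert (/ (1 - exp (-2)) <= 7 / 6).
        { replace (7 / 6) with (/ (1 - / 7)) by field. apply Rinv_le_contravar; lra. }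
        apply Rle_trans with (2 * (exp (-2) * (7 / 6))); [|lra].
        apply Rmult_le_compat_l; [lra|]. apply Rmult_le_compat_l; [lra|].
        eapply Rle_trans; [exact Hg|assumption]. }
  pose proof (Cmod_triangle_sub 1 (theta q)) as H2. rewrite Cmod_1, Cmod_sub_sym in H2. lra.
Qed.

(* The transformation formula is applied between [x] and the fixed point [2]. *)
Lemma inv_theta_real (x : R) : 0 < x <= 2 ->
  / Cmod (theta (RtoC (exp (- x)))) <= 3 / 2 * sqrt (x / 2) * exp (PI ^ 2 / (4 * x)).
Proof.
  intros Hx. set (kap := sqrt (2 / x)).
  assert (Hk2 : kap ^ 2 = 2 / x).
  { unfold kap. apply pow2_sqrt. apply Rmult_le_pos; [lra|]. left. apply Rinv_0_lt_compat. lra. }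
  assert (Hk : 1 <= kap).
  { rewrite <- sqrt_1. apply sqrt_le_1_alt. apply Rmult_le_reg_r with x; [lra|].
    unfold Rdiv. rewrite Rmult_assoc, Rinv_l by lra. lra. }
  pose proof (theta_transform kap (RtoC x) ltac:(simpl; lra) Hk) as E.
  replace (RtoC (kap ^ 2) * RtoC x)%C with (RtoC 2) in E.
  2:{ rewrite Hk2, <- RtoC_mult. f_equal. field. lra. }
  replace (cexp (- RtoC x)) with (RtoC (exp (- x))) in E by (rewrite <- RtoC_opp, cexp_RtoC; reflexivity).
  apply (f_equal Cmod) in E. rewrite !Cmod_mult, Cmod_RtoC_pos in E by lra.
  pose proof (wsum_ge x ltac:(lra)) as HW. pose proof wsum_2_le as HW2. pose proof theta_2_ge as HT.
  assert (Hr : Cmod (RtoC (exp (- x))) < 1).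
  { rewrite Cmod_RtoC_pos by (left; apply exp_pos). rewrite <- exp_0. apply exp_increasing. lra. }
  pose proof (proj1 (Cmod_gt_0 _) (theta_neq0 _ Hr)) as Hth.
  set (th := Cmod (theta (RtoC (exp (- x))))) in *. set (W := Cmod (wsum (RtoC x))) in *.
  set (W2 := Cmod (wsum (RtoC 2))) in *. set (T2 := Cmod (theta (cexp (- RtoC 2)))) in *.
  assert (Hs : sqrt (x / 2) = / kap).
  { unfold kap. rewrite <- sqrt_inv. f_equal. field. lra. }
  rewrite Hs.
  pose proof (exp_pos (PI ^ 2 / (4 * x))) as He. rewrite exp_Ropp in HW.
  apply Rmult_le_reg_l with th; [exact Hth|]. rewrite Rinv_r by lra.
  apply Rmult_le_reg_l with (kap * / exp (PI ^ 2 / (4 * x))).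
  { apply Rmult_lt_0_compat; [lra|apply Rinv_0_lt_compat, He]. }
  replace (kap * / exp (PI ^ 2 / (4 * x)) * (th * (3 / 2 * / kap * exp (PI ^ 2 / (4 * x))))) with (3 / 2 * th)
    by (field; lra).
  rewrite Rmult_1_r.
  (* The factor [3/2] of the claim is the inverse of the lower bound [2/3] for theta at the base
     point; the dual series there is at most 1. *)
  assert (H1 : kap * T2 * W <= th) by (rewrite E; rewrite <- (Rmult_1_r th) at 2; apply Rmult_le_compat_l; lra).
  assert (Hi : 0 < / exp (PI ^ 2 / (4 * x))) by (apply Rinv_0_lt_compat, He).
  assert (H2 : kap * / exp (PI ^ 2 / (4 * x)) * (2 / 3) <= kap * T2 * W).
  { replace (kap * / exp (PI ^ 2 / (4 * x)) * (2 / 3)) with (kap * (2 / 3) * / exp (PI ^ 2 / (4 * x))) by ring.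
    apply Rmult_le_compat; [nra|lra| |exact HW]. apply Rmult_le_compat_l; lra. }
  lra.
Qed.

(** * Major and minor arcs *)

Definition cst (k : nat) : R := PI ^ 2 / 4 * (1 - / INR k).

Lemma INR_k (k : nat) : (2 <= k <= 9)%nat -> 2 <= INR k <= 9.
Proof.
  intros Hk. destruct Hk as [H1 H2]. apply le_INR in H1. apply le_INR in H2. simpl in H1, H2. lra.
Qed.

Lemma cst_bounds (k : nat) : (2 <= k <= 9)%nat -> 12336 / 10000 <= cst k <= 21934 / 10000.
Proof.
  intros Hk. pose proof (INR_k k Hk) as Hi. pose proof PI_bounds as HP. unfold cst.
  assert (/ 9 <= / INR k <= / 2) by (split; apply Rinv_le_contravar; lra).
  assert (98690 / 10000 <= PI ^ 2 <= 98697 / 10000) by nra. split; nra.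
Qed.

(** [pi^2/4] is the rate of [1 / theta] at [|q|]; [-2] and [1/18] come from the Poisson kernels at
    [|q|] and at a point [q] with [|1 - q| >= 6 x]. *)
Lemma rate_bound : PI ^ 2 / 4 - 2 + / 18 <= 523 / 1000.
Proof. pose proof PI_bounds. assert (PI ^ 2 <= 98697 / 10000) by nra. lra. Qed.

Section Estimate.

Variables (k : nat) (x : R).
Hypothesis Hk : (2 <= k <= 9)%nat.
Hypothesis Hx : 0 < x <= / 25.

Variable z : C.
Hypothesis Hz : Re z = x.

Let q : C := cexp (- z).
Let r : R := exp (- x).

Lemma Cmod_q_r : Cmod q = r.
Proof. unfold q, r. rewrite Cmod_cexp. f_equal. rewrite <- Hz. reflexivity. Qed.

Lemma r_bounds : 1 - x <= r /\ r <= / (1 + x) /\ 0 < r /\ r < 1.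
Proof.
  unfold r. pose proof (exp_ineq1_le (- x)). pose proof (exp_ineq1_le x). pose proof (exp_pos (- x)).
  split; [lra|]. split; [rewrite exp_Ropp; apply Rinv_le_contravar; lra|]. split; [assumption|].
  rewrite <- exp_0. apply exp_increasing. lra.
Qed.

(** The trivial bound is at most [3 + 2 / x], and [x <= 1/25] turns the 3 into [0.12 / x]. Losing
    powers of [1/x] is harmless against the exponential margin. *)
Lemma theta_qk_le : Cmod (theta (q ^ k)) <= 212 / 100 / x.
Proof.
  pose proof r_bounds as [R1 [R2 [R3 R4]]].
  assert (Hrk : Cmod (q ^ k)%C <= r).
  { rewrite Cmod_pow, Cmod_q_r. destruct k as [|j]; [lia|]. simpl.
    assert (r ^ j <= 1 ^ j) by (apply pow_incr; lra). rewrite pow1 in *. nra. }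
  eapply Rle_trans; [apply theta_bound; lra|].
  assert (H1 : x / (1 + x) <= 1 - Cmod (q ^ k)%C).
  { replace (x / (1 + x)) with (1 - / (1 + x)) by (field; lra). lra. }
  assert (H2 : / (1 - Cmod (q ^ k)%C) <= / (x / (1 + x))).
  { apply Rinv_le_contravar; [|exact H1]. apply Rmult_lt_0_compat; [lra|apply Rinv_0_lt_compat; lra]. }
  replace (/ (x / (1 + x))) with (/ x + 1) in H2 by (field; lra).
  assert (H3 : 25 <= / x) by (rewrite <- (Rinv_inv 25); apply Rinv_le_contravar; lra).
  unfold Rdiv. lra.
Qed.

Lemma sqrt_half_le : sqrt (x / 2) <= 70711 / 100000 * sqrt x.
Proof.
  unfold Rdiv at 1. rewrite sqrt_mult by lra. rewrite Rmult_comm.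
  apply Rmult_le_compat_r; [apply sqrt_pos|].
  rewrite <- (sqrt_pow2 (70711 / 100000)) by lra. apply sqrt_le_1_alt. lra.
Qed.

Lemma minor_f (f : C) : (f * theta q = theta (q ^ k))%C -> 6 * x <= Cmod (1 - q)%C ->
  Cmod f <= 7 / sqrt x * exp (523 / 1000 / x).
Proof.
  intros Hf Hmin. pose proof r_bounds as [R1 [R2 [R3 R4]]].
  assert (Hq1 : Cmod q < 1) by (rewrite Cmod_q_r; exact R4).
  pose proof (theta_neq0 q Hq1) as Hn.
  assert (E : Cmod f = Cmod (theta (q ^ k)) * / Cmod (theta q)).
  { rewrite <- Hf, Cmod_mult. apply Cmod_gt_0 in Hn. field. lra. }
  rewrite E. pose proof theta_qk_le as H1.
  pose proof (theta_inv_le q Hq1) as H2. rewrite Cmod_q_r in H2.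
  pose proof (inv_theta_real x ltac:(lra)) as H3. fold r in H3.
  assert (H4 : (1 - r ^ 2) / Cmod (1 - q)%C ^ 2 <= / 18 * / x).
  { assert (G1 : 1 - r ^ 2 <= 2 * x) by nra.
    assert (G2 : (6 * x) ^ 2 <= Cmod (1 - q)%C ^ 2) by (apply pow_incr; lra).
    assert (G3 : / Cmod (1 - q)%C ^ 2 <= / (6 * x) ^ 2) by (apply Rinv_le_contravar; [apply pow_lt; lra|exact G2]).
    apply Rle_trans with (2 * x * / (6 * x) ^ 2).
    - apply Rmult_le_compat; [nra| |exact G1|exact G3]. left. apply Rinv_0_lt_compat.
      eapply Rlt_le_trans; [|exact G2]. apply pow_lt. lra.
    - right. field. lra. }
  assert (H5 : / x - 1 <= r / (1 - r)).
  { apply Rmult_le_reg_r with (x * (1 - r)); [apply Rmult_lt_0_compat; lra|].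
    replace ((/ x - 1) * (x * (1 - r))) with ((1 - x) * (1 - r)) by (field; lra).
    replace (r / (1 - r) * (x * (1 - r))) with (r * x) by (field; lra). nra. }
  pose proof rate_bound as HR.
  assert (Hix : 0 < / x) by (apply Rinv_0_lt_compat; lra).
  set (e1 := (1 - r ^ 2) / Cmod (1 - q)%C ^ 2 - 1 - 2 * r / (1 - r)) in *.
  assert (H6 : PI ^ 2 / (4 * x) + e1 <= 523 / 1000 / x + 1).
  { replace (PI ^ 2 / (4 * x)) with (PI ^ 2 / 4 * / x) by (field; lra).
    unfold e1. replace (2 * r / (1 - r)) with (2 * (r / (1 - r))) by (field; lra).
    assert ((PI ^ 2 / 4 - 2 + / 18) * / x <= 523 / 1000 * / x) by (apply Rmult_le_compat_r; lra).
    unfold Rdiv in *. lra. }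
  assert (H7 : / Cmod (theta q) <= 3 / 2 * (70711 / 100000 * sqrt x) * (exp (523 / 1000 / x) * 3)).
  { eapply Rle_trans; [exact H2|].
    apply Rle_trans with (3 / 2 * (70711 / 100000 * sqrt x) * exp (PI ^ 2 / (4 * x)) * exp e1).
    - apply Rmult_le_compat_r; [left; apply exp_pos|]. eapply Rle_trans; [exact H3|].
      apply Rmult_le_compat_r; [left; apply exp_pos|]. apply Rmult_le_compat_l; [lra|apply sqrt_half_le].
    - rewrite Rmult_assoc, <- exp_plus. apply Rmult_le_compat_l.
      + apply Rmult_le_pos; [lra|]. apply Rmult_le_pos; [lra|apply sqrt_pos].
      + eapply Rle_trans; [apply exp_le, H6|]. rewrite exp_plus.
        apply Rmult_le_compat_l; [left; apply exp_pos|apply exp_le_3]. }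
  assert (Hsx : 0 < sqrt x) by (apply sqrt_lt_R0; lra).
  assert (Hss : sqrt x * sqrt x = x) by (apply sqrt_sqrt; lra).
  pose proof (exp_pos (523 / 1000 / x)) as He.
  apply Rle_trans with (212 / 100 / x * (3 / 2 * (70711 / 100000 * sqrt x) * (exp (523 / 1000 / x) * 3))).
  - apply Rmult_le_compat; [apply Cmod_ge_0| |exact H1|exact H7].
    left. apply Rinv_0_lt_compat, Cmod_gt_0, Hn.
  (* [2.12 * 1.5 * 0.70711 * 3 < 7], where 3 bounds the factor [e] left over from the exponents. *)
  - replace (212 / 100 / x) with (212 / 100 / (sqrt x * sqrt x)) by (rewrite Hss; reflexivity).
    replace (212 / 100 / (sqrt x * sqrt x) * (3 / 2 * (70711 / 100000 * sqrt x) * (exp (523 / 1000 / x) * 3)))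
      with (212 / 100 * (3 / 2) * (70711 / 100000) * 3 * (/ sqrt x * exp (523 / 1000 / x))) by (field; lra).
    replace (7 / sqrt x * exp (523 / 1000 / x)) with (7 * (/ sqrt x * exp (523 / 1000 / x))) by (field; lra).
    apply Rmult_le_compat_r; [|lra]. apply Rmult_le_pos; [|lra]. left. apply Rinv_0_lt_compat, Hsx.
Qed.

Definition model_coef (j : nat) : R := cst k ^ S j / INR (fact (S j)).

(** The exponential series of [e^(c/z) - 1] with [z^(-j-1)] replaced by [polylog z j], a series in
    [e^(-z)]. The cut at [J] keeps the sum finite; [J] tends to infinity only at the level of
    coefficients. *)
Definition model_gf (J : nat) : C := Csum (fun j => RtoC (model_coef j) * polylog z j)%C J.

Lemma model_coef_pos (j : nat) : 0 <= model_coef j.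
Proof.
  pose proof (cst_bounds k Hk). apply Rmult_le_pos; [apply pow_le; lra|].
  left. apply Rinv_0_lt_compat, INR_fact_lt_0.
Qed.

Lemma model_sum_exp (y : R) (J : nat) : 0 < y ->
  Rsum (fun j => model_coef j * y ^ S j) J <= exp (cst k * y).
Proof.
  intros Hy. pose proof (cst_bounds k Hk).
  eapply Rle_trans; [|apply (Rsum_exp_le (cst k * y) (S J)); apply Rmult_le_pos; lra].
  rewrite Rsum_S0.
  rewrite (Rsum_ext (fun j => model_coef j * y ^ S j) (fun i => (cst k * y) ^ S i / INR (fact (S i)))).
  - simpl (_ ^ 0 / _). lra.
  - intros i _. unfold model_coef. rewrite Rpow_mult_distr. unfold Rdiv. ring.
Qed.

(** Makes [lam = 5 x] admissible in [polylog_bound] when [|1 - q| >= 6 x]. *)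
Lemma exp_5x : exp (5 * x) - 1 <= 6 * x.
Proof.
  pose proof (exp_ineq1_le (- (5 * x))) as H. pose proof (exp_pos (5 * x)) as Hp.
  rewrite exp_Ropp in H.
  assert (H1 : exp (5 * x) * (1 - 5 * x) <= 1).
  { apply Rle_trans with (exp (5 * x) * / exp (5 * x)); [apply Rmult_le_compat_l; lra|]. right. field. lra. }
  assert (H2 : exp (5 * x) <= 5 / 4) by nra. 
  (* Up to [1/30] the bound [exp (5 x) (1 - 5 x) <= 1] suffices; beyond it, the Taylor polynomial of
     degree 2 is needed. *)
  destruct (Rle_dec x (/ 30)) as [Hs|Hs]; [nra|].
  pose proof (cexp_taylor (RtoC (5 * x)) 3) as HT. unfold cexp_rem in HT.
  rewrite cexp_RtoC, Cmod_RtoC_pos in HT by lra. simpl in HT.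
  assert (E : (RtoC (exp (5 * x)) - (0 + 1 / 1 + RtoC (5 * x) * 1 / 1 + RtoC (5 * x) * (RtoC (5 * x) * 1) / RtoC (1 + 1)))%C
    = RtoC (exp (5 * x) - 1 - 5 * x - (5 * x) ^ 2 / 2)).
  { rewrite !RtoC_minus, RtoC_div, RtoC_pow by lra. rewrite RtoC_plus. simpl. field. }
  rewrite E, Cmod_R in HT.
  pose proof (Rle_abs (exp (5 * x) - 1 - 5 * x - (5 * x) ^ 2 / 2)).
  assert (5 * x * (5 * x * (5 * x * 1)) / (1 + 1 + 1 + 1 + 1 + 1) * exp (5 * x) <= (5 * x) ^ 2 * (1 / 5) / 6 * (5 / 4)).
  { replace (5 * x * (5 * x * (5 * x * 1)) / (1 + 1 + 1 + 1 + 1 + 1)) with ((5 * x) ^ 2 * (5 * x) / 6) by field.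
    apply Rmult_le_compat; [|lra| |exact H2].
    - apply Rmult_le_pos; [|lra]. apply Rmult_le_pos; [apply pow2_ge_0|lra].
    - unfold Rdiv. apply Rmult_le_compat_r; [lra|]. apply Rmult_le_compat_l; [apply pow2_ge_0|lra]. }
  nra.
Qed.

(** The polylogarithms are at most [(5 x)^(-i-1)], so the model is at most [e^(c / (5 x))], and
    [c / 5 < 0.44] is below the rate [0.523]. *)
Lemma minor_model (J : nat) : 6 * x <= Cmod (1 - q)%C ->
  Cmod (model_gf J) <= exp (523 / 1000 / x).
Proof.
  intros Hmin.
  assert (Hz0 : 0 < Re z) by lra.
  pose proof exp_5x as H5. pose proof (cst_bounds k Hk).
  assert (HP : forall i, Cmod (polylog z i) <= (/ (5 * x)) ^ S i).
  { apply (polylog_bound z Hz0 (5 * x)); [lra|]. fold q. lra. }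
  assert (Hi : 0 < / (5 * x)) by (apply Rinv_0_lt_compat; lra).
  unfold model_gf. eapply Rle_trans; [apply Csum_Cmod|].
  apply Rle_trans with (Rsum (fun j => model_coef j * (/ (5 * x)) ^ S j) J).
  - apply Rsum_le. intros j _. rewrite Cmod_mult, Cmod_RtoC_pos by apply model_coef_pos.
    apply Rmult_le_compat_l; [apply model_coef_pos|apply HP].
  - eapply Rle_trans; [apply model_sum_exp, Hi|]. apply exp_le.
    replace (cst k * / (5 * x)) with (cst k / 5 * / x) by (field; lra).
    unfold Rdiv at 2. apply Rmult_le_compat_r; [left; apply Rinv_0_lt_compat; lra|lra].
Qed.

(** From [|1 - q|^2 = (1 - r)^2 + 4 r sin^2 (y/2)] the half-angle is at most [3.2 x], and
    [1 + 4 * 3.2^2 < 42]. *)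
Lemma major_Cmod_z : Rabs (Im z) <= PI -> Cmod (1 - q)%C < 6 * x -> Cmod z ^ 2 <= 42 * x ^ 2.
Proof.
  intros Hy Hmaj. pose proof r_bounds as [R1 [R2 [R3 R4]]].
  set (y := Im z) in *. set (t := Rabs y / 2).
  assert (E : Cmod (1 - q)%C ^ 2 = (1 - r) ^ 2 + 4 * r * sin t ^ 2).
  { rewrite Cmod2_alt. unfold q, cexp.
    replace (Re (- z)%C) with (- x) by (rewrite <- Hz; reflexivity).
    replace (Im (- z)%C) with (- y) by reflexivity. fold r. rewrite cos_neg, sin_neg.
    unfold Re, Im, Cminus, Cplus, Copp, RtoC. simpl.
    assert (Ec : cos y = 1 - 2 * sin t * sin t).
    { rewrite <- cos_2a_sin. unfold t. replace (2 * (Rabs y / 2)) with (Rabs y) by field.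
      unfold Rabs. destruct (Rcase_abs y); [rewrite cos_neg|]; reflexivity. }
    pose proof (sin2_cos2 y) as Es. unfold Rsqr in Es.
    replace ((1 + - (r * cos y)) * ((1 + - (r * cos y)) * 1) + (0 + - (r * - sin y)) * ((0 + - (r * - sin y)) * 1))
      with (1 - 2 * r * cos y + r * r * (sin y * sin y + cos y * cos y)) by ring.
    rewrite Es, Ec. ring. }
  assert (Ht : 0 <= t <= 2).
  { unfold t. pose proof (Rabs_pos y). pose proof PI_4. lra. }
  pose proof (Cmod_ge_0 (1 - q)%C) as H0.
  assert (H1 : 4 * r * sin t ^ 2 <= (6 * x) ^ 2).
  { assert (Cmod (1 - q)%C ^ 2 <= (6 * x) ^ 2) by (apply pow_incr; lra).
    pose proof (pow2_ge_0 (1 - r)). lra. }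
  assert (H2 : sin t ^ 2 <= (31 / 10 * x) ^ 2).
  { assert (4 * (24 / 25) * sin t ^ 2 <= 4 * r * sin t ^ 2).
    { apply Rmult_le_compat_r; [apply pow2_ge_0|lra]. }
    nra. }
  (* Bootstrap: the crude sine bound confines [t] to [[0, 0.372]], where the cubic bound loses only
     3 percent. *)
  pose proof (sin_ge_third t Ht) as H3.
  assert (H4 : sin t <= 31 / 10 * x).
  { apply Rsqr_incr_0_var; [unfold Rsqr; nra|nra]. }
  assert (H5 : t <= 372 / 1000) by lra.
  pose proof (sin_ge_cubic t ltac:(lra)) as H6.
  assert (H7 : t * (97 / 100) <= sin t).
  { eapply Rle_trans; [|exact H6]. replace (t ^ 3) with (t * (t * t)) by ring.
    assert (t * t <= 15 / 100) by nra. nra. }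
  assert (H8 : t <= 32 / 10 * x) by lra.
  assert (E2 : Im z = y) by reflexivity.
  rewrite Cmod2_alt, Hz, E2, <- (pow2_abs y). replace (Rabs y) with (2 * t) by (unfold t; field).
  nra.
Qed.

End Estimate.

Lemma absbd_plus (a b : nat -> C) (A B : R) :
  absbd a A -> absbd b B -> absbd (fun n => a n + b n)%C (A + B).
Proof.
  intros HA HB n. eapply Rle_trans; [apply Rsum_le; intros; apply Cmod_triangle|].
  rewrite Rsum_plus. apply Rplus_le_compat; [apply HA|apply HB].
Qed.

Lemma absbd_scal (c : C) (a : nat -> C) (A : R) :
  absbd a A -> absbd (fun n => c * a n)%C (Cmod c * A).
Proof.
  intros HA n. rewrite (Rsum_ext _ (fun i => Cmod c * Cmod (a i))) by (intros; apply Cmod_mult).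
  rewrite Rsum_scal. apply Rmult_le_compat_l; [apply Cmod_ge_0|apply HA].
Qed.

Lemma absbd_Csum (f : nat -> nat -> C) (A : nat -> R) (J : nat) :
  (forall j, absbd (f j) (A j)) -> absbd (fun n => Csum (fun j => f j n) J) (Rsum A J).
Proof.
  intros H. induction J as [|J IH].
  - intros n. simpl. rewrite (Rsum_ext _ (fun _ => 0)), Rsum_const by (intros; apply Cmod_0). lra.
  - apply (absbd_plus (fun n => Csum (fun j => f j n) J)); [exact IH|apply H].
Qed.

Lemma absbd_ext (a b : nat -> C) (A : R) : (forall n, a n = b n) -> absbd a A -> absbd b A.
Proof. intros H HA n. rewrite (Rsum_ext _ (fun i => Cmod (a i))); [apply HA|]. intros; rewrite H; reflexivity. Qed.

Lemma wsum_tail_le (y : C) (M : R) : 0 < Re y ->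
  (forall n, Rsum (fun i => Cmod (wterm y (S i))) n <= M) ->
  Cmod (wsum y - wterm y 0)%C <= M.
Proof.
  intros Hy H.
  apply (Ccv_mod_le (fun n => Csum (wterm y) (S n) - wterm y 0)%C _ _ 0).
  - apply Ccv_minus; [|apply Ccv_const].
    apply (Ccv_subseq (Csum (wterm y)) _ S); [intros; lia|apply wsum_cv, Hy].
  - intros n _. rewrite Csum_S0.
    match goal with |- Cmod (Cminus (Cplus ?a ?b) _) <= _ => replace (a + b - a)%C with b by ring end.
    eapply Rle_trans; [apply Csum_Cmod|apply H].
Qed.

Section Major.

Variables (k : nat) (x : R).
Hypothesis Hk : (2 <= k <= 9)%nat.
Hypothesis Hx : 0 < x <= / 25.

Variable z : C.
Hypothesis Hz : Re z = x.
Hypothesis Hzx : Cmod z ^ 2 <= 42 * x ^ 2.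

Let rho : R := Re (/ z)%C.
Let c : R := cst k.

Lemma Re_z_pos : 0 < Re z.
Proof. rewrite Hz. lra. Qed.

Lemma x_le_Cmod_z : x <= Cmod z.
Proof. rewrite <- Hz. apply Re_le_Cmod. Qed.

Lemma Cmod_z_le : Cmod z <= / 2.
Proof.
  apply Rsqr_incr_0_var; [|lra]. unfold Rsqr.
  replace (Cmod z * Cmod z) with (Cmod z ^ 2) by ring. nra.
Qed.

Lemma rho_ge : 25 / 42 <= rho.
Proof.
  unfold rho. rewrite Re_inv, Hz. pose proof x_le_Cmod_z as H.
  assert (Hp : 0 < Cmod z ^ 2) by (apply pow_lt; lra).
  apply Rle_trans with (x * / (42 * x ^ 2)).
  - replace (x * / (42 * x ^ 2)) with (/ 42 * / x) by (field; lra).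
    assert (25 <= / x) by (rewrite <- (Rinv_inv 25); apply Rinv_le_contravar; lra). lra.
  - unfold Rdiv. apply Rmult_le_compat_l; [lra|]. apply Rinv_le_contravar; assumption.
Qed.

Lemma PI2_ge : 96 / 10 <= PI ^ 2.
Proof. pose proof PI_bounds. nra. Qed.

Lemma rho_geom (n : nat) : Rsum (fun i => exp (- (PI ^ 2 / 3 * rho * INR i))) n <= 2.
Proof.
  pose proof rho_ge as H1. pose proof PI2_ge as H2.
  assert (He : exp (- (1)) <= / 2).
  { rewrite exp_Ropp. apply Rinv_le_contravar; [lra|]. pose proof (exp_ineq1_le 1). lra. }
  apply Rle_trans with (Rsum (fun i => (/ 2) ^ i) n).
  - apply Rsum_le. intros i _. pose proof (pos_INR i) as Hi.
    apply Rle_trans with (exp (INR i * - (1))).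
    + apply exp_le. assert (1 <= PI ^ 2 / 3 * rho) by nra. nra.
    + clear - He. induction i as [|i IH]; [simpl; rewrite Rmult_0_l, exp_0; lra|].
      rewrite S_INR, Rmult_plus_distr_r, exp_plus, Rmult_1_l. simpl pow. rewrite Rmult_comm.
      apply Rmult_le_compat; [left; apply exp_pos|left; apply exp_pos|exact He|exact IH].
  - eapply Rle_trans; [apply Rsum_geom_le; lra|]. right. field.
Qed.

(** The modulus of the leading term [wterm z 0], the unit in which both tails are measured. *)
Let W0 : R := exp (- (PI ^ 2 / 4 * rho)).

Lemma freq_sqr (m : nat) : freq m ^ 2 = PI ^ 2 * (2 * INR m + 1) ^ 2.
Proof. unfold freq. ring. Qed.

(** The next frequency is [3 pi], and [(9 - 1) pi^2 / 4 = 2 pi^2]; the later terms are absorbed by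
    [rho_geom]. *)
Lemma wsum_tail_z : Cmod (wsum z - wterm z 0)%C <= 2 * W0 * exp (- (2 * PI ^ 2 * rho)).
Proof.
  apply wsum_tail_le; [apply Re_z_pos|]. intros n.
  pose proof rho_ge as H1. pose proof PI2_ge as H2.
  apply Rle_trans with (Rsum (fun i => W0 * exp (- (2 * PI ^ 2 * rho)) * exp (- (PI ^ 2 / 3 * rho * INR i))) n).
  - apply Rsum_le. intros i _. rewrite Cmod_wterm by apply Re_z_pos. fold rho.
    unfold W0. rewrite <- !exp_plus. apply exp_le. rewrite freq_sqr, S_INR. pose proof (pos_INR i) as Hi.
    assert (Hp : 0 <= PI ^ 2 * rho) by nra.
    assert (0 <= PI ^ 2 * rho * (INR i ^ 2 + 3 * INR i - INR i / 3)).
    { apply Rmult_le_pos; [exact Hp|]. nra. }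
    nra.
  - rewrite Rsum_scal. pose proof (rho_geom n).
    assert (0 < W0 * exp (- (2 * PI ^ 2 * rho))) by (apply Rmult_lt_0_compat; apply exp_pos). nra.
Qed.

Lemma Re_inv_kz : Re (/ (RtoC (INR k) * z))%C = rho / INR k.
Proof.
  pose proof (INR_k k Hk) as Hi. pose proof (Re_neq0 z Re_z_pos) as Hn.
  replace (/ (RtoC (INR k) * z))%C with (RtoC (/ INR k) * / z)%C.
  - rewrite Re_scale. fold rho. unfold Rdiv. ring.
  - rewrite RtoC_inv by lra. field. split; [exact Hn|]. apply RtoC_neq. lra.
Qed.

Lemma Re_kz_pos : 0 < Re (RtoC (INR k) * z)%C.
Proof. rewrite Re_scale, Hz. pose proof (INR_k k Hk). apply Rmult_lt_0_compat; lra. Qed.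

(* Here [k <= 9] enters: [(2 m + 1)^2 / k >= 1] for [m >= 1]. *)
Lemma wsum_tail_kz : Cmod (wsum (RtoC (INR k) * z) - wterm (RtoC (INR k) * z) 0)%C <= 2 * W0.
Proof.
  apply wsum_tail_le; [apply Re_kz_pos|]. intros n.
  pose proof rho_ge as H1. pose proof PI2_ge as H2. pose proof (INR_k k Hk) as Hi9.
  apply Rle_trans with (Rsum (fun i => W0 * exp (- (PI ^ 2 / 3 * rho * INR i))) n).
  - apply Rsum_le. intros i _. rewrite Cmod_wterm by apply Re_kz_pos. rewrite Re_inv_kz.
    unfold W0. rewrite <- exp_plus. apply exp_le. rewrite freq_sqr, S_INR. pose proof (pos_INR i) as Hi.
    assert (Hp : 0 <= PI ^ 2 * rho) by nra.
    assert (Hk9 : / 9 <= / INR k) by (apply Rinv_le_contravar; lra).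
    assert (H3 : PI ^ 2 * rho * (1 / 4 + INR i / 3) <= PI ^ 2 * rho * ((2 * (INR i + 1) + 1) ^ 2 / 4 * / INR k)).
    { apply Rmult_le_compat_l; [exact Hp|].
      apply Rle_trans with ((2 * (INR i + 1) + 1) ^ 2 / 4 * / 9); [nra|].
      apply Rmult_le_compat_l; [nra|exact Hk9]. }
    unfold Rdiv in *. lra.
  - rewrite Rsum_scal. pose proof (rho_geom n). assert (0 < W0) by apply exp_pos. nra.
Qed.

Lemma Cmod_wterm0 : Cmod (wterm z 0) = W0.
Proof.
  rewrite Cmod_wterm by apply Re_z_pos. fold rho. unfold W0. f_equal. rewrite freq_sqr. simpl (INR 0). field.
Qed.

Lemma wsum_z_ge : W0 / 2 <= Cmod (wsum z).
Proof.
  pose proof wsum_tail_z as H. pose proof rho_ge as H1. pose proof PI2_ge as H2.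
  assert (He : exp (- (2 * PI ^ 2 * rho)) <= / 4).
  { rewrite exp_Ropp. apply Rinv_le_contravar; [lra|]. pose proof (exp_ineq1_le (2 * PI ^ 2 * rho)). nra. }
  assert (HW : 0 < W0) by apply exp_pos.
  pose proof (Cmod_triangle_sub (wterm z 0) (wsum z)) as H3. rewrite Cmod_wterm0, Cmod_sub_sym in H3. nra.
Qed.

(** The quotient of the leading terms of the two dual series is exactly [e^(c/z)]: the origin of
    [cst]. *)
Lemma wterm_kz : wterm (RtoC (INR k) * z) 0 = (cexp (RtoC c / z) * wterm z 0)%C.
Proof.
  pose proof (INR_k k Hk) as Hi. pose proof (Re_neq0 z Re_z_pos) as Hn.
  unfold wterm. rewrite <- cexp_plus. f_equal. rewrite freq_sqr. simpl (INR 0).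
  replace (PI ^ 2 * (2 * 0 + 1) ^ 2) with (PI ^ 2) by ring.
  unfold c, cst. rewrite RtoC_mult, RtoC_minus, RtoC_inv, RtoC_div by lra. field.
  split; [exact Hn|]. apply RtoC_neq. lra.
Qed.

(** By the transformation [sqrt k f] is the quotient of the dual series at [k z] and at [z].
    Replacing both by their leading terms costs [2 W0] each, as [c < 2 pi^2] lets the tail at [z]
    outweigh [e^(c/z)]; dividing by [|wsum z| >= W0 / 2] gives 8. *)
Lemma major_f (f : C) : (f * theta (cexp (- z)) = theta (cexp (- z) ^ k))%C ->
  Cmod (RtoC (sqrt (INR k)) * f - cexp (RtoC c / z))%C <= 8.
Proof.
  intros Hf. pose proof (INR_k k Hk) as Hi. pose proof Re_z_pos as Hz0.
  assert (Hsk : 1 <= sqrt (INR k)) by (rewrite <- sqrt_1; apply sqrt_le_1_alt; lra).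
  pose proof (theta_transform (sqrt (INR k)) z Hz0 Hsk) as E.
  rewrite pow2_sqrt in E by lra.
  replace (cexp (- (RtoC (INR k) * z))) with (cexp (- z) ^ k)%C in E.
  2:{ rewrite cexp_pow. f_equal. ring. }
  pose proof (theta_neq0 _ (Cmod_cexp_opp_lt1 z Hz0)) as Hn.
  set (W := wsum z) in *. set (Wk := wsum (RtoC (INR k) * z)) in *.
  set (ez := cexp (RtoC c / z)) in *. set (th := theta (cexp (- z))) in *.
  assert (E1 : (RtoC (sqrt (INR k)) * f * W = Wk)%C).
  { replace Wk with (th * Wk / th)%C by (field; exact Hn). rewrite <- E, <- Hf. field. exact Hn. }
  assert (E2 : ((RtoC (sqrt (INR k)) * f - ez) * W =
      (Wk - wterm (RtoC (INR k) * z) 0) - ez * (W - wterm z 0))%C).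
  { rewrite wterm_kz. fold ez. rewrite <- E1. ring. }
  pose proof wsum_z_ge as HW. fold W in HW. pose proof wsum_tail_z as T1. fold W in T1.
  pose proof wsum_tail_kz as T2. fold Wk in T2.
  assert (HW0 : 0 < W0) by apply exp_pos.
  assert (Hez : Cmod ez * exp (- (2 * PI ^ 2 * rho)) <= 1).
  { unfold ez. rewrite Cmod_cexp. replace (Re (RtoC c / z)%C) with (c * rho).
    - rewrite <- exp_plus, <- exp_0. apply exp_le. pose proof (cst_bounds k Hk). fold c in H.
      pose proof rho_ge. pose proof PI2_ge. nra.
    - unfold Cdiv. rewrite Re_scale. reflexivity. }
  assert (H1 : Cmod ((RtoC (sqrt (INR k)) * f - ez) * W)%C <= 4 * W0).
  { rewrite E2. eapply Rle_trans; [apply Cmod_minus_le|]. rewrite Cmod_mult.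
    assert (Cmod ez * Cmod (W - wterm z 0)%C <= 2 * W0).
    { apply Rle_trans with (Cmod ez * (2 * W0 * exp (- (2 * PI ^ 2 * rho)))).
      - apply Rmult_le_compat_l; [apply Cmod_ge_0|exact T1].
      - replace (Cmod ez * (2 * W0 * exp (- (2 * PI ^ 2 * rho)))) with
          (2 * W0 * (Cmod ez * exp (- (2 * PI ^ 2 * rho)))) by ring.
        rewrite <- (Rmult_1_r (2 * W0)) at 2. apply Rmult_le_compat_l; lra. }
    lra. }
  rewrite Cmod_mult in H1. pose proof (Cmod_ge_0 (RtoC (sqrt (INR k)) * f - ez)%C). nra.
Qed.

(** [245 = 243 + 1 + 1]: the errors [2^(j+1)] of the polylogarithms sum to at most [e^(2 c) <= 3^5],
    the constant term of the exponential is missing from the model, and the Taylor remainder is at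
    most 1. *)
Lemma major_model (J : nat) : (c / x) ^ S J / INR (fact (S J)) * exp (c / x) <= 1 ->
  Cmod (model_gf k z J - cexp (RtoC c / z))%C <= 245.
Proof.
  intros HJ. pose proof (cst_bounds k Hk) as Hc. fold c in Hc. pose proof Re_z_pos as Hz0.
  pose proof (Re_neq0 z Hz0) as Hn. pose proof x_le_Cmod_z as Hzx2.
  set (T := Csum (fun j => RtoC (model_coef k j) * (/ z) ^ S j)%C J).
  assert (H1 : Cmod (model_gf k z J - T)%C <= exp (c * 2)).
  { unfold model_gf, T. rewrite <- Csum_minus. eapply Rle_trans; [apply Csum_Cmod|].
    eapply Rle_trans; [|apply (model_sum_exp k Hk 2 J); lra].
    apply Rsum_le. intros j _.
    replace (RtoC (model_coef k j) * polylog z j - RtoC (model_coef k j) * (/ z) ^ S j)%C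
      with (RtoC (model_coef k j) * polylog_err z j)%C by (unfold polylog_err; ring).
    pose proof (model_coef_pos k Hk j) as Hm.
    rewrite Cmod_mult, Cmod_RtoC_pos by exact Hm.
    apply Rmult_le_compat_l; [exact Hm|]. apply polylog_err_le; [exact Hz0|apply Cmod_z_le]. }
  assert (H2 : (T - cexp (RtoC c / z) = - 1 - cexp_rem (RtoC c / z) (S J))%C).
  { unfold cexp_rem. rewrite Csum_S0.
    rewrite (Csum_ext (fun i => (RtoC c / z) ^ S i / RtoC (INR (fact (S i))))%C
      (fun j => RtoC (model_coef k j) * (/ z) ^ S j)%C).
    - fold T. simpl ((RtoC c / z) ^ 0)%C. simpl (fact 0). simpl (INR 1). field.
    - intros j _. unfold model_coef. fold c. rewrite RtoC_div, RtoC_pow by apply INR_fact_neq_0.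
      unfold Cdiv. rewrite Cpow_mult_l. ring. }
  assert (H3 : Cmod (cexp_rem (RtoC c / z) (S J)) <= 1).
  { eapply Rle_trans; [apply cexp_taylor|]. eapply Rle_trans; [|exact HJ].
    assert (Hcz : Cmod (RtoC c / z)%C <= c / x).
    { rewrite Cmod_div, Cmod_RtoC_pos by (try lra; exact Hn). unfold Rdiv.
      apply Rmult_le_compat_l; [lra|]. apply Rinv_le_contravar; lra. }
    pose proof (Cmod_ge_0 (RtoC c / z)%C) as H0.
    assert (Hf : 0 < / INR (fact (S J))) by (apply Rinv_0_lt_compat, INR_fact_lt_0).
    apply Rmult_le_compat.
    - apply Rmult_le_pos; [apply pow_le, H0|lra].
    - left. apply exp_pos.
    - apply Rmult_le_compat_r; [lra|]. apply pow_incr. lra.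
    - apply exp_le, Hcz. }
  assert (H4 : exp (c * 2) <= 243).
  { apply Rle_trans with (exp (1 + 1 + 1 + 1 + 1)); [apply exp_le; lra|]. rewrite !exp_plus.
    pose proof exp_le_3 as H. pose proof (exp_pos 1).
    assert (exp 1 * exp 1 <= 9) by nra. assert (exp 1 * exp 1 * exp 1 <= 27) by nra.
    assert (exp 1 * exp 1 * exp 1 * exp 1 <= 81) by nra. nra. }
  replace (model_gf k z J - cexp (RtoC c / z))%C with
    ((model_gf k z J - T) + (T - cexp (RtoC c / z)))%C by ring.
  eapply Rle_trans; [apply Cmod_triangle|]. rewrite H2.
  pose proof (Cmod_minus_le (- 1) (cexp_rem (RtoC c / z) (S J))) as H5.
  replace (Cmod (- 1)%C) with 1 in H5 by (rewrite Cmod_R, Rabs_left; lra). lra.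
Qed.

End Major.

(** [253 = 8 + 245] adds up the errors on the major arc, so that the bound for the minor arc serves
    on the whole circle. *)
Lemma exp_rate_ge (x : R) : 0 < x <= / 25 -> 253 <= exp (523 / 1000 / x).
Proof.
  intros Hx.
  assert (H3 : 25 <= / x) by (rewrite <- (Rinv_inv 25); apply Rinv_le_contravar; lra).
  apply Rle_trans with (exp 13).
  - pose proof (Rsum_exp_le 13 4 ltac:(lra)) as H. simpl in H. lra.
  - apply exp_le. unfold Rdiv. lra.
Qed.

(** Cauchy's bound is applied to [sqrt k a] minus the coefficients of the truncated model. As [J]
    grows the latter, the sums of [c^(j+1) N^j / ((j+1)! j!)], tend to [c bes (c N)], while the
    bound does not depend on [J]. *)
Theorem coefficient_estimate (k : nat) (a : nat -> nat) (x : R) (N : nat) :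
  (2 <= k <= 9)%nat -> 0 < x <= / 25 ->
  (forall q, Cmod q < 1 -> absbd (fun n => RtoC (INR (a n)) * q ^ n)%C (ebound (Cmod q))) ->
  (forall q, Cmod q < 1 -> exists f, Ccv (Csum (fun n => RtoC (INR (a n)) * q ^ n)%C) f /\
     (f * theta q = theta (q ^ k))%C) ->
  Rabs (sqrt (INR k) * INR (a N) - cst k * bes (cst k * INR N)) * exp (- x) ^ N <=
  (7 * sqrt (INR k) + 1) / sqrt x * exp (523 / 1000 / x).
Proof.
  intros Hk Hx Hbd Hgf. set (c := cst k). set (S0 := (7 * sqrt (INR k) + 1) / sqrt x * exp (523 / 1000 / x)).
  pose proof (cst_bounds k Hk) as Hc. fold c in Hc. pose proof (INR_k k Hk) as Hi.
  assert (Hsk : 1 <= sqrt (INR k)) by (rewrite <- sqrt_1; apply sqrt_le_1_alt; lra).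
  pose proof (exp_pos (523 / 1000 / x)) as He.
  assert (Hsx : 0 < sqrt x) by (apply sqrt_lt_R0; lra).
  assert (Hsx1 : 1 <= / sqrt x).
  { rewrite <- Rinv_1. apply Rinv_le_contravar; [exact Hsx|]. rewrite <- sqrt_1. apply sqrt_le_1_alt. lra. }
  (* The coefficient of [e^(- n z)] in [model_gf k z J]. *)
  set (mj := fun J n => Rsum (fun j => model_coef k j * (INR n ^ j / INR (fact j))) J).
  assert (HJb : forall J, (c / x) ^ S J / INR (fact (S J)) * exp (c / x) <= 1 ->
      Rabs (sqrt (INR k) * INR (a N) - mj J N) * exp (- x) ^ N <= S0).
  { intros J HJ. set (h := fun n => RtoC (sqrt (INR k) * INR (a n) - mj J n)).
    replace (Rabs (sqrt (INR k) * INR (a N) - mj J N)) with (Cmod (h N)) by (unfold h; apply Cmod_R).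
    assert (Hhterm : forall (z : C) n, (h n * cexp (- z) ^ n =
       RtoC (sqrt (INR k)) * (RtoC (INR (a n)) * cexp (- z) ^ n) -
       Csum (fun j => RtoC (model_coef k j) * pterm z j n) J)%C).
    { intros z n. unfold h, mj. rewrite RtoC_minus, RtoC_mult, <- Csum_RtoC.
      transitivity (RtoC (sqrt (INR k)) * (RtoC (INR (a n)) * cexp (- z) ^ n) -
        cexp (- z) ^ n * Csum (fun i => RtoC (model_coef k i * (INR n ^ i / INR (fact i)))) J)%C; [ring|].
      f_equal. f_equal. rewrite <- Csum_scal. apply Csum_ext. intros j _. unfold pterm. rewrite RtoC_mult. ring. }
    assert (Hcv : forall z l, Re z = x -> Ccv (Csum (fun n => h n * cexp (- z) ^ n)%C) l ->
       exists f, (f * theta (cexp (- z)) = theta (cexp (- z) ^ k))%C /\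
         l = (RtoC (sqrt (INR k)) * f - model_gf k z J)%C).
    { intros z l Hz Hl. assert (Hz0 : 0 < Re z) by lra.
      destruct (Hgf _ (Cmod_cexp_opp_lt1 z Hz0)) as [f [Hf Ef]]. exists f. split; [exact Ef|].
      apply (Ccv_unique _ _ _ Hl).
      apply Ccv_ext with (fun M => RtoC (sqrt (INR k)) * Csum (fun n => RtoC (INR (a n)) * cexp (- z) ^ n) M -
        Csum (fun j => RtoC (model_coef k j) * Csum (pterm z j) M) J)%C.
      - intros M. rewrite <- Csum_scal.
        rewrite (Csum_ext (fun j => RtoC (model_coef k j) * Csum (pterm z j) M)%C
          (fun j => Csum (fun n => RtoC (model_coef k j) * pterm z j n)%C M)) by (intros; symmetry; apply Csum_scal).
        rewrite Csum_swap, <- Csum_minus. apply Csum_ext. intros n _. symmetry. apply Hhterm.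
      - apply Ccv_minus; [apply Ccv_scal, Hf|]. unfold model_gf.
        clear - Hz0. induction J as [|J IH]; [exact (Ccv_const 0)|].
        apply (Ccv_plus (fun M => Csum (fun j => RtoC (model_coef k j) * Csum (pterm z j) M)%C J)
          (fun M => RtoC (model_coef k J) * Csum (pterm z J) M)%C); [exact IH|].
        apply Ccv_scal, polylog_cv, Hz0. }
    assert (HA : exists A, absbd (fun n => h n * RtoC (exp (- x)) ^ n)%C A).
    { set (z := RtoC x). assert (Hz : 0 < Re z) by (simpl; lra).
      assert (Eq : RtoC (exp (- x)) = cexp (- z)) by (unfold z; rewrite <- RtoC_opp, cexp_RtoC; reflexivity).
      pose proof (absbd_scal (RtoC (sqrt (INR k))) _ _ (Hbd _ (Cmod_cexp_opp_lt1 z Hz))) as B1.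
      pose proof (absbd_Csum (fun j n => RtoC (model_coef k j) * pterm z j n)%C _ J
        (fun j => absbd_scal (RtoC (model_coef k j)) _ _ (pterm_bound z Hz j))) as B2.
      eexists. eapply absbd_ext; [|apply (absbd_plus _ _ _ _ B1 (absbd_scal (-1) _ _ B2))].
      intros n. rewrite Eq, Hhterm. cbv beta. ring. }
    destruct HA as [A HA].
    apply (coefficient_bound h x A S0 HA). intros z l Hz Hy Hl.
    destruct (Hcv z l Hz Hl) as [f [Ef ->]].
    destruct (Rle_lt_dec (6 * x) (Cmod (1 - cexp (- z))%C)) as [Hm|Hm].
    - pose proof (minor_f k x Hk Hx z Hz f Ef Hm) as M1.
      pose proof (minor_model k x Hk Hx z Hz J Hm) as M2.
      eapply Rle_trans; [apply Cmod_minus_le|]. rewrite Cmod_mult, Cmod_RtoC_pos by lra.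
      assert (sqrt (INR k) * Cmod f <= sqrt (INR k) * (7 / sqrt x * exp (523 / 1000 / x)))
        by (apply Rmult_le_compat_l; lra).
      assert (exp (523 / 1000 / x) <= / sqrt x * exp (523 / 1000 / x)) by nra.
      unfold S0, Rdiv in *. lra.
    - pose proof (major_Cmod_z x Hx z Hz Hy Hm) as Hzx.
      pose proof (major_f k x Hk Hx z Hz Hzx f Ef) as M1.
      pose proof (major_model k x Hk Hx z Hz Hzx J HJ) as M2.
      replace (RtoC (sqrt (INR k)) * f - model_gf k z J)%C with
        ((RtoC (sqrt (INR k)) * f - cexp (RtoC (cst k) / z)) - (model_gf k z J - cexp (RtoC (cst k) / z)))%C by ring.
      eapply Rle_trans; [apply Cmod_minus_le|].
      pose proof (exp_rate_ge x Hx) as HE.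
      assert (exp (523 / 1000 / x) <= S0); [|lra].
      unfold S0, Rdiv. rewrite <- (Rmult_1_l (exp _)) at 1. apply Rmult_le_compat_r; [lra|]. nra. }
  assert (Hlim : is_lim_seq (fun J => mj J N) (c * bes (c * INR N))).
  { pose proof (PSeries_correct bcoef (c * INR N) (ex_pseries_bcoef _)) as HP.
    apply is_pseries_R in HP.
    assert (HP2 : is_lim_seq (fun J => Rsum (fun j => bcoef j * (c * INR N) ^ j) (S J)) (bes (c * INR N))).
    { eapply is_lim_seq_ext; [|exact HP]. intros J. rewrite sum_n_Reals. apply sum_f_R0_Rsum. }
    apply is_lim_seq_incr_1 in HP2.
    apply (is_lim_seq_scal_l _ c) in HP2. simpl in HP2.
    eapply is_lim_seq_ext; [|exact HP2]. intros J. simpl. unfold mj. rewrite <- Rsum_scal. apply Rsum_ext.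
    intros j _. unfold model_coef, bcoef. fold c. rewrite Rpow_mult_distr. simpl pow. field.
    split; [apply INR_fact_neq_0|]. apply INR_fact_neq_0. }
  assert (Hev : exists J0, forall J, (J0 <= J)%nat -> (c / x) ^ S J / INR (fact (S J)) * exp (c / x) <= 1).
  { pose proof (cv_speed_pow_fact (c / x)) as HS. apply is_lim_seq_Reals in HS.
    apply (is_lim_seq_scal_r _ (exp (c / x))) in HS. simpl in HS. rewrite Rmult_0_l in HS.
    apply is_lim_seq_spec in HS. destruct (HS (mkposreal 1 Rlt_0_1)) as [J0 HJ0]. simpl in HJ0.
    exists J0. intros J HJ. specialize (HJ0 (S J) ltac:(lia)). apply Rabs_def2 in HJ0. unfold Rdiv in *. lra. }
  destruct Hev as [J0 HJ0].
  apply (is_lim_seq_le_loc (fun J => Rabs (sqrt (INR k) * INR (a N) - mj J N) * exp (- x) ^ N) (fun _ => S0)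
    (Rabs (sqrt (INR k) * INR (a N) - c * bes (c * INR N)) * exp (- x) ^ N) S0).
  - exists J0. intros J HJ. apply HJb, HJ0, HJ.
  - apply (is_lim_seq_scal_r _ (exp (- x) ^ N) (Finite _)).
    apply (is_lim_seq_abs _ (Finite _)). apply is_lim_seq_minus'; [apply is_lim_seq_const|exact Hlim].
  - apply is_lim_seq_const.
Qed.

(** * Large indices *)

Lemma exp_pow (x : R) (n : nat) : exp (INR n * x) = exp x ^ n.
Proof.
  induction n as [|n IH]; [simpl; rewrite Rmult_0_l; apply exp_0|].
  rewrite S_INR, Rmult_plus_distr_r, exp_plus, IH, Rmult_1_l. simpl. ring.
Qed.

(** [0.576 = 2 - 1.424] is the margin between the Bessel term and the error, and [2400 = 6 * 400]
    undoes the [1/6] of [bes_lower]. Of the seven powers, five give the size of the error and two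
    pay for [s sqrt s] and a further [sqrt s]. Seventh roots are compared, where the left side is
    linear. *)
Lemma exp_ge_pow7 (s : R) : 66 <= s -> 2400 * s ^ 7 <= exp (576 / 1000 * s).
Proof.
  intros Hs.
  assert (H1 : 27 / 10 <= exp 1).
  { pose proof (Rsum_exp_le 1 5 ltac:(lra)) as H. simpl in H. lra. }
  assert (H5 : 143 <= exp 5).
  { replace 5 with (INR 5 * 1) by (simpl; ring). rewrite exp_pow.
    apply Rle_trans with ((27 / 10) ^ 5); [simpl; lra|]. apply pow_incr. lra. }
  assert (HE : 204 <= exp (576 / 7000 * 66)).
  { replace (576 / 7000 * 66) with (5 + (576 / 7000 * 66 - 5)) by ring. rewrite exp_plus.
    pose proof (exp_ineq1_le (576 / 7000 * 66 - 5)). nra. }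
  assert (Hl : 305 / 100 * s <= exp (576 / 7000 * s)).
  { replace (576 / 7000 * s) with (576 / 7000 * 66 + 576 / 7000 * (s - 66)) by ring. rewrite exp_plus.
    pose proof (exp_ineq1_le (576 / 7000 * (s - 66))).
    apply Rle_trans with (204 * (1 + 576 / 7000 * (s - 66))); [nra|].
    apply Rmult_le_compat; nra. }
  replace (576 / 1000 * s) with (INR 7 * (576 / 7000 * s)) by (simpl; field). rewrite exp_pow.
  apply Rle_trans with ((305 / 100 * s) ^ 7).
  - rewrite Rpow_mult_distr. apply Rmult_le_compat_r; [apply pow_le; lra|]. simpl. lra.
  - apply pow_incr. lra.
Qed.

Lemma ln_near (u e : R) : Rabs (u - 1) <= e -> e <= / 2 -> Rabs (ln u) <= 2 * e.
Proof.
  intros Hu He. apply Rabs_le_between in Hu.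
  assert (H0 : 0 < u) by lra.
  assert (H1 : forall y, 0 < y -> ln y <= y - 1).
  { intros y Hy. pose proof (exp_ineq1_le (ln y)) as H. rewrite exp_ln in H by exact Hy. lra. }
  apply Rabs_le. split.
  - pose proof (H1 (/ u) (Rinv_0_lt_compat _ H0)) as H. rewrite ln_Rinv in H by exact H0.
    assert (/ u <= 1 + 2 * e); [|lra].
    apply Rmult_le_reg_l with u; [exact H0|]. rewrite Rinv_r by lra. nra.
  - pose proof (H1 u H0). lra.
Qed.

Section Large.

Variables (k : nat) (a : nat -> nat).
Hypothesis Hk : (2 <= k <= 9)%nat.
Hypothesis Hbd : forall q, Cmod q < 1 -> absbd (fun n => RtoC (INR (a n)) * q ^ n)%C (ebound (Cmod q)).
Hypothesis Hgf : forall q, Cmod q < 1 -> exists f, Ccv (Csum (fun n => RtoC (INR (a n)) * q ^ n)%C) f /\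
     (f * theta q = theta (q ^ k))%C.

Let c : R := cst k.

(** [x = c/s] is the saddle point, where [e^(x N)] and [e^(c/x)] both equal [e^s]. The error is at
    most [22 sqrt s e^(1.424 s)]: [22 = 7 * 3 + 1] as [sqrt k <= 3], and [0.424] bounds [0.523 / c]
    even for the least [c]. The Bessel term times [s sqrt s] is at least [400 s^7 e^(1.424 s)], and
    [0.055 = 22 / 400]. *)
Lemma relative_error (N : nat) (s : R) : 66 <= s -> s ^ 2 = c * INR N ->
  Rabs (sqrt (INR k) * INR (a N) / (c * bes (c * INR N)) - 1) <= 55 / 1000 / s ^ 5.
Proof.
  intros Hs HsN. pose proof (cst_bounds k Hk) as Hc. fold c in Hc. pose proof (INR_k k Hk) as Hi.
  assert (Hx : 0 < c / s <= / 25).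
  { split; [apply Rdiv_lt_0_compat; lra|]. apply Rmult_le_reg_r with s; [lra|].
    unfold Rdiv. rewrite Rmult_assoc, Rinv_l by lra. lra. }
  pose proof (coefficient_estimate k a (c / s) N Hk Hx Hbd Hgf) as H. fold c in H.
  assert (EN : INR N = s ^ 2 / c) by (rewrite HsN; field; lra).
  replace (exp (- (c / s)) ^ N) with (exp (- s)) in H.
  2:{ rewrite <- exp_pow. f_equal. rewrite EN. field. lra. }
  replace (523 / 1000 / (c / s)) with (523 / 1000 / c * s) in H by (field; lra).
  assert (Hsq : sqrt (INR k) <= 3).
  { rewrite <- (sqrt_pow2 3) by lra. apply sqrt_le_1_alt. lra. }
  assert (Hss : 0 < sqrt s) by (apply sqrt_lt_R0; lra).
  assert (Hix : / sqrt (c / s) <= sqrt s).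
  { rewrite sqrt_div by lra. assert (1 <= sqrt c) by (rewrite <- sqrt_1; apply sqrt_le_1_alt; lra).
    replace (/ (sqrt c / sqrt s)) with (sqrt s * / sqrt c) by (field; lra).
    rewrite <- (Rmult_1_r (sqrt s)) at 2. apply Rmult_le_compat_l; [lra|].
    rewrite <- Rinv_1. apply Rinv_le_contravar; lra. }
  assert (Hex : exp (523 / 1000 / c * s) <= exp (424 / 1000 * s)).
  { apply exp_le, Rmult_le_compat_r; [lra|]. apply Rmult_le_reg_r with c; [lra|].
    unfold Rdiv at 1. rewrite Rmult_assoc, Rinv_l by lra. lra. }
  set (B := bes (c * INR N)) in *.
  assert (HB : / 6 * exp (2 * s) <= B * (s * sqrt s)).
  { unfold B. rewrite <- HsN. apply bes_lower. lra. }
  pose proof (exp_ge_pow7 s Hs) as H7.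
  assert (HB0 : 0 < B) by (apply bes_pos; rewrite <- HsN; apply pow2_ge_0).
  set (D := Rabs (sqrt (INR k) * INR (a N) - c * B)) in *.
  assert (HD : D <= 22 * sqrt s * exp (1424 / 1000 * s)).
  { apply Rmult_le_reg_r with (exp (- s)); [apply exp_pos|].
    replace (22 * sqrt s * exp (1424 / 1000 * s) * exp (- s)) with (22 * sqrt s * exp (424 / 1000 * s)).
    2:{ rewrite (Rmult_assoc _ (exp _) (exp _)), <- exp_plus. do 2 f_equal. field. }
    eapply Rle_trans; [exact H|]. pose proof (sqrt_pos (INR k)).
    apply Rmult_le_compat; [|left; apply exp_pos| |exact Hex].
    - apply Rmult_le_pos; [lra|]. left. apply Rinv_0_lt_compat, sqrt_lt_R0. lra.
    - apply Rmult_le_compat; [lra| |lra|exact Hix].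
      left. apply Rinv_0_lt_compat, sqrt_lt_R0. lra. }
  assert (E2 : exp (2 * s) = exp (1424 / 1000 * s) * exp (576 / 1000 * s)).
  { rewrite <- exp_plus. f_equal. field. }
  pose proof (exp_pos (1424 / 1000 * s)) as HE.
  replace (sqrt (INR k) * INR (a N) / (c * B) - 1) with
    ((sqrt (INR k) * INR (a N) - c * B) * / (c * B)) by (field; lra).
  rewrite Rabs_mult. fold D. rewrite (Rabs_right (/ (c * B))).
  2:{ left. apply Rinv_0_lt_compat. nra. }
  assert (Hs5 : 0 < s ^ 5) by (apply pow_lt; lra).
  assert (G1 : 400 * s ^ 7 * exp (1424 / 1000 * s) <= B * (s * sqrt s)).
  { eapply Rle_trans; [|exact HB]. rewrite E2. nra. }
  assert (G2 : D * s ^ 5 <= 55 / 1000 * B).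
  { apply Rmult_le_reg_r with (s * sqrt s); [nra|].
    apply Rle_trans with (55 / 1000 * (400 * s ^ 7 * exp (1424 / 1000 * s))); [|nra].
    apply Rle_trans with (22 * sqrt s * exp (1424 / 1000 * s) * s ^ 5 * (s * sqrt s)).
    - apply Rmult_le_compat_r; [nra|]. apply Rmult_le_compat_r; lra.
    - right. replace (22 * sqrt s * exp (1424 / 1000 * s) * s ^ 5 * (s * sqrt s)) with
        (22 * exp (1424 / 1000 * s) * s ^ 6 * (sqrt s * sqrt s)) by ring.
      rewrite sqrt_sqrt by lra. field. }
  assert (0 <= D) by apply Rabs_pos.
  apply Rmult_le_reg_r with (s ^ 5 * (c * B)); [apply Rmult_lt_0_compat; [lra|apply Rmult_lt_0_compat; lra]|].
  replace (D * / (c * B) * (s ^ 5 * (c * B))) with (D * s ^ 5) by (field; lra).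
  replace (55 / 1000 / s ^ 5 * (s ^ 5 * (c * B))) with (55 / 1000 * B * c) by (field; lra).
  nra.
Qed.

(** Asking only for [s^2 <= c N] lets one [s] serve four consecutive indices. Taking logarithms
    doubles [0.055]. *)
Lemma log_error (N : nat) (s : R) : 66 <= s -> s ^ 2 <= c * INR N ->
  0 < INR (a N) /\
  Rabs (ln (INR (a N)) + ln (sqrt (INR k) / c) - lmod c (INR N)) <= 11 / 100 / s ^ 5.
Proof.
  intros Hs HsN. pose proof (cst_bounds k Hk) as Hc. fold c in Hc. pose proof (INR_k k Hk) as Hi.
  set (t := sqrt (c * INR N)).
  assert (Hst : s <= t) by (rewrite <- (sqrt_pow2 s) by lra; apply sqrt_le_1_alt; exact HsN).
  assert (Ht : t ^ 2 = c * INR N) by (apply pow2_sqrt; nra).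
  pose proof (relative_error N t ltac:(lra) Ht) as H.
  set (B := bes (c * INR N)) in *.
  assert (HB0 : 0 < B) by (apply bes_pos; rewrite <- Ht; apply pow2_ge_0).
  assert (Hs5 : 0 < s ^ 5) by (apply pow_lt; lra).
  assert (Hst5 : / t ^ 5 <= / s ^ 5) by (apply Rinv_le_contravar; [exact Hs5|apply pow_incr; lra]).
  assert (Hs5' : 1 <= s ^ 5) by (apply pow_R1_Rle; lra).
  assert (/ s ^ 5 <= 1) by (rewrite <- Rinv_1; apply Rinv_le_contravar; lra).
  assert (Hsk : 0 < sqrt (INR k)) by (apply sqrt_lt_R0; lra).
  assert (Ha : 0 < INR (a N)).
  { destruct (Req_dec (INR (a N)) 0) as [E|E]; [|pose proof (pos_INR (a N)); lra].
    rewrite E in H. unfold Rdiv in H at 1. rewrite Rmult_0_r, Rmult_0_l in H.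
    rewrite Rabs_left in H by lra. unfold Rdiv in H. lra. }
  split; [exact Ha|].
  pose proof (ln_near _ _ H ltac:(unfold Rdiv; lra)) as HL.
  replace (ln (sqrt (INR k) * INR (a N) / (c * B))) with
    (ln (INR (a N)) + ln (sqrt (INR k) / c) - lmod c (INR N)) in HL.
  - eapply Rle_trans; [exact HL|]. unfold Rdiv. lra.
  - unfold lmod. fold B. rewrite !ln_div by nra. rewrite !ln_mult by lra. ring.
Qed.

(** The weights 1, 3, 3, 1 turn the errors [0.11 s^-5] into [0.88 s^-5], against at least
    [0.89 s^-5] from the model; for second differences [0.44] stands against [0.45]. The constant
    [ln (sqrt k / c)] cancels. *)
Lemma log_differences (N : nat) : 4356 <= c * INR N ->
  let l i := ln (INR (a (i + N))) in
  (forall i, 0 < INR (a (i + N))) /\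
  0 < l 3%nat - 3 * l 2%nat + 3 * l 1%nat - l 0%nat /\ l 2%nat - 2 * l 1%nat + l 0%nat < 0.
Proof.
  intros HN l. pose proof (cst_bounds k Hk) as Hc. fold c in Hc.
  set (s := sqrt (c * INR N)).
  assert (Hs2 : s ^ 2 = c * INR N) by (apply pow2_sqrt; lra).
  assert (Hs : 66 <= s).
  { unfold s. rewrite <- (sqrt_pow2 66) by lra. apply sqrt_le_1_alt. lra. }
  assert (HR : forall i, s ^ 2 <= c * INR (i + N)).
  { intros i. rewrite plus_INR. pose proof (pos_INR i). nra. }
  assert (HP := fun i => proj1 (log_error (i + N) s Hs (HR i))).
  split; [exact HP|].
  assert (HE := fun i => proj2 (log_error (i + N) s Hs (HR i))).
  pose proof (HE 0%nat) as E0. pose proof (HE 1%nat) as E1.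
  pose proof (HE 2%nat) as E2. pose proof (HE 3%nat) as E3.
  fold (l 0%nat) in E0. fold (l 1%nat) in E1. fold (l 2%nat) in E2. fold (l 3%nat) in E3.
  replace (INR (0 + N)) with (INR N) in E0 by reflexivity.
  replace (INR (1 + N)) with (INR N + 1) in E1 by (rewrite plus_INR; simpl; ring).
  replace (INR (2 + N)) with (INR N + 2) in E2 by (rewrite plus_INR; simpl; ring).
  replace (INR (3 + N)) with (INR N + 3) in E3 by (rewrite plus_INR; simpl; ring).
  apply Rabs_le_between in E0, E1, E2, E3.
  pose proof (lmod_third c ltac:(lra) (INR N) ltac:(lra)) as T3.
  pose proof (lmod_second c ltac:(lra) (INR N) ltac:(lra)) as T2.
  set (p := / s ^ 5) in *. unfold Rdiv in E0, E1, E2, E3. fold p in E0, E1, E2, E3.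
  assert (Hs5 : 0 < s ^ 5) by (apply pow_lt; lra).
  assert (Hp : 0 < p) by (apply Rinv_0_lt_compat; lra).
  assert (Ht : forall u, 0 <= u <= 3 -> s <= sqrt (c * (INR N + u)) <= 101 / 100 * s).
  { intros u Hu. split.
    - apply sqrt_le_1_alt. nra.
    - rewrite <- (sqrt_pow2 (101 / 100 * s)) by lra. apply sqrt_le_1_alt.
      replace ((101 / 100 * s) ^ 2) with (10201 / 10000 * s ^ 2) by field. rewrite Hs2. nra. }
  (* The root is at most [1.01 s]; with [c^3 >= 1.8] and [1.01^-5 >= 0.8] the constant is at least
     [1.26 * 0.8]. *)
  assert (G3 : 89 / 100 * p <= c ^ 3 * (7 / 10) / sqrt (c * (INR N + 3)) ^ 5).
  { destruct (Ht 3 ltac:(lra)) as [t1 t2]. set (t := sqrt (c * (INR N + 3))) in *.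
    assert (t ^ 5 <= (101 / 100 * s) ^ 5) by (apply pow_incr; lra).
    assert (Hc3 : 18 / 10 <= c ^ 3) by (apply Rle_trans with ((12336 / 10000) ^ 3); [lra|apply pow_incr; lra]).
    apply Rle_trans with (126 / 100 * / (101 / 100 * s) ^ 5).
    - rewrite Rpow_mult_distr, Rinv_mult. fold p.
      assert (8 / 10 <= / (101 / 100) ^ 5); [|nra].
      apply Rmult_le_reg_r with ((101 / 100) ^ 5); [apply pow_lt; lra|]. rewrite Rinv_l by (apply pow_nonzero; lra). lra.
    - unfold Rdiv. apply Rmult_le_compat; [lra| |lra|].
      + left. apply Rinv_0_lt_compat, pow_lt. lra.
      + apply Rinv_le_contravar; [apply pow_lt; lra|assumption]. }
  (* The second difference is of order [s^-3]; it is weakened to [s^-5] only to share the scale of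
     the error. *)
  assert (G2 : 45 / 100 * p <= c ^ 2 * (2 / 5) / sqrt (c * (INR N + 2)) ^ 3).
  { destruct (Ht 2 ltac:(lra)) as [t1 t2]. set (t := sqrt (c * (INR N + 2))) in *.
    assert (t ^ 3 <= s ^ 5).
    { apply Rle_trans with ((101 / 100 * s) ^ 3); [apply pow_incr; lra|].
      replace (s ^ 5) with (s ^ 2 * s ^ 3) by ring. rewrite Rpow_mult_distr.
      apply Rmult_le_compat_r; [apply pow_le; lra|]. nra. }
    assert (/ s ^ 5 <= / t ^ 3) by (apply Rinv_le_contravar; [apply pow_lt; lra|assumption]).
    unfold Rdiv. apply Rmult_le_compat; [lra|lra|nra|assumption]. }
  split; lra.
Qed.

Theorem briggs_large (N : nat) : 4356 <= c * INR N ->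
  let A := INR (a (0 + N)) in let B := INR (a (1 + N)) in
  let C := INR (a (2 + N)) in let D := INR (a (3 + N)) in
  A ^ 2 * (C ^ 2 - B * D) < B ^ 2 * (B ^ 2 - A * C).
Proof.
  intros HN A B C D. destruct (log_differences N HN) as [HP [H3 H2]].
  unfold A, B, C, D. clear A B C D.
  pose proof (HP 0%nat) as PA. pose proof (HP 1%nat) as PB. pose proof (HP 2%nat) as PC. pose proof (HP 3%nat) as PD.
  set (A := INR (a (0 + N))) in *. set (B := INR (a (1 + N))) in *.
  set (C := INR (a (2 + N))) in *. set (D := INR (a (3 + N))) in *.
  assert (K2 : A * C < B * B).
  { apply ln_lt_inv; [nra|nra|]. rewrite !ln_mult by assumption. lra. }
  assert (K3 : C ^ 3 * A < D * B ^ 3).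
  { assert (0 < B ^ 3) by (apply pow_lt; assumption). assert (0 < C ^ 3) by (apply pow_lt; assumption).
    apply ln_lt_inv; try nra. rewrite !ln_mult by assumption. rewrite !ln_pow by assumption.
    replace (INR 3) with 3 by (simpl; ring). lra. }
  (* After this multiplication the left side is below [A^2 C^2 (B^2 - A C)], which is [K3], and
     [(A C)^2 <= B^4] by [K2]. *)
  apply Rmult_lt_reg_l with (B ^ 2); [nra|].
  assert (0 < A ^ 2) by nra. assert (0 < A * C) by nra.
  apply Rlt_le_trans with (A ^ 2 * C ^ 2 * (B ^ 2 - A * C)); [nra|].
  replace (A ^ 2 * C ^ 2) with ((A * C) * (A * C)) by ring.
  replace (B ^ 2 * (B ^ 2 * (B ^ 2 - A * C))) with ((B * B) * (B * B) * (B ^ 2 - A * C)) by ring.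
  apply Rmult_le_compat_r; [nra|]. nra.
Qed.

End Large.

(** * The recurrence *)

(* The coefficient of [q ^ n] in [theta (q ^ k)]. *)
Definition theta_coef (k n : nat) : R :=
  if (n =? 0)%nat then 1 else
  if (n =? k * (Nat.sqrt (n / k) * Nat.sqrt (n / k)))%nat then 2 * (-1) ^ Nat.sqrt (n / k) else 0.

Lemma theta_coef_sqr (k j : nat) : (0 < k)%nat -> theta_coef k (k * (S j * S j)) = 2 * (-1) ^ S j.
Proof.
  intros Hk. unfold theta_coef. rewrite (Nat.mul_comm k), Nat.div_mul by lia.
  rewrite Nat.sqrt_square, (Nat.mul_comm k), Nat.eqb_refl.
  destruct (Nat.eqb_spec (S j * S j * k) 0) as [E|E]; [nia|reflexivity].
Qed.

Lemma theta_coef_gap (k j n : nat) : (0 < k)%nat ->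
  (k * (j * j) < n < k * (S j * S j))%nat -> theta_coef k n = 0.
Proof.
  intros Hk Hn. unfold theta_coef. destruct (Nat.eqb_spec n 0) as [E|_]; [lia|].
  destruct (Nat.eqb_spec n (k * (Nat.sqrt (n / k) * Nat.sqrt (n / k)))) as [E|_]; [|reflexivity].
  exfalso. set (s := Nat.sqrt (n / k)) in *.
  assert (H1 : (j * j < s * s)%nat) by (apply (Nat.mul_lt_mono_pos_l k); lia).
  assert (H2 : (s * s < S j * S j)%nat) by (apply (Nat.mul_lt_mono_pos_l k); lia).
  apply Nat.square_lt_simpl_nonneg in H1; [|lia]. apply Nat.square_lt_simpl_nonneg in H2; [|lia]. lia.
Qed.

Lemma sparse_sum (k : nat) (g : nat -> R) (J : nat) : (0 < k)%nat ->
  Rsum (fun i => theta_coef k i * g i) (S (k * (J * J))) =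
  g O + 2 * Rsum (fun j => (-1) ^ S j * g (k * (S j * S j))%nat) J.
Proof.
  intros Hk. induction J as [|J IH].
  - rewrite !Nat.mul_0_r. simpl. unfold theta_coef. simpl. ring.
  - rewrite (Rsum_S _ J). set (L := S (k * (J * J))) in *.
    assert (H : forall m, (L + m <= k * (S J * S J))%nat ->
      Rsum (fun i => theta_coef k i * g i) (L + m) = Rsum (fun i => theta_coef k i * g i) L).
    { induction m as [|m IHm]; intros Hm; [rewrite Nat.add_0_r; reflexivity|].
      rewrite Nat.add_succ_r, Rsum_S, IHm by lia.
      rewrite (theta_coef_gap k J (L + m) Hk) by (unfold L in *; lia). ring. }
    specialize (H (k * (S J * S J) - L)%nat). replace (L + (k * (S J * S J) - L))%nat with (k * (S J * S J))%nat in H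
      by (unfold L; nia).
    rewrite Rsum_S, H, IH, theta_coef_sqr by (try exact Hk; lia). ring.
Qed.

Lemma is_series_Rsum (u : nat -> R) (l : R) : is_series u l <-> is_lim_seq (Rsum u) l.
Proof.
  rewrite is_lim_seq_incr_1. change (is_series u l) with (is_lim_seq (sum_n u) l).
  assert (H : forall n, sum_n u n = Rsum u (S n)) by (intros n; rewrite sum_n_Reals; apply sum_f_R0_Rsum).
  split; apply is_lim_seq_ext; intros n; [|symmetry]; apply H.
Qed.

Lemma theta_coef_le (k n : nat) : Rabs (theta_coef k n) <= 2.
Proof.
  unfold theta_coef. destruct (n =? 0)%nat; [rewrite Rabs_R1; lra|].
  destruct (n =? _)%nat; [|rewrite Rabs_R0; lra].
  rewrite Rabs_mult, pow_1_abs, Rabs_right; lra.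
Qed.

Lemma theta_pseries (k : nat) (x : R) : (0 < k)%nat -> Rabs x < 1 ->
  exists l, is_pseries (theta_coef k) x l /\ theta (RtoC x ^ k) = RtoC l.
Proof.
  intros Hk Hx.
  assert (Hex : ex_series (fun n => theta_coef k n * x ^ n)).
  { apply (@ex_series_le R_AbsRing R_CompleteNormedModule _ (fun n => 2 * Rabs x ^ n)).
    - intros n. change (norm (theta_coef k n * x ^ n)) with (Rabs (theta_coef k n * x ^ n)).
      rewrite Rabs_mult, <- RPow_abs. apply Rmult_le_compat_r; [apply pow_le, Rabs_pos|apply theta_coef_le].
    - apply (@ex_series_scal R_AbsRing R_NormedModule 2 (fun n => Rabs x ^ n)). apply ex_series_geom. rewrite Rabs_Rabsolu. exact Hx. }
  destruct Hex as [l Hl]. exists l. split; [apply is_pseries_R, Hl|].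
  assert (Hqk : Cmod (RtoC x ^ k)%C < 1).
  { destruct k as [|m]; [lia|]. apply pow_lt_1_disk. rewrite Cmod_R. exact Hx. }
  apply (Ccv_unique _ _ _ (theta_cv _ Hqk)).
  apply Ccv_ext with (fun J => RtoC (Rsum (fun i => theta_coef k i * x ^ i) (S (k * (J * J))))).
  - intros J. rewrite sparse_sum by exact Hk. unfold theta_sum.
    rewrite RtoC_plus, RtoC_mult, <- Csum_RtoC. simpl (x ^ 0). f_equal. f_equal. apply Csum_ext. intros j _.
    rewrite RtoC_mult, !RtoC_pow, Cpow_mul. reflexivity.
  - apply (Ccv_subseq (fun n => RtoC (Rsum (fun i => theta_coef k i * x ^ i) n)) _ (fun J => S (k * (J * J)))).
    + intros n. nia.
    + apply Ccv_RtoC, is_series_Rsum, Hl.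
Qed.

Lemma CV_radius_ge (u : nat -> R) (x l : R) : is_pseries u x l -> Rbar_le (Rabs x) (CV_radius u).
Proof.
  intros H. apply Rbar_not_lt_le. intros Hlt. apply (CV_disk_outside u x Hlt).
  apply ex_series_lim_0. exists l. apply is_pseries_R, H.
Qed.

Section Recurrence.

Variables (k : nat) (a : nat -> nat).
Hypothesis Hk : (0 < k)%nat.
Hypothesis Hgf : forall q, Cmod q < 1 -> exists f, Ccv (Csum (fun n => RtoC (INR (a n)) * q ^ n)%C) f /\
     (f * theta q = theta (q ^ k))%C.

Lemma gf_pseries (x : R) : Rabs x < 1 -> exists l la lk : R,
  is_pseries (fun n => INR (a n)) x l /\ is_pseries (theta_coef 1) x la /\
  is_pseries (theta_coef k) x lk /\ l * la = lk.
Proof.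
  intros Hx. destruct (theta_pseries 1 x ltac:(lia) Hx) as [la [H1 E1]].
  destruct (theta_pseries k x Hk Hx) as [lk [Hk1 Ek]].
  destruct (Hgf (RtoC x)) as [f [Hf Ef]]; [rewrite Cmod_R; exact Hx|].
  replace (RtoC x ^ 1)%C with (RtoC x) in E1 by (simpl; ring).
  rewrite E1, Ek in Ef.
  assert (Hl : la <> 0).
  { intros E. apply (theta_neq0 (RtoC x)); [rewrite Cmod_R; exact Hx|]. rewrite E1, E. reflexivity. }
  assert (Ef2 : f = RtoC (lk / la)).
  { rewrite RtoC_div, <- Ef by exact Hl. field. apply RtoC_neq, Hl. }
  exists (lk / la), la, lk. repeat split; [|exact H1|exact Hk1|field; exact Hl].
  apply is_pseries_R, is_series_Rsum, Ccv_RtoC_inv. rewrite <- Ef2.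
  eapply Ccv_ext; [|exact Hf]. intros n. rewrite <- Csum_RtoC. apply Csum_ext. intros i _.
  rewrite RtoC_mult, RtoC_pow. reflexivity.
Qed.

(** The product identity is known for functions on the disc; uniqueness of the coefficients of a
    real power series turns it into a recurrence. *)
Lemma theta_recurrence (n : nat) :
  Rsum (fun i => theta_coef 1 i * INR (a (n - i))) (S n) = theta_coef k n.
Proof.
  assert (H2 : Rabs (/ 2) < 1) by (rewrite Rabs_right; lra).
  destruct (gf_pseries (/ 2) H2) as [l [la [lk [Hl [Hla [Hlk _]]]]]].
  apply CV_radius_ge in Hl, Hla, Hlk. rewrite Rabs_right in Hl, Hla, Hlk by lra.
  assert (Hpos : forall u : nat -> R, Rbar_le (/ 2) (CV_radius u) -> forall x, Rabs x < / 2 -> Rbar_lt (Rabs x) (CV_radius u)).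
  { intros u Hu x Hx. eapply Rbar_lt_le_trans; [|exact Hu]. exact Hx. }
  transitivity (PS_mult (theta_coef 1) (fun n => INR (a n)) n).
  - unfold PS_mult. rewrite sum_f_R0_Rsum. reflexivity.
  - apply PSeries_ext_recip.
    (* Convergence of the product at [1/4], inside both radii, gives the product series a positive
       radius. *)
    + assert (H4 : Rabs (/ 4) < / 2) by (rewrite Rabs_right; lra).
      pose proof (is_pseries_mult (theta_coef 1) (fun n => INR (a n)) (/ 4) _ _
        (PSeries_correct _ _ (CV_radius_inside _ _ (Hpos _ Hla _ H4)))
        (PSeries_correct _ _ (CV_radius_inside _ _ (Hpos _ Hl _ H4)))
        (Hpos _ Hla _ H4) (Hpos _ Hl _ H4)) as HM.
      apply CV_radius_ge in HM. eapply Rbar_lt_le_trans; [|exact HM]. simpl. apply Rabs_pos_lt. lra.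
    + eapply Rbar_lt_le_trans; [|exact Hlk]. simpl. lra.
    + exists (mkposreal (/ 2) ltac:(lra)). intros x Hx.
      assert (Hx2 : Rabs x < / 2).
      { unfold ball in Hx. simpl in Hx. unfold AbsRing_ball, abs, minus, plus, opp in Hx. simpl in Hx.
        rewrite Ropp_0, Rplus_0_r in Hx. exact Hx. }
      rewrite PSeries_mult by (apply Hpos; assumption).
      destruct (gf_pseries x ltac:(lra)) as [l' [la' [lk' [A [B [D E]]]]]].
      apply is_pseries_unique in A, B, D. rewrite A, B, D, <- E. ring.
Qed.

End Recurrence.

(** * Evaluation of the recurrence on lists *)

Definition add8 (g : nat) : nat := S (S (S (S (S (S (S (S g))))))).

(* With [g = 7] this adds the entries of [l] at the positions [(2 r + 1) ^ 2 - 1]. *)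
Fixpoint square_walk (fuel g : nat) (l : list N) : N :=
  match fuel, l with
  | S fuel', x :: l' => (x + square_walk fuel' (add8 g) (skipn g l'))%N
  | _, _ => 0%N
  end.

(* [l] lists [a (n - 1), ..., a 0]; the next index of the form [k * j ^ 2] is [n + cd],
   [gap = k * (2 * j - 1)], and [even] tells whether [j] is even. *)
Fixpoint coefficients (m cd gap k2 : nat) (even : bool) (l : list N) : list N :=
  match m with
  | O => l
  | S m' =>
      (* [p] collects the odd squares and [q], after dropping 3 entries, the even ones. The
         coefficient is [2 (p - q)], with 2 added or subtracted at an index [k j^2]. Truncated
         subtraction is harmless because the coefficient is nonnegative. *)
      let p := square_walk 30 7 l in
      let q := square_walk 30 11 (skipn 3 l) in
      match cd with
      | O => coefficients m' (gap + k2 - 1) (gap + k2) k2 (negb even)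
               (N.double (if even then p + 1 - q else p - (q + 1))%N :: l)
      | S cd' => coefficients m' cd' gap k2 even (N.double (p - q)%N :: l)
      end
  end.

Definition INN (x : N) : R := INR (N.to_nat x).

(** Squares of one parity have gaps growing by 8, and the position reached after [r] jumps is the
    sum of the [S g + 8 i] for [i < r]. *)
Lemma square_walk_eq (fuel g : nat) (l : list N) :
  INN (square_walk fuel g l) = Rsum (fun r => INN (nth (r * S g + 4 * r * (r - 1)) l 0%N)) fuel.
Proof.
  revert g l. induction fuel as [|f IH]; intros g l; [reflexivity|].
  destruct l as [|x l].
  - simpl square_walk. rewrite (Rsum_ext _ (fun _ => 0)), Rsum_const; [unfold INN; simpl; ring|].
    intros i _. destruct (i * S g + 4 * i * (i - 1))%nat; reflexivity.
  - rewrite Rsum_S0. cbn [square_walk]. unfold INN at 1. rewrite N2Nat.inj_add, plus_INR.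
    f_equal. fold (INN (square_walk f (add8 g) (skipn g l))). rewrite IH. apply Rsum_ext. intros i _.
    rewrite nth_skipn. f_equal.
    replace (S i * S g + 4 * S i * (S i - 1))%nat with (S (g + (i * S (add8 g) + 4 * i * (i - 1))))%nat; [reflexivity|].
    unfold add8. destruct i; [lia|]. nia.
Qed.

Lemma Rsum_pairs (h : nat -> R) (m : nat) :
  Rsum (fun j => (-1) ^ S j * h j) (2 * m) = Rsum (fun r => h (2 * r + 1)%nat) m - Rsum (fun r => h (2 * r)%nat) m.
Proof.
  induction m as [|m IH]; [simpl; ring|].
  replace (2 * S m)%nat with (S (S (2 * m))) by lia. rewrite !Rsum_S, IH.
  replace (2 * m + 1)%nat with (S (2 * m)) by lia.
  replace ((-1) ^ S (S (2 * m))) with 1. replace ((-1) ^ S (2 * m)) with (-1). ring.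
  - symmetry. apply pow_1_odd.
  - symmetry. replace (S (S (2 * m))) with (2 * S m)%nat by lia. apply pow_1_even.
Qed.

Section Table.

Variables (k : nat) (a : nat -> nat).
Hypothesis Hk : (0 < k)%nat.
Hypothesis Hrec : forall n,
  Rsum (fun i => theta_coef 1 i * INR (a (n - i))) (S n) = theta_coef k n.

Lemma a_zero : a 0%nat = 1%nat.
Proof.
  pose proof (Hrec 0) as H. simpl in H. unfold theta_coef in H. simpl in H.
  apply INR_eq. simpl. lra.
Qed.

Definition is_table (n : nat) (l : list N) : Prop :=
  length l = n /\ forall i, (i < n)%nat -> nth i l 0%N = N.of_nat (a (n - 1 - i)).

(** Thirty odd and thirty even squares, the fuel of the two walks, exhaust the squares up to
    [3600 = 60^2]. *)
Lemma table_step (n : nat) (l : list N) : (0 < n <= 3600)%nat -> is_table n l ->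
  INR (a n) = 2 * (INN (square_walk 30 7 l) - INN (square_walk 30 11 (skipn 3 l))) + theta_coef k n.
Proof.
  intros Hn [Hl Ha].
  (* Extending by 0 beyond [n] matches the default 0 of [nth] past the end of the list. *)
  set (g := fun i => if (i <=? n)%nat then INR (a (n - i)) else 0).
  assert (H : Rsum (fun i => theta_coef 1 i * g i) (S (1 * (60 * 60))) = theta_coef k n).
  { rewrite <- Hrec. replace (S (1 * (60 * 60))) with (S n + (3600 - n))%nat by lia.
    rewrite Rsum_add. rewrite (Rsum_ext (fun i => theta_coef 1 (S n + i) * g (S n + i)%nat) (fun _ => 0)).
    - rewrite Rsum_const, Rmult_0_r, Rplus_0_r. apply Rsum_ext. intros i Hi. unfold g.
      destruct (Nat.leb_spec i n); [reflexivity|lia].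
    - intros i _. unfold g. destruct (Nat.leb_spec (S n + i) n); [lia|ring]. }
  rewrite sparse_sum in H by lia.
  replace 60%nat with (2 * 30)%nat in H by reflexivity.
  rewrite (Rsum_pairs (fun j => g (1 * (S j * S j))%nat)) in H.
  unfold g at 1 in H. simpl (0 <=? n)%nat in H. cbv iota in H. rewrite Nat.sub_0_r in H.
  assert (Hg : forall i, (0 < i)%nat -> g i = INN (nth (i - 1) l 0%N)).
  { intros i Hi. unfold g, INN. destruct (Nat.leb_spec i n) as [L|L].
    - rewrite Ha, Nat2N.id by lia. do 2 f_equal. lia.
    - rewrite nth_overflow by lia. reflexivity. }
  rewrite !square_walk_eq.
  rewrite (Rsum_ext (fun r => g (1 * (S (2 * r) * S (2 * r)))%nat)
    (fun r => INN (nth (r * 8 + 4 * r * (r - 1)) l 0%N))) in H.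
  2:{ intros i _. rewrite Hg by lia. f_equal. f_equal. destruct i; [lia|nia]. }
  rewrite (Rsum_ext (fun r => g (1 * (S (2 * r + 1) * S (2 * r + 1)))%nat)
    (fun r => INN (nth (r * 12 + 4 * r * (r - 1)) (skipn 3 l) 0%N))) in H.
  2:{ intros i _. rewrite Hg by lia. rewrite nth_skipn. f_equal. f_equal. destruct i; [lia|nia]. }
  lra.
Qed.

Lemma table_cons (n : nat) (l : list N) (x : N) :
  is_table n l -> INR (a n) = INN x -> is_table (S n) (x :: l).
Proof.
  intros [Hl Ha] Hx. split; [simpl; lia|]. intros [|i] Hi.
  - simpl. rewrite Nat.sub_0_r, Nat.sub_0_r. apply INR_eq in Hx. rewrite Hx. symmetry. apply N2Nat.id.
  - simpl nth. rewrite Ha by lia. do 2 f_equal. lia.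
Qed.

Lemma INN_double (x : N) : INN (N.double x) = 2 * INN x.
Proof. unfold INN. rewrite N2Nat.inj_double, mult_INR. reflexivity. Qed.

Lemma INN_sub (x y : N) : INN y <= INN x -> INN (x - y) = INN x - INN y.
Proof. intros H. unfold INN in *. apply INR_le in H. rewrite N2Nat.inj_sub, minus_INR by exact H. reflexivity. Qed.

Lemma INN_succ (x : N) : INN (x + 1) = INN x + 1.
Proof. unfold INN. rewrite N2Nat.inj_add, plus_INR. reflexivity. Qed.

Lemma theta_coef_between (j n : nat) :
  (k * (j * j) < n)%nat -> (n < k * (S j * S j))%nat -> theta_coef k n = 0.
Proof. intros H1 H2. apply theta_coef_gap with j; [exact Hk|split; assumption]. Qed.

(** Loop invariant: [k j^2 < n <= k (j + 1)^2], [cd] is the distance to the right end, [gap] the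
    length of this interval, and [e] the parity of [j + 1]. *)
Lemma coefficients_table (m n cd gap j : nat) (e : bool) (l : list N) :
  (0 < n)%nat -> (n + m <= 3600)%nat -> is_table n l ->
  (n + cd = k * (S j * S j))%nat -> gap = (k * (2 * j + 1))%nat -> (k * (j * j) < n)%nat ->
  (-1) ^ S j = (if e then 1 else -1) ->
  is_table (n + m) (coefficients m cd gap (2 * k) e l).
Proof.
  revert n cd gap j e l. induction m as [|m IH]; intros n cd gap j e l Hn Hm Ht Hcd Hgap Hj He.
  - rewrite Nat.add_0_r. exact Ht.
  - rewrite <- Nat.add_succ_comm. cbn [coefficients].
    pose proof (table_step n l ltac:(lia) Ht) as Hs. pose proof (pos_INR (a n)) as Hp.
    set (p := square_walk 30 7 l) in *. set (q := square_walk 30 11 (skipn 3 l)) in *.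
    destruct cd as [|cd].
    + apply (IH _ _ _ (S j)); try lia; try nia.
      * apply table_cons; [exact Ht|]. rewrite INN_double. rewrite Nat.add_0_r in Hcd.
        rewrite Hcd, theta_coef_sqr, He in Hs by exact Hk. rewrite <- Hcd in Hs.
        destruct e; cbv iota in Hs; rewrite INN_sub; rewrite ?INN_succ; try lra.
      * change ((-1) ^ S (S j)) with (-1 * (-1) ^ S j). rewrite He. destruct e; simpl; ring.
    + apply (IH _ _ _ j); try lia.
      * apply table_cons; [exact Ht|]. rewrite INN_double.
        rewrite (theta_coef_between j n) in Hs by lia. rewrite INN_sub; lra.
      * exact He.
Qed.

Definition table (m : nat) : list N := coefficients m (k - 1) k (2 * k) false [1%N].

Lemma table_correct (m : nat) : (1 + m <= 3600)%nat -> is_table (1 + m) (table m).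
Proof.
  intros Hm. apply (coefficients_table m 1 (k - 1) k 0); try lia.
  - split; [reflexivity|]. intros i Hi. replace i with O by lia. simpl. rewrite a_zero. reflexivity.
  - simpl. ring.
Qed.

End Table.

(** * Small indices *)

(** The Briggs inequality for consecutive values [A, B, C, D], with the subtracted products moved
    across because subtraction in [nat] truncates. *)
Definition briggs_nat (A B C D : nat) : Prop :=
  (B * B * (A * C) + A * A * (C * C) < B * B * (B * B) + A * A * (B * D))%nat.

Lemma briggs_nat_R (A B C D : nat) :
  INR A ^ 2 * (INR C ^ 2 - INR B * INR D) < INR B ^ 2 * (INR B ^ 2 - INR A * INR C) -> briggs_nat A B C D.
Proof. intros H. apply INR_lt. rewrite !plus_INR, !mult_INR. lra. Qed.

(* With [B = A (1 + x), C = B (1 + y), D = C (1 + z)] the inequality reads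
   [B ^ 2 (x - y) > A C (y - z)], and [A C < B ^ 2]; the quantities below are scaled by [M]. *)
Lemma briggs_of_convex_ratios (M A B C D x y z : R) : 0 < M -> 0 < A -> 0 < B -> 0 < C ->
  x * A <= M * (B - A) -> M * (C - B) < y * B -> z * C <= M * (D - C) ->
  y <= x -> 2 * y <= x + z -> A ^ 2 * (C ^ 2 - B * D) < B ^ 2 * (B ^ 2 - A * C).
Proof.
  intros HM HA HB HC Hx Hy Hz Hxy Hxz.
  set (u := M * (B - A) / A). set (v := M * (C - B) / B). set (w := M * (D - C) / C).
  assert (Hu : x <= u) by (apply Rmult_le_reg_r with A; [exact HA|]; unfold u; field_simplify; lra).
  assert (Hv : v < y) by (apply Rmult_lt_reg_r with B; [exact HB|]; unfold v; field_simplify; lra).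
  assert (Hw : z <= w) by (apply Rmult_le_reg_r with C; [exact HC|]; unfold w; field_simplify; lra).
  assert (EB : B ^ 2 - A * C = A * B * (u - v) / M) by (unfold u, v; field; lra).
  assert (EC : C ^ 2 - B * D = B * C * (v - w) / M) by (unfold v, w; field; lra).
  assert (HAB : 0 < A * B / M) by (apply Rdiv_lt_0_compat; nra).
  assert (HP : 0 < B ^ 2 - A * C).
  { rewrite EB. replace (A * B * (u - v) / M) with (A * B / M * (u - v)) by (field; lra). nra. }
  rewrite EC, EB.
  replace (A ^ 2 * (B * C * (v - w) / M)) with (A * B / M * (A * C * (v - w))) by (field; lra).
  replace (B ^ 2 * (A * B * (u - v) / M)) with (A * B / M * (B ^ 2 * (u - v))) by (field; lra).
  apply Rmult_lt_compat_l; [exact HAB|]. assert (0 < A * C) by nra.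
  apply Rle_lt_trans with (A * C * (u - v)); nra.
Qed.

(* [2 ^ 34 (B - A) / A], up to an error of 2, from the 35 leading bits of [A]. *)
Definition ratio (A B : N) : N :=
  let e := (N.log2 A - 34)%N in (N.shiftl (N.shiftr (B - A) e) 34 / N.shiftr A e)%N.

(** Either nothing is cut off, or the kept part of [A] is at least [2^34]. The upper bound loses one
    unit to the division and one to the low bits of [B - A]; the lower bound loses one to the low
    bits of [A], given [q <= M]. [1 <= q] rules out that [B - A] was truncated to 0. *)
Lemma ratio_bounds (A B : N) : (0 < A)%N ->
  let M := (2 ^ 34)%Z in let q := Z.of_N (ratio A B) in
  (M * (Z.of_N B - Z.of_N A) < (q + 2) * Z.of_N A)%Z /\
  (1 <= q <= M -> (q - 1) * Z.of_N A <= M * (Z.of_N B - Z.of_N A))%Z.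
Proof.
  intros HA M q. unfold q, ratio. clear q. set (e := (N.log2 A - 34)%N).
  rewrite N.shiftl_mul_pow2, !N.shiftr_div_pow2.
  set (P := (2 ^ e)%N). assert (HP : (0 < P)%N) by (unfold P; apply N.neq_0_lt_0, N.pow_nonzero; lia).
  set (A' := (A / P)%N). set (D := (B - A)%N). set (D' := (D / P)%N).
  assert (HA1 : (P * A' <= A)%N) by (apply N.Div0.mul_div_le).
  assert (HA2 : (A < P * N.succ A')%N) by (apply N.mul_succ_div_gt; lia).
  assert (HD1 : (P * D' <= D)%N) by (apply N.Div0.mul_div_le).
  assert (HD2 : (D < P * N.succ D')%N) by (apply N.mul_succ_div_gt; lia).
  assert (HA' : (P = 1 \/ 2 ^ 34 <= A')%N).
  { destruct (N.le_gt_cases (N.log2 A) 34) as [L|L].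
    - left. unfold P, e. replace (N.log2 A - 34)%N with 0%N by lia. reflexivity.
    - right. unfold A'. apply N.div_le_lower_bound; [lia|]. unfold P. rewrite <- N.pow_add_r.
      replace (e + 34)%N with (N.log2 A) by (unfold e; lia). apply N.log2_spec. exact HA. }
  assert (HA0 : (0 < A')%N) by (destruct HA' as [E|E]; [rewrite E in *; lia|lia]).
  set (q := (D' * 2 ^ 34 / A')%N).
  assert (Hq1 : (A' * q <= D' * 2 ^ 34)%N) by (apply N.Div0.mul_div_le).
  assert (Hq2 : (D' * 2 ^ 34 < A' * N.succ q)%N) by (apply N.mul_succ_div_gt; lia).
  change (2 ^ 34)%N with 17179869184%N in *. change M with 17179869184%Z.
  assert (HDle : (Z.of_N B - Z.of_N A <= Z.of_N D)%Z) by (unfold D; lia).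
  assert (HDeq : (0 < D)%N -> (Z.of_N D = Z.of_N B - Z.of_N A)%Z) by (unfold D; lia).
  clearbody D D' A' P q. clear M. 
  split.
  - apply Z.le_lt_trans with (17179869184 * Z.of_N D)%Z; [lia|].
    destruct HA' as [-> | HA']; [nia|].
    apply Z.lt_le_trans with (17179869184 * (Z.of_N P * (Z.of_N D' + 1)))%Z; [lia|].
    assert (17179869184 * (Z.of_N D' + 1) <= (Z.of_N q + 2) * Z.of_N A')%Z by nia.
    apply Z.le_trans with ((Z.of_N q + 2) * (Z.of_N P * Z.of_N A'))%Z; nia.
  - intros [Hl Hr].
    assert (HD0 : (0 < D)%N).
    { destruct (N.eq_0_gt_0_cases D) as [E|E]; [|exact E]. exfalso.
      assert (D' = 0%N) by nia. nia. }
    rewrite <- (HDeq HD0). destruct HA' as [-> | HA']; [nia|].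
    apply Z.le_trans with (17179869184 * (Z.of_N P * Z.of_N D'))%Z; [|lia].
    apply Z.le_trans with ((Z.of_N q - 1) * (Z.of_N P * (Z.of_N A' + 1)))%Z; [nia|].
    assert ((Z.of_N q - 1) * (Z.of_N A' + 1) <= 17179869184 * Z.of_N D')%Z by nia. nia.
Qed.

(** Division by 0 yields 0, so a positive ratio certifies a positive denominator. *)
Lemma ratio_pos (A B : N) : (1 <= ratio A B)%N -> (0 < A)%N.
Proof.
  intros H. destruct A; [exfalso|lia]. unfold ratio in H. rewrite N.shiftr_0_l in H.
  destruct (N.shiftl _ _); compute in H; apply H; reflexivity.
Qed.

(** The true ratio lies between [q - 1] and [q + 2]: the margin [3 = 2 + 1] makes the decrease
    certain, and [6 = 2 * 2 + 1 + 1] the convexity. *)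
Definition convex_at (q0 q1 q2 : N) : bool :=
  ((1 <=? q2) && (q2 <=? 2 ^ 34) && (q0 <=? 2 ^ 34) && (q1 + 3 <=? q0) && (2 * q1 + 6 <=? q0 + q2))%N%bool.

Lemma convex_at_briggs (A B C D : nat) :
  convex_at (ratio (N.of_nat A) (N.of_nat B)) (ratio (N.of_nat B) (N.of_nat C)) (ratio (N.of_nat C) (N.of_nat D)) = true ->
  briggs_nat A B C D.
Proof.
  unfold convex_at. intros H. repeat (apply andb_prop in H; destruct H as [H ?]).
  repeat match goal with E : (_ <=? _)%N = true |- _ => apply N.leb_le in E end.
  pose proof (ratio_pos _ _ H) as HC. pose proof (ratio_pos (N.of_nat A) (N.of_nat B) ltac:(lia)) as HA.
  destruct (ratio_bounds _ (N.of_nat B) HA) as [_ LA]. destruct (ratio_bounds _ (N.of_nat D) HC) as [_ LC].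
  set (q0 := ratio (N.of_nat A) (N.of_nat B)) in *. set (q1 := ratio (N.of_nat B) (N.of_nat C)) in *.
  set (q2 := ratio (N.of_nat C) (N.of_nat D)) in *.
  change (2 ^ 34)%N with 17179869184%N in *. change (2 ^ 34)%Z with 17179869184%Z in *.
  specialize (LA ltac:(lia)). specialize (LC ltac:(lia)).
  assert (HB : (0 < N.of_nat B)%N) by nia.
  destruct (ratio_bounds _ (N.of_nat C) HB) as [LB _]. fold q1 in LB.
  change (2 ^ 34)%Z with 17179869184%Z in *.
  rewrite !nat_N_Z in *. apply IZR_le in LA, LC. apply IZR_lt in LB.
  repeat rewrite ?mult_IZR, ?plus_IZR, ?minus_IZR, <- ?INR_IZR_INZ in *.
  apply briggs_nat_R.
  apply (briggs_of_convex_ratios 17179869184 _ _ _ _ (IZR (Z.of_N q0) - 1) (IZR (Z.of_N q1) + 2) (IZR (Z.of_N q2) - 1));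
    try assumption; try lra; try (apply lt_0_INR; lia).
  - rewrite <- minus_IZR, <- plus_IZR. apply IZR_le. lia.
  - rewrite <- !minus_IZR, <- plus_IZR, <- mult_IZR, <- plus_IZR. apply IZR_le. lia.
Qed.

(** * Testing a table *)

Fixpoint ratios (l : list N) : list N :=
  match l with
  | B :: ((A :: _) as l') => ratio A B :: ratios l'
  | _ => []
  end.

Fixpoint convex (n : nat) (l : list N) : bool :=
  match n, l with
  | O, _ => true
  | S n', q2 :: ((q1 :: q0 :: _) as l') => if convex_at q0 q1 q2 then convex n' l' else false
  | _, _ => false
  end.

Definition briggs_N (A B C D : N) : bool :=
  (B * B * (A * C) + A * A * (C * C) <? B * B * (B * B) + A * A * (B * D))%N.

Fixpoint all_briggs (n : nat) (l : list N) : bool :=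
  match n, l with
  | O, _ => true
  | S n', D :: ((C :: B :: A :: _) as l') => if briggs_N A B C D then all_briggs n' l' else false
  | _, _ => false
  end.

Lemma nth_ratios (l : list N) (i : nat) : (S i < length l)%nat ->
  nth i (ratios l) 0%N = ratio (nth (S i) l 0%N) (nth i l 0%N).
Proof.
  revert i. induction l as [|B [|A l] IH]; intros i Hi; simpl in Hi; try lia.
  destruct i as [|i]; [reflexivity|]. change (nth (S i) (ratios (B :: A :: l)) 0%N) with (nth i (ratios (A :: l)) 0%N).
  rewrite IH by (simpl; lia). reflexivity.
Qed.

Lemma convex_nth (n : nat) (l : list N) (i : nat) : convex n l = true -> (i < n)%nat ->
  convex_at (nth (S (S i)) l 0%N) (nth (S i) l 0%N) (nth i l 0%N) = true.
Proof.
  revert l i. induction n as [|n IH]; intros l i H Hi; [lia|].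
  destruct l as [|q2 [|q1 [|q0 l]]]; try discriminate H. simpl in H.
  destruct (convex_at q0 q1 q2) eqn:E; [|discriminate H].
  destruct i as [|i]; [exact E|]. apply (IH (q1 :: q0 :: l)); [exact H|lia].
Qed.

Lemma all_briggs_nth (n : nat) (l : list N) (i : nat) : all_briggs n l = true -> (i < n)%nat ->
  briggs_N (nth (S (S (S i))) l 0%N) (nth (S (S i)) l 0%N) (nth (S i) l 0%N) (nth i l 0%N) = true.
Proof.
  revert l i. induction n as [|n IH]; intros l i H Hi; [lia|].
  destruct l as [|D [|C [|B [|A l]]]]; try discriminate H. simpl in H.
  destruct (briggs_N A B C D) eqn:E; [|discriminate H].
  destruct i as [|i]; [exact E|]. apply (IH (C :: B :: A :: l)); [exact H|lia].
Qed.

(* For the first indices the ratios are not convex and the inequality itself is tested. *)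
Definition check (k lo hi : nat) : bool :=
  let l := table k (hi + 2) in
  (* The list starts at index [hi + 2], so the convexity tests run from [n = hi - 1] down to 200.
     After [skipn] it starts at index 202, and the direct tests run from [n = 199] down to [lo]. *)
  if convex (hi - 200) (ratios l) then all_briggs (200 - lo) (skipn (hi - 200) l) else false.

Lemma check_correct (k lo hi : nat) (a : nat -> nat) : (0 < k)%nat -> (200 <= hi <= 3597)%nat ->
  (forall n : nat, Rsum (fun i => theta_coef 1 i * INR (a (n - i)%nat)) (S n) = theta_coef k n) ->
  check k lo hi = true ->
  forall n : nat, (lo <= n < hi)%nat -> briggs_nat (a n) (a (1 + n)%nat) (a (2 + n)%nat) (a (3 + n)%nat).
Proof.
  intros Hk Hhi Hrec H n Hn. destruct (table_correct k a Hk Hrec (hi + 2) ltac:(lia)) as [Hl Ht].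
  unfold check in H. set (l := table k (hi + 2)) in *.
  destruct (convex (hi - 200) (ratios l)) eqn:E; [|discriminate H].
  assert (HN : forall j, (j <= 3)%nat -> nth (hi - 1 - n + j) l 0%N = N.of_nat (a (3 - j + n)%nat)).
  { intros j Hj. rewrite Ht by lia. do 2 f_equal. lia. }
  pose proof (HN 0%nat ltac:(lia)) as H0. pose proof (HN 1%nat ltac:(lia)) as H1.
  pose proof (HN 2%nat ltac:(lia)) as H2. pose proof (HN 3%nat ltac:(lia)) as H3.
  set (i := (hi - 1 - n)%nat) in *.
  replace (i + 0)%nat with i in H0 by lia. replace (i + 1)%nat with (S i) in H1 by lia.
  replace (i + 2)%nat with (S (S i)) in H2 by lia. replace (i + 3)%nat with (S (S (S i))) in H3 by lia.
  destruct (Nat.le_gt_cases 200 n) as [L|L].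
  - pose proof (convex_nth _ _ i E ltac:(lia)) as HC.
    rewrite !nth_ratios, H0, H1, H2, H3 in HC by lia. apply convex_at_briggs, HC.
  - pose proof (all_briggs_nth _ _ (i - (hi - 200)) H ltac:(lia)) as HB.
    rewrite !nth_skipn in HB.
    replace (hi - 200 + S (S (S (i - (hi - 200)))))%nat with (S (S (S i))) in HB by lia.
    replace (hi - 200 + S (S (i - (hi - 200))))%nat with (S (S i)) in HB by lia.
    replace (hi - 200 + S (i - (hi - 200)))%nat with (S i) in HB by lia.
    replace (hi - 200 + (i - (hi - 200)))%nat with i in HB by lia.
    rewrite H0, H1, H2, H3 in HB. apply N.ltb_lt in HB. unfold briggs_nat. simpl in HB |- *.
    rewrite <- !Nat2N.inj_mul, <- !Nat2N.inj_add in HB. lia.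
Qed.

(** The numerical hypothesis is [4356 <= c hi] with [pi^2] replaced by the lower bound [9.869], and
    doubled; it joins the computed range to that of [briggs_large]. *)
Lemma briggs_from_check (k lo hi : nat) (c : nat -> nat -> nat) (a : nat -> nat) : (2 <= k <= 9)%nat ->
  (forall n, c O n = match n with O => 1%nat | _ => O end) ->
  (forall m n, not_dvd k (S m) = true ->
     c (S m) n = (c m n + if (S m <=? n)%nat then c m (n - S m) + c (S m) (n - S m) else 0)%nat) ->
  (forall m n, not_dvd k (S m) = false -> c (S m) n = c m n) ->
  (forall m n, (n <= m)%nat -> c m n = a n) ->
  (200 <= hi <= 3597)%nat -> 2 * 4356 <= 98690 / 20000 * (1 - / INR k) * INR hi -> check k lo hi = true ->
  forall n, (lo <= n)%nat -> briggs_nat (a n) (a (1 + n)%nat) (a (2 + n)%nat) (a (3 + n)%nat).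
Proof.
  intros Hk H0 Hs Hd Hf Hhi Hc Hchk n Hn.
  assert (Hgf : forall q, Cmod q < 1 -> exists f, Ccv (Csum (fun n => RtoC (INR (a n)) * q ^ n)%C) f /\
     (f * theta q = theta (q ^ k))%C).
  { intros q Hq. destruct (gf_sum _ _ _ H0 Hs Hd Hf q Hq) as [f [F1 F2]]. exists f. split; [exact F1|].
    apply gf_theta; [lia|exact Hq|exact F2]. }
  destruct (Nat.lt_ge_cases n hi) as [L|L].
  - apply (check_correct k lo hi a); try assumption; try lia. apply theta_recurrence; [lia|exact Hgf].
  - apply briggs_nat_R. apply (briggs_large k a Hk (gf_bound _ _ _ H0 Hs Hd Hf) Hgf n).
    apply le_INR in L. pose proof (INR_k k Hk) as Hi. unfold cst. pose proof PI_bounds as HP.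
    assert (98690 / 10000 <= PI ^ 2) by nra.
    assert (/ INR k <= / 2) by (apply Rinv_le_contravar; lra).
    pose proof (pos_INR hi).
    apply Rle_trans with (98690 / 40000 * (1 - / INR k) * INR hi); [lra|].
    apply Rmult_le_compat; [nra|assumption|nra|exact L].
Qed.

(** The upper limits here and below are the least [hi] with [9.869 / 4 (1 - 1/k) hi >= 4356]. *)
Lemma check2 : check 2 75 3532 = true. Proof. vm_cast_no_check (eq_refl true). Qed.
Lemma check3 : check 3 17 2649 = true. Proof. vm_cast_no_check (eq_refl true). Qed.
Lemma check4 : check 4 33 2355 = true. Proof. vm_cast_no_check (eq_refl true). Qed.
Lemma check5 : check 5 30 2207 = true. Proof. vm_cast_no_check (eq_refl true). Qed.
Lemma check6 : check 6 10 2119 = true. Proof. vm_cast_no_check (eq_refl true). Qed.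
Lemma check7 : check 7 24 2060 = true. Proof. vm_cast_no_check (eq_refl true). Qed.
Lemma check8 : check 8 27 2018 = true. Proof. vm_cast_no_check (eq_refl true). Qed.
Lemma check9 : check 9 10 1987 = true. Proof. vm_cast_no_check (eq_refl true). Qed.

Lemma briggs_counts (k : nat) (c : nat -> nat -> nat) (a : nat -> nat) : (2 <= k <= 9)%nat ->
  (forall n, c O n = match n with O => 1%nat | _ => O end) ->
  (forall m n, not_dvd k (S m) = true ->
     c (S m) n = (c m n + if (S m <=? n)%nat then c m (n - S m) + c (S m) (n - S m) else 0)%nat) ->
  (forall m n, not_dvd k (S m) = false -> c (S m) n = c m n) ->
  (forall m n, (n <= m)%nat -> c m n = a n) ->
  forall n, (Nbar k <= n)%nat -> briggs_nat (a n) (a (1 + n)%nat) (a (2 + n)%nat) (a (3 + n)%nat).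
Proof.
  intros Hk H0 Hs Hd Hf.
  assert (HINR : forall hi : nat, 2 * 4356 <= 98690 / 20000 * (1 - / IZR (Z.of_nat k)) * IZR (Z.of_nat hi) ->
    2 * 4356 <= 98690 / 20000 * (1 - / INR k) * INR hi) by (intros hi; rewrite !INR_IZR_INZ; trivial).
  assert (E : (k = 2 \/ k = 3 \/ k = 4 \/ k = 5 \/ k = 6 \/ k = 7 \/ k = 8 \/ k = 9)%nat) by lia.
  destruct E as [-> | [-> | [-> | [-> | [-> | [-> | [-> | ->]]]]]]].
  - apply (briggs_from_check 2 75 3532 c a Hk H0 Hs Hd Hf); [lia| |exact check2]. apply HINR. simpl Z.of_nat. lra.
  - apply (briggs_from_check 3 17 2649 c a Hk H0 Hs Hd Hf); [lia| |exact check3]. apply HINR. simpl Z.of_nat. lra.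
  - apply (briggs_from_check 4 33 2355 c a Hk H0 Hs Hd Hf); [lia| |exact check4]. apply HINR. simpl Z.of_nat. lra.
  - apply (briggs_from_check 5 30 2207 c a Hk H0 Hs Hd Hf); [lia| |exact check5]. apply HINR. simpl Z.of_nat. lra.
  - apply (briggs_from_check 6 10 2119 c a Hk H0 Hs Hd Hf); [lia| |exact check6]. apply HINR. simpl Z.of_nat. lra.
  - apply (briggs_from_check 7 24 2060 c a Hk H0 Hs Hd Hf); [lia| |exact check7]. apply HINR. simpl Z.of_nat. lra.
  - apply (briggs_from_check 8 27 2018 c a Hk H0 Hs Hd Hf); [lia| |exact check8]. apply HINR. simpl Z.of_nat. lra.
  - apply (briggs_from_check 9 10 1987 c a Hk H0 Hs Hd Hf); [lia| |exact check9]. apply HINR. simpl Z.of_nat. lra.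
Qed.

Local Close Scope R_scope.

From mathcomp Require Import all_boot all_order all_algebra.
From mathcomp Require Import zify.

Set Implicit Arguments.
Unset Strict Implicit.
Unset Printing Implicit Defensive.

Import GRing.Theory.

(** * Counting overpartitions by largest part *)

Section Counting.

Variable k : nat.

Definition ov_le (m n : nat) : seq (seq (nat * bool)) :=
  [seq s <- overpartitions k n | all (fun x => x.1 <= m) s].

Definition ov_free (m n : nat) : seq (seq (nat * bool)) :=
  [seq s <- ov_le m n | (m, true) \notin s].

Definition cnt (m n : nat) : nat := size (ov_le m n).
Definition cnt_free (m n : nat) : nat := size (ov_free m n).

Lemma ov_le_uniq (m n : nat) : uniq (ov_le m n).
Proof. exact/filter_uniq/overpartitions_uniq. Qed.

Lemma ov_free_uniq (m n : nat) : uniq (ov_free m n).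
Proof. exact/filter_uniq/ov_le_uniq. Qed.

Lemma mem_ov_le (m n : nat) (s : seq (nat * bool)) :
  (s \in ov_le m n) = [&& all (fun x => x.1 <= m) s, is_overpartition n s & is_regular k s].
Proof. by rewrite mem_filter mem_overpartitions. Qed.

(** Only a first occurrence may be overlined, so a leading [m] forbids an overlined [m] later; this
    makes [ov_free] the right set of tails, whatever the mark [b]. *)
Lemma mem_ov_le_cons (m n : nat) (b : bool) (s : seq (nat * bool)) :
  0 < m -> ~~ (k %| m) ->
  ((m, b) :: s \in ov_le m n) = (m <= n) && (s \in ov_free m (n - m)).
Proof.
move=> m0 km; rewrite [s \in _]mem_filter !mem_ov_le /= leqnn /=.
rewrite /is_overpartition /is_regular /= m0 km /= (path_sortedE (leT := geq)); last first.
  by move=> y x z /= xy yz; apply: leq_trans yz xy.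
rewrite all_map /=.
have -> : all (fun y : nat * bool => y.2 ==> (m != y.1)) s = ((m, true) \notin s).
  rewrite -has_pred1 -all_predC; apply: eq_all => -[a c] /=.
  by rewrite xpair_eqE [a == m]eq_sym; case: c; rewrite ?andbT ?andbF.
have -> : (m + sumn [seq i.1 | i <- s] == n) =
          (m <= n) && (sumn [seq i.1 | i <- s] == n - m) by lia.
rewrite /preim /=.
by case: (all _ s); case: (m <= n); case: (_ \notin s); rewrite ?andbF ?andbT ?andTb //=;
  case: (sorted _ _); case: (all _ _); case: (pairwise _ _); case: (_ == _).
Qed.

Lemma size_uniq_mem (T : eqType) (s t : seq T) : uniq s -> uniq t -> s =i t -> size s = size t.
Proof. by move=> us ut st; apply/perm_size/uniq_perm. Qed.

(** The parts decrease, so whether [m] occurs at all is decided by the head. *)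
Lemma ov_le_pred (m n : nat) (s : seq (nat * bool)) : 0 < m ->
  (s \in ov_le m.-1 n) = (s \in ov_le m n) && (if ohead s is Some x then x.1 != m else true).
Proof.
move=> m0; rewrite !mem_ov_le /is_overpartition; case: s => [|[a b] s] /=.
  by rewrite !andbT.
rewrite (path_sortedE (leT := geq)); last by move=> y x z /= xy yz; apply: leq_trans yz xy.
rewrite all_map; set S := all (preim _ _) s.
set P := all (fun x => x.1 <= m.-1) s; set Q := all (fun x => x.1 <= m) s.
case hS : S; last by rewrite !andbF.
have PQ : a <= m.-1 -> P /\ Q.
  move=> am; split; apply/allP => x xs.
    by move/allP: hS => /(_ x xs) /= h; exact: leq_trans h am.
  by move/allP: hS => /(_ x xs) /= h; apply: leq_trans h (leq_trans am _); lia.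
case: (boolP (a <= m.-1)) => am.
  have [-> ->] := PQ am; clear PQ hS P Q S.
  have [h1 h2] : a <= m /\ a != m by split; lia.
  by rewrite h1 h2 /= !andbT.
clear PQ hS; have [->|am2] := eqVneq a m; first by rewrite !andbF.
by rewrite (_ : (a <= m) = false) // leqNgt; apply/negbTE; rewrite negbK; lia.
Qed.

(** Either [m] does not occur, or the head is [m], overlined or not, followed in both cases by an
    arbitrary element of [ov_free]. *)
Lemma cnt_rec (m n : nat) : 0 < m -> ~~ (k %| m) ->
  cnt m n = cnt m.-1 n + (if m <= n then (cnt_free m (n - m)).*2 else 0).
Proof.
move=> m0 km.
pose L b := if m <= n then [seq (m, b) :: s | s <- ov_free m (n - m)] else [::].
have -> : (if m <= n then (cnt_free m (n - m)).*2 else 0) = size (L true ++ L false).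
  by rewrite size_cat /L; case: ifP => // _; rewrite !size_map addnn.
rewrite /cnt -size_cat; apply: size_uniq_mem; first exact: ov_le_uniq.
  have uL b : uniq (L b).
    by rewrite /L; case: ifP => // _; rewrite map_inj_uniq ?ov_free_uniq // => s t [].
  have hL b s : s \in L b -> ohead s = Some (m, b).
    by rewrite /L; case: ifP => // _ /mapP[t _ ->].
  rewrite !cat_uniq ov_le_uniq !uL /= andbT; apply/andP; split.
    apply/hasPn => s; rewrite mem_cat => sL; rewrite ov_le_pred //.
    by case/orP: sL => /hL ->; rewrite /= eqxx andbF.
  by apply/hasPn => s /hL sf; apply/negP => /hL; rewrite sf.
move=> s; rewrite !mem_cat ov_le_pred //.
have inL b : (s \in L b) = (ohead s == Some (m, b)) && (s \in ov_le m n).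
  rewrite /L; case: s => [|x s].
    by case: ifP => //= _; apply/mapP => -[].
  case: (boolP (x == (m, b))) => [/eqP ->|xm].
    rewrite mem_ov_le_cons // /= eqxx /=; case: ifP => //= _.
    by rewrite mem_map // => ? ? [].
  rewrite (_ : ohead _ == _ = false) /=; last by apply/eqP => -[] /eqP; rewrite (negbTE xm).
  by case: ifP => // _; apply/mapP => -[t _ [e _]]; rewrite e eqxx in xm.
rewrite !inL; case: s {inL} => [|[a b] s] /=; first by rewrite andbT orbF.
case: (_ \in _); rewrite ?andbF ?andbT //=.
by rewrite !(inj_eq (@Some_inj _)) !xpair_eqE; case: (a == m); case: b.
Qed.

(** The same case distinction, with the overlined head excluded. *)
Lemma cnt_free_rec (m n : nat) : 0 < m -> ~~ (k %| m) ->
  cnt_free m n = cnt m.-1 n + (if m <= n then cnt_free m (n - m) else 0).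
Proof.
move=> m0 km.
pose L := if m <= n then [seq (m, false) :: s | s <- ov_free m (n - m)] else [::].
have -> : (if m <= n then cnt_free m (n - m) else 0) = size L.
  by rewrite /L; case: ifP => // _; rewrite !size_map.
rewrite /cnt_free /cnt -size_cat; apply: size_uniq_mem; first exact: ov_free_uniq.
  have uL : uniq L.
    by rewrite /L; case: ifP => // _; rewrite map_inj_uniq ?ov_free_uniq // => s t [].
  have hL s : s \in L -> ohead s = Some (m, false).
    by rewrite /L; case: ifP => // _ /mapP[t _ ->].
  rewrite cat_uniq ov_le_uniq uL /= andbT.
  by apply/hasPn => s /hL sL; rewrite ov_le_pred // sL /= eqxx andbF.
move=> s; rewrite mem_cat.
have inL : (s \in L) = [&& ohead s == Some (m, false), (m, true) \notin s & s \in ov_le m n].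
  rewrite /L; case: s => [|x s].
    by case: ifP => //= _; apply/mapP => -[].
  case: (boolP (x == (m, false))) => [/eqP ->|xm].
    rewrite mem_ov_le_cons // /= eqxx inE /=; case: ifP => //= _; last by rewrite andbF.
    rewrite mem_map; last by move=> ? ? [].
    rewrite {1 2}/ov_free mem_filter xpair_eqE andbF /=.
    by case: (_ \notin s).
  rewrite (_ : ohead _ == _ = false) /=; last by apply/eqP => -[] /eqP; rewrite (negbTE xm).
  by case: ifP => // _; apply/mapP => -[t _ [e _]]; rewrite e eqxx in xm.
rewrite inL {1}/ov_free mem_filter ov_le_pred //.
case sm : (s \in ov_le m n); rewrite ?andbF ?andbT //=.
case: s sm {inL} => [|[a b] s] //= sm.
have [am|am] := eqVneq a m; last first.
  rewrite (_ : _ \notin _ = true) //.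
  have : (a, b) :: s \in ov_le m.-1 n by rewrite ov_le_pred // sm /= am.
  rewrite mem_ov_le => /andP[h _]; apply/negP => /(allP h) /=; lia.
by rewrite am (inj_eq (@Some_inj _)) xpair_eqE eqxx /=; case: b sm => //= _; rewrite inE eqxx.
Qed.

(** Eliminates [cnt_free]: adding [cnt m.-1 (n - m)] to [cnt_rec] at [n - m] gives twice
    [cnt_free_rec] at [n - m]. *)
Lemma cnt_step (m n : nat) : 0 < m -> ~~ (k %| m) ->
  cnt m n = cnt m.-1 n + (if m <= n then cnt m.-1 (n - m) + cnt m (n - m) else 0).
Proof.
move=> m0 km; rewrite cnt_rec //; case: ifP => // mn.
rewrite [cnt m (n - m)]cnt_rec // cnt_free_rec //.
by case: ifP => _; lia.
Qed.

Lemma cnt_dvd (m n : nat) : 0 < m -> k %| m -> cnt m n = cnt m.-1 n.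
Proof.
move=> m0 km; apply: size_uniq_mem; try exact: ov_le_uniq.
move=> s; rewrite [RHS]ov_le_pred // mem_ov_le; case: s => [|[a b] s] /=; first by rewrite !andbT.
have [am|am] := eqVneq a m; last by rewrite !andbT.
by rewrite am /is_regular /= km /= !andbF.
Qed.

Lemma cnt0 (n : nat) : cnt 0 n = (n == 0).
Proof.
have -> : nat_of_bool (n == 0) = size (if n == 0 then [:: [::]] else [::] : seq (seq (nat * bool))) by case: eqP.
apply: size_uniq_mem; [exact: ov_le_uniq | by case: ifP |].
move=> s; rewrite mem_ov_le; case: s => [|[a b] s].
  by rewrite /is_overpartition /= andbT eq_sym; case: ifP.
rewrite /is_overpartition /=.
case: ifP => _; rewrite ?inE /=; apply/negbTE; lia.
Qed.

Lemma cnt_full (m n : nat) : n <= m -> cnt m n = pbar k n.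
Proof.
move=> nm; rewrite /cnt /ov_le /pbar; congr size; apply/all_filterP/allP => s.
rewrite mem_overpartitions => /andP[/and4P[_ _ _ /eqP sn] _].
apply/allP => x xs; apply: leq_trans nm; rewrite -sn.
elim: s xs {sn} => //= y s IHs; rewrite inE => /orP[/eqP ->|/IHs h]; first exact: leq_addr.
exact: leq_trans h (leq_addl _ _).
Qed.

End Counting.

(** * The theorem *)

Lemma not_dvdE (k m : nat) : 0 < k -> not_dvd k m = ~~ (k %| m).
Proof.
move=> k0; congr (~~ _); apply/idP/idP => [/PeanoNat.Nat.eqb_eq/PeanoNat.Nat.Div0.mod_divides[q ->]|].
  exact: dvdn_mulr.
by case/dvdnP=> q ->; apply/PeanoNat.Nat.eqb_eq/PeanoNat.Nat.Div0.mod_mul.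
Qed.

Lemma pbar_briggs (k n : nat) : 2 <= k <= 9 -> Nbar k <= n ->
  briggs_nat (pbar k n) (pbar k (1 + n)) (pbar k (2 + n)) (pbar k (3 + n)).
Proof.
move=> hk hn; apply: (@briggs_counts k (cnt k) (pbar k)); try lia.
- by move=> [|m]; rewrite cnt0.
- move=> m j; rewrite not_dvdE; last lia; move=> km.
  rewrite cnt_step //; congr (_ + _); have [h|h] := leqP m.+1 j.
    by have /PeanoNat.Nat.leb_le -> : (m.+1 <= j)%coq_nat by apply/leP.
  by have /PeanoNat.Nat.leb_nle -> : ~ (m.+1 <= j)%coq_nat by apply/leP; rewrite -ltnNge.
- by move=> m j; rewrite not_dvdE; [move/negbFE => km; rewrite cnt_dvd|lia].
- by move=> m j h; apply: cnt_full; lia.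
Qed.

Theorem theorem3p9 (k : nat) (hk : 2 <= k <= 9) :
  briggs (fun m : nat => Posz (pbar k (m + Nbar k))).
Proof.
(* At the index [m.+1] the first of the four values is the one at [m], hence the instance
   [n = m + Nbar k]. *)
move=> [//|m] _; have := @pbar_briggs k (m + Nbar k) hk (leq_addl _ _).
rewrite /= !addSn !add0n; set A := pbar k (m + _); set B := pbar k _.+1.
set C := pbar k _.+2; set D := pbar k _.+3; rewrite /briggs_nat => H.
rewrite !expr2. lia.
Qed.
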